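(* The Lindelöf Hypothesis is true if and only if, for every $k\in\mathbb{N}$, the functions $\phi_{N,k}(x)=e^{-x}\sum_{n=0}^{N}\frac{(-1)^n\ell_{n,k}}{n!}x^n$ converge to $\phi_k$ in $L^2(\mathbb{R}_+)$ as $N\to\infty$.
   Context: $J_0$ is the Bessel function of the first kind of order $0$. $d_k(n)$ is the number of ordered factorizations of $n$ into $k$ factors; $\lambda_{j,k}$ are defined by $(s-1)^k\zeta^k(s)=\sum_{j\ge0}\frac{\lambda_{j,k}}{j!}(s-1)^j$ for $|s-1|\le1$; $a_{j,k}=(-1)^{k-1-j}\sum_{i=0}^{k-1-j}(-1)^i\frac{\lambda_{i,k}}{i!}$, $P_k(X)=\sum_{j=0}^{k-1}\frac{a_{j,k}}{j!}X^j$, $\Delta_k(x)=\sum_{1\le n\le x}d_k(n)-xP_k(\log x)$; $\ell_{n,k}=(-1)^n\sum_{j=1}^n\binom{n-1}{j-1}\frac{\lambda_{j+k,k}}{(j+k)!}$ for $n\ge1$, $\ell_{0,k}=(-1)^k\sum_{j=0}^{k}(-1)^j\frac{\lambda_{j,k}}{j!}$. $\phi_k(x)=\int_1^\infty\Delta_k(r)J_0(2\sqrt{x\log r})\,r^{-2}dr$ for $x\ge0$. The Lindelöf Hypothesis is the statement $\zeta(\frac12+it)=O(|t|^\varepsilon)$ for every $\varepsilon>0$. *)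

(* Defs.v *)
From Stdlib Require Import Reals Lra Lia List Arith ClassicalEpsilon.
From Coquelicot Require Import Coquelicot.
Open Scope R_scope.

Definition cpow_neg (n : nat) (s : C) : C :=
  let a := - (Re s) * ln (INR n) in
  let b := - (Im s) * ln (INR n) in
  (exp a * cos b, exp a * sin b).

Definition cpow2 (w : C) : C :=
  let a := Re w * ln 2 in
  let b := Im w * ln 2 in
  (exp a * cos b, exp a * sin b).

Fixpoint csum (f : nat -> C) (n : nat) : C :=
  match n with
  | O => f O
  | S m => Cplus (csum f m) (f (S m))
  end.

Definition CSeries (a : nat -> C) : C :=
  (Series (fun n => Re (a n)), Series (fun n => Im (a n))).

(* Hasse's globally convergent series for the Dirichlet eta function:
   eta(s) = sum_{n>=0} 2^{-(n+1)} sum_{j=0}^{n} (-1)^j binom(n,j) (j+1)^{-s},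
   an entire function; zeta(s) = eta(s) / (1 - 2^{1-s}) for s <> 1. *)
Definition eta (s : C) : C :=
  CSeries (fun n : nat =>
    Cmult (RtoC (/ 2 ^ (S n)))
      (csum (fun j => Cmult (RtoC ((-1) ^ j * Binomial.C n j)) (cpow_neg (S j) s)) n)).

Definition zeta (s : C) : C :=
  Cdiv (eta s) (Cminus (RtoC 1) (cpow2 (Cminus (RtoC 1) s))).

Definition Lindelof : Prop :=
  forall eps : R, 0 < eps ->
    exists M T : R, forall t : R, T <= Rabs t ->
      Cmod (zeta (1 / 2, t)) <= M * Rpower (Rabs t) eps.

Definition J0 (z : R) : R :=
  Series (fun m : nat => (-1) ^ m / (INR (fact m)) ^ 2 * (z / 2) ^ (2 * m)).

(* d_0(n) = [n = 1], d_{k+1}(n) = sum_{d | n} d_k(n / d):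
   the number of ordered factorizations of n into k factors. *)
Fixpoint dk (k n : nat) : nat :=
  match k with
  | O => if Nat.eqb n 1 then 1%nat else 0%nat
  | S k' => fold_right Nat.add 0%nat
              (map (fun d => if Nat.eqb (n mod d) 0 then dk k' (n / d) else 0%nat)
                   (seq 1 n))
  end.

Definition rsum (f : nat -> R) (m len : nat) : R :=
  fold_right Rplus 0 (map f (seq m len)).

(* (s-1)^k zeta(s)^k = sum_{j>=0} lambda_{j,k}/j! (s-1)^j  for |s-1| <= 1
   (at s = 1 the left side is understood by its removable value, so we
   require the identity for s <> 1).  lam j k is the (unique) such family. *)
Definition lambda_spec (L : nat -> nat -> R) : Prop :=
  forall (k : nat) (s : C), s <> RtoC 1 -> Cmod (Cminus s (RtoC 1)) <= 1 ->
    is_series (fun j : nat => Cmult (RtoC (L j k / INR (fact j))) (Cpow (Cminus s (RtoC 1)) j))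
              (Cmult (Cpow (Cminus s (RtoC 1)) k) (Cpow (zeta s) k)).

Definition lam : nat -> nat -> R :=
  epsilon (inhabits (fun _ _ : nat => 0)) lambda_spec.

Definition a_coef (j k : nat) : R :=
  (-1) ^ (k - 1 - j) *
  rsum (fun i => (-1) ^ i * lam i k / INR (fact i)) 0 (S (k - 1 - j)).

Definition Pk (k : nat) (X : R) : R :=
  rsum (fun j => a_coef j k / INR (fact j) * X ^ j) 0 k.

Definition Delta (k : nat) (x : R) : R :=
  rsum (fun n => INR (dk k n)) 1 (Z.to_nat (Int_part x)) - x * Pk k (ln x).

Definition ell (n k : nat) : R :=
  match n with
  | O => (-1) ^ k * rsum (fun j => (-1) ^ j * lam j k / INR (fact j)) 0 (S k)
  | S _ => (-1) ^ n *
           rsum (fun j => Binomial.C (n - 1) (j - 1) * lam (j + k)%nat k / INR (fact (j + k)))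
                1 n
  end.

Definition phi (k : nat) (x : R) : R :=
  RInt_gen (fun r => Delta k r * J0 (2 * sqrt (x * ln r)) / r ^ 2)
           (at_point 1) (Rbar_locally p_infty).

Definition phiN (N k : nat) (x : R) : R :=
  exp (- x) * rsum (fun n => (-1) ^ n * ell n k / INR (fact n) * x ^ n) 0 (S N).

Definition L2_converges (k : nat) : Prop :=
  exists v : nat -> R,
    (forall N : nat,
       is_RInt_gen (fun x => (phiN N k x - phi k x) ^ 2)
                   (at_point 0) (Rbar_locally p_infty) (v N)) /\
    is_lim_seq v 0.

(* Main.v *)
(** The substitution w = 1 - 1/s maps the half plane Re s > 1/2 onto the unit disc, and
    (-1)^n l_(n,k) is the coefficient of w^(n+k) in the expansion of (w zeta)^k, which is
    analytic in the disc.

    If phi_(N,k) converges in L^2, its consecutive differences c_n e^(-x) x^n / n!, with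
    c_n = (-1)^n l_(n,k), stay bounded in L^2, so c_n = O(n) and |w zeta|^k is bounded by a
    multiple of (1 - |w|)^(-2) for every k.  On the line Re s = 1/2 + |t|^(-A) this is
    |zeta|^k << |t|^B with B independent of k, and as (s-1) zeta(s) has a polynomially bounded
    Lipschitz constant the bound moves to the line Re s = 1/2; large k gives Lindelof.

    Conversely, under Lindelof the boundary function (w zeta)^k is square integrable on the
    unit circle, so the sum of c_n^2 is finite: multiply by a power of (1-w)/(1+d-w) to make
    the function Lipschitz up to the boundary, use Parseval over finitely many equally spaced
    nodes, and let d -> 0.  The hyperbola method gives sum_(n<=x) d_k(n) = x Q(log x) + O(x^(1-d))
    for some polynomial Q and some d > 0; the Laplace transform in log x of the error term,
    compared with ((s-1) zeta(s))^k near s = 1, shows that Q = P_k and evaluates the moments of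
    Delta_k, whence phi_k(x) = e^(-x) sum_n c_n x^n / n!.  Jensen's inequality for the Poisson
    weights e^(-x) x^n / n! bounds the integral of (phi_(N,k) - phi_k)^2 by the tail of sum c_n^2. *)

Require Import Defs.
From Stdlib Require Import Reals Lra Lia List Arith ZArith Psatz ClassicalEpsilon.
From Coquelicot Require Import Coquelicot.
Open Scope R_scope.

(* [eq] at the carrier of a Coquelicot structure is not recognised by [ring]. *)
Ltac Req := cbv beta; match goal with |- @eq _ ?x ?y => change (@eq R x y) end.

(** Analytic functions occur only as sums [pser] of absolutely convergent power series with real
    coefficients, and circle integrals only as averages over finitely many points. Bounds on zeta
    all come from one function, [Zf], built from the trapezoidal errors of (s - 1) x^(-s): its cubic
    growth and cubic Lipschitz constant on Re s >= 1/2 serve both implications. The Hasse series of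
    the statement is matched with it on the critical line and on the closed disc |s - 1| <= 1.

    The obstacle on the unit circle is w = 1, the image of s = infinity, where the available control
    on the radial approach to the boundary values degenerates. Hence a regularisation whose
    Lipschitz constant may blow up as d -> 0 while its modulus stays at most 1.

    The power saving in the divisor sums makes the moments of the error term in u = log r grow at
    most geometrically; the series of J_0(2 sqrt(x u)), with coefficients of size x^j / j!^2, can
    then be integrated term by term. The factor exp(-x) of phi_(N,k) reflects that the (-1)^n
    l_(n,k) are a binomial transform of these moments. *)

(** * Real series: dominated convergence and interchange of summations *)

Lemma sum_n_S (f : nat -> R) (n : nat) : sum_n f (S n) = sum_n f n + f (S n).
Proof. exact (sum_Sn f n). Qed.

Lemma ex_series_Rle (a b : nat -> R) :
  (forall n, Rabs (a n) <= b n) -> ex_series b -> ex_series a.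
Proof. intros H Hb. exact (ex_series_le a b H Hb). Qed.

Lemma is_series_Series (a : nat -> R) (l : R) : is_series a l -> Series a = l.
Proof. apply is_series_unique. Qed.

Lemma Series_abs_le (a b : nat -> R) :
  (forall n, Rabs (a n) <= b n) -> ex_series b -> Rabs (Series a) <= Series b.
Proof.
  intros H Hb.
  assert (ex_series (fun n => Rabs (a n))).
  { apply ex_series_Rle with b; auto. intros n. rewrite Rabs_Rabsolu. auto. }
  apply Rle_trans with (Series (fun n => Rabs (a n))).
  - now apply Series_Rabs.
  - apply Series_le; auto. intros n; split; auto. apply Rabs_pos.
Qed.

Lemma sum_n_le_Series (a : nat -> R) (N : nat) :
  (forall n, 0 <= a n) -> ex_series a -> sum_n a N <= Series a.
Proof.
  intros Ha Hs.
  apply (is_lim_seq_incr_compare (sum_n a) (Series a)).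
  - apply Series_correct in Hs. exact Hs.
  - intros n. rewrite sum_Sn. unfold plus; simpl. specialize (Ha (S n)). lra.
Qed.

Lemma ex_series_pos_bounded (a : nat -> R) (C : R) :
  (forall n, 0 <= a n) -> (forall N, sum_n a N <= C) -> ex_series a.
Proof.
  intros Ha HC.
  destruct (ex_finite_lim_seq_incr (sum_n a) C) as [l Hl].
  - intros n. rewrite sum_Sn. unfold plus; simpl. specialize (Ha (S n)). lra.
  - auto.
  - exists l. exact Hl.
Qed.

Lemma Series_tail_small (b : nat -> R) (eps : R) :
  ex_series b -> 0 < eps ->
  exists N, forall n, (N <= n)%nat -> Rabs (Series (fun k => b (S n + k)%nat)) < eps.
Proof.
  intros Hb He.
  assert (Hl : is_lim_seq (sum_n b) (Series b)) by exact (Series_correct _ Hb).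
  apply is_lim_seq_spec in Hl. destruct (Hl (mkposreal eps He)) as [N HN].
  exists N. intros n Hn. specialize (HN n Hn). simpl in HN.
  rewrite (Series_incr_n b (S n)) in HN by (auto; lia). simpl pred in HN.
  rewrite sum_n_Reals in HN.
  replace (Series (fun k => b (S n + k)%nat))
    with (- (sum_f_R0 b n - (sum_f_R0 b n + Series (fun k => b (S n + k)%nat)))) by ring.
  rewrite Rabs_Ropp. exact HN.
Qed.

Lemma is_lim_seq_sum_n (f : nat -> nat -> R) (g : nat -> R) (N : nat) :
  (forall n, is_lim_seq (fun M => f M n) (g n)) ->
  is_lim_seq (fun M => sum_n (f M) N) (sum_n g N).
Proof.
  intros H. induction N.
  - apply (is_lim_seq_ext (fun M => f M 0%nat)). { intros M. now rewrite sum_O. } rewrite sum_O. apply H.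
  - apply (is_lim_seq_ext (fun M => sum_n (f M) N + f M (S N))). { intros M. now rewrite sum_Sn.
    } rewrite sum_Sn.
    apply is_lim_seq_plus'; auto.
Qed.

(** Dominated convergence for series: beyond a fixed index both sums are bounded by the tail of [b],
    and the finitely many remaining terms converge one by one. *)
Lemma tannery (f : nat -> nat -> R) (g b : nat -> R) :
  (forall n, is_lim_seq (fun M => f M n) (g n)) ->
  (forall M n, Rabs (f M n) <= b n) -> ex_series b ->
  is_lim_seq (fun M => Series (f M)) (Series g).
Proof.
  intros Hf Hb Hs.
  assert (Hg : forall n, Rabs (g n) <= b n).
  { intros n. assert (is_lim_seq (fun M => Rabs (f M n)) (Rabs (g n))).
    { apply (is_lim_seq_abs _ (g n)). apply Hf. }
    apply (is_lim_seq_le (fun M => Rabs (f M n)) (fun _ => b n) (Rabs (g n)) (b n)); auto.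
    apply is_lim_seq_const. }
  assert (Hfs : forall M, ex_series (f M)) by (intros M; apply ex_series_Rle with b; auto).
  assert (Hgs : ex_series g) by (apply ex_series_Rle with b; auto).
  apply is_lim_seq_spec. intros [eps He]. simpl.
  destruct (Series_tail_small b (eps / 3) Hs ltac:(lra)) as [N HN].
  specialize (HN N (le_n N)).
  pose proof (is_lim_seq_sum_n f g N Hf) as HS.
  apply is_lim_seq_spec in HS. destruct (HS (mkposreal (eps/3) ltac:(lra))) as [M0 HM0].
  exists M0. intros M HM. specialize (HM0 M HM). simpl in HM0.
  rewrite (Series_incr_n (f M) (S N)) by (auto; lia).
  rewrite (Series_incr_n g (S N)) by (auto; lia). simpl pred. rewrite <- !sum_n_Reals.
  assert (Hbt : ex_series (fun k => b (S N + k)%nat)).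
  { apply ex_series_incr_n. auto. }
  assert (Rabs (Series (fun k => f M (S N + k)%nat)) <= Series (fun k => b (S N + k)%nat))
    by (apply Series_abs_le; auto).
  assert (Rabs (Series (fun k => g (S N + k)%nat)) <= Series (fun k => b (S N + k)%nat))
    by (apply Series_abs_le; auto).
  unfold Rabs in *.
  repeat destruct Rcase_abs; lra.
Qed.

Lemma sum_n_series_swap (a : nat -> nat -> R) (col : nat -> R) (M : nat) :
  (forall m, is_series (fun n => a n m) (col m)) ->
  is_series (fun n => sum_n (a n) M) (sum_n col M).
Proof.
  intros H. induction M.
  - apply (is_series_ext (fun n => a n 0%nat)). { intros n. now rewrite sum_O. }
    rewrite sum_O. apply H.
  - apply (is_series_ext (fun n => plus (sum_n (a n) M) (a n (S M)))).
    { intros n. now rewrite sum_Sn. }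
    rewrite sum_Sn. exact (is_series_plus (fun n => sum_n (a n) M) (fun n => a n (S M)) _ _ IHM (H (S M))).
Qed.

Lemma sum_n_Rabs_le (a : nat -> R) (N : nat) :
  Rabs (sum_n a N) <= sum_n (fun n => Rabs (a n)) N.
Proof. apply (norm_sum_n_m a 0 N). Qed.

Lemma sum_n_mono (a b : nat -> R) (N : nat) :
  (forall n, a n <= b n) -> sum_n a N <= sum_n b N.
Proof.
  intros H. induction N. { now rewrite !sum_O. }
  rewrite !sum_Sn. unfold plus; simpl. specialize (H (S N)). lra.
Qed.

(** A finite number of columns may be summed first; the partial row sums are dominated by the row
    bounds [B n], so [tannery] lets the number of columns tend to infinity. *)
Lemma fubini (a bb : nat -> nat -> R) (A B col : nat -> R) (s : R) :
  (forall n m, Rabs (a n m) <= bb n m) ->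
  (forall n, is_series (bb n) (B n)) -> ex_series B ->
  (forall n, is_series (a n) (A n)) -> is_series A s ->
  (forall m, is_series (fun n => a n m) (col m)) ->
  is_series col s.
Proof.
  intros Hab HB HBs HA HAs Hcol.
  assert (Hpos : forall n m, 0 <= bb n m).
  { intros n m. apply Rle_trans with (2 := Hab n m). apply Rabs_pos. }
  assert (H : is_lim_seq (fun M => Series (fun n => sum_n (a n) M)) (Series A)).
  { apply (tannery (fun M n => sum_n (a n) M) A B); auto.
    intros M n. eapply Rle_trans. apply sum_n_Rabs_le.
      eapply Rle_trans. apply sum_n_mono. apply Hab.
      rewrite <- (is_series_Series _ _ (HB n)). apply sum_n_le_Series; auto.
      exists (B n). auto. }
  rewrite (is_series_Series _ _ HAs) in H.
  apply (is_lim_seq_ext (fun M => Series (fun n => sum_n (a n) M)) (sum_n col) s); auto.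
  intros M. apply is_series_Series. now apply sum_n_series_swap.
Qed.

Lemma is_series_Rplus (a b : nat -> R) (la lb : R) :
  is_series a la -> is_series b lb -> is_series (fun n => a n + b n) (la + lb).
Proof. intros Ha Hb. exact (is_series_plus a b la lb Ha Hb). Qed.

Lemma is_series_Rminus (a b : nat -> R) (la lb : R) :
  is_series a la -> is_series b lb -> is_series (fun n => a n - b n) (la - lb).
Proof. intros Ha Hb. exact (is_series_minus a b la lb Ha Hb). Qed.

Lemma is_series_Rscal (c : R) (a : nat -> R) (la : R) :
  is_series a la -> is_series (fun n => c * a n) (c * la).
Proof. intros Ha. exact (is_series_scal c a la Ha). Qed.

(** * Complex limits and series, taken componentwise *)

Definition Clim (u : nat -> C) (l : C) : Prop :=
  is_lim_seq (fun n => Re (u n)) (Re l) /\ is_lim_seq (fun n => Im (u n)) (Im l).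

Definition Cser (a : nat -> C) (l : C) : Prop :=
  is_series (fun n => Re (a n)) (Re l) /\ is_series (fun n => Im (a n)) (Im l).

Lemma C_eq (x y : C) : Re x = Re y -> Im x = Im y -> x = y.
Proof. destruct x, y. simpl. intros -> ->. reflexivity. Qed.

Lemma im_le_Cmod (c : C) : Rabs (Im c) <= Cmod c.
Proof. destruct c as [a b]. eapply Rle_trans. 2: apply (Rmax_Cmod (a, b)). apply Rmax_r. Qed.

Lemma Cmod_le_sum (c : C) : Cmod c <= Rabs (Re c) + Rabs (Im c).
Proof.
  destruct c as [a b]. replace (a, b) with (RtoC a + RtoC b * Ci)%C.
  2:{ unfold RtoC, Ci, Cplus, Cmult. simpl. f_equal; ring. }
  eapply Rle_trans. apply Cmod_triangle. rewrite Cmod_mult, !Cmod_R.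
  assert (HCi : Cmod Ci = 1).
  { unfold Cmod, Ci. transitivity (sqrt 1). f_equal; simpl; ring. apply sqrt_1. }
  rewrite HCi.
  replace (Re (RtoC a + RtoC b * Ci)) with a by (simpl; ring).
  replace (Im (RtoC a + RtoC b * Ci)) with b by (simpl; ring). lra.
Qed.

Lemma Re_plus (x y : C) : Re (x + y) = Re x + Re y. Proof. reflexivity. Qed.
Lemma Im_plus (x y : C) : Im (x + y) = Im x + Im y. Proof. reflexivity. Qed.
Lemma Re_minus (x y : C) : Re (x - y) = Re x - Re y. Proof. reflexivity. Qed.
Lemma Im_minus (x y : C) : Im (x - y) = Im x - Im y. Proof. reflexivity. Qed.
Lemma Re_mult (x y : C) : Re (x * y) = Re x * Re y - Im x * Im y. Proof. reflexivity. Qed.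
Lemma Im_mult (x y : C) : Im (x * y) = Re x * Im y + Im x * Re y. Proof. reflexivity. Qed.
Lemma Re_scal (a : R) (x : C) : Re (RtoC a * x) = a * Re x.
Proof. rewrite Re_mult. simpl. ring. Qed.
Lemma Im_scal (a : R) (x : C) : Im (RtoC a * x) = a * Im x.
Proof. rewrite Im_mult. simpl. ring. Qed.

Lemma Re_RtoC (a : R) : Re (RtoC a) = a. Proof. reflexivity. Qed.
Lemma Im_RtoC (a : R) : Im (RtoC a) = 0. Proof. reflexivity. Qed.

Lemma Clim_unique (u : nat -> C) (l l' : C) : Clim u l -> Clim u l' -> l = l'.
Proof.
  intros [H1 H2] [H3 H4]. apply C_eq.
  - apply is_lim_seq_unique in H1. apply is_lim_seq_unique in H3. congruence.
  - apply is_lim_seq_unique in H2. apply is_lim_seq_unique in H4. congruence.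
Qed.

Lemma Clim_ext (u v : nat -> C) (l : C) : (forall n, u n = v n) -> Clim u l -> Clim v l.
Proof. intros H [H1 H2]. split; eapply is_lim_seq_ext; eauto; intros n; simpl; now rewrite H. Qed.

Lemma Clim_const (c : C) : Clim (fun _ => c) c.
Proof. split; apply is_lim_seq_const. Qed.

Lemma Clim_plus (u v : nat -> C) (l m : C) :
  Clim u l -> Clim v m -> Clim (fun n => u n + v n)%C (l + m).
Proof. intros [H1 H2] [H3 H4]. split; apply is_lim_seq_plus'; auto. Qed.

Lemma Clim_minus (u v : nat -> C) (l m : C) :
  Clim u l -> Clim v m -> Clim (fun n => u n - v n)%C (l - m).
Proof. intros [H1 H2] [H3 H4]. split; apply is_lim_seq_minus'; auto. Qed.

Lemma Clim_mult (u v : nat -> C) (l m : C) :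
  Clim u l -> Clim v m -> Clim (fun n => u n * v n)%C (l * m).
Proof.
  intros [H1 H2] [H3 H4]. split.
  - rewrite Re_mult. apply is_lim_seq_minus'; apply is_lim_seq_mult'; auto.
  - rewrite Im_mult. apply is_lim_seq_plus'; apply is_lim_seq_mult'; auto.
Qed.

Lemma Clim_Cmod0 (u : nat -> C) (l : C) :
  Clim u l <-> is_lim_seq (fun n => Cmod (u n - l)) 0.
Proof.
  split.
  - intros [H1 H2].
    apply (is_lim_seq_le_le (fun _ => 0) _ (fun n => Rabs (Re (u n) - Re l) + Rabs (Im (u n) - Im l))).
    + intros n. split. apply Cmod_ge_0. apply Cmod_le_sum.
    + apply is_lim_seq_const.
    + assert (H : forall (v : nat -> R) (x : R), is_lim_seq v x -> is_lim_seq (fun n => Rabs (v n - x)) 0).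
      { intros v x Hv. replace (Finite 0) with (Rbar_abs (x - x)) by (simpl; f_equal; rewrite Rminus_diag;
          apply Rabs_R0).
        apply is_lim_seq_abs. apply is_lim_seq_minus'; auto. apply is_lim_seq_const. }
      replace 0 with (0 + 0) by ring. apply is_lim_seq_plus'; now apply H.
  - intros H. split; apply is_lim_seq_spec; intros eps; apply is_lim_seq_spec in H;
      destruct (H eps) as [N HN];
    exists N; intros n Hn; specialize (HN n Hn); rewrite Rminus_0_r,
      (Rabs_pos_eq (Cmod _)) in HN by apply Cmod_ge_0;
    eapply Rle_lt_trans; try exact HN.
    + apply (re_le_Cmod (u n - l)).
    + apply (im_le_Cmod (u n - l)).
Qed.

Lemma Clim_Cmod (u : nat -> C) (l : C) : Clim u l -> is_lim_seq (fun n => Cmod (u n)) (Cmod l).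
Proof.
  intros H. apply Clim_Cmod0 in H.
  apply is_lim_seq_spec. intros eps. apply is_lim_seq_spec in H. destruct (H eps) as [N HN].
  exists N. intros n Hn. specialize (HN n Hn).
  rewrite Rminus_0_r, (Rabs_pos_eq (Cmod _)) in HN by apply Cmod_ge_0.
  eapply Rle_lt_trans. 2: exact HN.
  assert (Cmod (u n) <= Cmod (u n - l) + Cmod l).
  { eapply Rle_trans. 2: apply Cmod_triangle. right. f_equal. ring. }
  assert (Cmod l <= Cmod (u n - l) + Cmod (u n)).
  { replace (Cmod (u n - l)) with (Cmod (l - u n)). eapply Rle_trans. 2: apply Cmod_triangle. right. f_equal.
    ring.
    rewrite <- Cmod_opp. f_equal. ring. }
  apply Rabs_le. lra.
Qed.

Lemma Clim_Cmod_le (u : nat -> C) (l : C) (K : R) :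
  Clim u l -> (forall n, Cmod (u n) <= K) -> Cmod l <= K.
Proof.
  intros H HK. apply Clim_Cmod in H.
  apply (is_lim_seq_le (fun n => Cmod (u n)) (fun _ => K) (Cmod l) K); auto.
  apply is_lim_seq_const.
Qed.

Lemma Clim_dominated (u : nat -> C) (l : C) (v : nat -> R) :
  (forall n, Cmod (u n - l) <= v n) -> is_lim_seq v 0 -> Clim u l.
Proof.
  intros H Hv. apply Clim_Cmod0. apply (is_lim_seq_le_le (fun _ => 0) _ v); auto.
  intros n; split; auto. apply Cmod_ge_0. apply is_lim_seq_const.
Qed.

Lemma Clim_incr (u : nat -> C) (l : C) : Clim u l -> Clim (fun n => u (S n)) l.
Proof. intros [H1 H2]. split. now apply is_lim_seq_incr_1 in H1. now apply is_lim_seq_incr_1 in H2. Qed.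

(** [Csumn f n] has [n] terms whereas [sum_n f n] has [n + 1]; hence the shifts by [S] wherever the
    two meet. *)
Fixpoint Csumn (f : nat -> C) (n : nat) : C :=
  match n with O => RtoC 0 | S m => (Csumn f m + f m)%C end.

Lemma Csumn_ext (f g : nat -> C) (n : nat) :
  (forall i, (i < n)%nat -> f i = g i) -> Csumn f n = Csumn g n.
Proof.
  induction n; simpl; intros H; auto. rewrite IHn by (intros; apply H; lia). rewrite H by lia. auto.
Qed.
Lemma Csumn_plus (f g : nat -> C) (n : nat) : Csumn (fun i => f i + g i)%C n = (Csumn f n + Csumn g n)%C.
Proof. induction n; simpl. ring. rewrite IHn. ring. Qed.
Lemma Csumn_scal (c : C) (f : nat -> C) (n : nat) : Csumn (fun i => c * f i)%C n = (c * Csumn f n)%C.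
Proof. induction n; simpl. ring. rewrite IHn. ring. Qed.

Lemma Re_Csumn (f : nat -> C) (n : nat) : Re (Csumn f (S n)) = sum_n (fun i => Re (f i)) n.
Proof.
  induction n. { simpl Csumn. rewrite sum_O, Re_plus. simpl. ring. }
  rewrite sum_Sn. change (Csumn f (S (S n))) with (Csumn f (S n) + f (S n))%C. rewrite Re_plus, IHn.
  reflexivity.
Qed.
Lemma Im_Csumn (f : nat -> C) (n : nat) : Im (Csumn f (S n)) = sum_n (fun i => Im (f i)) n.
Proof.
  induction n. { simpl Csumn. rewrite sum_O, Im_plus. simpl. ring. }
  rewrite sum_Sn. change (Csumn f (S (S n))) with (Csumn f (S n) + f (S n))%C. rewrite Im_plus, IHn.
  reflexivity.
Qed.

Lemma Cser_Clim (a : nat -> C) (l : C) : Cser a l <-> Clim (Csumn a) l.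
Proof.
  split; intros [H1 H2].
  - split; apply is_lim_seq_incr_1.
    + apply (is_lim_seq_ext (sum_n (fun i => Re (a i)))); auto. intros n. now rewrite Re_Csumn.
    + apply (is_lim_seq_ext (sum_n (fun i => Im (a i)))); auto. intros n. now rewrite Im_Csumn.
  - apply is_lim_seq_incr_1 in H1. apply is_lim_seq_incr_1 in H2. split.
    + apply (is_lim_seq_ext _ (sum_n (fun i => Re (a i)))) in H1; auto. intros n. now rewrite Re_Csumn.
    + apply (is_lim_seq_ext _ (sum_n (fun i => Im (a i)))) in H2; auto. intros n. now rewrite Im_Csumn.
Qed.

Lemma Cser_unique (a : nat -> C) (l l' : C) : Cser a l -> Cser a l' -> l = l'.
Proof. rewrite !Cser_Clim. apply Clim_unique. Qed.

Lemma Cser_ext (a b : nat -> C) (l : C) : (forall n, a n = b n) -> Cser a l -> Cser b l.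
Proof. intros H [H1 H2]. split; eapply is_series_ext; eauto; intros n; simpl; now rewrite H. Qed.

Lemma Cser_plus (a b : nat -> C) (l m : C) :
  Cser a l -> Cser b m -> Cser (fun n => a n + b n)%C (l + m).
Proof. intros [H1 H2] [H3 H4]. split.
  - apply (is_series_Rplus (fun n => Re (a n)) (fun n => Re (b n))); auto.
  - apply (is_series_Rplus (fun n => Im (a n)) (fun n => Im (b n))); auto. Qed.

Lemma Cser_scal (c : C) (a : nat -> C) (l : C) : Cser a l -> Cser (fun n => c * a n)%C (c * l).
Proof.
  intros [H1 H2]. split.
  - rewrite Re_mult. apply (is_series_minus (V:=R_NormedModule));
      apply (is_series_scal_l (V:=R_NormedModule)); auto.
  - rewrite Im_mult. apply (is_series_plus (V:=R_NormedModule)); apply (is_series_scal_l (V:=R_NormedModule));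
      auto.
Qed.

Lemma Cser_ex (a : nat -> C) (b : nat -> R) :
  (forall n, Cmod (a n) <= b n) -> ex_series b -> exists l, Cser a l.
Proof.
  intros H Hb.
  assert (H1 : ex_series (fun n => Re (a n))).
  { apply ex_series_Rle with b; auto. intros n. eapply Rle_trans. apply re_le_Cmod. auto. }
  assert (H2 : ex_series (fun n => Im (a n))).
  { apply ex_series_Rle with b; auto. intros n. eapply Rle_trans. apply im_le_Cmod. auto. }
  destruct H1 as [x Hx], H2 as [y Hy]. exists (x, y). split; auto.
Qed.

Lemma Cmod_Csumn (a : nat -> C) (n : nat) (b : nat -> R) :
  (forall i, Cmod (a i) <= b i) -> Cmod (Csumn a (S n)) <= sum_n b n.
Proof.
  intros H. induction n.
  - rewrite sum_O. simpl Csumn. replace (0 + a 0%nat)%C with (a 0%nat) by ring. auto.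
  - rewrite sum_Sn. change (Csumn a (S (S n))) with (Csumn a (S n) + a (S n))%C.
    eapply Rle_trans. apply Cmod_triangle. unfold plus; simpl plus. specialize (H (S n)). simpl in *. lra.
Qed.

Lemma Cser_Cmod_le (a : nat -> C) (l : C) (b : nat -> R) :
  Cser a l -> (forall n, Cmod (a n) <= b n) -> ex_series b -> Cmod l <= Series b.
Proof.
  intros H Hb Hs. apply Cser_Clim in H. apply Clim_incr in H.
  apply (Clim_Cmod_le _ _ _ H). intros n.
  eapply Rle_trans. apply (Cmod_Csumn a n b Hb). apply sum_n_le_Series; auto.
  intros i. eapply Rle_trans. apply Cmod_ge_0. apply Hb.
Qed.

Lemma Cser_fubini (a : nat -> nat -> C) (bb : nat -> nat -> R) (A : nat -> C) (B : nat -> R) (col : nat ->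
  C) (s : C) :
  (forall n m, Cmod (a n m) <= bb n m) ->
  (forall n, is_series (bb n) (B n)) -> ex_series B ->
  (forall n, Cser (a n) (A n)) -> Cser A s ->
  (forall m, Cser (fun n => a n m) (col m)) ->
  Cser col s.
Proof.
  intros Hab HB HBs HA HAs Hcol. split.
  - apply (fubini (fun n m => Re (a n m)) bb (fun n => Re (A n)) B); auto.
    + intros n m. eapply Rle_trans. apply re_le_Cmod. auto.
    + intros n. apply (HA n).
    + apply HAs.
    + intros m. apply (Hcol m).
  - apply (fubini (fun n m => Im (a n m)) bb (fun n => Im (A n)) B); auto.
    + intros n m. eapply Rle_trans. apply im_le_Cmod. auto.
    + intros n. apply (HA n).
    + apply HAs.
    + intros m. apply (Hcol m).
Qed.

(** * The complex exponential and the powers x^(-s) *)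

Definition cexp (z : C) : C := (exp (Re z) * cos (Im z), exp (Re z) * sin (Im z)).

(* [xpow x s] is [x^{-s}]. *)
Definition xpow (x : R) (s : C) : C := cexp (RtoC (- ln x) * s).

Lemma exp_mono (x y : R) : x <= y -> exp x <= exp y.
Proof. intros [H | ->]. left. now apply exp_increasing. lra. Qed.

Lemma cexp_plus (z z' : C) : cexp (z + z') = (cexp z * cexp z')%C.
Proof.
  unfold cexp. rewrite Re_plus, Im_plus, exp_plus, cos_plus, sin_plus.
  apply C_eq; simpl; ring.
Qed.

Lemma cexp_0 : cexp (RtoC 0) = RtoC 1.
Proof. unfold cexp. simpl. rewrite exp_0, cos_0, sin_0. apply C_eq; simpl; ring. Qed.

Lemma Cmod_cexp (z : C) : Cmod (cexp z) = exp (Re z).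
Proof.
  unfold Cmod, cexp. simpl.
  replace (exp (Re z) * cos (Im z) * (exp (Re z) * cos (Im z) * 1) +
           exp (Re z) * sin (Im z) * (exp (Re z) * sin (Im z) * 1))
    with (Rsqr (exp (Re z)) * (Rsqr (sin (Im z)) + Rsqr (cos (Im z)))) by (unfold Rsqr; ring).
  rewrite sin2_cos2, Rmult_1_r. apply sqrt_Rsqr. left. apply exp_pos.
Qed.

Lemma xpow_plus (x : R) (s s' : C) : xpow x (s + s') = (xpow x s * xpow x s')%C.
Proof. unfold xpow. rewrite <- cexp_plus. f_equal. ring. Qed.

Lemma xpow_0 (x : R) : xpow x 0 = 1.
Proof. unfold xpow. rewrite <- cexp_0. f_equal. ring. Qed.

Lemma xpow_1 (x : R) : 0 < x -> xpow x 1 = RtoC (/ x).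
Proof.
  intros Hx. unfold xpow, cexp. apply C_eq; simpl.
  - replace (- ln x * 1 - 0 * 0) with (- ln x) by ring.
    replace (- ln x * 0 + 0 * 1) with 0 by ring.
    rewrite exp_Ropp, exp_ln, cos_0; auto. ring.
  - replace (- ln x * 0 + 0 * 1) with 0 by ring. rewrite sin_0. ring.
Qed.

Lemma xpow_S (x : R) (s : C) : 0 < x -> xpow x (s + 1) = (xpow x s * RtoC (/ x))%C.
Proof. intros Hx. now rewrite xpow_plus, xpow_1. Qed.

Lemma xpow_base_mult (x y : R) (s : C) : 0 < x -> 0 < y -> xpow (x * y) s = (xpow x s * xpow y s)%C.
Proof.
  intros Hx Hy. unfold xpow. rewrite <- cexp_plus. f_equal. rewrite ln_mult; auto.
  rewrite !RtoC_opp, RtoC_plus. ring.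
Qed.

Lemma xpow_base_1 (s : C) : xpow 1 s = 1.
Proof. unfold xpow. rewrite <- cexp_0, ln_1. f_equal. rewrite Ropp_0. ring. Qed.

Lemma Cmod_xpow (x : R) (s : C) : Cmod (xpow x s) = exp (- Re s * ln x).
Proof. unfold xpow. rewrite Cmod_cexp. rewrite Re_scal. f_equal. ring. Qed.

Definition Cder (f : R -> C) (x : R) (l : C) : Prop :=
  is_derive (fun y => Re (f y)) x (Re l) /\ is_derive (fun y => Im (f y)) x (Im l).

Lemma Cder_xpow (c s : C) (x : R) : 0 < x ->
  Cder (fun y => c * xpow y s)%C x (- s * c * xpow x (s + 1)).
Proof.
  intros Hx. rewrite xpow_S by auto. destruct c as [c1 c2]. destruct s as [a b]. unfold xpow, cexp.
  split; simpl; auto_derive; repeat split; auto;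
  replace (- ln x * b + 0 * a) with (- ln x * b) by ring;
  replace (- ln x * a - 0 * b) with (- ln x * a) by ring;
  replace (- ln x * a + - (0 * b)) with (- ln x * a) by ring; ring.
Qed.

Lemma Cder_ext (f g : R -> C) (x : R) (l l' : C) :
  (forall y, f y = g y) -> l = l' -> Cder f x l -> Cder g x l'.
Proof.
  intros H <- [H1 H2]. split.
  - apply (is_derive_ext (fun y => Re (f y))); auto. intros y. now rewrite H.
  - apply (is_derive_ext (fun y => Im (f y))); auto. intros y. now rewrite H.
Qed.

Lemma Cder_minus (f g : R -> C) (x : R) (l m : C) :
  Cder f x l -> Cder g x m -> Cder (fun y => f y - g y)%C x (l - m)%C.
Proof.
  intros [H1 H2] [H3 H4]. split.
  - exact (is_derive_minus (fun y => Re (f y)) (fun y => Re (g y)) x (Re l) (Re m) H1 H3).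
  - exact (is_derive_minus (fun y => Im (f y)) (fun y => Im (g y)) x (Im l) (Im m) H2 H4).
Qed.

Lemma mvt_bound (f f' : R -> R) (a b K : R) : a <= b ->
  (forall x, a <= x <= b -> is_derive f x (f' x)) ->
  (forall x, a <= x <= b -> Rabs (f' x) <= K) ->
  Rabs (f b - f a) <= K * (b - a).
Proof.
  intros Hab Hd HK.
  destruct (MVT_gen f a b f') as [c [Hc He]].
  - intros x Hx. rewrite Rmin_left, Rmax_right in Hx by auto. apply Hd. lra.
  - intros x Hx. rewrite Rmin_left, Rmax_right in Hx by auto.
    apply continuity_pt_filterlim. apply (ex_derive_continuous f). exists (f' x). auto.
  - rewrite Rmin_left, Rmax_right in Hc by auto. rewrite He, Rabs_mult, (Rabs_pos_eq (b - a)) by lra.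
    apply Rmult_le_compat_r. lra. auto.
Qed.

Lemma trapezoid_bound (F f g h : R -> R) (a K : R) :
  (forall x, a <= x <= a + 1 -> is_derive F x (f x)) ->
  (forall x, a <= x <= a + 1 -> is_derive f x (g x)) ->
  (forall x, a <= x <= a + 1 -> is_derive g x (h x)) ->
  (forall x, a <= x <= a + 1 -> Rabs (h x) <= K) ->
  Rabs ((f a + f (a + 1)) / 2 - (F (a + 1) - F a)) <= K / 2.
Proof.
  intros HF Hf Hg HK.
  set (G := fun y => (f a + f y) / 2 * (y - a) - (F y - F a)).
  assert (HG : forall y, a <= y <= a + 1 -> is_derive G y ((f a - f y + (y - a) * g y) / 2)).
  { intros y Hy. unfold G. specialize (HF y Hy). specialize (Hf y Hy).
    auto_derive.
    - repeat split; eexists; eassumption.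
    - rewrite (is_derive_unique _ _ _ HF : Derive (fun x => F x) y = _),
        (is_derive_unique _ _ _ Hf : Derive (fun x => f x) y = _). field. }
  assert (HG' : Rabs (G (a + 1) - G a) <= K / 2 * (a + 1 - a)).
  { apply mvt_bound with (f' := fun y => (f a - f y + (y - a) * g y) / 2). lra. exact HG.
    intros y Hy.
    assert (HK0 : 0 <= K) by (apply Rle_trans with (2 := HK y Hy); apply Rabs_pos).
    assert (H : Rabs ((f y - g y * y) - (f a - g y * a)) <= K * (y - a)).
    { apply mvt_bound with (f := fun u => f u - g y * u) (f' := fun u => g u - g y * 1). lra.
      - intros u Hu. apply (is_derive_minus f (fun u => g y * u) u (g u) (g y * 1)).
        apply Hf; lra. auto_derive; auto.
      - intros u Hu. replace (g u - g y * 1) with (- (g y - g u)) by ring. rewrite Rabs_Ropp.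
        apply Rle_trans with (K * (y - u)).
        + apply mvt_bound with (f' := h). lra. intros v Hv; apply Hg; lra. intros v Hv; apply HK; lra.
        + nra. }
    replace ((f a - f y + (y - a) * g y) / 2) with (- ((f y - g y * y) - (f a - g y * a)) / 2) by field.
    unfold Rdiv at 1. rewrite Rabs_mult, Rabs_Ropp, (Rabs_pos_eq (/ 2)) by lra. nra. }
  unfold G in HG'. replace (a + 1 - a) with 1 in HG' by ring.
  replace ((f a + f (a + 1)) / 2 - (F (a + 1) - F a)) with
    ((f a + f (a + 1)) / 2 * 1 - (F (a + 1) - F a) - ((f a + f a) / 2 * (a - a) - (F a - F a))) by field.
  lra.
Qed.

Lemma Ctrapezoid_bound (F f g h : R -> C) (a K : R) :
  (forall x, a <= x <= a + 1 -> Cder F x (f x)) ->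
  (forall x, a <= x <= a + 1 -> Cder f x (g x)) ->
  (forall x, a <= x <= a + 1 -> Cder g x (h x)) ->
  (forall x, a <= x <= a + 1 -> Cmod (h x) <= K) ->
  Cmod (RtoC (/ 2) * (f a + f (a + 1)%R) - (F (a + 1)%R - F a)) <= K.
Proof.
  intros HF Hf Hg HK. eapply Rle_trans. apply Cmod_le_sum.
  rewrite Re_minus, Im_minus, Re_scal, Im_scal.
  rewrite !Re_plus, !Im_plus, !Re_minus, !Im_minus.
  pose proof (trapezoid_bound (fun x => Re (F x)) (fun x => Re (f x)) (fun x => Re (g x)) (fun x => Re (h x))
    a K
    (fun x Hx => proj1 (HF x Hx)) (fun x Hx => proj1 (Hf x Hx)) (fun x Hx => proj1 (Hg x Hx))
    (fun x Hx => Rle_trans _ _ _ (re_le_Cmod _) (HK x Hx))) as H1.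
  pose proof (trapezoid_bound (fun x => Im (F x)) (fun x => Im (f x)) (fun x => Im (g x)) (fun x => Im (h x))
    a K
    (fun x Hx => proj2 (HF x Hx)) (fun x Hx => proj2 (Hf x Hx)) (fun x Hx => proj2 (Hg x Hx))
    (fun x Hx => Rle_trans _ _ _ (im_le_Cmod _) (HK x Hx))) as H2.
  cbv beta in H1, H2. unfold Rdiv in H1, H2. rewrite (Rmult_comm _ (/ 2)) in H1.
  rewrite (Rmult_comm _ (/ 2)) in H2.
  lra.
Qed.

Lemma Cder_line (z d : C) (u : R) :
  Cder (fun t => cexp (z + RtoC t * d)) u (d * cexp (z + RtoC u * d)).
Proof. destruct z as [a b], d as [p q]. split; unfold cexp; simpl; auto_derive; auto;
  replace (a + (u * p + - (0 * q))) with (a + u * p) by ring;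
  replace (a + (u * p - 0 * q)) with (a + u * p) by ring;
  replace (b + (u * q + 0 * p)) with (b + u * q) by ring; ring. Qed.

(** On the segment from [z] to [z'] the real part stays between those of the end points, so the
    modulus of [cexp] stays below [K]. The factor 2 comes from applying the mean value theorem to
    real and imaginary parts separately. *)
Lemma cexp_lip (z z' : C) (K : R) :
  exp (Re z) <= K -> exp (Re z') <= K -> Cmod (cexp z' - cexp z) <= 2 * K * Cmod (z' - z).
Proof.
  intros H1 H2. set (d := (z' - z)%C).
  assert (HK : forall u, 0 <= u <= 1 -> Cmod (d * cexp (z + RtoC u * d)) <= K * Cmod d).
  { intros u Hu. rewrite Cmod_mult, Cmod_cexp, Rmult_comm. apply Rmult_le_compat_r. apply Cmod_ge_0.
    rewrite Re_plus, Re_scal. unfold d. rewrite Re_minus.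
    destruct (Rle_dec (Re z) (Re z')).
    - apply Rle_trans with (2 := H2). apply exp_mono. nra.
    - apply Rle_trans with (2 := H1). apply exp_mono. nra. }
  assert (E0 : cexp z = cexp (z + RtoC 0 * d)) by (f_equal; ring).
  assert (E1 : cexp z' = cexp (z + RtoC 1 * d)) by (f_equal; unfold d; ring).
  rewrite E0, E1. eapply Rle_trans. apply Cmod_le_sum. rewrite Re_minus, Im_minus.
  assert (A1 : Rabs (Re (cexp (z + RtoC 1 * d)) - Re (cexp (z + RtoC 0 * d))) <= K * Cmod d * (1 - 0)).
  { apply (mvt_bound (fun t => Re (cexp (z + RtoC t * d))) (fun u => Re (d * cexp (z + RtoC u * d)))).
    lra. intros; apply Cder_line. intros u Hu. eapply Rle_trans. apply re_le_Cmod. auto. }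
  assert (A2 : Rabs (Im (cexp (z + RtoC 1 * d)) - Im (cexp (z + RtoC 0 * d))) <= K * Cmod d * (1 - 0)).
  { apply (mvt_bound (fun t => Im (cexp (z + RtoC t * d))) (fun u => Im (d * cexp (z + RtoC u * d)))).
    lra. intros; apply Cder_line. intros u Hu. eapply Rle_trans. apply im_le_Cmod. auto. }
  lra.
Qed.

(** * The function (s - 1) zeta(s) by the trapezoidal rule *)

(* [V n s] is the trapezoidal-rule error of (s-1) x^{-s} on [n+1, n+2];
   it telescopes to the Euler-Maclaurin continuation of (s-1) zeta(s). *)
Definition V (n : nat) (s : C) : C :=
  (RtoC (/ 2) * ((s - 1) * xpow (INR (S n)) s + (s - 1) * xpow (INR (S n) + 1) s)
   - (- xpow (INR (S n) + 1) (s - 1) - - xpow (INR (S n)) (s - 1)))%C.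

(** The majorant (n+1)^(-3/2). The exponent is the least value of Re s + 2 on the half plane Re s >=
    -1/2, where s + 2 is the exponent in the second derivative of x^(-s). *)
Definition q32 (n : nat) : R := exp (- (3 / 2) * ln (INR (S n))).

Lemma q32_pos (n : nat) : 0 < q32 n. Proof. apply exp_pos. Qed.

Lemma INR_S_ge1 (n : nat) : 1 <= INR (S n).
Proof. rewrite S_INR. pose proof (pos_INR n). lra. Qed.

Lemma ln_ge_0 (x : R) : 1 <= x -> 0 <= ln x.
Proof. intros H. rewrite <- ln_1. apply ln_le; lra. Qed.

Lemma ln_le_id (x : R) : 0 < x -> ln x <= x.
Proof. intros H. pose proof (exp_ineq1_le (ln x)). rewrite exp_ln in H0 by auto. lra. Qed.

Lemma ln_mono (x y : R) : 0 < x -> x <= y -> ln x <= ln y.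
Proof. intros. now apply ln_le. Qed.

(** The factor [s - 1] makes the antiderivative equal to -x^(1-s): nothing is divided by [s - 1],
    and the pole of zeta becomes an ordinary point. *)
Lemma V_derivs (s : C) (x : R) : 0 < x ->
  Cder (fun y => - xpow y (s - 1))%C x ((s - 1) * xpow x s) /\
  Cder (fun y => (s - 1) * xpow y s)%C x (- (s - 1) * s * xpow x (s + 1)) /\
  Cder (fun y => - (s - 1) * s * xpow y (s + 1))%C x ((s - 1) * s * (s + 1) * xpow x (s + 1 + 1)).
Proof.
  intros Hx. split; [|split].
  - apply (Cder_ext (fun y => (- (1))%C * xpow y (s - 1))%C (fun y => - xpow y (s - 1))%C x
             (- (s - 1) * (- (1))%C * xpow x (s - 1 + 1))%C).
    intros y; ring. replace (s - 1 + 1)%C with s by ring. ring. now apply Cder_xpow.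
  - eapply Cder_ext. 3: apply (Cder_xpow (s - 1) s x Hx). intros; reflexivity. ring.
  - eapply Cder_ext. 3: apply (Cder_xpow (- (s - 1) * s) (s + 1) x Hx). intros; reflexivity. ring.
Qed.

Lemma xpow_q32 (n : nat) (s : C) (x : R) :
  3 / 2 <= Re s -> INR (S n) <= x -> Cmod (xpow x s) <= q32 n.
Proof.
  intros Hs Hx. rewrite Cmod_xpow. apply exp_mono. pose proof (INR_S_ge1 n).
  assert (ln (INR (S n)) <= ln x) by (apply ln_mono; lra).
  assert (0 <= ln (INR (S n))) by (apply ln_ge_0; auto). nra.
Qed.

Lemma V_bound (n : nat) (s : C) : - (1 / 2) <= Re s ->
  Cmod (V n s) <= Cmod (s - 1) * Cmod s * Cmod (s + 1) * q32 n.
Proof.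
  intros Hs. unfold V. pose proof (INR_S_ge1 n).
  apply (Ctrapezoid_bound (fun y => - xpow y (s - 1))%C (fun y => (s - 1) * xpow y s)%C
     (fun y => - (s - 1) * s * xpow y (s + 1))%C (fun y => (s - 1) * s * (s + 1) * xpow y (s + 1 + 1))%C).
  - intros x Hx. apply V_derivs. lra.
  - intros x Hx. apply V_derivs. lra.
  - intros x Hx. apply V_derivs. lra.
  - intros x Hx. rewrite !Cmod_mult. apply Rmult_le_compat_l.
    { repeat apply Rmult_le_pos; apply Cmod_ge_0. }
    apply xpow_q32. rewrite !Re_plus. simpl. lra. lra.
Qed.

(** Varying the exponent brings down a factor log x, which is at most x; the spare unit between 5/2
    and 3/2 pays for it. *)
Lemma xpow_lip (n : nat) (s s' : C) (x : R) :
  5 / 2 <= Re s -> 5 / 2 <= Re s' -> INR (S n) <= x ->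
  Cmod (xpow x s' - xpow x s) <= 2 * Cmod (s' - s) * q32 n.
Proof.
  intros Hs Hs' Hx. pose proof (INR_S_ge1 n).
  assert (Hl : 0 <= ln x) by (apply ln_ge_0; lra).
  unfold xpow. eapply Rle_trans. apply (cexp_lip _ _ (exp (- (5 / 2) * ln x))).
  - rewrite Re_scal. apply exp_mono. nra.
  - rewrite Re_scal. apply exp_mono. nra.
  - replace (RtoC (- ln x) * s' - RtoC (- ln x) * s)%C with (RtoC (- ln x) * (s' - s))%C by ring.
    rewrite Cmod_mult, Cmod_R, Rabs_Ropp, (Rabs_pos_eq _ Hl).
    replace (exp (- (5 / 2) * ln x)) with (exp (- (3 / 2) * ln x) * / x).
    2:{ rewrite <- (exp_ln x) at 2 by lra. rewrite <- exp_Ropp, <- exp_plus. f_equal. field. }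
    assert (ln x * / x <= 1). { apply Rmult_le_reg_r with x. lra. rewrite Rmult_assoc, Rinv_l by lra.
    pose proof (ln_le_id x). lra. }
    assert (exp (- (3 / 2) * ln x) <= q32 n).
    { apply exp_mono. assert (ln (INR (S n)) <= ln x) by (apply ln_mono; lra). lra. }
    pose proof (Cmod_ge_0 (s' - s)). pose proof (exp_pos (- (3 / 2) * ln x)).
    replace (2 * (exp (- (3 / 2) * ln x) * / x) * (ln x * Cmod (s' - s)))
      with (2 * Cmod (s' - s) * (exp (- (3 / 2) * ln x) * (ln x * / x))) by ring.
    apply Rmult_le_compat_l. lra. nra.
Qed.

(** The difference of two trapezoidal errors is the trapezoidal error of the difference. Its second
    derivative splits into a difference of the cubic z^3 - z, which contains the factor [s' - s],
    and a difference of powers of x, treated by [xpow_lip]. *)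
Lemma V_lip (n : nat) (s s' : C) : 1 / 2 <= Re s -> 1 / 2 <= Re s' ->
  Cmod (V n s' - V n s) <= 3 * (1 + Cmod s + Cmod s') ^ 3 * Cmod (s' - s) * q32 n.
Proof.
  intros Hs Hs'. pose proof (INR_S_ge1 n).
  replace (V n s' - V n s)%C with
   (RtoC (/ 2) * (((s' - 1) * xpow (INR (S n)) s' - (s - 1) * xpow (INR (S n)) s) + ((s' - 1) * xpow (INR (S
     n) + 1) s' - (s - 1) * xpow (INR (S n) + 1) s))
   - ((- xpow (INR (S n) + 1) (s' - 1) - - xpow (INR (S n) + 1) (s - 1)) - (- xpow (INR (S n)) (s' - 1) - -
       xpow (INR (S n)) (s - 1))))%C
   by (unfold V; ring).
  apply (Ctrapezoid_bound (fun y => - xpow y (s' - 1) - - xpow y (s - 1))%C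
      (fun y => (s' - 1) * xpow y s' - (s - 1) * xpow y s)%C
      (fun y => - (s' - 1) * s' * xpow y (s' + 1) - - (s - 1) * s * xpow y (s + 1))%C
      (fun y => (s' - 1) * s' * (s' + 1) * xpow y (s' + 1 + 1) - (s - 1) * s * (s + 1) * xpow y (s + 1 +
        1))%C).
  - intros x Hx. apply Cder_minus; apply V_derivs; lra.
  - intros x Hx. apply Cder_minus; apply V_derivs; lra.
  - intros x Hx. apply Cder_minus; apply V_derivs; lra.
  - intros x Hx.
    replace ((s' - 1) * s' * (s' + 1) * xpow x (s' + 1 + 1) - (s - 1) * s * (s + 1) * xpow x (s + 1 + 1))%C
      with ((s' - s) * (s' * s' + s' * s + s * s - 1) * xpow x (s' + 1 + 1) +
            ((s - 1) * s * (s + 1)) * (xpow x (s' + 1 + 1) - xpow x (s + 1 + 1)))%C by ring.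
    eapply Rle_trans. apply Cmod_triangle. rewrite !Cmod_mult.
    assert (H1 : Cmod (xpow x (s' + 1 + 1)) <= q32 n).
    { apply xpow_q32. rewrite !Re_plus; simpl; lra. lra. }
    assert (H2 : Cmod (xpow x (s' + 1 + 1) - xpow x (s + 1 + 1)) <= 2 * Cmod (s' - s) * q32 n).
    { replace (s' - s)%C with ((s' + 1 + 1) - (s + 1 + 1))%C by ring. apply xpow_lip.
      rewrite !Re_plus; simpl; lra. rewrite !Re_plus; simpl; lra. lra. }
    set (R := 1 + Cmod s + Cmod s').
    pose proof (Cmod_ge_0 s) as P1. pose proof (Cmod_ge_0 s') as P2. pose proof (Cmod_ge_0 (s' - s)) as P3.
    assert (H3 : Cmod (s' * s' + s' * s + s * s - 1) <= R ^ 3).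
    { eapply Rle_trans. apply (Cmod_triangle _ (- (1))%C).
      rewrite Cmod_opp, Cmod_1. eapply Rle_trans. apply Rplus_le_compat_r. apply Cmod_triangle.
      rewrite Cmod_mult. eapply Rle_trans. apply Rplus_le_compat_r. apply Rplus_le_compat_r.
      apply Cmod_triangle.
      rewrite !Cmod_mult. apply Rle_trans with (R ^ 2). unfold R. simpl. nra. unfold R. simpl.
nra. }
    assert (H4 : Cmod (s - 1) * Cmod s * Cmod (s + 1) <= R ^ 3).
    { assert (Cmod (s - 1) <= R). { eapply Rle_trans. apply (Cmod_triangle s (- (1))%C).
      rewrite Cmod_opp, Cmod_1. unfold R; lra. }
      assert (Cmod (s + 1) <= R). { eapply Rle_trans. apply (Cmod_triangle s 1%C). rewrite Cmod_1.
      unfold R; lra. }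
      assert (Cmod s <= R) by (unfold R; lra).
      pose proof (Cmod_ge_0 (s - 1)). pose proof (Cmod_ge_0 (s + 1)).
      replace (R ^ 3) with (R * R * R) by ring.
      apply Rmult_le_compat; auto. apply Rmult_le_pos; auto. apply Rmult_le_compat; auto. }
    pose proof (Cmod_ge_0 (xpow x (s' + 1 + 1))).
    pose proof (Cmod_ge_0 (xpow x (s' + 1 + 1) - xpow x (s + 1 + 1))).
    pose proof (Cmod_ge_0 (s' * s' + s' * s + s * s - 1)).
    assert (Cmod (s' - s) * Cmod (s' * s' + s' * s + s * s - 1) * Cmod (xpow x (s' + 1 + 1)) <=
      Cmod (s' - s) * R ^ 3 * q32 n).
    { apply Rmult_le_compat; auto. apply Rmult_le_pos; auto. apply Rmult_le_compat; auto. lra. }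
    nra.
Qed.

(** Telescoping: for consecutive square roots [a] and [b] one has 1/b^3 <= 2/a - 2/b, so the partial
    sums stay below 3. *)
Lemma ex_series_q32 : ex_series q32.
Proof.
  apply ex_series_pos_bounded with 3. { intros; left; apply q32_pos. }
  assert (H : forall N, sum_n q32 N <= 3 - 2 * / sqrt (INR (S N))).
  { induction N.
    - rewrite sum_O. unfold q32. simpl INR. rewrite ln_1, Rmult_0_r, exp_0, sqrt_1. lra.
    - rewrite sum_n_S.
      set (a := sqrt (INR (S N))) in *. set (b := sqrt (INR (S (S N)))).
      pose proof (INR_S_ge1 N). pose proof (INR_S_ge1 (S N)).
      assert (Ha : 0 < a) by (apply sqrt_lt_R0; lra).
      assert (Hb : 0 < b) by (apply sqrt_lt_R0; lra).
      assert (Ha2 : a * a = INR (S N)) by (apply sqrt_sqrt; lra).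
      assert (Hb2 : b * b = INR (S N) + 1) by (unfold b; rewrite sqrt_sqrt by lra; now rewrite (S_INR (S N))).
      assert (Hq : q32 (S N) = / (b * b * b)).
      { unfold q32. rewrite <- (sqrt_sqrt (INR (S (S N)))) by lra. fold b. rewrite ln_mult by auto.
        replace (- (3 / 2) * (ln b + ln b)) with (- (ln b + ln b + ln b)) by field.
        rewrite exp_Ropp, !exp_plus, exp_ln by auto. reflexivity. }
      rewrite Hq.
      assert (Hab : a <= b) by (apply sqrt_le_1; try lra; rewrite (S_INR (S N)); lra).
      assert (/ (b * b * b) <= 2 * / a - 2 * / b).
      { replace (2 * / a - 2 * / b) with (2 * ((b - a) / (a * b))) by (field; lra).
        replace (b - a) with (1 / (a + b)).
        2:{ apply Rmult_eq_reg_r with (a + b). 2: lra. field_simplify; [|lra]. nra. }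
        apply Rmult_le_reg_r with (b * b * b * (a * b * (a + b))).
        { repeat apply Rmult_lt_0_compat; lra. }
        field_simplify; [|lra|lra]. nra. }
      lra. }
  intros N. specialize (H N). pose proof (INR_S_ge1 N).
  assert (0 < / sqrt (INR (S N))) by (apply Rinv_0_lt_compat, sqrt_lt_R0; lra). lra.
Qed.

Definition VS (s : C) : C := (Series (fun n => Re (V n s)), Series (fun n => Im (V n s))).

(** Euler-Maclaurin for (s - 1) zeta(s): the integral of (s - 1) x^(-s) over x >= 1 contributes 1
    and half of the first term contributes (s - 1)/2, together (s + 1)/2; the trapezoidal errors
    make up the rest. *)
Definition Zf (s : C) : C := (RtoC (/ 2) * (s + 1) + VS s)%C.

Lemma VS_Cser (s : C) : - (1 / 2) <= Re s -> Cser (fun n => V n s) (VS s).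
Proof.
  intros Hs. destruct (Cser_ex (fun n => V n s) (fun n => Cmod (s - 1) * Cmod s * Cmod (s + 1) * q32 n)) as [l
    Hl].
  - intros n. now apply V_bound.
  - apply (ex_series_scal_l (Cmod (s - 1) * Cmod s * Cmod (s + 1)) q32). apply ex_series_q32.
  - destruct Hl as [H1 H2]. unfold VS. split; simpl; apply Series_correct; eexists; eauto.
Qed.

Definition Q32 : R := Series q32.

Lemma Q32_pos : 0 <= Q32.
Proof.
  unfold Q32. apply Rle_trans with (sum_n q32 0).
  - rewrite sum_O. left. apply q32_pos.
  - apply sum_n_le_Series. intros n. left. apply q32_pos. apply ex_series_q32.
Qed.

Lemma VS_bound (s : C) : - (1 / 2) <= Re s ->
  Cmod (VS s) <= Cmod (s - 1) * Cmod s * Cmod (s + 1) * Q32.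
Proof.
  intros Hs. unfold Q32. rewrite <- Series_scal_l.
  apply (Cser_Cmod_le (fun n => V n s)).
  - now apply VS_Cser.
  - intros n. now apply V_bound.
  - apply (ex_series_scal_l (Cmod (s - 1) * Cmod s * Cmod (s + 1)) q32). apply ex_series_q32.
Qed.

Lemma Zf_bound (s : C) : - (1 / 2) <= Re s -> Cmod (Zf s) <= (1 + Q32) * (1 + Cmod s) ^ 3.
Proof.
  intros Hs. unfold Zf. eapply Rle_trans. apply Cmod_triangle. rewrite Cmod_mult, Cmod_R, Rabs_pos_eq by lra.
  pose proof (VS_bound s Hs). pose proof Q32_pos. pose proof (Cmod_ge_0 s).
  assert (A : Cmod (s - 1) <= 1 + Cmod s). { eapply Rle_trans. apply (Cmod_triangle s (- (1))%C).
  rewrite Cmod_opp, Cmod_1. lra. }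
  assert (B : Cmod (s + 1) <= 1 + Cmod s). { eapply Rle_trans. apply (Cmod_triangle s 1%C). rewrite Cmod_1.
  lra. }
  pose proof (Cmod_ge_0 (s - 1)). pose proof (Cmod_ge_0 (s + 1)).
  assert (Cmod (s - 1) * Cmod s * Cmod (s + 1) <= (1 + Cmod s) ^ 3).
  { replace ((1 + Cmod s) ^ 3) with ((1 + Cmod s) * (1 + Cmod s) * (1 + Cmod s)) by ring.
    apply Rmult_le_compat; auto. apply Rmult_le_pos; auto. apply Rmult_le_compat; auto. lra. }
  nra.
Qed.

Lemma Zf_lip (s s' : C) : 1 / 2 <= Re s -> 1 / 2 <= Re s' ->
  Cmod (Zf s' - Zf s) <= (1 + 3 * Q32) * (1 + Cmod s + Cmod s') ^ 3 * Cmod (s' - s).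
Proof.
  intros Hs Hs'. unfold Zf.
  replace (RtoC (/ 2) * (s' + 1) + VS s' - (RtoC (/ 2) * (s + 1) + VS s))%C
    with (RtoC (/ 2) * (s' - s) + (VS s' - VS s))%C by ring.
  eapply Rle_trans. apply Cmod_triangle. rewrite Cmod_mult, Cmod_R, Rabs_pos_eq by lra.
pose proof (Cmod_ge_0 s). pose proof (Cmod_ge_0 s'). pose proof (Cmod_ge_0 (s' - s)).
  assert (Cmod (VS s' - VS s) <= 3 * (1 + Cmod s + Cmod s') ^ 3 * Cmod (s' - s) * Q32).
  { unfold Q32. rewrite <- Series_scal_l. apply (Cser_Cmod_le (fun n => V n s' - V n s)%C).
    - apply (Cser_ext (fun n => V n s' + (- (1))%C * V n s)%C). intros; ring.
      replace (VS s' - VS s)%C with (VS s' + (- (1))%C * VS s)%C by ring.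
      apply Cser_plus. apply VS_Cser; lra. apply Cser_scal. apply VS_Cser; lra.
    - intros n. now apply V_lip.
    - apply (ex_series_scal_l (3 * (1 + Cmod s + Cmod s') ^ 3 * Cmod (s' - s)) q32). apply ex_series_q32. }
  assert (1 <= (1 + Cmod s + Cmod s') ^ 3).
  { rewrite <- (pow1 3). apply pow_incr. lra. }
  assert (Cmod (s' - s) <= (1 + Cmod s + Cmod s') ^ 3 * Cmod (s' - s)) by nra.
  lra.
Qed.

(** * Hasse's series computes (1 - 2^{1-s}) zeta(s) *)

(** Defined by Pascal's rule, so that it vanishes for [k > n], where the truncated subtraction in
    [Binomial.C] gives a nonzero value. *)
Fixpoint bin (n k : nat) : R :=
  match n, k with
  | _, O => 1
  | O, S _ => 0
  | S n', S k' => bin n' k' + bin n' (S k')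
  end.

Lemma bin_0_r (n : nat) : bin n 0 = 1.
Proof. now destruct n. Qed.

Lemma bin_SS (n k : nat) : bin (S n) (S k) = bin n k + bin n (S k).
Proof. reflexivity. Qed.

Lemma bin_gt (n k : nat) : (n < k)%nat -> bin n k = 0.
Proof.
  revert k. induction n; intros [|k] H; try lia; auto.
  rewrite bin_SS, !IHn by lia. ring.
Qed.

Lemma bin_diag (n : nat) : bin n n = 1.
Proof. induction n; auto. rewrite bin_SS, IHn, bin_gt by lia. ring. Qed.

Lemma bin_pos (n k : nat) : 0 <= bin n k.
Proof.
  revert k; induction n; intros [|k]; simpl; try lra.
  pose proof (IHn k). pose proof (IHn (S k)). lra.
Qed.

Lemma bin_C (n k : nat) : (k <= n)%nat -> Binomial.C n k = bin n k.
Proof.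
  revert k. induction n; intros k Hk.
  - replace k with 0%nat by lia. simpl. unfold Binomial.C. simpl. field.
  - destruct k.
    + simpl. unfold Binomial.C. rewrite Nat.sub_0_r. simpl (fact 0). simpl (INR 1). field.
      apply INR_fact_neq_0.
    + rewrite bin_SS. destruct (Nat.eq_dec k n) as [->|Hn].
      * rewrite bin_diag, bin_gt by lia. unfold Binomial.C. rewrite Nat.sub_diag. simpl (fact 0).
        simpl (INR 1). field. apply INR_fact_neq_0.
      * rewrite <- pascal by lia. rewrite !IHn by lia. reflexivity.
Qed.

Lemma Csumn_head (f : nat -> C) (n : nat) : Csumn f (S n) = (f 0%nat + Csumn (fun i => f (S i)) n)%C.
Proof. induction n. simpl. ring. change (Csumn f (S (S n))) with (Csumn f (S n) + f (S n))%C. rewrite IHn.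
simpl. ring. Qed.

(** With E the shift of sequences, [diff n] is (1 - E)^n and [mean n] below is ((1 + E)/2)^n, both
    evaluated at index 0. *)
Fixpoint diff (n : nat) (a : nat -> C) : C :=
  match n with
  | O => a O
  | S m => (diff m a - diff m (fun i => a (S i)))%C
  end.

Fixpoint mean (n : nat) (a : nat -> C) : C :=
  match n with
  | O => a O
  | S m => (RtoC (/ 2) * (mean m a + mean m (fun i => a (S i))))%C
  end.

Fixpoint rmean (n : nat) (a : nat -> R) : R :=
  match n with
  | O => a O
  | S m => / 2 * (rmean m a + rmean m (fun i => a (S i)))
  end.

Lemma diff_ext (n : nat) (a b : nat -> C) : (forall i, a i = b i) -> diff n a = diff n b.
Proof.
  revert a b. induction n; intros a b H; simpl; auto.
  rewrite (IHn a b), (IHn (fun i => a (S i)) (fun i => b (S i))); auto.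
Qed.

Lemma mean_ext (n : nat) (a b : nat -> C) : (forall i, a i = b i) -> mean n a = mean n b.
Proof.
  revert a b. induction n; intros a b H; simpl; auto.
  rewrite (IHn a b), (IHn (fun i => a (S i)) (fun i => b (S i))); auto.
Qed.

Lemma mean_minus (n : nat) (a b : nat -> C) : mean n (fun i => a i - b i)%C = (mean n a - mean n b)%C.
Proof. revert a b. induction n; intros a b; simpl; auto. rewrite !IHn. ring. Qed.

Lemma mean_opp (n : nat) (a : nat -> C) : mean n (fun i => - a i)%C = (- mean n a)%C.
Proof. revert a. induction n; intros a; simpl; auto. rewrite !IHn. ring. Qed.

(** The number [K] of terms is left free because Pascal's rule combines a sum of length [S K] with a
    shifted one of length [K]; the additional terms vanish. *)
Lemma diff_bin (K n : nat) (a : nat -> C) : (S n <= K)%nat ->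
  Csumn (fun j => RtoC ((-1) ^ j * bin n j) * a j)%C K = diff n a.
Proof.
  revert K a. induction n; intros K a HK.
  - destruct K; [lia|]. rewrite Csumn_head. simpl diff.
    rewrite (Csumn_ext _ (fun _ => RtoC 0 * RtoC 0)%C).
    + rewrite Csumn_scal. simpl. rewrite Rmult_1_l. ring.
    + intros i _. simpl bin. rewrite Rmult_0_r. ring.
  - destruct K; [lia|]. cbn [diff]. rewrite <- (IHn (S K) a) by lia.
    rewrite <- (IHn K (fun i => a (S i))) by lia.
    rewrite !Csumn_head. rewrite !bin_0_r.
    replace (Csumn (fun i => RtoC ((-1) ^ S i * bin (S n) (S i)) * a (S i))%C K) with
      (Csumn (fun i => (RtoC ((-1) ^ S i * bin n (S i)) * a (S i)) + (- (1))%C * (RtoC ((-1) ^ i * bin n i) *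
        a (S i)))%C K).
    + rewrite Csumn_plus, Csumn_scal. ring.
    + apply Csumn_ext. intros i _. rewrite bin_SS. simpl pow.
      rewrite !RtoC_mult, RtoC_plus. ring.
Qed.

Lemma RtoC_pow_half (n : nat) : (RtoC (/ 2 ^ S n) = RtoC (/ 2) * RtoC (/ 2 ^ n))%C.
Proof. rewrite <- RtoC_mult. f_equal. simpl. field. apply pow_nonzero. lra. Qed.

(** The sign (-1)^i conjugates the shift E into -E, which turns ((1 + E)/2)^n into 2^(-n) (1 -
    E)^n. *)
Lemma mean_alt (n : nat) (a : nat -> C) :
  mean n (fun i => RtoC ((-1) ^ i) * a i)%C = (RtoC (/ 2 ^ n) * diff n a)%C.
Proof.
  revert a. induction n; intros a.
  - simpl. rewrite Rinv_1. ring.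
  - cbn [mean diff]. rewrite (mean_ext n (fun i => RtoC ((-1) ^ S i) * a (S i))%C (fun i => - (RtoC ((-1) ^ i)
      * a (S i)))%C).
    + rewrite mean_opp, (IHn a), (IHn (fun i => a (S i))), RtoC_pow_half. ring.
    + intros i. simpl pow. rewrite RtoC_mult. ring.
Qed.

(** Partial sums of the transformed series are binomial means of the original partial sums: one more
    averaging adds half of the mean of the increments, and these increments are the alternating
    terms of [mean_alt]. *)
Lemma euler_transform (a : nat -> C) (N : nat) :
  Csumn (fun n => RtoC (/ 2 ^ S n) * diff n a)%C N = mean N (Csumn (fun j => RtoC ((-1) ^ j) * a j)%C).
Proof.
  induction N.
  - reflexivity.
  - cbn [Csumn mean]. rewrite IHN, RtoC_pow_half.
    rewrite <- Cmult_assoc, <- mean_alt.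
    rewrite (mean_ext N (fun i => RtoC ((-1) ^ i) * a i)%C
       (fun i => Csumn (fun j => RtoC ((-1) ^ j) * a j) (S i) - Csumn (fun j => RtoC ((-1) ^ j) * a j) i)%C).
    + rewrite mean_minus.
      set (y := mean N (fun i => Csumn _ (S i))).
      replace (mean N (fun i => (Csumn (fun j => RtoC ((-1) ^ j) * a j) i + RtoC ((-1) ^ i) * a i)%C)) with y
        by reflexivity.
      apply C_eq; simpl; field.
    + intros i. simpl. ring.
Qed.

Lemma Cmod_mean (n : nat) (a : nat -> C) (l : C) :
  Cmod (mean n a - l) <= rmean n (fun i => Cmod (a i - l)).
Proof.
  revert a. induction n; intros a; cbn [mean rmean]. lra.
  replace (RtoC (/ 2) * (mean n a + mean n (fun i => a (S i))) - l)%C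
    with (RtoC (/ 2) * ((mean n a - l) + (mean n (fun i => a (S i)) - l)))%C by (apply C_eq; simpl; field).
  rewrite Cmod_mult, Cmod_R, Rabs_pos_eq by lra. apply Rmult_le_compat_l. lra.
  eapply Rle_trans. apply Cmod_triangle. apply Rplus_le_compat. apply IHn. apply (IHn (fun i => a (S i))).
Qed.

Lemma rmean_le (n : nat) (a : nat -> R) (e : R) : (forall i, a i <= e) -> rmean n a <= e.
Proof. revert a. induction n; intros a H; cbn [rmean]; auto. pose proof (IHn a H).
pose proof (IHn (fun i => a (S i)) (fun i => H (S i))). lra. Qed.

(** Once [y] stays below the midpoint of [e] and [e'], the excess of [x] over this midpoint is at
    least halved in every step. *)
Lemma halving_limit (x y : nat -> R) (e : R) :
  (forall n, x (S n) = / 2 * (x n + y n)) ->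
  (forall e', e < e' -> exists N, forall n, (N <= n)%nat -> y n <= e') ->
  (forall e', e < e' -> exists N, forall n, (N <= n)%nat -> x n <= e').
Proof.
  intros Hx Hy e' He. destruct (Hy ((e + e') / 2) ltac:(lra)) as [N HN].
  assert (H : forall k, x (N + k)%nat - (e + e') / 2 <= (/ 2) ^ k * Rabs (x N - (e + e') / 2)).
  { induction k.
    - rewrite Nat.add_0_r. simpl. rewrite Rmult_1_l. apply Rle_abs.
    - rewrite Nat.add_succ_r, Hx. specialize (HN (N + k)%nat ltac:(lia)). simpl pow. lra. }
  assert (L : is_lim_seq (fun k => (/ 2) ^ k * Rabs (x N - (e + e') / 2)) (0 * Rabs (x N - (e + e') / 2))).
  { apply is_lim_seq_mult'. apply is_lim_seq_geom. rewrite Rabs_pos_eq; lra. apply is_lim_seq_const. }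
  rewrite Rmult_0_l in L. apply is_lim_seq_spec in L.
  destruct (L (mkposreal ((e' - e) / 2) ltac:(lra))) as [K HK].
  exists (N + K)%nat. intros n Hn. specialize (HK (n - N)%nat ltac:(lia)). simpl in HK.
  specialize (H (n - N)%nat). replace (N + (n - N))%nat with n in H by lia.
  rewrite Rminus_0_r in HK. apply Rabs_def2 in HK. lra.
Qed.

(** Regularity of Euler's summation. The induction is on the number [k] of leading terms that may
    exceed eps/2: shifting the sequence removes one of them, and [halving_limit] carries the bound
    from the shifted means to the means. *)
Lemma rmean_lim (a : nat -> R) : (forall i, 0 <= a i) -> is_lim_seq a 0 -> is_lim_seq (fun N => rmean N a) 0.
Proof.
  intros Ha Hl. apply is_lim_seq_spec. intros [eps He]. simpl.
  assert (Hpos : forall N b, (forall i, 0 <= b i) -> 0 <= rmean N b).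
  { induction N; intros b Hb; cbn [rmean]; auto. pose proof (IHN b Hb).
    pose proof (IHN (fun i => b (S i)) (fun i => Hb (S i))). lra. }
  apply is_lim_seq_spec in Hl. destruct (Hl (mkposreal (eps / 2) ltac:(lra))) as [I HI]. simpl in HI.
  assert (H : forall k b, (forall i, (k <= i)%nat -> b i <= eps / 2) ->
     forall e', eps / 2 < e' -> exists N, forall n, (N <= n)%nat -> rmean n b <= e').
  { induction k; intros b Hb.
    - intros e' He'. exists 0%nat. intros n _. apply rmean_le. intros i. specialize (Hb i ltac:(lia)). lra.
    - apply (halving_limit (fun n => rmean n b) (fun n => rmean n (fun i => b (S i)))).
      + reflexivity.
      + apply IHk. intros i Hi. apply Hb. lia. }
  destruct (H I a) with (e' := 3 / 4 * eps) as [N HN].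
  - intros i Hi. specialize (HI i Hi). rewrite Rminus_0_r, Rabs_pos_eq in HI by auto. lra.
  - lra.
  - exists N. intros n Hn. specialize (HN n Hn). rewrite Rminus_0_r, Rabs_pos_eq by auto. lra.
Qed.

(** The terms of Hasse's series are those of the Euler transform, so its sum is that of the
    alternating series wherever the latter converges. *)
Lemma euler_sum (a : nat -> C) (l : C) :
  Cser (fun j => RtoC ((-1) ^ j) * a j)%C l -> Cser (fun n => RtoC (/ 2 ^ S n) * diff n a)%C l.
Proof.
  rewrite !Cser_Clim. intros H. apply Clim_Cmod0 in H.
  apply (Clim_dominated _ _ (fun N => rmean N (fun i => Cmod (Csumn (fun j => RtoC ((-1) ^ j) * a j) i -
    l)%C))).
  - intros N. rewrite euler_transform. apply Cmod_mean.
  - apply rmean_lim; auto. intros; apply Cmod_ge_0.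
Qed.

Definition Sn (N : nat) (s : C) : C := Csumn (fun i => xpow (INR (S i)) s) N.

Lemma V_partial_sum (N : nat) (s : C) :
  (RtoC (/ 2) * (s + 1) + Csumn (fun n => V n s) N =
   (s - 1) * Sn (S N) s - RtoC (/ 2) * (s - 1) * xpow (INR (S N)) s + xpow (INR (S N)) (s - 1))%C.
Proof.
  induction N.
  - unfold Sn. simpl Csumn. simpl INR. rewrite !xpow_base_1. apply C_eq; simpl; field.
  - change (Csumn (fun n => V n s) (S N)) with (Csumn (fun n => V n s) N + V N s)%C.
    rewrite Cplus_assoc, IHN.
    change (Sn (S (S N)) s) with (Sn (S N) s + xpow (INR (S (S N))) s)%C.
    unfold V. rewrite (S_INR (S N)).

apply C_eq; simpl; field.
Qed.

Lemma ln_INR_lim : is_lim_seq (fun n => ln (INR (S n))) p_infty.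
Proof.
  apply (is_lim_seq_incr_1 (fun n => ln (INR n))).
  apply (is_lim_comp_seq ln INR p_infty p_infty). apply is_lim_ln_p.
  - exists 0%nat. discriminate.
  - apply is_lim_seq_INR.
Qed.

Lemma exp_ln_INR_lim (a : R) : 0 < a -> is_lim_seq (fun n => exp (- a * ln (INR (S n)))) 0.
Proof.
  intros Ha. apply (is_lim_comp_seq exp (fun n => - a * ln (INR (S n))) m_infty 0).
  - apply is_lim_exp_m.
  - exists 0%nat. discriminate.
  - replace m_infty with (Rbar_mult (- a) p_infty).
    + apply is_lim_seq_scal_l. apply ln_INR_lim.
    + apply is_Rbar_mult_unique, is_Rbar_mult_sym, is_Rbar_mult_p_infty_neg. simpl. lra.
Qed.

Lemma xpow_lim0 (s : C) : 0 < Re s -> Clim (fun n => xpow (INR (S n)) s) 0.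
Proof.
  intros Hs. apply (Clim_dominated _ _ (fun n => exp (- Re s * ln (INR (S n))))).
  - intros n. rewrite <- Cmod_xpow. right. f_equal. ring.
  - now apply exp_ln_INR_lim.
Qed.

(** The half term at the end of the range tends to 0 for Re s > 0, but N^(1-s) does not when Re s <=
    1, so it is kept in the limit. *)
Lemma Zf_limit (s : C) : 0 < Re s ->
  Clim (fun N => (s - 1) * Sn (S N) s + xpow (INR (S N)) (s - 1))%C (Zf s).
Proof.
  intros Hs.
  apply (Clim_ext (fun N => (RtoC (/ 2) * (s + 1) + Csumn (fun n => V n s) N) + RtoC (/ 2) * (s - 1) * xpow
    (INR (S N)) s)%C).
  - intros N. rewrite V_partial_sum. ring.
  - replace (Zf s) with (Zf s + RtoC (/ 2) * (s - 1) * 0)%C by ring.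
    apply Clim_plus. apply Clim_plus. apply Clim_const. apply Cser_Clim. apply VS_Cser. lra.
    apply Clim_mult. apply Clim_const. now apply xpow_lim0.
Qed.

Lemma Clim_even_odd (u : nat -> C) (l : C) :
  Clim (fun n => u (2 * n)%nat) l -> Clim (fun n => u (S (2 * n))) l -> Clim u l.
Proof.
  rewrite !Clim_Cmod0. intros H1 H2. apply is_lim_seq_spec. intros eps.
  apply is_lim_seq_spec in H1. apply is_lim_seq_spec in H2.
  destruct (H1 eps) as [N1 HN1]. destruct (H2 eps) as [N2 HN2].
  exists (2 * N1 + 2 * N2 + 2)%nat. intros n Hn.
  destruct (Nat.Even_or_Odd n) as [[m ->]|[m ->]].
  - apply HN1. lia.
  - replace (2 * m + 1)%nat with (S (2 * m)) by lia. apply HN2. lia.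
Qed.

Lemma RtoC_m1 : RtoC (-1) = (- (1))%C.
Proof. apply C_eq; simpl; ring. Qed.

Lemma two_xpow (s : C) : (RtoC 2 * xpow 2 s = xpow 2 (s - 1))%C.
Proof.
  replace s with ((s - 1) + 1)%C at 1 by ring. rewrite xpow_S by lra.
  apply C_eq; simpl; field.
Qed.

Lemma alt_sum_even (N : nat) (s : C) :
  (Csumn (fun j => RtoC ((-1) ^ j) * xpow (INR (S j)) s) (2 * N) = Sn (2 * N) s - xpow 2 (s - 1) * Sn N s)%C.
Proof.
  induction N.
  - unfold Sn. simpl. ring.
  - replace (2 * S N)%nat with (S (S (2 * N))) by lia. unfold Sn in *.
    cbn [Csumn]. rewrite IHN.
    replace (INR (S (S (2 * N)))) with (2 * INR (S N)) by (rewrite !S_INR, mult_INR; simpl; ring).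
    rewrite xpow_base_mult by (try lra; pose proof (INR_S_ge1 N); lra). rewrite <- two_xpow.
    rewrite pow_1_even. replace (-1 * (-1) ^ (2 * N)) with (-1) by (rewrite pow_1_even; ring).
    replace ((-1) ^ S (2 * N)) with (-1) by (now rewrite pow_1_odd).
    rewrite RtoC_m1. ring.
Qed.

(** The limit of [Zf_limit] is taken along 2N and along N. Subtracting 2^(1-s) times the second from
    the first cancels the powers (2N)^(1-s) and leaves the even partial sums of the alternating
    series; the odd ones differ by a term tending to 0. *)
Lemma alt_series (s : C) : 0 < Re s -> s <> 1 ->
  Cser (fun j => RtoC ((-1) ^ j) * xpow (INR (S j)) s)%C ((1 - xpow 2 (s - 1)) * Zf s / (s - 1)).
Proof.
  intros Hs Hs1. assert (Hz : (s - 1)%C <> 0). { intros H. apply Hs1. replace s with ((s - 1) + 1)%C by ring.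
  rewrite H. ring. }
  apply Cser_Clim.
  assert (E : Clim (fun n => Csumn (fun j => RtoC ((-1) ^ j) * xpow (INR (S j)) s)%C (2 * n)) ((1 - xpow 2 (s
    - 1)) * Zf s / (s - 1))).
  { assert (U : Clim (fun N => (s - 1) * Sn (S N) s + xpow (INR (S N)) (s - 1))%C (Zf s)) by (now apply
      Zf_limit).
    assert (U2 : Clim (fun N => (s - 1) * Sn (2 * S N) s + xpow (INR (2 * S N)) (s - 1))%C (Zf s)).
    { apply Clim_Cmod0. apply Clim_Cmod0 in U.
      apply (is_lim_seq_subseq _ _ (fun n => (2 * n + 1)%nat)) in U.
      - revert U. apply is_lim_seq_ext. intros n. replace (S (2 * n + 1)) with (2 * S n)%nat by lia.
        reflexivity.
      - apply eventually_subseq. intros; lia. }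
    assert (W : Clim (fun n => Csumn (fun j => RtoC ((-1) ^ j) * xpow (INR (S j)) s)%C (2 * S n)) ((1 - xpow 2
      (s - 1)) * Zf s / (s - 1))).
    { apply (Clim_ext (fun N => (/ (s - 1)) * (((s - 1) * Sn (2 * S N) s + xpow (INR (2 * S N)) (s - 1)) -
        xpow 2 (s - 1) * ((s - 1) * Sn (S N) s + xpow (INR (S N)) (s - 1))))%C).
      - intros N. rewrite alt_sum_even. rewrite mult_INR.
        rewrite xpow_base_mult by (try (simpl; lra); pose proof (INR_S_ge1 N); lra).
        replace (INR 2) with 2 by (simpl; ring). field. auto.
      - replace ((1 - xpow 2 (s - 1)) * Zf s / (s - 1))%C with (/ (s - 1) * (Zf s - xpow 2 (s - 1) * Zf s))%C
          by (field; auto).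
        apply Clim_mult. apply Clim_const. apply Clim_minus; auto. apply Clim_mult; auto. apply Clim_const. }
    destruct W as [W1 W2]. split; apply is_lim_seq_incr_1; auto. }
  apply Clim_even_odd; auto.
  cbn [Csumn]. replace ((1 - xpow 2 (s - 1)) * Zf s / (s - 1))%C with ((1 - xpow 2 (s - 1)) * Zf s / (s - 1) +
    0)%C at 1 by ring.
  apply Clim_plus; auto.
  apply (Clim_ext (fun n => xpow (INR (S (2 * n))) s)).
  - intros n. rewrite pow_1_even. ring.
  - pose proof (xpow_lim0 s Hs) as H. apply Clim_Cmod0. apply Clim_Cmod0 in H.
    apply (is_lim_seq_subseq _ _ (fun n => (2 * n)%nat)) in H; auto.
    apply eventually_subseq. intros; lia.
Qed.

Lemma CSeries_Cser (a : nat -> C) (l : C) : Cser a l -> CSeries a = l.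
Proof. intros [H1 H2]. unfold CSeries. apply is_series_unique in H1. apply is_series_unique in H2.
rewrite H1, H2. now destruct l. Qed.

Lemma csum_Csumn (f : nat -> C) (n : nat) : csum f n = Csumn f (S n).
Proof. induction n. simpl. ring. cbn [csum]. rewrite IHn. reflexivity. Qed.

Lemma cpow_neg_xpow (n : nat) (s : C) : cpow_neg n s = xpow (INR n) s.
Proof.
  unfold cpow_neg, xpow, cexp. rewrite Re_scal, Im_scal.
  f_equal; f_equal; f_equal; ring.
Qed.

Lemma cpow2_xpow (s : C) : cpow2 (1 - s) = xpow 2 (s - 1).
Proof.
  unfold cpow2, xpow, cexp. rewrite Re_scal, Im_scal, !Re_minus, !Im_minus.
  f_equal; f_equal; f_equal; simpl; ring.
Qed.

Lemma eta_euler (s l : C) :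
  Cser (fun n => RtoC (/ 2 ^ S n) * diff n (fun j => xpow (INR (S j)) s))%C l -> eta s = l.
Proof.
  intros H. unfold eta. apply CSeries_Cser. revert H. apply Cser_ext. intros n. f_equal.
  rewrite csum_Csumn, <- (diff_bin (S n) n) by lia.
  apply Csumn_ext. intros i Hi. rewrite cpow_neg_xpow, bin_C by lia. reflexivity.
Qed.

Lemma zeta_Zf (s : C) : 0 < Re s -> s <> 1 -> (1 - xpow 2 (s - 1))%C <> 0 ->
  zeta s = (Zf s / (s - 1))%C.
Proof.
  intros Hs H1 H2. unfold zeta.
  rewrite cpow2_xpow. rewrite (eta_euler s ((1 - xpow 2 (s - 1)) * Zf s / (s - 1))).
  - field. split; auto. intros H. apply H1. replace s with ((s - 1) + 1)%C by ring. rewrite H. ring.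
  - apply euler_sum. now apply alt_series.
Qed.

Lemma xpow_m1 (x : R) : 0 < x -> xpow x (RtoC (-1)) = RtoC x.
Proof.
  intros Hx. unfold xpow, cexp. rewrite Re_scal, Im_scal. simpl.
  replace (- ln x * -1) with (ln x) by ring. rewrite Rmult_0_r, cos_0, sin_0, exp_ln by auto.
  apply C_eq; simpl; ring.
Qed.

(** At s = 0 the integrand is the constant -1, for which the trapezoidal rule is exact. *)
Lemma Zf_0 : Zf 0 = RtoC (/ 2).
Proof.
  assert (H : Cser (fun n => V n 0) 0).
  { apply (Cser_ext (fun _ => RtoC 0)).
    - intros n. unfold V. replace (0 - 1)%C with (RtoC (-1)) by (rewrite RtoC_m1; ring).
      rewrite !xpow_0, !xpow_m1 by (pose proof (INR_S_ge1 n); lra). rewrite RtoC_plus.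
      apply C_eq; simpl; field.
    - apply Cser_Clim. apply (Clim_ext (fun _ => RtoC 0)); [|apply Clim_const].
      intros n; induction n; simpl; auto. rewrite <- IHn. ring. }
  unfold Zf. rewrite (Cser_unique _ _ _ (VS_Cser 0 ltac:(simpl; lra)) H). ring.
Qed.

(** The point 0 lies on the closed disc where [lambda_spec] demands the expansion, but not in Re s >
    0, where [alt_series] applies. Here all higher differences of the constant sequence vanish and
    Hasse's series reduces to its first term. *)
Lemma zeta_0 : zeta 0 = (Zf 0 / (0 - 1))%C.
Proof.
  unfold zeta. rewrite cpow2_xpow. rewrite (eta_euler 0 (RtoC (/ 2))).
  - rewrite Zf_0. replace (0 - 1)%C with (RtoC (-1)) by (rewrite RtoC_m1; ring). rewrite xpow_m1 by lra.
    apply C_eq; simpl; field; lra.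
  - apply (Cser_ext (fun n => match n with O => RtoC (/ 2) | _ => RtoC 0 end)).
    + intros n. destruct n.
      * cbn [diff]. rewrite xpow_0. simpl. apply C_eq; simpl; field.
      * cbn [diff]. rewrite (diff_ext n (fun i => xpow (INR (S (S i))) 0) (fun j => xpow (INR (S j)) 0)).
        ring. intros i. now rewrite !xpow_0.
    + apply Cser_Clim. apply (Clim_ext (fun n => match n with O => RtoC 0 | _ => RtoC (/ 2) end)).
      * intros n. destruct n; auto. rewrite Csumn_head.
        rewrite (Csumn_ext _ (fun _ => RtoC 0 * RtoC 0)%C), Csumn_scal by (intros; ring). ring.
      * split; apply is_lim_seq_incr_1; apply is_lim_seq_const.
Qed.

(** * Finite real sums *)

Fixpoint fsum (f : nat -> R) (n : nat) : R :=
  match n with O => 0 | S m => fsum f m + f m end.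

Lemma fsum_ext (f g : nat -> R) (n : nat) :
  (forall i, (i < n)%nat -> f i = g i) -> fsum f n = fsum g n.
Proof. induction n; simpl; intros H; auto. rewrite IHn by (intros; apply H; lia). rewrite H by lia. auto. Qed.

Lemma fsum_plus (f g : nat -> R) (n : nat) : fsum (fun i => f i + g i) n = fsum f n + fsum g n.
Proof. induction n; simpl; [ring|]. rewrite IHn. ring. Qed.

Lemma fsum_minus (f g : nat -> R) (n : nat) : fsum (fun i => f i - g i) n = fsum f n - fsum g n.
Proof. induction n; simpl; [ring|]. rewrite IHn. ring. Qed.

Lemma fsum_scal (c : R) (f : nat -> R) (n : nat) : fsum (fun i => c * f i) n = c * fsum f n.
Proof. induction n; simpl; [ring|]. rewrite IHn. ring. Qed.

Lemma fsum_const (c : R) (n : nat) : fsum (fun _ => c) n = INR n * c.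
Proof. induction n; simpl fsum. simpl; ring. rewrite IHn, S_INR. ring. Qed.

Lemma fsum_le (f g : nat -> R) (n : nat) :
  (forall i, (i < n)%nat -> f i <= g i) -> fsum f n <= fsum g n.
Proof. induction n; simpl; intros H. lra. assert (fsum f n <= fsum g n) by (apply IHn; intros; apply H; lia).
specialize (H n ltac:(lia)). lra. Qed.

Lemma fsum_pos (f : nat -> R) (n : nat) : (forall i, (i < n)%nat -> 0 <= f i) -> 0 <= fsum f n.
Proof. intros H. rewrite <- (Rmult_0_r (INR n)), <- fsum_const. apply fsum_le. auto. Qed.

Lemma fsum_Rabs (f : nat -> R) (n : nat) : Rabs (fsum f n) <= fsum (fun i => Rabs (f i)) n.
Proof. induction n; simpl. rewrite Rabs_R0; lra. eapply Rle_trans. apply Rabs_triang. lra. Qed.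

Lemma fsum_head (f : nat -> R) (n : nat) : fsum f (S n) = f 0%nat + fsum (fun i => f (S i)) n.
Proof. induction n. simpl; ring. change (fsum f (S (S n))) with (fsum f (S n) + f (S n)). rewrite IHn.
simpl; ring. Qed.

Lemma fsum_swap (f : nat -> nat -> R) (n m : nat) :
  fsum (fun i => fsum (f i) m) n = fsum (fun j => fsum (fun i => f i j) n) m.
Proof.
  induction n; simpl.
  - symmetry. rewrite fsum_const. ring.
  - rewrite IHn, fsum_plus. reflexivity.
Qed.

Lemma fsum_mono_n (f : nat -> R) (n m : nat) : (forall i, 0 <= f i) -> (n <= m)%nat -> fsum f n <= fsum f m.
Proof. intros Hf H. induction H; simpl. lra. specialize (Hf m). lra. Qed.

Lemma fsum_app (f : nat -> R) (n m : nat) : fsum f (n + m) = fsum f n + fsum (fun i => f (n + i)%nat) m.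
Proof. induction m; simpl. rewrite Nat.add_0_r; ring. rewrite Nat.add_succ_r. simpl. rewrite IHm. ring. Qed.

Lemma fsum_delta (f : nat -> R) (i n : nat) : (i < n)%nat ->
  (forall j, (j < n)%nat -> j <> i -> f j = 0) -> fsum f n = f i.
Proof.
  induction n; intros Hi H. lia. simpl. destruct (Nat.eq_dec i n) as [->|Hn].
  - rewrite (fsum_ext f (fun _ => 0)), fsum_const by (intros; apply H; lia). ring.
  - rewrite IHn, (H n) by (try lia; intros; apply H; lia). ring.
Qed.

Lemma sum_n_fsum (f : nat -> R) (n : nat) : sum_n f n = fsum f (S n).
Proof. induction n. rewrite sum_O. simpl; ring. rewrite sum_n_S, IHn. reflexivity. Qed.

Lemma sum_f_R0_fsum (f : nat -> R) (n : nat) : sum_f_R0 f n = fsum f (S n).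
Proof. rewrite <- sum_n_Reals. apply sum_n_fsum. Qed.

Lemma fsum_lim_series (a : nat -> R) (l : R) : is_series a l <-> is_lim_seq (fsum a) l.
Proof.
  split; intros H.
  - apply is_lim_seq_incr_1. apply (is_lim_seq_ext (sum_n a)); auto. intros n. apply sum_n_fsum.
  - apply is_lim_seq_incr_1 in H. apply (is_lim_seq_ext _ (sum_n a)) in H; auto. intros n.
    now rewrite sum_n_fsum.
Qed.

Lemma fsum_le_Series (a : nat -> R) (n : nat) : (forall n, 0 <= a n) -> ex_series a -> fsum a n <= Series a.
Proof. intros Ha Hs. apply Rle_trans with (sum_n a n). rewrite sum_n_fsum. simpl. specialize (Ha n). lra.
now apply sum_n_le_Series. Qed.

Lemma rsum_fsum (f : nat -> R) (m n : nat) : rsum f m n = fsum (fun i => f (m + i)%nat) n.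
Proof.
  unfold rsum. revert m. induction n; intros m. reflexivity.
  rewrite fsum_head. simpl. rewrite IHn, Nat.add_0_r. f_equal.
  apply fsum_ext. intros i _. f_equal. lia.
Qed.

(** * Power series with real coefficients at complex points *)

Definition pser (a : nat -> R) (w l : C) : Prop := Cser (fun n => RtoC (a n) * w ^ n)%C l.

Definition absconv (a : nat -> R) (r : R) : Prop := ex_series (fun n => Rabs (a n) * r ^ n).

Lemma Cmod_term (a : nat -> R) (w : C) (n : nat) : Cmod (RtoC (a n) * w ^ n) = Rabs (a n) * Cmod w ^ n.
Proof. now rewrite Cmod_mult, Cmod_R, Cmod_pow. Qed.

Lemma absconv_le (a : nat -> R) (r r' : R) : 0 <= r' <= r -> absconv a r -> absconv a r'.
Proof.
  intros Hr H. apply ex_series_Rle with (2 := H). intros n.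
  rewrite Rabs_mult, Rabs_Rabsolu. apply Rmult_le_compat_l. apply Rabs_pos.
  rewrite Rabs_pos_eq by (apply pow_le; lra). apply pow_incr. auto.
Qed.

Lemma pser_ex (a : nat -> R) (w : C) : absconv a (Cmod w) -> exists l, pser a w l.
Proof. intros H. eapply Cser_ex. 2: exact H. intros n. rewrite Cmod_term. lra. Qed.

Lemma pser_unique (a : nat -> R) (w l l' : C) : pser a w l -> pser a w l' -> l = l'.
Proof. apply Cser_unique. Qed.

Lemma pser_ext (a b : nat -> R) (w l : C) : (forall n, a n = b n) -> pser a w l -> pser b w l.
Proof. intros H. apply Cser_ext. intros n. now rewrite H. Qed.

Lemma pser_plus (a b : nat -> R) (w l m : C) : pser a w l -> pser b w m ->
  pser (fun n => a n + b n) w (l + m).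
Proof. intros H1 H2. eapply Cser_ext. 2: exact (Cser_plus _ _ _ _ H1 H2). intros n. cbv beta.
rewrite RtoC_plus. ring. Qed.

Lemma pser_scal (c : R) (a : nat -> R) (w l : C) : pser a w l -> pser (fun n => c * a n) w (RtoC c * l).
Proof. intros H1. eapply Cser_ext. 2: exact (Cser_scal (RtoC c) _ _ H1). intros n. cbv beta.
rewrite RtoC_mult. ring. Qed.

Lemma PS_mult_fsum (a b : nat -> R) (n : nat) : PS_mult a b n = fsum (fun k => a k * b (n - k)%nat) (S n).
Proof. unfold PS_mult. apply sum_f_R0_fsum. Qed.

Lemma pser_mult (a b : nat -> R) (w l m : C) :
  absconv a (Cmod w) -> absconv b (Cmod w) ->
  pser a w l -> pser b w m -> pser (PS_mult a b) w (l * m).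
Proof.
  intros Ha Hb [L1 L2] [M1 M2].
  assert (Aa : forall (g : C -> R), (forall c, Rabs (g c) <= Cmod c) -> forall a, absconv a (Cmod w) ->
    ex_series (fun n => Rabs (g (RtoC (a n) * w ^ n)%C))).
  { intros g Hg a' H. apply ex_series_Rle with (2 := H). intros n. rewrite Rabs_Rabsolu. eapply Rle_trans.
    apply Hg. rewrite Cmod_term; lra. }
  pose proof (is_series_mult _ _ _ _ L1 M1 (Aa Re re_le_Cmod _ Ha) (Aa Re re_le_Cmod _ Hb)) as P1.
  pose proof (is_series_mult _ _ _ _ L2 M2 (Aa Im im_le_Cmod _ Ha) (Aa Im im_le_Cmod _ Hb)) as P2.
  pose proof (is_series_mult _ _ _ _ L1 M2 (Aa Re re_le_Cmod _ Ha) (Aa Im im_le_Cmod _ Hb)) as P3.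
  pose proof (is_series_mult _ _ _ _ L2 M1 (Aa Im im_le_Cmod _ Ha) (Aa Re re_le_Cmod _ Hb)) as P4.
  assert (E : forall n k, (k <= n)%nat -> (w ^ n = w ^ k * w ^ (n - k))%C).
  { intros n k Hk. rewrite <- Cpow_add_r. f_equal. lia. }
  split.
  - rewrite Re_mult. eapply is_series_ext. 2: exact (is_series_Rminus _ _ _ _ P1 P2).
    intros n. cbv beta. rewrite Re_scal, PS_mult_fsum, !sum_f_R0_fsum, <- fsum_minus, Rmult_comm,
      <- fsum_scal.
    apply fsum_ext. intros k Hk. rewrite !Re_scal, !Im_scal, (E n k) by lia. rewrite Re_mult. ring.
  - rewrite Im_mult. eapply is_series_ext. 2: exact (is_series_Rplus _ _ _ _ P3 P4).
    intros n. cbv beta. rewrite Im_scal, PS_mult_fsum, !sum_f_R0_fsum, <- fsum_plus, Rmult_comm, <- fsum_scal.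
    apply fsum_ext. intros k Hk. rewrite !Re_scal, !Im_scal, (E n k) by lia. rewrite Im_mult. ring.
Qed.

Lemma absconv_mult (a b : nat -> R) (r : R) : 0 <= r -> absconv a r -> absconv b r -> absconv (PS_mult a b) r.
Proof.
  intros Hr Ha Hb. destruct Ha as [la Ha], Hb as [lb Hb].
  assert (P : forall c : nat -> R, ex_series (fun n => Rabs (c n) * r ^ n) ->
    ex_series (fun n => Rabs (Rabs (c n) * r ^ n))).
  { intros c H. eapply ex_series_ext. 2: exact H. intros n. cbv beta. rewrite (Rabs_pos_eq (_ * _)); auto.
    apply Rmult_le_pos. apply Rabs_pos. apply pow_le; auto. }
  pose proof (is_series_mult _ _ _ _ Ha Hb (P a (ex_intro _ _ Ha)) (P b (ex_intro _ _ Hb))) as H.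
  apply ex_series_Rle with (2 := ex_intro _ _ H). intros n.
  rewrite Rabs_mult, Rabs_Rabsolu, (Rabs_pos_eq (r ^ n)) by (apply pow_le; auto).
  rewrite PS_mult_fsum, sum_f_R0_fsum.
  apply Rle_trans with (fsum (fun k => Rabs (a k * b (n - k)%nat)) (S n) * r ^ n).
  - apply Rmult_le_compat_r. apply pow_le; auto. apply fsum_Rabs.
  - right. rewrite Rmult_comm, <- fsum_scal. apply fsum_ext. intros k Hk.
    replace (r ^ n) with (r ^ k * r ^ (n - k)) by (rewrite <- pow_add; f_equal; lia).
    rewrite Rabs_mult. ring.
Qed.

Fixpoint PS_pow (a : nat -> R) (k : nat) : nat -> R :=
  match k with
  | O => fun n => match n with O => 1 | S _ => 0 end
  | S k' => PS_mult a (PS_pow a k')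
  end.

Lemma finite_series (f : nat -> R) (N : nat) : (forall i, (N <= i)%nat -> f i = 0) -> is_series f (fsum f N).
Proof.
  intros H. apply fsum_lim_series. apply (is_lim_seq_ext_loc (fun _ => fsum f N)).
  - exists N. intros n Hn. replace n with (N + (n - N))%nat by lia. rewrite fsum_app.
    rewrite (fsum_ext (fun i => f (N + i)%nat) (fun _ => 0)), fsum_const by (intros i _; apply H; lia). ring.
  - apply is_lim_seq_const.
Qed.

Lemma absconv_finite (a : nat -> R) (N : nat) (r : R) : (forall i, (N <= i)%nat -> a i = 0) -> absconv a r.
Proof. intros H. eexists. apply (finite_series _ N). intros i Hi. rewrite H, Rabs_R0 by auto. ring. Qed.

Lemma pser_finite (a : nat -> R) (N : nat) (w : C) : (forall i, (N <= i)%nat -> a i = 0) ->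
  pser a w (Csumn (fun n => RtoC (a n) * w ^ n)%C N).
Proof.
  intros H. apply Cser_Clim.
  assert (E : forall n, (N <= n)%nat -> Csumn (fun n => RtoC (a n) * w ^ n)%C n =
    Csumn (fun n => RtoC (a n) * w ^ n)%C N).
  { induction 1; auto. simpl. rewrite IHle, H by auto. ring. }
  split; [apply (is_lim_seq_ext_loc (fun _ => Re (Csumn (fun n => RtoC (a n) * w ^ n)%C N))) |
          apply (is_lim_seq_ext_loc (fun _ => Im (Csumn (fun n => RtoC (a n) * w ^ n)%C N)))];
    try apply is_lim_seq_const; exists N; intros n Hn; cbv beta; now rewrite (E n Hn).
Qed.

Lemma absconv_pow (a : nat -> R) (k : nat) (r : R) : 0 <= r -> absconv a r -> absconv (PS_pow a k) r.
Proof.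
  intros Hr Ha. induction k; simpl.
  - apply (absconv_finite _ 1). intros [|i] Hi; auto; lia.
  - now apply absconv_mult.
Qed.

Lemma pser_pow (a : nat -> R) (k : nat) (w l : C) : absconv a (Cmod w) -> pser a w l ->
  pser (PS_pow a k) w (l ^ k).
Proof.
  intros Ha H. induction k; simpl.
  - replace (RtoC 1) with (Csumn (fun n => RtoC (PS_pow a 0 n) * w ^ n)%C 1) by (simpl; ring).
    apply pser_finite. intros [|i] Hi; auto; lia.
  - apply pser_mult; auto. apply absconv_pow; auto. apply Cmod_ge_0.
Qed.

(** * A discrete Parseval inequality and Cauchy's estimates *)

Definition cis (t : R) : C := (cos t, sin t).

Lemma Cmod_cis (t : R) : Cmod (cis t) = 1.
Proof.
  unfold Cmod, cis; simpl. replace (cos t * (cos t * 1) + sin t * (sin t * 1)) with (Rsqr (sin t) + Rsqr (cos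
    t)) by (unfold Rsqr; ring).
  rewrite sin2_cos2. apply sqrt_1.
Qed.

Lemma cis_pow (t : R) (n : nat) : (cis t ^ n)%C = cis (INR n * t).
Proof.
  induction n.
  - simpl. unfold cis. rewrite Rmult_0_l, cos_0, sin_0. reflexivity.
  - rewrite S_INR. simpl Cpow. rewrite IHn. unfold cis.
    replace ((INR n + 1) * t) with (t + INR n * t) by ring.
    rewrite cos_plus, sin_plus. apply C_eq; simpl; ring.
Qed.

(* The midpoints of the [M] equal arcs of the unit circle: unlike the roots of
   unity they avoid the point 1. *)
Definition node (M j : nat) : R := (2 * INR j + 1) * PI / INR M.

Lemma sin_2PI_INR (n : nat) : sin (2 * INR n * PI) = 0.
Proof. rewrite <- (Rplus_0_l (2 * INR n * PI)), sin_period. apply sin_0. Qed.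

(** Multiplication by 2 sin(p pi / M) makes the sum of cosines telescope to sin(2 p pi) = 0; this
    sine is positive because p < M. *)
Lemma node_sum_pos (M p : nat) : (0 < p < M)%nat -> fsum (fun j => cos (INR p * node M j)) M = 0.
Proof.
  intros Hp. assert (HM : 0 < INR M) by (apply lt_0_INR; lia).
  assert (Hpp : 0 < INR p) by (apply lt_0_INR; lia).
  assert (HpM : INR p < INR M) by (apply lt_INR; lia).
  assert (Hs : 0 < sin (INR p * PI / INR M)).
  { pose proof PI_RGT_0. apply sin_gt_0.
    - apply Rdiv_lt_0_compat; auto. nra.
    - apply Rmult_lt_reg_r with (INR M); auto. unfold Rdiv. rewrite Rmult_assoc, Rinv_l by lra. nra. }
  assert (T : forall n, 2 * sin (INR p * PI / INR M) * fsum (fun j => cos (INR p * node M j)) n =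
    sin (2 * INR n * (INR p * PI / INR M))).
  { induction n.
    - simpl. rewrite !Rmult_0_r, Rmult_0_l, sin_0. ring.
    - simpl fsum. rewrite Rmult_plus_distr_l, IHn. unfold node. rewrite S_INR.
      set (x := INR p * PI / INR M).
      replace (INR p * ((2 * INR n + 1) * PI / INR M)) with (2 * INR n * x + x) by (unfold x; field; lra).
      replace (2 * (INR n + 1) * x) with ((2 * INR n * x + x) + x) by ring.
      replace (2 * INR n * x) with ((2 * INR n * x + x) - x) at 1 by ring.
      generalize (2 * INR n * x + x). intros y0. rewrite sin_minus, sin_plus. ring. }
  specialize (T M). replace (2 * INR M * (INR p * PI / INR M)) with (2 * INR p * PI) in T by (field; lra).
  rewrite sin_2PI_INR in T. nra.
Qed.

Lemma node_sum (M n m : nat) : (n < M)%nat -> (m < M)%nat ->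
  fsum (fun j => cos ((INR n - INR m) * node M j)) M = if Nat.eqb n m then INR M else 0.
Proof.
  intros Hn Hm. destruct (Nat.eqb_spec n m) as [->|Hnm].
  - rewrite (fsum_ext _ (fun _ => 1)), fsum_const. ring.
    intros j _. rewrite Rminus_diag, Rmult_0_l. apply cos_0.
  - destruct (Nat.lt_ge_cases m n).
    + rewrite <- (node_sum_pos M (n - m)) by lia. apply fsum_ext. intros j _. now rewrite minus_INR by lia.
    + rewrite <- (node_sum_pos M (m - n)) by lia. apply fsum_ext. intros j _. rewrite minus_INR by lia.
      rewrite <- cos_neg. f_equal. ring.
Qed.

Definition normsq (c : C) : R := Re c * Re c + Im c * Im c.

Lemma normsq_Cmod (c : C) : normsq c = Cmod c * Cmod c.
Proof. unfold normsq, Cmod, Re, Im. rewrite sqrt_sqrt. ring. nra. Qed.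

Lemma parseval_finite (x : nat -> R) (N : nat) :
  fsum (fun j => normsq (Csumn (fun n => RtoC (x n) * cis (INR n * node N j))%C N)) N
  = INR N * fsum (fun n => x n * x n) N.
Proof.
  assert (E : forall t, normsq (Csumn (fun n => RtoC (x n) * cis (INR n * t))%C N) =
     fsum (fun n => fsum (fun m => x n * x m * cos ((INR n - INR m) * t)) N) N).
  { intros t. unfold normsq.
    assert (E1 : forall K, Re (Csumn (fun n => RtoC (x n) * cis (INR n * t))%C K) =
      fsum (fun n => x n * cos (INR n * t)) K).
    { induction K; auto. cbn [Csumn fsum]. now rewrite Re_plus, IHK, Re_scal. }
    assert (E2 : forall K, Im (Csumn (fun n => RtoC (x n) * cis (INR n * t))%C K) =
      fsum (fun n => x n * sin (INR n * t)) K).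
    { induction K; auto. cbn [Csumn fsum]. now rewrite Im_plus, IHK, Im_scal. }
    rewrite E1, E2, <- !fsum_scal, <- fsum_plus. apply fsum_ext. intros n _.
    rewrite (Rmult_comm _ (x n * cos (INR n * t))), (Rmult_comm _ (x n * sin (INR n * t))), <- !fsum_scal,
      <- fsum_plus.
    apply fsum_ext. intros m _. rewrite Rmult_minus_distr_r, cos_minus. ring. }
  rewrite (fsum_ext _ _ _ (fun j _ => E (node N j))). rewrite fsum_swap, <- fsum_scal. apply fsum_ext.
  intros n Hn.
  rewrite fsum_swap. rewrite (fsum_delta _ n); auto.
  - rewrite fsum_scal, node_sum, Nat.eqb_refl by auto. ring.
  - intros m Hm Hne. rewrite fsum_scal, node_sum by auto. destruct (Nat.eqb_spec n m); [congruence|ring].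
Qed.

(** Parseval is exact for a truncation taken at as many nodes as it has terms. The tail [t] is
    bounded uniformly in the angle by absolute convergence, and (B + t)^2 <= 2 B^2 + 2 t^2 costs the
    factor 2 in the conclusion. *)
Lemma parseval_bound (a : nat -> R) (r K : R) (f : C -> C) :
  0 <= r -> absconv a r ->
  (forall t, pser a (RtoC r * cis t) (f (RtoC r * cis t)%C)) ->
  (forall M, (1 <= M)%nat -> fsum (fun j => normsq (f (RtoC r * cis (node M j))%C)) M <= INR M * K) ->
  forall N, fsum (fun n => (a n * r ^ n) * (a n * r ^ n)) N <= 2 * K.
Proof.
  intros Hr Ha Hf HK N. apply le_epsilon. intros eps He.
  (* The minimum with 1 ensures that the square of the tail is also at most eps/2. *)
  destruct (Series_tail_small _ (Rmin 1 (eps / 2)) Ha ltac:(apply Rmin_pos; lra)) as [N0 HN0].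
  set (N1 := (N0 + N)%nat). specialize (HN0 N1 ltac:(unfold N1; lia)).
  set (t := Series (fun k => Rabs (a (S N1 + k)%nat) * r ^ (S N1 + k))) in *.
  assert (Ht : t * t <= eps / 2).
  { pose proof (Rmin_l 1 (eps / 2)). pose proof (Rmin_r 1 (eps / 2)).
    assert (Rabs t * Rabs t <= 1 * (eps / 2)) by (apply Rmult_le_compat; try apply Rabs_pos; lra).
    rewrite <- Rabs_mult, Rabs_pos_eq in H1 by nra. lra. }
  assert (S1 : forall u, Cmod (Csumn (fun n => RtoC (a n) * (RtoC r * cis u) ^ n)%C (S N1)) <=
    Cmod (f (RtoC r * cis u)%C) + t).
  { intros u. set (w := (RtoC r * cis u)%C).
    assert (Hw : Cmod w = r) by (unfold w; rewrite Cmod_mult, Cmod_R, Cmod_cis, Rabs_pos_eq; lra).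
    assert (H : Cser (fun k => RtoC (a (S N1 + k)%nat) * w ^ (S N1 + k))%C (f w - Csumn (fun n => RtoC (a n) *
      w ^ n)%C (S N1))).
    { pose proof (Hf u) as H. fold w in H. apply Cser_Clim in H. apply Cser_Clim.
      assert (H' : Clim (fun k => Csumn (fun n => RtoC (a n) * w ^ n)%C (S N1 + k)) (f w)).
      { destruct H as [H1 H2].
        split; [apply (is_lim_seq_incr_n _ (S N1)) in H1;
          revert H1 | apply (is_lim_seq_incr_n _ (S N1)) in H2; revert H2];
        apply is_lim_seq_ext; intros n; do 2 f_equal; lia. }
      eapply Clim_ext. 2: exact (Clim_minus _ _ _ _ H' (Clim_const (Csumn (fun n => RtoC (a n) * w ^ n)%C (S
        N1)))).
      intros k. cbv beta. induction k. rewrite Nat.add_0_r. simpl Csumn at 3. ring.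
      rewrite Nat.add_succ_r. change (Csumn ?g (S ?k)) with (Csumn g k + g k)%C at 1 3. rewrite <- IHk. ring.
      }
    apply (Cser_Cmod_le _ _ (fun k => Rabs (a (S N1 + k)%nat) * r ^ (S N1 + k))) in H.
    - fold t in H. replace (Csumn (fun n => RtoC (a n) * w ^ n)%C (S N1)) with (f w - (f w - Csumn (fun n =>
        RtoC (a n) * w ^ n)%C (S N1)))%C by ring.
      eapply Rle_trans. apply (Cmod_triangle (f w)). rewrite Cmod_opp. lra.
    - intros n. rewrite (Cmod_term a w (S N1 + n)), Hw. apply Rle_refl.
    - apply (ex_series_incr_n (fun n => Rabs (a n) * r ^ n) (S N1)). exact Ha. }
  apply Rle_trans with (fsum (fun n => (a n * r ^ n) * (a n * r ^ n)) (S N1)).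
  { apply fsum_mono_n. intros; nra. unfold N1; lia. }
  apply Rmult_le_reg_l with (INR (S N1)). apply lt_0_INR; lia.
  rewrite <- (parseval_finite (fun n => a n * r ^ n)).
  apply Rle_trans with (fsum (fun j => 2 * normsq (f (RtoC r * cis (node (S N1) j))%C) + eps) (S N1)).
  - apply fsum_le. intros j _. specialize (S1 (node (S N1) j)).
    rewrite (Csumn_ext (fun n => RtoC (a n * r ^ n) * cis (INR n * node (S N1) j))%C
               (fun n => RtoC (a n) * (RtoC r * cis (node (S N1) j)) ^ n)%C)
      by (intros n _; rewrite Cpow_mult_l, cis_pow, RtoC_mult, RtoC_pow; ring).
    rewrite !normsq_Cmod. set (A := Cmod (Csumn _ _)) in *. set (B := Cmod (f _)) in *.
    assert (0 <= A) by apply Cmod_ge_0.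
    pose proof (Rle_0_sqr (B - t)) as HBt. unfold Rsqr in HBt.
nra.
  - rewrite fsum_plus, fsum_scal, fsum_const. specialize (HK (S N1) ltac:(lia)). lra.
Qed.

(** A single square in [parseval_bound]; the resulting factor sqrt 2 is rounded up to 2. *)
Lemma cauchy_estimate (a : nat -> R) (r K : R) (f : C -> C) :
  0 <= r -> absconv a r ->
  (forall t, pser a (RtoC r * cis t) (f (RtoC r * cis t)%C)) ->
  (forall t, Cmod (f (RtoC r * cis t)%C) <= K) ->
  forall n, Rabs (a n) * r ^ n <= 2 * K.
Proof.
  intros Hr Ha Hf HK n.
  assert (K0 : 0 <= K) by (apply Rle_trans with (2 := HK 0); apply Cmod_ge_0).
  assert (H : fsum (fun n => (a n * r ^ n) * (a n * r ^ n)) (S n) <= 2 * (K * K)).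
  { apply (parseval_bound a r (K * K) f); auto. intros M _. rewrite <- fsum_const. apply fsum_le.
    intros j _. rewrite normsq_Cmod. apply Rmult_le_compat; auto; apply Cmod_ge_0. }
  simpl in H. assert (0 <= fsum (fun n => (a n * r ^ n) * (a n * r ^ n)) n) by (apply fsum_pos; intros; nra).
  rewrite <- (Rabs_pos_eq (r ^ n)) by (apply pow_le; auto). rewrite <- Rabs_mult.
  apply Rsqr_incr_0_var; [|lra]. rewrite <- Rsqr_abs. unfold Rsqr. nra.
Qed.

(** * The exponential series and uniqueness of power series coefficients *)

Lemma pow_fact_exp (x : R) (n : nat) : 0 <= x -> x ^ n / INR (fact n) <= exp x.
Proof.
  intros Hx. pose proof (is_exp_Reals x) as H.
  assert (H' : is_series (fun n => x ^ n / INR (fact n)) (exp x)).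
  { eapply is_series_ext. 2: exact H. intros k. unfold scal; simpl. unfold mult; simpl. rewrite pow_n_pow.
    field. apply INR_fact_neq_0. }
  rewrite <- (is_series_Series _ _ H').
  assert (P : forall k, 0 <= x ^ k / INR (fact k)).
  { intros k. apply Rmult_le_pos. apply pow_le; auto. left. apply Rinv_0_lt_compat. apply INR_fact_lt_0. }
  apply Rle_trans with (fsum (fun n => x ^ n / INR (fact n)) (S n)).
  - simpl. assert (0 <= fsum (fun n => x ^ n / INR (fact n)) n) by (apply fsum_pos; auto). lra.
  - apply fsum_le_Series; auto. exists (exp x); auto.
Qed.

Lemma is_series_exp (x : R) : is_series (fun n => / INR (fact n) * x ^ n) (exp x).
Proof.
  eapply is_series_ext. 2: exact (is_exp_Reals x). intros k. unfold scal; simpl. unfold mult; simpl.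
  rewrite pow_n_pow. ring.
Qed.

Lemma CV_radius_infinite (a : nat -> R) (z : R) :
  (forall n, Rabs (a n) <= z ^ n / INR (fact n)) -> 0 <= z -> CV_radius a = p_infty.
Proof.
  intros H Hz. destruct (CV_radius_bounded a) as [Hub _].
  assert (B : forall r : R, Rbar_le r (CV_radius a)).
  { intros r. apply Hub. exists (exp (z * Rabs r)). intros n. rewrite Rabs_mult, <- RPow_abs.
    eapply Rle_trans. 2: apply (pow_fact_exp (z * Rabs r) n). 2: apply Rmult_le_pos; auto; apply Rabs_pos.
    rewrite Rpow_mult_distr. unfold Rdiv.
    replace (z ^ n * Rabs r ^ n * / INR (fact n)) with (z ^ n / INR (fact n) * Rabs r ^ n) by (unfold Rdiv;
      ring).
    apply Rmult_le_compat_r. apply pow_le, Rabs_pos. apply H. }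
  destruct (CV_radius a) as [r| |]; auto.
  - specialize (B (r + 1)). simpl in B. lra.
  - specialize (B 0). simpl in B. contradiction.
Qed.

Lemma PSeries_1 (a : nat -> R) : CV_radius a = p_infty -> is_series a (PSeries a 1).
Proof.
  intros H. assert (E : ex_pseries a 1) by (apply CV_radius_inside; rewrite H; exact I).
  apply PSeries_correct in E. eapply is_series_ext. 2: exact E.
  intros n. unfold scal; simpl. unfold mult; simpl. rewrite pow_n_pow, pow1. ring.
Qed.

(* Both components of [cexp (- t Z) * sum_n (t Z)^n / n!] have zero derivative in [t]. *)
Lemma cexp_series (Z : C) : Cser (fun n => RtoC (/ INR (fact n)) * Z ^ n)%C (cexp Z).
Proof.
  set (a := fun n => / INR (fact n) * Re (Z ^ n)). set (b := fun n => / INR (fact n) * Im (Z ^ n)).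
  assert (Ra : CV_radius a = p_infty).
  { apply (CV_radius_infinite a (Cmod Z)). 2: apply Cmod_ge_0. intros n. unfold a.
    assert (0 < / INR (fact n)) by (apply Rinv_0_lt_compat, INR_fact_lt_0).
    rewrite Rabs_mult, Rabs_pos_eq by lra. unfold Rdiv. rewrite Rmult_comm. apply Rmult_le_compat_r. lra.
    rewrite <- Cmod_pow. apply re_le_Cmod. }
  assert (Rb : CV_radius b = p_infty).
  { apply (CV_radius_infinite b (Cmod Z)). 2: apply Cmod_ge_0. intros n. unfold b.
    assert (0 < / INR (fact n)) by (apply Rinv_0_lt_compat, INR_fact_lt_0).
    rewrite Rabs_mult, Rabs_pos_eq by lra. unfold Rdiv. rewrite Rmult_comm. apply Rmult_le_compat_r. lra.
    rewrite <- Cmod_pow. apply im_le_Cmod. }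
  assert (Ea : forall t, ex_pseries a t) by (intros; apply CV_radius_inside; rewrite Ra; exact I).
  assert (Eb : forall t, ex_pseries b t) by (intros; apply CV_radius_inside; rewrite Rb; exact I).
  set (x := Re Z). set (y := Im Z).
  assert (Da : forall t, is_derive (PSeries a) t (x * PSeries a t - y * PSeries b t)).
  { intros t. replace (x * PSeries a t - y * PSeries b t) with (PSeries (PS_derive a) t).
    - apply is_derive_PSeries. rewrite Ra. exact I.
    - rewrite <- !PSeries_scal. rewrite <- PSeries_minus. 2,3: apply ex_pseries_scal; auto; apply Rmult_comm.
      apply PSeries_ext. intros n. unfold PS_derive, PS_minus, PS_plus, PS_opp, PS_scal, plus, opp, scal;
        simpl. unfold mult; simpl.
      unfold a, b. rewrite Cpow_S, Re_mult. fold x y. rewrite fact_simpl, mult_INR. rewrite S_INR.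
      change (match n with 0%nat => 1 | S _ => INR n + 1 end) with (INR (S n)). rewrite S_INR.
      field. split. apply INR_fact_neq_0. pose proof (pos_INR n); lra. }
  assert (Db : forall t, is_derive (PSeries b) t (x * PSeries b t + y * PSeries a t)).
  { intros t. replace (x * PSeries b t + y * PSeries a t) with (PSeries (PS_derive b) t).
    - apply is_derive_PSeries. rewrite Rb. exact I.
    - rewrite <- !PSeries_scal. rewrite <- PSeries_plus. 2,3: apply ex_pseries_scal; auto; apply Rmult_comm.
      apply PSeries_ext. intros n. unfold PS_derive, PS_plus, PS_scal, plus, scal; simpl. unfold mult; simpl.
      unfold a, b. rewrite Cpow_S, Im_mult. fold x y. rewrite fact_simpl, mult_INR. rewrite S_INR.
      change (match n with 0%nat => 1 | S _ => INR n + 1 end) with (INR (S n)). rewrite S_INR.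
      field. split. apply INR_fact_neq_0. pose proof (pos_INR n); lra. }
  set (u := fun t => exp (- x * t) * (PSeries a t * cos (y * t) + PSeries b t * sin (y * t))).
  set (v := fun t => exp (- x * t) * (- PSeries a t * sin (y * t) + PSeries b t * cos (y * t))).
  assert (Hd : forall g, (forall t, is_derive g t 0) -> g 1 = g 0).
  { intros g Hg. assert (H : Rabs (g 1 - g 0) <= 0 * (1 - 0)).
    { apply (mvt_bound g (fun _ => 0)); auto. lra. intros; rewrite Rabs_R0; lra. }
    rewrite Rmult_0_l in H. pose proof (Rabs_pos (g 1 - g 0)).
    destruct (Req_dec (g 1 - g 0) 0); [lra|]. apply Rabs_no_R0 in H1. lra. }
  assert (Hu : u 1 = u 0).
  { apply Hd. intros t. unfold u. auto_derive.
    - repeat split; eexists; [apply Da|apply Db].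
    - rewrite (is_derive_unique _ _ _ (Da t) : Derive (fun x => PSeries a x) t = _),
        (is_derive_unique _ _ _ (Db t) : Derive (fun x => PSeries b x) t = _). ring. }
  assert (Hv : v 1 = v 0).
  { apply Hd. intros t. unfold v. auto_derive.
    - repeat split; eexists; [apply Da|apply Db].
    - rewrite (is_derive_unique _ _ _ (Da t) : Derive (fun x => PSeries a x) t = _),
        (is_derive_unique _ _ _ (Db t) : Derive (fun x => PSeries b x) t = _). ring. }
  assert (A0 : PSeries a 0 = 1). { rewrite PSeries_0. unfold a. simpl. field. }
  assert (B0 : PSeries b 0 = 0). { rewrite PSeries_0. unfold b. simpl. field. }
  unfold u in Hu. unfold v in Hv. rewrite A0, B0, !Rmult_0_r, cos_0, sin_0, exp_0, !Rmult_1_r in Hu, Hv.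
  assert (HE : exp x * exp (- x) = 1) by (rewrite <- exp_plus, Rplus_opp_r; apply exp_0).
  pose proof (sin2_cos2 y) as SC. unfold Rsqr in SC.
  pose proof (PSeries_1 a Ra) as Sa. pose proof (PSeries_1 b Rb) as Sb.
  set (A := PSeries a 1) in *. set (B := PSeries b 1) in *.
  assert (U1 : A * cos y + B * sin y = exp x).
  { transitivity (exp x * exp (- x) * (A * cos y + B * sin y)). rewrite HE; ring. rewrite Rmult_assoc, Hu.
    ring. }
  assert (V1 : - A * sin y + B * cos y = 0).
  { transitivity (exp x * exp (- x) * (- A * sin y + B * cos y)). rewrite HE; ring. rewrite Rmult_assoc, Hv.
    ring. }
  split; simpl.
  - fold x y. replace (exp x * cos y) with A.
    2:{ rewrite <- U1. transitivity (A * (sin y * sin y + cos y * cos y) ). rewrite SC; ring.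
        transitivity ((A * cos y + B * sin y) * cos y - sin y * (- A * sin y + B * cos y)). ring. rewrite V1.
        ring. }
    eapply is_series_ext. 2: exact Sa. intros n. unfold a. rewrite <- Re_scal. reflexivity.
  - fold x y. replace (exp x * sin y) with B.
    2:{ rewrite <- U1. transitivity (B * (sin y * sin y + cos y * cos y) ). rewrite SC; ring.
        transitivity ((A * cos y + B * sin y) * sin y + cos y * (- A * sin y + B * cos y)). ring. rewrite V1.
        ring. }
    eapply is_series_ext. 2: exact Sb. intros n. unfold b. rewrite <- Im_scal. reflexivity.
Qed.

Lemma is_pseries_series (a : nat -> R) (x l : R) : is_pseries a x l <-> is_series (fun n => a n * x ^ n) l.
Proof.
  assert (E : forall n, scal (pow_n x n) (a n) = a n * x ^ n).
  { intros n. unfold scal; simpl. unfold mult; simpl. rewrite pow_n_pow. ring. }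
  split; intros H; (eapply is_series_ext; [|exact H]); intros n; cbv beta; now rewrite E.
Qed.

Lemma ex_pseries_radius (a : nat -> R) (x : R) : ex_pseries a x -> Rbar_le (Rabs x) (CV_radius a).
Proof.
  intros H. destruct (Rbar_le_lt_dec (Rabs x) (CV_radius a)) as [|h]; auto.
  exfalso. apply CV_disk_outside in h. apply h.
  apply ex_series_lim_0. destruct H as [l Hl]. apply is_pseries_series in Hl. now exists l.
Qed.

(** The identity is known for positive x only; continuity of the sum along rho/(k + 2) carries it to
    x = 0. *)
Lemma coef_zero_0 (d : nat -> R) (rho : R) : 0 < rho ->
  (forall x, 0 < x < rho -> is_series (fun n => d n * x ^ n) 0) -> d 0%nat = 0.
Proof.
  intros Hr Hd.
  assert (HR : Rbar_lt 0 (CV_radius d)).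
  { assert (H : ex_pseries d (rho / 2)) by (exists 0; apply is_pseries_series; apply Hd; lra).
    apply ex_pseries_radius in H. eapply Rbar_lt_le_trans. 2: exact H. simpl. rewrite Rabs_pos_eq; lra. }
  assert (HC : continuity_pt (PSeries d) 0) by (apply PSeries_continuity; now rewrite Rabs_R0).
  assert (L : is_lim_seq (fun k => PSeries d (rho * / (INR k + 2))) (PSeries d 0)).
  { apply is_lim_seq_continuous; auto. rewrite <- (Rmult_0_r rho).
    apply is_lim_seq_mult'. apply is_lim_seq_const.
    replace (Finite 0) with (Rbar_inv p_infty) by reflexivity.
    apply is_lim_seq_inv; [|discriminate].
    eapply is_lim_seq_plus. apply is_lim_seq_INR. apply is_lim_seq_const. reflexivity. }
  assert (L0 : is_lim_seq (fun k => PSeries d (rho * / (INR k + 2))) 0).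
  { apply (is_lim_seq_ext (fun _ => 0)); [|apply is_lim_seq_const].
    intros k. symmetry. apply is_pseries_unique, is_pseries_series, Hd.
    pose proof (pos_INR k). assert (0 < / (INR k + 2)) by (apply Rinv_0_lt_compat; lra).
    assert (/ (INR k + 2) < 1) by (rewrite <- Rinv_1; apply Rinv_lt_contravar; lra). split; nra. }
  apply is_lim_seq_unique in L. apply is_lim_seq_unique in L0. rewrite L in L0. injection L0 as L0.
  now rewrite PSeries_0 in L0.
Qed.

Lemma coef_zero (d : nat -> R) (rho : R) : 0 < rho ->
  (forall x, 0 < x < rho -> is_series (fun n => d n * x ^ n) 0) -> forall n, d n = 0.
Proof.
  intros Hr Hd n. revert d Hd. induction n; intros d Hd.
  - now apply (coef_zero_0 d rho).
  - apply (IHn (fun m => d (S m))). intros x Hx.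
    assert (E : forall m, / x * (d (S m) * x ^ S m) = d (S m) * x ^ m) by (intros m; simpl; field; lra).
    apply (is_series_ext _ _ _ E). rewrite <- (Rmult_0_r (/ x)). apply is_series_Rscal.
    apply (is_series_incr_1 (fun m => d m * x ^ m)).
    rewrite (coef_zero_0 d rho) by auto.
    rewrite Rmult_0_l. change (plus 0 0) with (0 + 0). rewrite Rplus_0_l. auto.
Qed.

Lemma coef_unique (a b : nat -> R) (rho : R) : 0 < rho ->
  (forall x, 0 < x < rho -> exists l, is_series (fun n => a n * x ^ n) l /\
    is_series (fun n => b n * x ^ n) l) ->
  forall n, a n = b n.
Proof.
  intros Hr H n. apply Rminus_diag_uniq. apply (coef_zero (fun n => a n - b n) rho); auto.
  intros x Hx. destruct (H x Hx) as [l [H1 H2]]. rewrite <- (Rminus_diag l).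
  eapply is_series_ext. 2: exact (is_series_Rminus _ _ _ _ H1 H2).
  intros m. cbv beta. symmetry. apply Rmult_minus_distr_r.
Qed.

Lemma pser_real (a : nat -> R) (x l : R) : is_series (fun n => a n * x ^ n) l <-> pser a (RtoC x) (RtoC l).
Proof.
  split.
  - intros H. split.
    + eapply is_series_ext. 2: exact H. intros n. cbv beta. rewrite Re_scal, <- RtoC_pow. reflexivity.
    + apply (is_series_ext (fun n => 0)). intros n. rewrite Im_scal, <- RtoC_pow. symmetry. apply Rmult_0_r.
      apply (finite_series (fun _ => 0) 0). auto.
  - intros [H _]. eapply is_series_ext. 2: exact H. intros n. cbv beta. rewrite Re_scal, <- RtoC_pow.
    reflexivity.
Qed.

Lemma Cser_RtoC (a : nat -> R) (l : R) : is_series a l -> Cser (fun n => RtoC (a n)) (RtoC l).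
Proof. intros H. split; simpl; auto. apply (finite_series (fun _ => 0) 0). auto. Qed.

Definition shiftc (a : nat -> R) (n : nat) : R := match n with O => 0 | S m => a m end.

Lemma pser_shiftc (a : nat -> R) (z l : C) : pser a z l -> pser (shiftc a) z (z * l).
Proof.
  intros H. apply (Cser_scal z) in H. apply Cser_Clim. apply Cser_Clim in H.
  assert (E : forall n, Csumn (fun n => RtoC (shiftc a n) * z ^ n)%C (S n) =
    Csumn (fun n => z * (RtoC (a n) * z ^ n))%C n).
  { intros n. rewrite Csumn_head. simpl.
    rewrite (Csumn_ext _ (fun n => z * (RtoC (a n) * z ^ n))%C) by (intros; ring). ring. }
  destruct H as [H1 H2]. split; apply is_lim_seq_incr_1.
  - eapply is_lim_seq_ext. 2: exact H1. intros n. cbv beta. now rewrite E.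
  - eapply is_lim_seq_ext. 2: exact H2. intros n. cbv beta. now rewrite E.
Qed.

Lemma absconv_shiftc (a : nat -> R) (r : R) : absconv a r -> absconv (shiftc a) r.
Proof.
  intros H. apply (ex_series_incr_1 (fun n => Rabs (shiftc a n) * r ^ n)). simpl.
  apply (ex_series_ext (fun k => scal r (Rabs (a k) * r ^ k))).
  - intros n. unfold scal; simpl. unfold mult; simpl. ring.
  - exact (ex_series_scal_l r _ H).
Qed.

Lemma absconv_plus (a b : nat -> R) (r : R) : 0 <= r -> absconv a r -> absconv b r ->
  absconv (fun n => a n + b n) r.
Proof.
  intros Hr Ha Hb. apply ex_series_Rle with (fun n => Rabs (a n) * r ^ n + Rabs (b n) * r ^ n).
  - intros n. rewrite Rabs_mult, Rabs_Rabsolu, (Rabs_pos_eq (r ^ n)) by (apply pow_le; lra).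
    rewrite <- Rmult_plus_distr_r. apply Rmult_le_compat_r. apply pow_le; lra. apply Rabs_triang.
  - exact (ex_series_plus _ _ Ha Hb).
Qed.

Lemma absconv_scal (c : R) (a : nat -> R) (r : R) : absconv a r -> absconv (fun n => c * a n) r.
Proof.
  intros H. apply (ex_series_ext (fun k => scal (Rabs c) (Rabs (a k) * r ^ k))).
  - intros n. rewrite Rabs_mult. unfold scal; simpl. unfold mult; simpl. ring.
  - exact (ex_series_scal_l (Rabs c) _ H).
Qed.

(** * Existence of the expansion of ((s-1) zeta(s))^k at s = 1 *)

Definition ecoef (x : R) (n : nat) : R := (- ln x) ^ n / INR (fact n).

Lemma pser_ecoef (x : R) (z : C) : pser (ecoef x) z (xpow x z).
Proof.
  unfold xpow. eapply Cser_ext. 2: apply cexp_series. intros n. cbv beta. unfold ecoef, Rdiv.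
  rewrite Cpow_mult_l, RtoC_mult, RtoC_pow. ring.
Qed.

Lemma absconv_ecoef (x r : R) : 0 <= r -> absconv (ecoef x) r.
Proof.
  intros Hr. exists (exp (Rabs (ln x) * r)).
  eapply is_series_ext. 2: apply is_series_exp. intros n. cbv beta. unfold ecoef, Rdiv.
  assert (0 < / INR (fact n)) by (apply Rinv_0_lt_compat, INR_fact_lt_0).
  rewrite Rabs_mult, (Rabs_pos_eq (/ _)) by lra. rewrite <- RPow_abs, Rabs_Ropp, Rpow_mult_distr. Req. ring.
Qed.

(** Taylor coefficients of [V n (1 + z)] in z, read off from n^(-1-z) = n^(-1) n^(-z); the prefactor
    s - 1 = z is a shift. *)
Definition vc (n : nat) : nat -> R := fun m =>
  / 2 * (shiftc (fun m => / INR (S n) * ecoef (INR (S n)) m) m + shiftc (fun m => / (INR (S n) + 1) * ecoef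
    (INR (S n) + 1) m) m)
  + (ecoef (INR (S n) + 1) m + (-1) * ecoef (INR (S n)) m).

Lemma pser_vc (n : nat) (z : C) : pser (vc n) z (V n (1 + z)).
Proof.
  unfold vc. pose proof (INR_S_ge1 n).
  replace (V n (1 + z)) with (RtoC (/ 2) * (z * (RtoC (/ INR (S n)) * xpow (INR (S n)) z) + z * (RtoC (/ (INR
    (S n) + 1)) * xpow (INR (S n) + 1) z))
     + (xpow (INR (S n) + 1) z + RtoC (-1) * xpow (INR (S n)) z))%C.
  - apply pser_plus; [apply pser_scal|]; apply pser_plus;
    try apply pser_shiftc; try apply pser_scal; apply pser_ecoef.
  - unfold V. replace (1 + z - 1)%C with z by ring. replace (1 + z)%C with (z + 1)%C by ring.
    rewrite !xpow_S by lra. rewrite RtoC_m1. ring.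
Qed.

Lemma absconv_vc (n : nat) (r : R) : 0 <= r -> absconv (vc n) r.
Proof.
  intros Hr. unfold vc.
  apply absconv_plus; auto; [apply absconv_scal|]; apply absconv_plus; auto;
  try apply absconv_shiftc; try apply absconv_scal; apply absconv_ecoef; auto.
Qed.

(** Cauchy's estimate on the circle of radius 3/2 about 1, the largest contained in Re s >= -1/2.
    There the cubic factor of [V_bound] is at most (3/2)(5/2)(7/2) < 14, and Cauchy's estimate
    doubles it to 28. *)
Lemma vc_bound (n m : nat) : Rabs (vc n m) <= 28 * q32 n * (2 / 3) ^ m.
Proof.
  assert (H : Rabs (vc n m) * (3 / 2) ^ m <= 2 * (14 * q32 n)).
  { apply (cauchy_estimate (vc n) (3 / 2) (14 * q32 n) (fun z => V n (1 + z))). lra. apply absconv_vc; lra.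
    - intros t. apply pser_vc.
    - intros t. set (z := (RtoC (3 / 2) * cis t)%C).
      assert (Hz : Cmod z = 3 / 2) by (unfold z; rewrite Cmod_mult, Cmod_R, Cmod_cis, Rabs_pos_eq; lra).
      pose proof (re_le_Cmod z) as Hre. rewrite Hz in Hre. apply Rabs_le_between in Hre.
      eapply Rle_trans. apply V_bound. rewrite Re_plus, Re_RtoC. lra.
      replace (1 + z - 1)%C with z by ring.
      replace (1 + z + 1)%C with (RtoC 2 + z)%C by (rewrite (RtoC_plus 1 1 : RtoC 2 = _); ring).
      assert (Cmod (1 + z) <= 5 / 2) by (eapply Rle_trans; [apply Cmod_triangle|]; rewrite Cmod_1; lra).
      assert (Cmod (RtoC 2 + z) <= 7 / 2) by (eapply Rle_trans; [apply Cmod_triangle|]; rewrite Cmod_R,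
        Rabs_pos_eq; lra).
      rewrite Hz. pose proof (Cmod_ge_0 (1 + z)). pose proof (q32_pos n).
      apply Rmult_le_compat_r. lra. nra. }
  replace (Rabs (vc n m)) with (Rabs (vc n m) * (3 / 2) ^ m * (2 / 3) ^ m).
  - replace (28 * q32 n) with (2 * (14 * q32 n)) by ring. apply Rmult_le_compat_r; auto. apply pow_le; lra.
  - rewrite Rmult_assoc, <- Rpow_mult_distr. replace (3 / 2 * (2 / 3)) with 1 by field. rewrite pow1. ring.
Qed.

(* Taylor coefficients of [Zf] at 1. *)
Definition zc (m : nat) : R :=
  Series (fun n => vc n m) + match m with O => 1 | S O => / 2 | _ => 0 end.

Lemma ex_series_vc (m : nat) : ex_series (fun n => vc n m).
Proof.
  apply ex_series_Rle with (fun n => (28 * (2 / 3) ^ m) * q32 n).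
  - intros n. eapply Rle_trans. apply vc_bound. right; ring.
  - apply (ex_series_scal_l (28 * (2 / 3) ^ m) q32). apply ex_series_q32.
Qed.

Lemma zc_bound (m : nat) : Rabs (Series (fun n => vc n m)) <= 28 * Q32 * (2 / 3) ^ m.
Proof.
  replace (28 * Q32 * (2 / 3) ^ m) with (Series (fun n => (28 * (2 / 3) ^ m) * q32 n)).
  - apply Series_abs_le. intros n. eapply Rle_trans. apply vc_bound. right; ring.
    apply (ex_series_scal_l (28 * (2 / 3) ^ m) q32). apply ex_series_q32.
  - rewrite Series_scal_l. unfold Q32. ring.
Qed.

Lemma geom_series (q : R) : 0 <= q < 1 -> is_series (fun n => q ^ n) (/ (1 - q)).
Proof. intros H. apply is_series_geom. rewrite Rabs_pos_eq; lra. Qed.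

(** The ratio (2/3)(5/4) = 5/6 is less than 1, while 5/4 > 1 leaves the closed unit disc of
    [lambda_spec] inside the region of absolute convergence. *)
Lemma absconv_zc : absconv zc (5 / 4).
Proof.
  unfold zc. apply (absconv_plus _ (fun m => match m with O => 1 | S O => / 2 | _ => 0 end)). lra.
  - apply ex_series_Rle with (fun m => 28 * Q32 * (5 / 6) ^ m).
    + intros m. rewrite Rabs_mult, Rabs_Rabsolu, (Rabs_pos_eq (_ ^ _)) by (apply pow_le; lra).
      replace ((5 / 6) ^ m) with ((2 / 3) ^ m * (5 / 4) ^ m) by (rewrite <- Rpow_mult_distr; f_equal; field).
      rewrite <- Rmult_assoc. apply Rmult_le_compat_r. apply pow_le; lra. apply zc_bound.
    + apply (ex_series_scal_l (28 * Q32) (fun m => (5 / 6) ^ m)). eexists. apply geom_series. lra.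
  - apply (absconv_finite _ 2). intros [|[|i]] Hi; auto; lia.
Qed.

Lemma pser_zc (z : C) : Cmod z <= 5 / 4 -> pser zc z (Zf (1 + z)).
Proof.
  intros Hz. unfold zc, Zf. rewrite Cplus_comm.
  apply (pser_plus (fun m => Series (fun n => vc n m)) (fun m => match m with O => 1 | S O => / 2 | _ => 0
    end)).
  - pose proof (re_le_Cmod z) as Hre. apply Rabs_le_between in Hre.
    apply (Cser_fubini (fun n m => RtoC (vc n m) * z ^ m)%C (fun n m => 28 * q32 n * (5 / 6) ^ m)
             (fun n => V n (1 + z)) (fun n => 28 * q32 n * / (1 - 5 / 6))).
    + intros n m. rewrite Cmod_term.
      replace ((5 / 6) ^ m) with ((2 / 3) ^ m * (5 / 4) ^ m) by (rewrite <- Rpow_mult_distr; f_equal; field).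
      rewrite <- Rmult_assoc. apply Rmult_le_compat. apply Rabs_pos. apply pow_le, Cmod_ge_0. apply vc_bound.
      apply pow_incr. split; auto. apply Cmod_ge_0.
    + intros n. apply is_series_Rscal. apply geom_series. lra.
    + apply (ex_series_ext (fun n => scal (28 * / (1 - 5 / 6)) (q32 n))).
      intros n. unfold scal; simpl; unfold mult; simpl. ring.
      exact (ex_series_scal_l (28 * / (1 - 5 / 6)) q32 ex_series_q32).
    + intros n. apply pser_vc.
    + apply VS_Cser. rewrite Re_plus, Re_RtoC. lra.
    + intros m. rewrite (Cmult_comm (RtoC (Series _))). eapply Cser_ext.
      2: exact (Cser_scal (z ^ m)%C _ _ (Cser_RtoC _ _ (Series_correct _ (ex_series_vc m)))).
      intros n. cbv beta. ring.
  - replace (RtoC (/ 2) * (1 + z + 1))%C with (Csumn (fun m => RtoC (match m with O => 1 | S O => / 2 | _ => 0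
      end) * z ^ m)%C 2).
    + apply (pser_finite (fun m => match m with O => 1 | S O => / 2 | _ => 0 end)).
      intros [|[|i]] Hi; auto; lia.
    + apply C_eq; simpl; field.
Qed.

Lemma Cser_is_series (a : nat -> C) (l : C) : Cser a l <-> is_series (V := C_NormedModule) a l.
Proof.
  assert (E : forall n, sum_n (G := C_NormedModule) a n = (sum_n (fun i => Re (a i)) n,
    sum_n (fun i => Im (a i)) n)).
  { induction n. rewrite !sum_O. now destruct (a 0%nat). rewrite sum_Sn, IHn, !sum_n_S. reflexivity. }
  split.
  - intros [H1 H2]. apply filterlim_locally. intros eps.
    assert (H1' := proj1 (filterlim_locally _ _) H1 eps).
    assert (H2' := proj1 (filterlim_locally _ _) H2 eps).
    generalize (filter_and _ _ H1' H2'). apply filter_imp. intros n [B1 B2]. rewrite E. split; auto.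
  - intros H. assert (H' := proj1 (filterlim_locally _ _) H).
    split; apply filterlim_locally; intros eps; generalize (H' eps); apply filter_imp; intros n B;
      rewrite E in B; apply B.
Qed.

Lemma Cmod_re_im_lt (s : C) : Cmod (s - 1) <= 1 -> s <> 0 -> 0 < Re s.
Proof.
  intros H H0. destruct (Rlt_le_dec 0 (Re s)); auto. exfalso. apply H0.
  assert (Hn : normsq (s - 1) <= 1).
  { rewrite normsq_Cmod. pose proof (Cmod_ge_0 (s - 1)). nra. }
  unfold normsq in Hn. rewrite Re_minus, Im_minus in Hn. simpl in Hn.
  apply C_eq; simpl; nra.
Qed.

Lemma ln_2_lt_1 : ln 2 < 1.
Proof. apply exp_lt_inv. rewrite exp_ln by lra. pose proof (exp_ineq1 1). lra. Qed.

Lemma ln_2_pos : 0 < ln 2.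
Proof. rewrite <- ln_1. apply ln_increasing; lra. Qed.

(** The roots of 2^(-z) = 1 are the multiples of 2 pi i / log 2, all outside the closed unit disc
    except 0. The modulus forces Re z = 0; then the half angle has vanishing sine and is smaller
    than pi. *)
Lemma xpow2_eq_1 (z : C) : Cmod z <= 1 -> (1 - xpow 2 z)%C = 0 -> z = 0.
Proof.
  intros Hz H. assert (E : xpow 2 z = 1). { replace (xpow 2 z) with (1 - (1 - xpow 2 z))%C by ring. rewrite H.
  ring. }
  assert (E1 : exp (- Re z * ln 2) = 1). { rewrite <- Cmod_xpow, E. apply Cmod_1. }
  pose proof ln_2_lt_1. pose proof ln_2_pos.
  assert (Re z = 0). { rewrite <- exp_0 in E1. apply exp_inv in E1. nra. }
  assert (E2 : cos (ln 2 * Im z) = 1).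
  { unfold xpow, cexp in E. apply (f_equal Re) in E. rewrite Re_scal, Im_scal, H2 in E. simpl in E.
    rewrite Rmult_0_r, exp_0, Rmult_1_l in E. rewrite <- E, <- cos_neg. f_equal. ring. }
  pose proof (im_le_Cmod z) as Him. apply C_eq; auto. simpl.
  assert (Hs : sin (ln 2 * Im z / 2) = 0).
  { pose proof (cos_2a_sin (ln 2 * Im z / 2)) as H3.
    replace (2 * (ln 2 * Im z / 2)) with (ln 2 * Im z) in H3 by field.
    rewrite E2 in H3. nra. }
  assert (Hb : Rabs (Im z) <= 1) by lra. apply Rabs_le_between in Hb.
  pose proof PI2_1 as HPI.
  destruct (Rtotal_order (Im z) 0) as [h|[h|h]]; auto; exfalso.
  - assert (0 < sin (- (ln 2 * Im z / 2))) by (apply sin_gt_0; nra). rewrite sin_neg in H3. lra.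
  - assert (0 < sin (ln 2 * Im z / 2)) by (apply sin_gt_0; nra). lra.
Qed.

Lemma zeta_disc (s : C) : s <> 1 -> Cmod (s - 1) <= 1 -> zeta s = (Zf s / (s - 1))%C.
Proof.
  intros H1 H. destruct (excluded_middle_informative (s = 0)) as [->|H0].
  - apply zeta_0.
  - apply zeta_Zf; auto. now apply Cmod_re_im_lt.
    intros E. apply H1. apply xpow2_eq_1 in E; auto. replace s with ((s - 1) + 1)%C by ring. rewrite E. ring.
Qed.

Lemma zc_lambda_spec : lambda_spec (fun j k => INR (fact j) * PS_pow zc k j).
Proof.
  intros k s H1 H. apply Cser_is_series.
  assert (Hz : (s - 1)%C <> 0). { intros E. apply H1. replace s with ((s - 1) + 1)%C by ring. rewrite E. ring.
  }
  rewrite <- Cpow_mult_l, zeta_disc by auto.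
  replace ((s - 1) * (Zf s / (s - 1)))%C with (Zf (1 + (s - 1))).
  - eapply Cser_ext. 2: apply (pser_pow zc k (s - 1)).
    + intros n. cbv beta. do 2 f_equal. field. apply INR_fact_neq_0.
    + apply (absconv_le _ (5 / 4)); [|apply absconv_zc]. split. apply Cmod_ge_0. lra.
    + apply pser_zc. lra.
  - replace (1 + (s - 1))%C with s by ring. field. auto.
Qed.

(** [lam] is only a choice of some solution of [lambda_spec]. A solution exists by [zc_lambda_spec],
    so the choice is one too, and both expansions at s = 1 + x with 0 < x < 1 have the same sum,
    hence the same coefficients. *)
Lemma lam_zc (j k : nat) : lam j k / INR (fact j) = PS_pow zc k j.
Proof.
  assert (HL : lambda_spec lam).
  { unfold lam. apply epsilon_spec. eexists. apply zc_lambda_spec. }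
  revert j. apply (coef_unique _ _ 1). lra. intros x Hx.
  assert (Hs : (RtoC (1 + x) <> 1)). { intros E. apply (f_equal Re) in E. simpl in E. lra. }
  assert (Ez : (RtoC (1 + x) - 1 = RtoC x)%C) by (rewrite RtoC_plus; ring).
  assert (Hm : Cmod (RtoC (1 + x) - 1) <= 1). { rewrite Ez, Cmod_R, Rabs_pos_eq; lra. }
  pose proof (HL k _ Hs Hm) as A. pose proof (zc_lambda_spec k _ Hs Hm) as B.
  apply Cser_is_series in A. apply Cser_is_series in B. rewrite Ez in A, B.
  set (l := (RtoC x ^ k * zeta (RtoC (1 + x)) ^ k)%C) in *.
  exists (Re l). split.
  - destruct A as [A _]. eapply is_series_ext. 2: exact A. intros n. cbv beta. rewrite Re_scal, <- RtoC_pow.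
    reflexivity.
  - destruct B as [B _]. eapply is_series_ext. 2: exact B. intros n. cbv beta. rewrite Re_scal, <- RtoC_pow.
    rewrite Re_RtoC. Req. field. apply INR_fact_neq_0.
Qed.

(** * The change of variable w = 1 - 1/s *)

Definition ones (n : nat) : R := 1.
Definition delta0 (n : nat) : R := match n with O => 1 | S _ => 0 end.

Lemma pser_delta0 (w : C) : pser delta0 w 1.
Proof.
  replace (RtoC 1) with (Csumn (fun n => RtoC (delta0 n) * w ^ n)%C 1) by (simpl; ring).
  apply pser_finite. intros [|i] Hi; auto; lia.
Qed.

Lemma absconv_delta0 (r : R) : absconv delta0 r.
Proof. apply (absconv_finite _ 1). intros [|i] Hi; auto; lia. Qed.

Lemma one_minus_neq0 (w : C) : Cmod w < 1 -> (1 - w)%C <> 0.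
Proof. intros H E. replace w with (1 - (1 - w))%C in H by ring. rewrite E in H.
replace (1 - 0)%C with (RtoC 1) in H by ring. rewrite Cmod_1 in H. lra. Qed.

Lemma absconv_ones (r : R) : 0 <= r < 1 -> absconv ones r.
Proof.
  intros H. exists (/ (1 - r)). eapply is_series_ext. 2: apply geom_series; auto.
  intros n. unfold ones. rewrite Rabs_R1. Req. ring.
Qed.

Lemma pser_ones (w : C) : Cmod w < 1 -> pser ones w (/ (1 - w)).
Proof.
  intros H. pose proof (Cmod_ge_0 w). destruct (pser_ex ones w) as [l Hl]. apply absconv_ones; lra.
  assert (E : pser ones w (1 + w * l)).
  { eapply pser_ext. 2: exact (pser_plus _ _ _ _ _ (pser_delta0 w) (pser_shiftc _ _ _ Hl)).
    intros [|n]; unfold delta0, ones, shiftc; ring. }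
  pose proof (pser_unique _ _ _ _ Hl E) as E1. pose proof (one_minus_neq0 w H).
  replace (/ (1 - w))%C with l; auto.
  replace l with ((1 - w) * l / (1 - w))%C by (field; auto).
  replace ((1 - w) * l)%C with (l - w * l)%C by ring. rewrite E1 at 1. field. auto.
Qed.

Lemma bin_hockey (n j : nat) : fsum (fun k => bin k j) (S n) = bin (S n) (S j).
Proof.
  induction n. simpl. destruct j; simpl; ring.
  change (fsum (fun k => bin k j) (S (S n))) with (fsum (fun k => bin k j) (S n) + bin (S n) j).
  rewrite IHn, (bin_SS (S n) j). ring.
Qed.

Lemma bin_col_S (j n : nat) : shiftc (PS_mult (fun m => bin m j) ones) n = bin n (S j).
Proof.
  destruct n; auto. simpl shiftc. rewrite PS_mult_fsum, <- bin_hockey. apply fsum_ext.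
  intros; unfold ones; ring.
Qed.

(** Multiplication by w/(1-w) takes partial sums and shifts; by the hockey-stick identity this turns
    column j of Pascal's triangle into column j + 1. *)
Lemma bin_col (j : nat) (w : C) : Cmod w < 1 ->
  absconv (fun m => bin m j) (Cmod w) /\ pser (fun m => bin m j) w (w ^ j * (/ (1 - w)) ^ S j)%C.
Proof.
  intros H. pose proof (Cmod_ge_0 w). assert (Ho : absconv ones (Cmod w)) by (apply absconv_ones; lra).
  induction j as [|j [IH1 IH2]].
  - split.
    + eapply ex_series_ext. 2: exact Ho. intros n. cbv beta. rewrite bin_0_r. reflexivity.
    + eapply pser_ext. 2: replace (w ^ 0 * (/ (1 - w)) ^ 1)%C with (/ (1 - w))%C by (simpl; ring).
      2: now apply pser_ones.
      intros n. now rewrite bin_0_r.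
  - split.
    + assert (A : absconv (shiftc (PS_mult (fun m => bin m j) ones)) (Cmod w)).
      { apply absconv_shiftc, absconv_mult; auto. }
      eapply ex_series_ext. 2: exact A. intros n. cbv beta. now rewrite bin_col_S.
    + replace (w ^ S j * (/ (1 - w)) ^ S (S j))%C with (w * ((w ^ j * (/ (1 - w)) ^ S j) * / (1 - w)))%C by
        (simpl; ring).
      eapply pser_ext. intros n. apply bin_col_S. apply pser_shiftc, pser_mult; auto. now apply pser_ones.
Qed.

(* [cb m j] is the coefficient of [w^m] in [(w/(1-w))^j]. *)
Definition cb (m j : nat) : R :=
  match m, j with
  | O, O => 1
  | S m', S j' => bin m' j'
  | _, _ => 0
  end.

Lemma cb_pos (m j : nat) : 0 <= cb m j.
Proof. destruct m, j; simpl; try lra. apply bin_pos. Qed.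

Lemma cb_gt (m j : nat) : (m < j)%nat -> cb m j = 0.
Proof. destruct m, j; simpl; intros H; try lia; auto. apply bin_gt. lia. Qed.

Lemma pser_cb (j : nat) (w : C) : Cmod w < 1 -> pser (fun m => cb m j) w ((w / (1 - w)) ^ j).
Proof.
  intros H. destruct j.
  - simpl. eapply pser_ext. 2: apply pser_delta0. intros [|n]; reflexivity.
  - replace ((w / (1 - w)) ^ S j)%C with (w * (w ^ j * (/ (1 - w)) ^ S j))%C.
    + eapply pser_ext. 2: apply pser_shiftc, bin_col; auto. intros [|n]; reflexivity.
    + unfold Cdiv. rewrite Cpow_mult_l. simpl. ring.
Qed.

Lemma series_cb (j : nat) (r : R) : 0 <= r < 1 -> is_series (fun m => cb m j * r ^ m) ((r / (1 - r)) ^ j).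
Proof.
  intros H. apply pser_real. rewrite RtoC_pow, RtoC_div, RtoC_minus by lra. apply pser_cb.
  rewrite Cmod_R, Rabs_pos_eq; lra.
Qed.

(** Coefficients in w of the series [a] in the variable w/(1-w), which is s - 1 for w = 1 - 1/s. *)
Definition comp (a : nat -> R) (m : nat) : R := fsum (fun j => cb m j * a j) (S m).

Lemma comp_series (a : nat -> R) (m : nat) : is_series (fun j => cb m j * a j) (comp a m).
Proof. apply finite_series. intros i Hi. rewrite cb_gt by lia. ring. Qed.

Lemma absconv_comp (a : nat -> R) (r : R) : 0 <= r < 1 -> absconv a (r / (1 - r)) -> absconv (comp a) r.
Proof.
  intros Hr Ha.
  assert (Hpos : forall j m, 0 <= Rabs (a j) * (cb m j * r ^ m)).
  { intros. apply Rmult_le_pos. apply Rabs_pos. apply Rmult_le_pos. apply cb_pos. apply pow_le; lra. }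
  assert (HH : is_series (fun m => comp (fun j => Rabs (a j)) m * r ^ m) (Series (fun j => Rabs (a j) * (r /
    (1 - r)) ^ j))).
  { apply (fubini (fun j m => Rabs (a j) * (cb m j * r ^ m)) (fun j m => Rabs (a j) * (cb m j * r ^ m))
      (fun j => Rabs (a j) * (r / (1 - r)) ^ j) (fun j => Rabs (a j) * (r / (1 - r)) ^ j)); auto.
    - intros j m. rewrite Rabs_pos_eq; auto. lra.
    - intros j. apply is_series_Rscal. now apply series_cb.
    - intros j. apply is_series_Rscal. now apply series_cb.
    - now apply Series_correct.
    - intros m. rewrite Rmult_comm. eapply is_series_ext.
      2: apply is_series_Rscal, (comp_series (fun j => Rabs (a j)) m).
      intros j. Req. ring. }
  apply ex_series_Rle with (2 := ex_intro _ _ HH). intros m.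
  rewrite Rabs_mult, Rabs_Rabsolu, (Rabs_pos_eq (r ^ m)) by (apply pow_le; lra).
  apply Rmult_le_compat_r. apply pow_le; lra. unfold comp. eapply Rle_trans. apply fsum_Rabs.
  right. apply fsum_ext. intros i _. rewrite Rabs_mult, (Rabs_pos_eq (cb _ _)) by apply cb_pos. ring.
Qed.

Lemma pser_comp (a : nat -> R) (w l : C) : Cmod w < 1 -> absconv a (Cmod w / (1 - Cmod w)) ->
  pser a (w / (1 - w)) l -> pser (comp a) w l.
Proof.
  intros Hw Ha Hl. pose proof (Cmod_ge_0 w).
  apply (Cser_fubini (fun j m => RtoC (a j) * (RtoC (cb m j) * w ^ m))%C (fun j m => Rabs (a j) * (cb m j *
    Cmod w ^ m))
    (fun j => RtoC (a j) * (w / (1 - w)) ^ j)%C (fun j => Rabs (a j) * (Cmod w / (1 - Cmod w)) ^ j)); auto.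
  - intros j m. rewrite !Cmod_mult, !Cmod_R, Cmod_pow, (Rabs_pos_eq (cb _ _)) by apply cb_pos. lra.
  - intros j. apply is_series_Rscal. apply series_cb. lra.
  - intros j. apply Cser_scal. now apply pser_cb.
  - intros m. rewrite (Cmult_comm (RtoC _)). eapply Cser_ext.
    2: exact (Cser_scal (w ^ m)%C _ _ (Cser_RtoC _ _ (comp_series a m))).
    intros j. cbv beta. rewrite RtoC_mult. ring.
Qed.

Lemma comp_plus (a b : nat -> R) (m : nat) : comp (fun j => a j + b j) m = comp a m + comp b m.
Proof. unfold comp. rewrite <- fsum_plus. apply fsum_ext. intros; ring. Qed.

Definition sw (w : C) : C := (/ (1 - w))%C.

Lemma sw_eq (w : C) : (1 - w)%C <> 0 -> (1 + w / (1 - w) = sw w)%C.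
Proof. intros H. unfold sw. field. auto. Qed.

Lemma normsq_sub (w : C) : normsq (1 - w) - (1 - normsq w) = 2 * (normsq (1 - w)) - 2 * Re (1 - w).
Proof. unfold normsq. rewrite Re_minus, Im_minus, Re_RtoC, Im_RtoC. ring. Qed.

Lemma Re_sw (w : C) : (1 - w)%C <> 0 -> Re (sw w) = Re (1 - w) / normsq (1 - w).
Proof. intros H. unfold sw, Cinv, normsq. simpl. f_equal. ring. Qed.

Lemma normsq_pos (c : C) : c <> 0 -> 0 < normsq c.
Proof.
  intros H. rewrite normsq_Cmod. pose proof (Cmod_gt_0 c) as [H1 _]. specialize (H1 H). nra.
Qed.

Lemma Re_sw_half (w : C) : (1 - w)%C <> 0 -> Re (sw w) - 1 / 2 = (1 - normsq w) / (2 * normsq (1 - w)).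
Proof.
  intros H. rewrite Re_sw by auto. pose proof (normsq_pos _ H). pose proof (normsq_sub w).
  apply Rmult_eq_reg_r with (2 * normsq (1 - w)); [|lra]. field_simplify; [|lra|lra]. lra.
Qed.

Lemma Re_sw_ge (w : C) : (1 - w)%C <> 0 -> Cmod w <= 1 -> 1 / 2 <= Re (sw w).
Proof.
  intros H Hw. pose proof (Re_sw_half w H). pose proof (normsq_pos _ H).
  assert (normsq w <= 1) by (rewrite normsq_Cmod; pose proof (Cmod_ge_0 w); nra).
  assert (0 <= (1 - normsq w) / (2 * normsq (1 - w))).
  { apply Rmult_le_pos. lra. left. apply Rinv_0_lt_compat. lra. } lra.
Qed.

Lemma Cmod_sw (w : C) : (1 - w)%C <> 0 -> Cmod (sw w) = / Cmod (1 - w).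
Proof. intros H. unfold sw. now apply Cmod_inv. Qed.

Lemma Cmod_sub_ge (z w : C) : Cmod z - Cmod w <= Cmod (z - w).
Proof.
  assert (Cmod z <= Cmod (z - w) + Cmod w). { eapply Rle_trans. 2: apply Cmod_triangle. right. f_equal. ring.
  } lra.
Qed.

Lemma Cmod_sub_le (z w : C) : Cmod (z - w) <= Cmod z + Cmod w.
Proof. eapply Rle_trans. apply Cmod_triangle. rewrite Cmod_opp. lra. Qed.

Lemma Vsw_bound (n : nat) (w : C) (r : R) : 0 <= r < 1 -> Cmod w = r ->
  Cmod (V n (sw w)) <= 2 * (/ (1 - r)) ^ 3 * q32 n.
Proof.
  intros Hr Hw. assert (H1 : (1 - w)%C <> 0) by (apply one_minus_neq0; lra).
  eapply Rle_trans. apply V_bound. pose proof (Re_sw_ge w H1). lra.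
  assert (Hs : Cmod (sw w) <= / (1 - r)).
  { rewrite Cmod_sw by auto. apply Rinv_le_contravar. lra. pose proof (Cmod_sub_ge 1 w). rewrite Cmod_1 in H.
    lra. }
  assert (Hi : 1 <= / (1 - r)) by (rewrite <- Rinv_1 at 1; apply Rinv_le_contravar; lra).
  assert (Hm : Cmod (sw w - 1) <= / (1 - r)).
  { replace (sw w - 1)%C with (w * sw w)%C by (unfold sw; field; auto). rewrite Cmod_mult, Hw. nra. }
  assert (Hp : Cmod (sw w + 1) <= 2 * / (1 - r)) by (eapply Rle_trans; [apply Cmod_triangle|]; rewrite Cmod_1;
    lra).
  apply Rmult_le_compat_r. left; apply q32_pos.
  replace (2 * (/ (1 - r)) ^ 3) with (/ (1 - r) * / (1 - r) * (2 * / (1 - r))) by ring.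
  apply Rmult_le_compat; auto; try apply Rmult_le_pos; try apply Cmod_ge_0.
  apply Rmult_le_compat; auto; apply Cmod_ge_0.
Qed.

Lemma pser_comp_vc (n : nat) (w : C) : Cmod w < 1 -> pser (comp (vc n)) w (V n (sw w)).
Proof.
  intros H. pose proof (Cmod_ge_0 w). assert (H1 : (1 - w)%C <> 0) by (apply one_minus_neq0; lra).
  apply pser_comp; auto.
  - apply absconv_vc. apply Rmult_le_pos; auto. left. apply Rinv_0_lt_compat. lra.
  - rewrite <- sw_eq by auto. apply pser_vc.
Qed.

Lemma comp_vc_bound (n m : nat) (r : R) : 0 <= r < 1 ->
  Rabs (comp (vc n) m) * r ^ m <= 4 * (/ (1 - r)) ^ 3 * q32 n.
Proof.
  intros Hr. replace (4 * (/ (1 - r)) ^ 3 * q32 n) with (2 * (2 * (/ (1 - r)) ^ 3 * q32 n)) by ring.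
  assert (Hm : forall t, Cmod (RtoC r * cis t) = r) by (intros t; rewrite Cmod_mult, Cmod_R, Cmod_cis,
    Rabs_pos_eq; lra).
  apply (cauchy_estimate (comp (vc n)) r _ (fun w => V n (sw w))). lra.
  - apply absconv_comp; auto. apply absconv_vc. apply Rmult_le_pos. lra. left. apply Rinv_0_lt_compat. lra.
  - intros t. apply pser_comp_vc. rewrite Hm. lra.
  - intros t. now apply Vsw_bound.
Qed.

Definition zext (m : nat) : R := match m with O => 1 | S O => / 2 | _ => 0 end.

Lemma zext_fin (i : nat) : (2 <= i)%nat -> zext i = 0.
Proof. destruct i as [|[|i]]; intros; auto; lia. Qed.

Lemma comp_zc (m : nat) : comp zc m = Series (fun n => comp (vc n) m) + comp zext m.
Proof.
  unfold zc. fold zext. rewrite (comp_plus (fun m => Series (fun n => vc n m)) zext). f_equal.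
  symmetry. apply is_series_Series. unfold comp.
  generalize (S m) as K. induction K; simpl.
  - apply (finite_series (fun _ => 0) 0). auto.
  - apply is_series_Rplus; auto. apply is_series_Rscal. apply Series_correct, ex_series_vc.
Qed.

Lemma ex_series_comp_vc (m : nat) : ex_series (fun n => comp (vc n) m).
Proof.
  unfold comp. generalize (S m) as K. induction K; simpl.
  - exists 0. apply (finite_series (fun _ => 0) 0). auto.
  - destruct IHK as [l Hl]. eexists. apply is_series_Rplus. exact Hl. apply is_series_Rscal.
    apply Series_correct, ex_series_vc.
Qed.

(** [zc] is known to converge only up to radius 5/4 in s - 1, so direct substitution would cover
    only part of |w| < 1. Each [vc n], however, converges everywhere, and its substituted series
    converges on the whole disc. Cauchy's estimate on an intermediate radius [r] bounds its
    coefficients by a constant times [q32 n], with the constant independent of n, which allows the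
    summations over n and m to be interchanged. *)
Lemma comp_zc_conv (w : C) : Cmod w < 1 -> absconv (comp zc) (Cmod w) /\ pser (comp zc) w (Zf (sw w)).
Proof.
  intros Hw. pose proof (Cmod_ge_0 w) as H0. set (r := (1 + Cmod w) / 2).
  assert (Hr : 0 < r < 1) by (unfold r; lra). assert (Hwr : Cmod w < r) by (unfold r; lra).
  assert (H1 : (1 - w)%C <> 0) by (apply one_minus_neq0; lra).
  set (K := 4 * (/ (1 - r)) ^ 3).
  set (q := Cmod w / r). assert (Hq : 0 <= q < 1).
  { unfold q. split. apply Rmult_le_pos; auto. left; apply Rinv_0_lt_compat; lra. apply Rmult_lt_reg_r with r.
    lra. unfold Rdiv; rewrite Rmult_assoc, Rinv_l by lra. lra. }
  assert (B : forall n m, Rabs (comp (vc n) m) * Cmod w ^ m <= K * q32 n * q ^ m).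
  { intros n m. replace (Cmod w ^ m) with (r ^ m * q ^ m).
    - rewrite <- Rmult_assoc. apply Rmult_le_compat_r. apply pow_le; lra. apply comp_vc_bound. lra.
    - rewrite <- Rpow_mult_distr. f_equal. unfold q. field. lra. }
  assert (Ez : forall r', 0 <= r' < 1 -> absconv (comp zext) r') by (intros; apply absconv_comp; auto;
    apply (absconv_finite _ 2); apply zext_fin).
  split.
  - assert (A : absconv (fun m => Series (fun n => comp (vc n) m)) (Cmod w)).
    { apply ex_series_Rle with (fun m => K * Q32 * q ^ m).
      - intros m. rewrite Rabs_mult, Rabs_Rabsolu, (Rabs_pos_eq (_ ^ _)) by (apply pow_le; auto).
        rewrite <- (Rabs_pos_eq (Cmod w ^ m)) by (apply pow_le; auto). rewrite <- Rabs_mult, <- Series_scal_r.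
        replace (K * Q32 * q ^ m) with (Series (fun n => K * q ^ m * q32 n)) by (rewrite Series_scal_l;
          unfold Q32; ring).
        apply Series_abs_le.
        + intros n. rewrite Rabs_mult, (Rabs_pos_eq (_ ^ _)) by (apply pow_le; auto). eapply Rle_trans.
          apply B. right; ring.
        + apply (ex_series_scal_l (K * q ^ m) q32). apply ex_series_q32.
      - apply (ex_series_scal_l (K * Q32) (fun m => q ^ m)). eexists. now apply geom_series. }
    eapply ex_series_ext. 2: exact (absconv_plus _ _ _ H0 A (Ez (Cmod w) (conj H0 Hw))).
    intros m. cbv beta. now rewrite comp_zc.
  - eapply pser_ext. { intros m. symmetry. apply comp_zc. }
    unfold Zf. rewrite Cplus_comm. apply (pser_plus (fun m => Series (fun n => comp (vc n) m))).
    + apply (Cser_fubini (fun n m => RtoC (comp (vc n) m) * w ^ m)%C (fun n m => K * q32 n * q ^ m)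
             (fun n => V n (sw w)) (fun n => K * q32 n * / (1 - q))).
      * intros n m. rewrite Cmod_term. apply B.
      * intros n. apply is_series_Rscal. now apply geom_series.
      * apply (ex_series_ext (fun n => scal (K * / (1 - q)) (q32 n))).
        intros n. unfold scal; simpl; unfold mult; simpl. ring.
        exact (ex_series_scal_l (K * / (1 - q)) q32 ex_series_q32).
      * intros n. now apply pser_comp_vc.
      * apply VS_Cser. pose proof (Re_sw_ge w H1). lra.
      * intros m. rewrite (Cmult_comm (RtoC (Series _))). eapply Cser_ext.
        2: exact (Cser_scal (w ^ m)%C _ _ (Cser_RtoC _ _ (Series_correct _ (ex_series_comp_vc m)))).
        intros n. cbv beta. ring.
    + apply pser_comp; auto. apply (absconv_finite _ 2); apply zext_fin.
      replace (RtoC (/ 2) * (sw w + 1))%C with (Csumn (fun m => RtoC (zext m) * (w / (1 - w)) ^ m)%C 2).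
      * apply (pser_finite zext). apply zext_fin.
      * rewrite <- sw_eq by auto. generalize (w / (1 - w))%C. intros z. apply C_eq; simpl; field.
Qed.

(* Taylor coefficients of [w zeta(s) = (s-1) zeta(s) / s] in [w]. *)
Definition bc (m : nat) : R := comp zc m + (-1) * shiftc (comp zc) m.

Definition bw (w : C) : C := ((1 - w) * Zf (sw w))%C.

Lemma bc_conv (w : C) : Cmod w < 1 -> absconv bc (Cmod w) /\ pser bc w (bw w).
Proof.
  intros Hw. destruct (comp_zc_conv w Hw) as [H1 H2]. split.
  - apply absconv_plus; auto. apply Cmod_ge_0. now apply absconv_scal, absconv_shiftc.
  - unfold bw. replace ((1 - w) * Zf (sw w))%C with (Zf (sw w) + RtoC (-1) * (w * Zf (sw w)))%C by (rewrite
      RtoC_m1; ring).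
    apply pser_plus; auto. now apply pser_scal, pser_shiftc.
Qed.

Fixpoint shiftn (i : nat) (a : nat -> R) : nat -> R :=
  match i with O => a | S i' => shiftc (shiftn i' a) end.

Lemma shiftn_add (i m : nat) (a : nat -> R) : shiftn i a (m + i) = a m.
Proof. induction i; simpl. now rewrite Nat.add_0_r. rewrite Nat.add_succ_r. simpl. apply IHi. Qed.

Lemma pser_shiftn (i : nat) (a : nat -> R) (w l : C) : pser a w l -> pser (shiftn i a) w (w ^ i * l).
Proof.
  intros H. induction i; simpl. replace (1 * l)%C with l by ring. auto.
  rewrite <- Cmult_assoc. now apply pser_shiftc.
Qed.

Fixpoint omw (p : nat) : nat -> R :=
  match p with O => delta0 | S p' => fun m => omw p' m + (-1) * shiftc (omw p') m end.

Lemma pser_omw (p : nat) (w : C) : pser (omw p) w ((1 - w) ^ p).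
Proof.
  induction p; simpl. apply pser_delta0.
  replace ((1 - w) * (1 - w) ^ p)%C with ((1 - w) ^ p + RtoC (-1) * (w * (1 - w) ^ p))%C by (rewrite RtoC_m1;
    ring).
  apply pser_plus; auto. now apply pser_scal, pser_shiftc.
Qed.

Lemma omw_high (p n : nat) : omw p (S n + p) = 0.
Proof.
  revert n. induction p; intros n; auto.
  change (omw (S p) (S n + S p)) with (omw p (S n + S p) + -1 * shiftc (omw p) (S n + S p)).
  replace (S n + S p)%nat with (S (S n + p)) by lia.
  change (shiftc (omw p) (S (S n + p))) with (omw p (S n + p)).
  change (S (S n + p)) with (S (S n) + p)%nat. rewrite !IHp. ring.
Qed.

Lemma omw_top (p : nat) : omw p p = (-1) ^ p.
Proof.
  induction p; auto. change (omw (S p) (S p)) with (omw p (1 + p) + -1 * omw p p). rewrite IHp, omw_high.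
  simpl. ring.
Qed.

Definition Lam (k i : nat) : R := PS_pow zc k i.

(** The entry at 0 is suppressed because the term i = k belongs to the polynomial part of [ecf]. *)
Definition Lam' (k j : nat) : R := match j with O => 0 | S _ => Lam k (j + k) end.

(** With z = w/(1-w), the term z^i (1-w)^k is the polynomial w^i (1-w)^(k-i) of degree k for i <= k,
    and w^k z^(i-k) for i > k. The first kind contributes nothing beyond w^k and supplies [ell 0 k]
    as coefficient of w^k; the second kind supplies [ell n k] for n >= 1. This is the source of the
    two cases in [ell]. *)
Definition ecf (k m : nat) : R :=
  fsum (fun i => Lam k i * shiftn i (omw (k - i)) m) (S k) + shiftn k (comp (Lam' k)) m.

Lemma pser_fsum (f : nat -> nat -> R) (v : nat -> C) (w : C) (K : nat) :
  (forall i, (i < K)%nat -> pser (f i) w (v i)) -> pser (fun m => fsum (fun i => f i m) K) w (Csumn v K).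
Proof.
  induction K; intros H; simpl.
  - exact (pser_finite (fun _ => 0) 0 w (fun _ _ => eq_refl)).
  - apply pser_plus. apply IHK. intros; apply H; lia. apply H. lia.
Qed.

Lemma coef_unique_pser (a b : nat -> R) (rho : R) : 0 < rho ->
  (forall x, 0 < x < rho -> exists l : C, pser a (RtoC x) l /\ pser b (RtoC x) l) -> forall n, a n = b n.
Proof.
  intros Hr H. apply (coef_unique a b rho Hr). intros x Hx. destruct (H x Hx) as [l [[H1 _] [H2 _]]].
  exists (Re l). split; [eapply is_series_ext; [|exact H1]|eapply is_series_ext; [|exact H2]];
  intros n; cbv beta; rewrite Re_scal, <- RtoC_pow; reflexivity.
Qed.

Lemma pser_Lam (k : nat) (z : C) : Cmod z <= 5 / 4 -> absconv (Lam k) (Cmod z) /\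
  pser (Lam k) z (Zf (1 + z) ^ k).
Proof.
  intros H. pose proof (Cmod_ge_0 z). assert (A : absconv zc (Cmod z)) by (apply (absconv_le _ (5 / 4));
    [lra|apply absconv_zc]).
  split. now apply absconv_pow. apply pser_pow; auto. now apply pser_zc.
Qed.

Lemma Csumn_Cser_tail (a : nat -> C) (l : C) (N : nat) :
  Cser a l -> Cser (fun j => a (N + j)%nat) (l - Csumn a N).
Proof.
  intros H. apply Cser_Clim in H. apply Cser_Clim.
  assert (H' : Clim (fun k => Csumn a (N + k)) l).
  { destruct H as [H1 H2].
    split; [apply (is_lim_seq_incr_n _ N) in H1; revert H1 | apply (is_lim_seq_incr_n _ N) in H2; revert H2];
    apply is_lim_seq_ext; intros n; do 2 f_equal; lia. }
  eapply Clim_ext. 2: exact (Clim_minus _ _ _ _ H' (Clim_const (Csumn a N))).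
  intros k. cbv beta. induction k. rewrite Nat.add_0_r. simpl Csumn at 3. ring.
  rewrite Nat.add_succ_r. simpl Csumn. rewrite <- IHk. ring.
Qed.

(** Both sides are evaluated at 0 < x < 1/4, where x/(1-x) <= 1/3 is well inside the disc on which
    [Lam] converges; uniqueness of coefficients does the rest. *)
Lemma pow_bc_ecf (k m : nat) : PS_pow bc k m = ecf k m.
Proof.
  revert m. apply (coef_unique_pser _ _ (1 / 4)). lra. intros x Hx. set (w := RtoC x).
  assert (Hw : Cmod w = x) by (unfold w; rewrite Cmod_R, Rabs_pos_eq; lra).
  destruct (bc_conv w ltac:(lra)) as [B1 B2]. exists (bw w ^ k)%C. split. now apply pser_pow.
  assert (H1 : (1 - w)%C <> 0) by (apply one_minus_neq0; lra).
  assert (Hw0 : w <> 0). { intros E. rewrite E, Cmod_0 in Hw. lra. }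
  set (z := (w / (1 - w))%C).
  assert (Hz : Cmod z <= 1 / 3).
  { unfold z. rewrite Cmod_div by auto. rewrite Hw. pose proof (Cmod_sub_ge 1 w). rewrite Cmod_1, Hw in H.
    apply Rmult_le_reg_r with (Cmod (1 - w)). lra. unfold Rdiv. rewrite Rmult_assoc, Rinv_l by lra. lra. }
  assert (Hxx : 0 <= x / (1 - x) <= 1 / 3).
  { split. apply Rmult_le_pos. lra. left; apply Rinv_0_lt_compat; lra.
    apply Rmult_le_reg_r with (1 - x). lra. unfold Rdiv. rewrite Rmult_assoc, Rinv_l by lra. lra. }
  destruct (pser_Lam k z ltac:(lra)) as [L1 L2]. unfold z in L2. rewrite sw_eq in L2 by auto. fold z in L2.
  assert (HL' : pser (Lam' k) z ((Zf (sw w) ^ k - Csumn (fun i => RtoC (Lam k i) * z ^ i)%C (S k)) / z ^ k)).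
  { assert (Hz0 : z <> 0). { unfold z. intros E. apply Hw0.
    replace w with (w / (1 - w) * (1 - w))%C by (field; auto). rewrite E. ring. }
    assert (Hzk : (z ^ k)%C <> 0) by (now apply Cpow_nz).
    pose proof (Csumn_Cser_tail _ _ (S k) L2) as T. apply (Cser_scal (/ z ^ S k)%C) in T.
    assert (T' : pser (fun j => Lam k (S j + k)) z (/ z ^ S k * (Zf (sw w) ^ k - Csumn (fun i => RtoC (Lam k
      i) * z ^ i)%C (S k)))).
    { eapply Cser_ext. 2: exact T. intros j. cbv beta. replace (S j + k)%nat with (S k + j)%nat by lia.
      rewrite Cpow_add_r. field. now apply Cpow_nz. }
    apply pser_shiftc in T'. replace (_ / z ^ k)%C with (z * (/ z ^ S k * (Zf (sw w) ^ k - Csumn (fun i =>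
      RtoC (Lam k i) * z ^ i)%C (S k))))%C.
    - eapply pser_ext. 2: exact T'. intros [|j]; reflexivity.
    - simpl Cpow. field. auto. }
  assert (HL'' : pser (comp (Lam' k)) w ((Zf (sw w) ^ k - Csumn (fun i => RtoC (Lam k i) * z ^ i)%C (S k)) / z
    ^ k)).
  { apply pser_comp. lra.
    - rewrite Hw. assert (A : absconv (Lam k) (5 / 4)). { apply absconv_pow. lra. apply absconv_zc. }
      set (r := x / (1 - x)) in *.
      assert (A2 : absconv (fun j => Lam k (S j + k)) r).
      { destruct (Rlt_le_dec 0 r) as [hr|hr].
        - apply (absconv_le _ (5 / 4) r ltac:(lra)) in A. apply (ex_series_incr_n _ (S k)) in A.
          apply (ex_series_ext (fun n => scal (/ r ^ S k) (Rabs (Lam k (S k + n)%nat) * r ^ (S k + n)))).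
          + intros n. replace (S n + k)%nat with (S k + n)%nat by lia. rewrite pow_add.
            unfold scal; simpl; unfold mult; simpl.
            field. split. apply pow_nonzero; lra. lra.
          + exact (ex_series_scal_l (/ r ^ S k) _ A).
        - replace r with 0 by lra. eexists. apply (finite_series _ 1). intros [|i] Hi. lia. simpl. ring. }
      eapply ex_series_ext. 2: exact (absconv_shiftc _ _ A2). intros [|j]; reflexivity.
    - exact HL'. }
  unfold ecf.
  replace (bw w ^ k)%C with (Csumn (fun i => RtoC (Lam k i) * (w ^ i * (1 - w) ^ (k - i)))%C (S k) + w ^ k *
    ((Zf (sw w) ^ k - Csumn (fun i => RtoC (Lam k i) * z ^ i)%C (S k)) / z ^ k))%C.
  - apply pser_plus. 2: now apply pser_shiftn.
    apply (pser_fsum (fun i m => Lam k i * shiftn i (omw (k - i)) m)). intros i Hi.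
    apply pser_scal, pser_shiftn, pser_omw.
  - assert (Hwk : (w ^ k)%C <> 0) by (now apply Cpow_nz).
    assert (H1k : ((1 - w) ^ k)%C <> 0) by (now apply Cpow_nz).
    assert (Ezk : (w ^ k / z ^ k = (1 - w) ^ k)%C).
    { unfold z, Cdiv. rewrite Cpow_mult_l, Cpow_inv by auto. field. auto. }
    replace (w ^ k * ((Zf (sw w) ^ k - Csumn (fun i => RtoC (Lam k i) * z ^ i)%C (S k)) / z ^ k))%C
      with ((w ^ k / z ^ k) * (Zf (sw w) ^ k - Csumn (fun i => RtoC (Lam k i) * z ^ i)%C (S k)))%C by (unfold
        Cdiv; ring).
    rewrite Ezk. unfold bw. rewrite Cpow_mult_l.
    replace (Csumn (fun i => RtoC (Lam k i) * (w ^ i * (1 - w) ^ (k - i)))%C (S k)) with ((1 - w) ^ k * Csumn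
      (fun i => RtoC (Lam k i) * z ^ i)%C (S k))%C.
    ring. rewrite <- Csumn_scal. apply Csumn_ext. intros i Hi.
    replace ((1 - w) ^ k)%C with ((1 - w) ^ i * (1 - w) ^ (k - i))%C by (rewrite <- Cpow_add_r; f_equal; lia).
    unfold z, Cdiv. rewrite Cpow_mult_l, Cpow_inv by auto. field. now apply Cpow_nz.
Qed.

Lemma ell_0 (k : nat) : ell 0 k = fsum (fun i => (-1) ^ (k - i) * Lam k i) (S k).
Proof.
  simpl ell. rewrite rsum_fsum, <- fsum_scal. apply fsum_ext. intros i Hi.
  simpl. unfold Rdiv. rewrite Rmult_assoc. fold (Rdiv (lam i k) (INR (fact i))). rewrite lam_zc.
  replace ((-1) ^ k) with ((-1) ^ (k - i) * (-1) ^ i) by (rewrite <- pow_add; f_equal; lia).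
  replace ((-1) ^ (k - i) * (-1) ^ i * ((-1) ^ i * PS_pow zc k i)) with ((-1) ^ (k - i) * ((-1) ^ i * (-1) ^
    i) * PS_pow zc k i) by ring.
  rewrite <- Rpow_mult_distr. replace (-1 * -1) with 1 by ring. rewrite pow1. unfold Lam. ring.
Qed.

Lemma ell_S (n k : nat) : (-1) ^ S n * ell (S n) k = fsum (fun i => bin n i * Lam k (S i + k)) (S n).
Proof.
  cbn [ell]. rewrite rsum_fsum, <- Rmult_assoc, <- Rpow_mult_distr. replace (-1 * -1) with 1 by ring.
  rewrite pow1, Rmult_1_l.
  apply fsum_ext. intros i Hi.
  replace (S n - 1)%nat with n by lia. replace (1 + i - 1)%nat with i by lia. rewrite bin_C by lia.
  unfold Rdiv. rewrite Rmult_assoc. fold (Rdiv (lam (1 + i + k) k) (INR (fact (1 + i + k)))). rewrite lam_zc.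
  reflexivity.
Qed.

Lemma ell_coef (n k : nat) : (-1) ^ n * ell n k = PS_pow bc k (n + k).
Proof.
  rewrite pow_bc_ecf. unfold ecf. rewrite shiftn_add. destruct n.
  - rewrite ell_0. unfold comp. simpl (fsum (fun j => cb 0 j * Lam' k j) 1).
    replace (0 + 1 * 0) with 0 by ring. rewrite Rplus_0_r. simpl ((-1) ^ 0). rewrite Rmult_1_l.
    apply fsum_ext. intros i Hi.
    replace (0 + k)%nat with ((k - i) + i)%nat by lia. rewrite shiftn_add, omw_top. ring.
  - rewrite ell_S, (fsum_ext (fun i => Lam k i * shiftn i (omw (k - i)) (S n + k)) (fun _ => 0)), fsum_const.
    + unfold comp. rewrite (fsum_head (fun j => cb (S n) j * Lam' k j) (S n)). change (cb (S n) 0) with 0.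
      rewrite Rmult_0_l, Rmult_0_r, !Rplus_0_l. reflexivity.
    + intros i Hi. replace (S n + k)%nat with ((S n + (k - i)) + i)%nat by lia. rewrite shiftn_add, omw_high.
      ring.
Qed.

(** * L2 convergence implies the Lindelof hypothesis *)

Lemma RInt_gen_elim (f : R -> R) (a l eps : R) : 0 < eps ->
  is_RInt_gen f (at_point a) (Rbar_locally p_infty) l ->
  exists M, forall b, M < b -> exists y, is_RInt f a b y /\ Rabs (y - l) < eps.
Proof.
  intros He H. specialize (H (ball l (mkposreal eps He)) (locally_ball l (mkposreal eps He))).
  destruct H as [P Q HP [M HQ] H]. exists M. intros b Hb.
  specialize (H a b HP (HQ b Hb)). destruct H as [y [Hy1 Hy2]]. exists y. split; auto.
Qed.

Lemma RInt_gen_pos_le (f : R -> R) (a l : R) : (forall x, 0 <= f x) ->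
  is_RInt_gen f (at_point a) (Rbar_locally p_infty) l ->
  forall b, a <= b -> ex_RInt f a b /\ RInt f a b <= l.
Proof.
  intros Hf H b Hab.
  assert (Hex : forall b', exists c, b' < c /\ ex_RInt f a c).
  { intros b'. destruct (RInt_gen_elim f a l 1 Rlt_0_1 H) as [M HM].
    destruct (HM (Rmax M b' + 1)) as [y [Hy _]]. pose proof (Rmax_l M b'); lra.
    exists (Rmax M b' + 1). split. pose proof (Rmax_r M b'); lra. now exists y. }
  assert (Hb : ex_RInt f a b).
  { destruct (Hex b) as [c [Hc1 Hc2]]. apply (ex_RInt_Chasles_1 f a b c); auto. lra. }
  split; auto. apply le_epsilon. intros eps He.
  destruct (RInt_gen_elim f a l eps He H) as [M HM].
  destruct (HM (Rmax M b + 1)) as [y [Hy1 Hy2]]. pose proof (Rmax_l M b); lra.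
  set (c := Rmax M b + 1) in *. assert (Hbc : b < c) by (unfold c; pose proof (Rmax_r M b); lra).
  assert (Hex2 : ex_RInt f b c) by (apply (ex_RInt_Chasles_2 f a b c); [lra|now exists y]).
  rewrite <- (is_RInt_unique _ _ _ _ Hy1) in Hy2. rewrite <- (RInt_Chasles f a b c) in Hy2 by auto.
  change (plus (RInt f a b) (RInt f b c)) with (RInt f a b + RInt f b c) in Hy2.
  assert (0 <= RInt f b c) by (apply RInt_ge_0; auto; lra).
  apply Rabs_def2 in Hy2. lra.
Qed.

Lemma seq_bounded (v : nat -> R) (l : R) : is_lim_seq v l -> exists B, 0 < B /\ forall n, Rabs (v n) <= B.
Proof. intros H. apply is_lim_seq_Reals in H. destruct (maj_by_pos v (exist _ l H)) as [B [HB1 HB2]].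
now exists B. Qed.

Lemma exp_pow (x : R) (n : nat) : exp x ^ n = exp (INR n * x).
Proof.
  induction n. simpl. now rewrite Rmult_0_l, exp_0.
  rewrite S_INR. simpl pow. rewrite IHn, <- exp_plus. f_equal. ring.
Qed.

(** A crude form of Stirling's upper bound. The inductive step is exp(1/(x+1)) <= (x+1)/x, raised to
    the power x + 1. *)
Lemma fact_bound (n : nat) : INR (fact (S n)) <= INR (S n) * INR (S n) ^ S n * exp (- INR n).
Proof.
  induction n.
  - simpl. rewrite Ropp_0, exp_0. lra.
  - rewrite fact_simpl, mult_INR. pose proof (INR_S_ge1 n). pose proof (INR_S_ge1 (S n)).
    apply Rle_trans with (INR (S (S n)) * (INR (S n) * INR (S n) ^ S n * exp (- INR n))).
    { apply Rmult_le_compat_l; lra. }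
    rewrite (Rmult_assoc (INR (S (S n))) (_ ^ _)). apply Rmult_le_compat_l. lra.
    set (x := INR (S n)) in *. replace (INR (S (S n))) with (x + 1) by (unfold x; rewrite (S_INR (S n));
      reflexivity).
    assert (E : x * exp (/ (x + 1)) <= x + 1).
    { pose proof (exp_ineq1_le (- / (x + 1))).
      assert (x * / (x + 1) <= exp (- / (x + 1))). { eapply Rle_trans. 2: exact H1. right. field. lra. }
      assert (exp (- / (x + 1)) * exp (/ (x + 1)) = 1) by (rewrite <- exp_plus, Rplus_opp_l; apply exp_0).
      pose proof (exp_pos (/ (x + 1))).
      assert (x * / (x + 1) * exp (/ (x + 1)) <= 1) by nra.
      replace (x * exp (/ (x + 1))) with (x * / (x + 1) * exp (/ (x + 1)) * (x + 1)) by (field; lra). nra. }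
    assert (E2 : (x * exp (/ (x + 1))) ^ S (S n) <= (x + 1) ^ S (S n)).
    { apply pow_incr. split; auto. apply Rmult_le_pos. lra. left; apply exp_pos. }
    rewrite Rpow_mult_distr in E2.
    assert (E3 : exp (/ (x + 1)) ^ S (S n) = exp 1).
    { rewrite exp_pow. f_equal. rewrite (S_INR (S n)). fold x. field. lra. }
    rewrite E3 in E2.
    apply Rle_trans with (x ^ S (S n) * exp 1 * exp (- x)).
    + right. replace (exp (- INR n)) with (exp 1 * exp (- x)). simpl; ring.
      rewrite <- exp_plus. f_equal. unfold x. rewrite S_INR. ring.
    + apply Rmult_le_compat_r. left; apply exp_pos. exact E2.
Qed.

Definition cc (k n : nat) : R := (-1) ^ n * ell n k.

Lemma phiN_fsum (N k : nat) (x : R) : phiN N k x = exp (- x) * fsum (fun n => cc k n / INR (fact n) * x ^ n)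
  (S N).
Proof. unfold phiN. rewrite rsum_fsum. f_equal. Qed.

(** Two consecutive [phiN] differ by [cc k N] times the Poisson weight exp(-x) x^N / N!, and the
    square of the difference is at most twice the sum of the squared distances to [phi]. On [N, N+1]
    the weight is at least exp(-2)/N, by [fact_bound], so this interval alone bounds the
    coefficient. Any polynomial rate with exponent independent of k would serve the later
    argument. *)
Lemma L2_coef_growth (k : nat) : L2_converges k -> exists K, forall n, Rabs (cc k n) <= K * (INR n + 1).
Proof.
  intros [v [Hv1 Hv2]]. destruct (seq_bounded v 0 Hv2) as [B [HB1 HB2]].
  exists (Rabs (cc k 0) + exp 2 * (B * 4 + 1)). intros n.
  assert (0 < exp 2) by apply exp_pos.
  destruct n as [|n].
  { simpl. rewrite Rplus_0_l, Rmult_1_r. nra. }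
  set (N := S n). pose proof (INR_S_ge1 n) as HN. fold N in HN.
  set (g := fun M x => (phiN M k x - phi k x) ^ 2).
  assert (Hg : forall M x, 0 <= g M x) by (intros; apply pow2_ge_0).
  destruct (RInt_gen_pos_le (g N) 0 (v N) (Hg N) (Hv1 N) (INR N + 1) ltac:(lra)) as [E1 I1].
  destruct (RInt_gen_pos_le (g n) 0 (v n) (Hg n) (Hv1 n) (INR N + 1) ltac:(lra)) as [E2 I2].
  set (h := fun x => 2 * g N x + 2 * g n x).
  assert (Eh : ex_RInt h 0 (INR N + 1)).
  { apply (ex_RInt_plus (fun x => 2 * g N x) (fun x => 2 * g n x)); apply (ex_RInt_scal (V :=
      R_NormedModule)); auto. }
  assert (Ih : RInt h 0 (INR N + 1) <= 4 * B).
  { unfold h. rewrite (RInt_plus (fun x => 2 * g N x) (fun x => 2 * g n x)) by (apply (ex_RInt_scal (V :=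
      R_NormedModule)); auto).
    rewrite (RInt_scal (V := R_CompleteNormedModule) (g N)) by auto.
    rewrite (RInt_scal (V := R_CompleteNormedModule) (g n)) by auto.
    change (2 * RInt (g N) 0 (INR N + 1) + 2 * RInt (g n) 0 (INR N + 1) <= 4 * B).
    pose proof (HB2 N). pose proof (HB2 n). pose proof (Rle_abs (v N)). pose proof (Rle_abs (v n)). lra. }
  set (m := cc k N * (exp (-2) / INR N)).
  assert (Hm : m ^ 2 <= 4 * B).
  { apply Rle_trans with (2 := Ih).
    rewrite <- (RInt_Chasles h 0 (INR N) (INR N + 1)).
    2: apply (ex_RInt_Chasles_1 h 0 (INR N) (INR N + 1)); auto; lra.
    2: apply (ex_RInt_Chasles_2 h 0 (INR N) (INR N + 1)); auto; lra.
    change (m ^ 2 <= RInt h 0 (INR N) + RInt h (INR N) (INR N + 1)).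
    assert (Hh : forall x, 0 <= h x) by (intros x; unfold h; pose proof (Hg N x); pose proof (Hg n x); lra).
    assert (0 <= RInt h 0 (INR N)).
    { apply RInt_ge_0; auto. lra. apply (ex_RInt_Chasles_1 h 0 (INR N) (INR N + 1)); auto; lra. }
    assert (m ^ 2 <= RInt h (INR N) (INR N + 1)); [|lra].
    replace (m ^ 2) with (RInt (fun _ => m ^ 2) (INR N) (INR N + 1)).
    2: { rewrite RInt_const. change ((INR N + 1 - INR N) * m ^ 2 = m ^ 2). ring. }
    apply RInt_le. lra. apply ex_RInt_const. apply (ex_RInt_Chasles_2 h 0 (INR N) (INR N + 1)); auto; lra.
    intros x Hx. apply Rle_trans with ((phiN N k x - phiN n k x) ^ 2).
    2: { unfold h, g. set (p := phiN N k x). set (q := phiN n k x). set (r := phi k x).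
         pose proof (pow2_ge_0 ((p - r) + (q - r))). simpl in *. nra. }
    rewrite !phiN_fsum. fold N. change (fsum ?f (S N)) with (fsum f N + f N). cbv beta.
    replace (exp (- x) * (fsum (fun n0 => cc k n0 / INR (fact n0) * x ^ n0) N + cc k N / INR (fact N) * x ^ N)
      -
             exp (- x) * fsum (fun n0 => cc k n0 / INR (fact n0) * x ^ n0) N)
      with (cc k N * (exp (- x) * x ^ N / INR (fact N))) by (unfold Rdiv; ring).
    unfold m. rewrite !Rpow_mult_distr. apply Rmult_le_compat_l. apply pow2_ge_0.
    apply pow_incr. split. apply Rmult_le_pos. left; apply exp_pos. left; apply Rinv_0_lt_compat; lra.
    pose proof (fact_bound n) as HF. fold N in HF. pose proof (INR_fact_lt_0 N) as HF0.
    apply Rmult_le_reg_r with (INR (fact N) * INR N). nra.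
    replace (exp (-2) / INR N * (INR (fact N) * INR N)) with (exp (-2) * INR (fact N)) by (field; lra).
    replace (exp (- x) * x ^ N / INR (fact N) * (INR (fact N) * INR N)) with (exp (- x) * x ^ N * INR N) by
      (field; lra).
    apply Rle_trans with (exp (-2) * (INR N * INR N ^ N * exp (- INR n))).
    { apply Rmult_le_compat_l. left; apply exp_pos. exact HF. }
    replace (exp (-2) * (INR N * INR N ^ N * exp (- INR n))) with (exp (- (INR N + 1)) * INR N ^ N * INR N).
    2: { replace (exp (- (INR N + 1))) with (exp (-2) * exp (- INR n)). ring. rewrite <- exp_plus. f_equal.
         unfold N. rewrite S_INR. ring. }
    apply Rmult_le_compat_r. lra. apply Rmult_le_compat. left; apply exp_pos. apply pow_le; lra.
    apply exp_mono. lra. apply pow_incr. lra. }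
  assert (Hm2 : Rabs m <= 4 * B + 1).
  { destruct (Rle_dec (Rabs m) 1). lra. assert (Rabs m <= Rabs m * Rabs m) by nra.
    rewrite <- Rabs_mult, (Rabs_pos_eq (m * m)) in H0 by nra. simpl in Hm. lra. }
  assert (Ecc : Rabs (cc k N) = Rabs m * (exp 2 * INR N)).
  { unfold m. rewrite Rabs_mult, (Rabs_pos_eq (exp (-2) / INR N)).
    - replace (exp (-2)) with (/ exp 2) by (rewrite <- exp_Ropp; f_equal; ring). field. split; lra.
    - apply Rmult_le_pos. left; apply exp_pos. left; apply Rinv_0_lt_compat; lra. }
  rewrite Ecc. pose proof (Rabs_pos (cc k 0)).
  assert (Rabs m * (exp 2 * INR N) <= (4 * B + 1) * (exp 2 * INR N)) by (apply Rmult_le_compat_r; nra).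
  nra.
Qed.

Lemma pow_coef_growth (k : nat) : L2_converges k -> exists K, 0 <= K /\ forall m, Rabs (PS_pow bc k m) <=
  K * (INR m + 1).
Proof.
  intros H. destruct (L2_coef_growth k H) as [K HK].
  assert (K0 : 0 <= K). { specialize (HK 0%nat). pose proof (Rabs_pos (cc k 0)). simpl in HK. lra. }
  set (S0 := fsum (fun m => Rabs (PS_pow bc k m)) k).
  assert (0 <= S0) by (apply fsum_pos; intros; apply Rabs_pos).
  exists (K + S0). split. lra. intros m. pose proof (pos_INR m). destruct (Nat.lt_ge_cases m k).
  - apply Rle_trans with S0.
    + unfold S0. replace k with (S m + (k - S m))%nat at 2 by lia. rewrite fsum_app. simpl.
      assert (0 <= fsum (fun m => Rabs (PS_pow bc k m)) m) by (apply fsum_pos; intros; apply Rabs_pos).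
      assert (0 <= fsum (fun i => Rabs (PS_pow bc k (S (m + i)))) (k - S m)) by (apply fsum_pos; intros;
        apply Rabs_pos). lra.
    + nra.
  - specialize (HK (m - k)%nat). unfold cc in HK. rewrite ell_coef in HK.
    replace (m - k + k)%nat with m in HK by lia.
    rewrite minus_INR in HK by lia. pose proof (pos_INR k). nra.
Qed.

Lemma series_SINR (r : R) : 0 <= r < 1 -> is_series (fun m => (INR m + 1) * r ^ m) ((/ (1 - r)) ^ 2).
Proof.
  intros H. apply pser_real. assert (Hm : Cmod (RtoC r) = r) by (rewrite Cmod_R, Rabs_pos_eq; lra).
  replace (RtoC ((/ (1 - r)) ^ 2)) with (/ (1 - RtoC r) * / (1 - RtoC r))%C.
  - apply (pser_ext (PS_mult ones ones)).
    + intros n. rewrite PS_mult_fsum. rewrite (fsum_ext _ (fun _ => 1)), fsum_const by (intros; unfold ones;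
        ring). rewrite S_INR. ring.
    + apply pser_mult; try (apply absconv_ones; lra); apply pser_ones; lra.
  - rewrite <- RtoC_minus, <- RtoC_inv, <- RtoC_mult by lra. f_equal. ring.
Qed.

Lemma bw_pow_bound (k : nat) (K : R) : 0 <= K -> (forall m, Rabs (PS_pow bc k m) <= K * (INR m + 1)) ->
  forall w, Cmod w < 1 -> Cmod (bw w) ^ k <= K * (/ (1 - Cmod w)) ^ 2.
Proof.
  intros HK H w Hw. destruct (bc_conv w Hw) as [B1 B2]. pose proof (Cmod_ge_0 w).
  pose proof (pser_pow bc k w _ B1 B2) as P. rewrite <- Cmod_pow.
  eapply Rle_trans. apply (Cser_Cmod_le _ _ (fun m => K * ((INR m + 1) * Cmod w ^ m)) P).
  - intros n. rewrite Cmod_term. rewrite <- Rmult_assoc. apply Rmult_le_compat_r. apply pow_le; auto. auto.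
  - apply (ex_series_scal_l K (fun m => (INR m + 1) * Cmod w ^ m)). eexists. apply series_SINR; lra.
  - rewrite Series_scal_l, (is_series_Series _ _ (series_SINR (Cmod w) ltac:(lra))). lra.
Qed.

(** For w = 1 - 1/s one has 1 - |w|^2 = 2 eta / |s|^2, hence 1 - |w| >= eta / |s|^2, and [Zf s] is s
    times [bw w]. *)
Lemma Zf_pow_bound (k : nat) (K eta : R) (s : C) : 0 <= K -> (forall m, Rabs (PS_pow bc k m) <=
  K * (INR m + 1)) ->
  0 < eta -> Re s = 1 / 2 + eta -> Cmod (Zf s) ^ k <= Cmod s ^ k * (K * (Cmod s ^ 2 / eta) ^ 2).
Proof.
  intros HK H He Hs.
  assert (Hs0 : s <> 0). { intros E. rewrite E in Hs. simpl in Hs. lra. }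
  set (w := (1 - / s)%C).
  assert (E1 : (1 - w)%C = (/ s)%C) by (unfold w; ring).
  assert (Hw1 : (1 - w)%C <> 0). { rewrite E1. intros E. apply (f_equal (Cmult s)) in E.
  rewrite Cinv_r in E by auto. rewrite Cmult_0_r in E. injection E; lra. }
  assert (E2 : sw w = s) by (unfold sw; rewrite E1; field; auto).
  pose proof (Re_sw_half w Hw1) as Hh. rewrite E2, Hs, E1 in Hh.
  assert (Hps : 0 < Cmod s) by (now apply Cmod_gt_0).
  assert (En : normsq (/ s)%C = / (Cmod s ^ 2)). { rewrite normsq_Cmod, Cmod_inv by auto. simpl. field. lra. }
  rewrite En, normsq_Cmod in Hh.
  assert (Hq : 0 < Cmod s ^ 2) by (apply pow_lt; auto).
  assert (Hww : 1 - Cmod w * Cmod w = 2 * (eta / Cmod s ^ 2)).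
  { replace (1 / 2 + eta - 1 / 2) with eta in Hh by ring. rewrite Hh. field. lra. }
  assert (0 < eta / Cmod s ^ 2) by (apply Rdiv_lt_0_compat; auto).
  assert (Hw : Cmod w < 1) by nra.
  assert (Hd : eta / Cmod s ^ 2 <= 1 - Cmod w) by nra.
  pose proof (bw_pow_bound k K HK H w Hw) as HB.
  assert (Eb : (Zf s = s * bw w)%C). { unfold bw. rewrite E2, E1. field. auto. }
  rewrite Eb, Cmod_mult, Rpow_mult_distr. apply Rmult_le_compat_l. apply pow_le; lra.
  apply Rle_trans with (1 := HB). apply Rmult_le_compat_l; auto. apply pow_incr. split.
  left; apply Rinv_0_lt_compat; lra.
  replace (Cmod s ^ 2 / eta) with (/ (eta / Cmod s ^ 2)) by (field; lra).
  apply Rinv_le_contravar; auto.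
Qed.

Lemma zeta_half (t : R) : zeta ((1 / 2)%R, t) = (Zf ((1 / 2)%R, t) / (((1 / 2)%R, t) - 1))%C.
Proof.
  apply zeta_Zf.
  - simpl. lra.
  - intros E. injection E; lra.
  - intros E. assert (Hx : xpow 2 (((1 / 2)%R, t) - 1) = 1).
    { replace (xpow 2 (((1 / 2)%R, t) - 1)) with (1 - (1 - xpow 2 (((1 / 2)%R, t) - 1)))%C by ring. rewrite E.
    ring. }
    apply (f_equal Cmod) in Hx. rewrite Cmod_xpow, Cmod_1 in Hx. apply (f_equal ln) in Hx.
    rewrite ln_exp, ln_1 in Hx. simpl in Hx.
    pose proof ln_2_pos. nra.
Qed.

Lemma Cmod_pair_le (a b : R) : Cmod (a, b) <= Rabs a + Rabs b.
Proof. apply (Cmod_le_sum (a, b)). Qed.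

Lemma pow_root_le (X C Y : R) (k : nat) : (1 <= k)%nat -> 0 <= X -> 1 <= C -> 0 < Y -> X ^ k <= C * Y ^ k ->
  X <= C * Y.
Proof.
  intros Hk HX HC HY H. apply Rnot_lt_le. intros Hlt.
  assert (HCY : 0 < C * Y) by nra.
  assert (Hm : forall j, (C * Y) ^ j <= X ^ j) by (intros; apply pow_incr; lra).
  destruct k; [lia|].
  assert (H1 : (C * Y) ^ S k < X ^ S k).
  { simpl. pose proof (pow_lt (C * Y) k HCY). specialize (Hm k). nra. }
  rewrite Rpow_mult_distr in H1.
  assert (C <= C ^ S k). { rewrite <- (pow_1 C) at 1. apply Rle_pow; auto; lia. }
  pose proof (pow_lt Y (S k) HY). nra.
Qed.

Lemma L2_implies_Lindelof : (forall k : nat, (1 <= k)%nat -> L2_converges k) -> Lindelof.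
Proof.
  intros H eps He.
  (* With eta = T^(-3) and |s| <= 3T, the bound (|s|^2 / eta)^2 of [Zf_pow_bound] is at most 81
     T^10: hence the number 10. *)
  assert (Hk : exists k, (1 <= k)%nat /\ 10 <= eps * INR k).
  { destruct (INR_unbounded (10 / eps)) as [k Hk]. exists (S k). split. lia. rewrite S_INR.
    apply Rmult_lt_compat_l with (r := eps) in Hk; auto.
    replace (eps * (10 / eps)) with 10 in Hk by (field; lra). nra. }
  destruct Hk as [k [Hk1 Hk2]]. destruct (pow_coef_growth k (H k Hk1)) as [K [HK0 HK]].
  (* 343 is the cube of 7, from 1 + |s| + |s'| <= 7T in [Zf_lip]; the factors 3^k and 81 come from
     |s| <= 3T. *)
  set (L := 343 * (1 + 3 * Q32)). set (C1 := 1 + 3 ^ k * 81 * K).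
  assert (H3k : 0 <= 3 ^ k * 81 * K) by (apply Rmult_le_pos; auto; apply Rmult_le_pos; [apply pow_le|]; lra).
  pose proof Q32_pos as HQ.
  exists (L + C1), 1. intros t Ht. set (T := Rabs t) in *.
  assert (HT0 : 0 < T) by lra. assert (HT1 : 1 <= T ^ 3) by (rewrite <- (pow1 3); apply pow_incr; lra).
  (* The shift off the line is the reciprocal of the cubic Lipschitz constant, so that moving back
     to Re s = 1/2 changes [Zf] by a bounded amount. *)
  set (eta := / T ^ 3). assert (Heta : 0 < eta <= 1).
  { unfold eta. split. apply Rinv_0_lt_compat; lra. rewrite <- Rinv_1. apply Rinv_le_contravar; lra. }
  set (s' := ((1 / 2)%R, t)). set (s := ((1 / 2 + eta)%R, t)).
  assert (Hs'T : Cmod s' <= 3 * T). { eapply Rle_trans. apply Cmod_pair_le. fold T.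
  rewrite Rabs_pos_eq by lra. lra. }
  assert (HsT : Cmod s <= 3 * T). { eapply Rle_trans. apply Cmod_pair_le. fold T. rewrite Rabs_pos_eq by lra.
  lra. }
  pose proof (Cmod_ge_0 s) as Ps. pose proof (Cmod_ge_0 s') as Ps'.
  assert (A1 : Cmod (Zf s' - Zf s) <= L).
  { eapply Rle_trans. apply Zf_lip; simpl; lra.
    assert (E : Cmod (s' - s) <= eta).
    { replace (s' - s)%C with (RtoC (- eta)) by (apply C_eq; simpl; ring).
      rewrite Cmod_R, Rabs_Ropp, Rabs_pos_eq; lra. }
    assert (E3 : (1 + Cmod s + Cmod s') ^ 3 <= 343 * T ^ 3).
    { replace (343 * T ^ 3) with ((7 * T) ^ 3) by ring. apply pow_incr. lra. }
    unfold L. apply Rle_trans with ((1 + 3 * Q32) * (343 * T ^ 3) * eta).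
    - apply Rmult_le_compat; try apply Cmod_ge_0; auto. apply Rmult_le_pos. lra. apply pow_le; lra.
      apply Rmult_le_compat_l; lra.
    - right. unfold eta. field. lra. }
  assert (A2 : Cmod (Zf s) / T <= C1 * Rpower T (10 / INR k)).
  { assert (Hkp : 0 < INR k) by (apply lt_0_INR; lia).
    apply (pow_root_le (Cmod (Zf s) / T) C1 (Rpower T (10 / INR k)) k Hk1).
    - apply Rmult_le_pos. apply Cmod_ge_0. left; apply Rinv_0_lt_compat; lra.
    - unfold C1; lra.
    - apply exp_pos.
    - rewrite <- (Rpower_pow k (Rpower T (10 / INR k))) by apply exp_pos. rewrite Rpower_mult.
      replace (10 / INR k * INR k) with (INR 10) by (simpl; field; lra).
      rewrite Rpower_pow by lra. unfold Rdiv. rewrite Rpow_mult_distr, pow_inv by lra.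
      pose proof (Zf_pow_bound k K eta s HK0 HK (proj1 Heta) eq_refl) as Z.
      assert (HTk : 0 < T ^ k) by (apply pow_lt; lra).
      apply Rmult_le_reg_r with (T ^ k); auto. rewrite Rmult_assoc, Rinv_l, Rmult_1_r by lra.
      apply Rle_trans with (1 := Z).
      apply Rle_trans with ((3 * T) ^ k * (K * (81 * T ^ 10))).
      + apply Rmult_le_compat. apply pow_le; auto. apply Rmult_le_pos; auto. apply pow2_ge_0.
        apply pow_incr; lra. apply Rmult_le_compat_l; auto.
        replace (81 * T ^ 10) with ((9 * T ^ 2 * T ^ 3) ^ 2) by ring. apply pow_incr. split.
        apply Rmult_le_pos. apply pow2_ge_0. left; apply Rinv_0_lt_compat; lra.
        unfold Rdiv, eta. rewrite Rinv_inv. apply Rmult_le_compat_r. lra.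
        replace (9 * T ^ 2) with ((3 * T) ^ 2) by ring. apply pow_incr; lra.
      + rewrite Rpow_mult_distr. unfold C1.
        assert (0 <= T ^ 10 * T ^ k) by (apply Rmult_le_pos; apply pow_le; lra). nra. }
  assert (Hlt : T <= Cmod (s' - 1)).
  { pose proof (im_le_Cmod (s' - 1)) as E. rewrite Im_minus in E. simpl in E. rewrite Rminus_0_r in E.
    exact E. }
  assert (HRp : Rpower T (10 / INR k) <= Rpower T eps).
  { apply Rle_Rpower. lra. assert (Hkp : 0 < INR k) by (apply lt_0_INR; lia).
    apply Rmult_le_reg_r with (INR k); auto.
    unfold Rdiv. rewrite Rmult_assoc, Rinv_l; lra. }
  assert (HR1 : 1 <= Rpower T eps). { rewrite <- (Rpower_O T) by lra. apply Rle_Rpower; lra. }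
  change (zeta s') with (zeta ((1 / 2)%R, t)). rewrite zeta_half. fold s'.
  rewrite Cmod_div by (intros E; rewrite E, Cmod_0 in Hlt; lra).
  apply Rle_trans with (Cmod (Zf s') / T).
  { apply Rmult_le_compat_l. apply Cmod_ge_0. apply Rinv_le_contravar; auto. }
  assert (A3 : Cmod (Zf s') <= L + Cmod (Zf s)). { pose proof (Cmod_sub_ge (Zf s') (Zf s)). lra. }
  assert (A4 : Cmod (Zf s') / T <= L + Cmod (Zf s) / T).
  { apply Rle_trans with ((L + Cmod (Zf s)) / T). apply Rmult_le_compat_r; auto.
    left; apply Rinv_0_lt_compat; lra.
    unfold Rdiv. rewrite Rmult_plus_distr_r. apply Rplus_le_compat_r.
    assert (/ T <= 1) by (rewrite <- Rinv_1; apply Rinv_le_contravar; lra). unfold L in *. nra. }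
  assert (0 <= L) by (unfold L; lra). assert (1 <= C1) by (unfold C1; lra).
  rewrite Rmult_plus_distr_r. apply Rle_trans with (1 := A4). apply Rplus_le_compat. nra.
  apply Rle_trans with (1 := A2). apply Rmult_le_compat_l; lra.
Qed.

(** * The Lindelof hypothesis makes the coefficients square summable *)

(** x - x^3/6 >= x/3 as long as x^2 <= 4. *)
Lemma sin_ge_third (x : R) : 0 <= x <= 2 -> x / 3 <= sin x.
Proof.
  intros H. destruct (pre_sin_bound x 0 ltac:(lra) ltac:(lra)) as [H1 _].
  apply Rle_trans with (2 := H1). unfold sin_approx, sin_term. simpl. field_simplify. nra.
Qed.

Lemma sin_min_third (x : R) : 0 < x < PI -> Rmin x (PI - x) / 3 <= sin x.
Proof.
  intros H. pose proof PI_4. destruct (Rle_dec x (PI / 2)).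
  - rewrite Rmin_left by lra. apply sin_ge_third. lra.
  - rewrite Rmin_right by lra. rewrite <- sin_PI_x. apply sin_ge_third. lra.
Qed.

Lemma Cmod_one_cis (t : R) : 0 <= sin (t / 2) -> Cmod (1 - cis t) = 2 * sin (t / 2).
Proof.
  intros H. unfold Cmod, cis. simpl.
  replace ((1 + - cos t) * ((1 + - cos t) * 1) + (0 + - sin t) * ((0 + - sin t) * 1)) with (2 - 2 * cos t +
    (Rsqr (sin t) + Rsqr (cos t) - 1)) by (unfold Rsqr; ring).
  rewrite sin2_cos2. replace t with (2 * (t / 2)) at 1 by field. rewrite cos_2a_sin.
  replace (2 - 2 * (1 - 2 * sin (t / 2) * sin (t / 2)) + (1 - 1)) with (Rsqr (2 * sin (t / 2))) by (unfold
    Rsqr; ring).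
  apply sqrt_Rsqr. lra.
Qed.

Lemma sum_inv_sqrt (M : nat) : fsum (fun j => / sqrt (INR (S j))) M <= 2 * sqrt (INR M).
Proof.
  induction M.
  - simpl. rewrite sqrt_0. lra.
  - cbn [fsum]. set (a := sqrt (INR M)) in *. set (b := sqrt (INR (S M))). pose proof (INR_S_ge1 M).
    pose proof (pos_INR M).
    assert (Hb : 0 < b) by (apply sqrt_lt_R0; lra).
    assert (Ha2 : a * a = INR M) by (apply sqrt_sqrt; lra).
    assert (Hb2 : b * b = INR M + 1) by (unfold b; rewrite sqrt_sqrt by lra; apply S_INR).
    assert (/ b <= 2 * b - 2 * a).
    { apply Rmult_le_reg_r with b; auto. rewrite Rinv_l by lra. nra. }
    lra.
Qed.

Lemma fsum_rev (g : nat -> R) (M : nat) : fsum (fun j => g (M - j)%nat) M = fsum (fun j => g (S j)) M.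
Proof.
  induction M; auto. rewrite fsum_head. simpl fsum at 2. rewrite Rplus_comm. f_equal.
  rewrite <- IHM. apply fsum_ext. intros; f_equal; lia.
Qed.

Lemma node_half (M j : nat) : (j < M)%nat -> 0 < node M j / 2 < PI /\ INR (S j) / INR M <= node M j / 2 /\
  INR (M - j) / INR M <= PI - node M j / 2.
Proof.
  intros H. assert (HM : 0 < INR M) by (apply lt_0_INR; lia). pose proof PI2_1 as HPI. pose proof (pos_INR j).
  assert (Hj : INR j + 1 <= INR M) by (rewrite <- S_INR; apply le_INR; lia).
  unfold node. rewrite S_INR, minus_INR by lia.
  assert (E : (2 * INR j + 1) * PI / INR M / 2 = (2 * INR j + 1) * (PI / 2) / INR M) by (field; lra).
  rewrite E.
  assert (E2 : PI - (2 * INR j + 1) * (PI / 2) / INR M =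
    (2 * INR M - (2 * INR j + 1)) * (PI / 2) / INR M) by (field; lra).
  assert (HI : 0 < / INR M) by (apply Rinv_0_lt_compat; auto).
  assert (B1 : INR j + 1 <= (2 * INR j + 1) * (PI / 2)) by nra.
  assert (B2 : INR M - INR j <= (2 * INR M - (2 * INR j + 1)) * (PI / 2)) by nra.
  rewrite E2. repeat split.
  - apply Rdiv_lt_0_compat; nra.
  - assert (0 < PI - (2 * INR j + 1) * (PI / 2) / INR M); [|lra]. rewrite E2. apply Rdiv_lt_0_compat; nra.
  - apply Rmult_le_compat_r; lra.
  - apply Rmult_le_compat_r; lra.
Qed.

Lemma sin_node_pos (M j : nat) : (j < M)%nat -> 0 < sin (node M j / 2).
Proof. intros H. destruct (node_half M j H) as [H1 _]. apply sin_gt_0; lra. Qed.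

Lemma sqrt_inv_sin_node (M j : nat) : (j < M)%nat ->
  sqrt (/ sin (node M j / 2)) <= sqrt (3 * INR M) * (/ sqrt (INR (S j)) + / sqrt (INR (M - j))).
Proof.
  intros H. destruct (node_half M j H) as [H1 [H2 H3]]. pose proof (sin_min_third _ H1) as H4.
  assert (HM : 0 < INR M) by (apply lt_0_INR; lia). pose proof (INR_S_ge1 j) as Hj.
  assert (HMj : 1 <= INR (M - j)) by (replace (M - j)%nat with (S (M - S j)) by lia; apply INR_S_ge1).
  assert (P1 : 0 < / sqrt (INR (S j))) by (apply Rinv_0_lt_compat, sqrt_lt_R0; lra).
  assert (P2 : 0 < / sqrt (INR (M - j))) by (apply Rinv_0_lt_compat, sqrt_lt_R0; lra).
  assert (P3 : 0 <= sqrt (3 * INR M)) by apply sqrt_pos.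
  assert (G : forall a, 0 < a -> a / INR M / 3 <= sin (node M j / 2) -> sqrt (/ sin (node M j / 2)) <=
    sqrt (3 * INR M) * / sqrt a).
  { intros a Ha Hle. rewrite <- sqrt_inv, <- sqrt_mult_alt by lra. apply sqrt_le_1_alt.
    replace (3 * INR M * / a) with (/ (a / INR M / 3)) by (field; lra). apply Rinv_le_contravar; auto.
    repeat apply Rdiv_lt_0_compat; lra. }
  unfold Rmin in H4. destruct (Rle_dec (node M j / 2) (PI - node M j / 2)).
  - apply Rle_trans with (sqrt (3 * INR M) * / sqrt (INR (S j))). apply G; lra. nra.
  - apply Rle_trans with (sqrt (3 * INR M) * / sqrt (INR (M - j))). apply G; lra. nra.
Qed.

(** The discrete form of the integrability of |1 - w|^(-1/2) on the unit circle. The half angle of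
    the node with index j is at least (j+1)/M away from 0 and (M-j)/M away from pi, so the sum is
    compared with two sums of inverse square roots; the constant is 4 sqrt 3 <= 8. *)
Lemma sum_sqrt_inv_sin (M : nat) : fsum (fun j => sqrt (/ sin (node M j / 2))) M <= INR M * 8.
Proof.
  pose proof (pos_INR M) as HM.
  apply Rle_trans with (fsum (fun j => sqrt (3 * INR M) * (/ sqrt (INR (S j)) + / sqrt (INR (M - j)))) M).
  { apply fsum_le. intros; now apply sqrt_inv_sin_node. }
  rewrite fsum_scal, fsum_plus. rewrite (fsum_rev (fun j => / sqrt (INR j))).
  pose proof (sum_inv_sqrt M). rewrite sqrt_mult_alt by lra.
  assert (Hs : sqrt (INR M) * sqrt (INR M) = INR M) by (apply sqrt_sqrt; auto).
  assert (H3 : sqrt 3 <= 2). { replace 2 with (sqrt (2 * 2)) by (apply sqrt_square; lra). apply sqrt_le_1_alt.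
  lra. }
  assert (0 <= sqrt 3) by apply sqrt_pos. assert (0 <= sqrt (INR M)) by apply sqrt_pos.
  assert (E : sqrt 3 * sqrt (INR M) * (4 * sqrt (INR M)) <= INR M * 8).
  { replace (sqrt 3 * sqrt (INR M) * (4 * sqrt (INR M))) with (4 * sqrt 3 * (sqrt (INR M) * sqrt (INR M))) by
      ring. rewrite Hs. nra. }
  eapply Rle_trans. 2: exact E. apply Rmult_le_compat_l. nra. lra.
Qed.

Lemma Cmod_pow_diff (a b : C) (B : R) (k : nat) : Cmod a <= B -> Cmod b <= B ->
  Cmod (a ^ k - b ^ k) <= INR k * (B + 1) ^ k * Cmod (a - b).
Proof.
  intros Ha Hb. pose proof (Cmod_ge_0 b). pose proof (Cmod_ge_0 (a - b)).
  induction k.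
  - simpl. replace (1 - 1)%C with (RtoC 0) by ring. rewrite Cmod_0. lra.
  - replace (a ^ S k - b ^ S k)%C with (a * (a ^ k - b ^ k) + (a - b) * b ^ k)%C by (simpl; ring).
    eapply Rle_trans. apply Cmod_triangle. rewrite !Cmod_mult, Cmod_pow.
    assert (P : 1 <= (B + 1) ^ k) by (apply pow_R1_Rle; lra).
    assert (Q : Cmod b ^ k <= (B + 1) ^ k) by (apply pow_incr; lra).
    rewrite S_INR. simpl pow. pose proof (Cmod_ge_0 (a ^ k - b ^ k)).
    assert (0 <= B * (B + 1) ^ k * Cmod (a - b)) by (repeat apply Rmult_le_pos; lra).
    nra.
Qed.

Lemma Cmod_mult_diff (a b a' b' : C) : Cmod (a * b - a' * b') <=
  Cmod (a - a') * Cmod b + Cmod a' * Cmod (b - b').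
Proof.
  replace (a * b - a' * b')%C with ((a - a') * b + a' * (b - b'))%C by ring.
  eapply Rle_trans. apply Cmod_triangle. rewrite !Cmod_mult. lra.
Qed.

(** Five factors 1 - w compensate exactly the Lipschitz behaviour of [Zf (sw w)] near w = 1: three
    for the cubic constant in s = 1/(1-w), and two for the difference quotient of s with respect to
    w. *)
Definition yw (w : C) : C := ((1 - w) ^ 5 * Zf (sw w))%C.

(** Since Re s >= 1/2, also |s| >= 1/2 and 1 + |s| <= 3|s|; the cube of 3 gives 27. *)
Lemma Zf_sw_bound (w : C) : (1 - w)%C <> 0 -> Cmod w <= 1 ->
  Cmod (Zf (sw w)) <= 27 * (1 + Q32) * (/ Cmod (1 - w)) ^ 3.
Proof.
  intros H Hw. pose proof (Re_sw_ge w H Hw) as Hre. eapply Rle_trans. apply Zf_bound. lra.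
  rewrite <- Cmod_sw by auto. pose proof (re_le_Cmod (sw w)) as R1. rewrite Rabs_pos_eq in R1 by lra.
  replace (27 * (1 + Q32) * Cmod (sw w) ^ 3) with ((1 + Q32) * (3 * Cmod (sw w)) ^ 3) by ring.
  pose proof Q32_pos. apply Rmult_le_compat_l. lra. apply pow_incr. lra.
Qed.

Lemma yw_bound (w : C) : (1 - w)%C <> 0 -> Cmod w <= 1 -> Cmod (yw w) <= 108 * (1 + Q32).
Proof.
  intros H Hw. unfold yw. rewrite Cmod_mult, Cmod_pow. pose proof (Zf_sw_bound w H Hw) as HZ.
  assert (Hu : 0 < Cmod (1 - w)) by (now apply Cmod_gt_0).
  assert (Hu2 : Cmod (1 - w) <= 2) by (eapply Rle_trans; [apply Cmod_sub_le|]; rewrite Cmod_1; lra).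
  pose proof Q32_pos.
  apply Rle_trans with (Cmod (1 - w) ^ 5 * (27 * (1 + Q32) * (/ Cmod (1 - w)) ^ 3)).
  - apply Rmult_le_compat_l; auto. apply pow_le; lra.
  - replace (Cmod (1 - w) ^ 5 * (27 * (1 + Q32) * (/ Cmod (1 - w)) ^ 3)) with (27 * (1 + Q32) * Cmod (1 - w) ^
      2) by (field; lra).
    assert (Cmod (1 - w) ^ 2 <= 4) by (simpl; nra). nra.
Qed.

(** Only points on a common radius are compared. There 1 - r <= |u|, whence |u'| <= 2|u|, so that
    the singular factors at the two points are comparable. The difference of fifth powers is
    divisible by u - u', leaving degree four against the cubic growth of [Zf]. *)
Lemma yw_lip (r t : R) : 0 <= r < 1 -> (1 - cis t)%C <> 0 ->
  Cmod (yw (RtoC r * cis t) - yw (cis t)) <= (4320 * (1 + Q32) + 250 * (1 + 3 * Q32)) * (1 - r).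
Proof.
  intros Hr H'. set (w := (RtoC r * cis t)%C). set (w' := cis t) in *.
  assert (Hw' : Cmod w' <= 1) by (unfold w'; rewrite Cmod_cis; lra).
  assert (Hw : Cmod w = r) by (unfold w, w'; rewrite Cmod_mult, Cmod_R, Cmod_cis, Rabs_pos_eq; lra).
  assert (H : (1 - w)%C <> 0) by (apply one_minus_neq0; lra).
  set (u := (1 - w)%C) in *. set (u' := (1 - w')%C) in *.
  assert (Hp : 0 < Cmod u) by (now apply Cmod_gt_0). assert (Hp' : 0 < Cmod u') by (now apply Cmod_gt_0).
  assert (Ed : Cmod (u - u') = 1 - r).
  { replace (u - u')%C with (RtoC (1 - r) * cis t)%C by (unfold u, u', w, w'; rewrite RtoC_minus; ring).
    rewrite Cmod_mult, Cmod_R, Cmod_cis, Rabs_pos_eq; lra. }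
  assert (H1r : 1 - r <= Cmod u). { unfold u. pose proof (Cmod_sub_ge 1 w). rewrite Cmod_1, Hw in H0. lra. }
  assert (Hu2 : Cmod u <= 2) by (unfold u; eapply Rle_trans; [apply Cmod_sub_le|]; rewrite Cmod_1; lra).
  assert (Huu : Cmod u' <= 2 * Cmod u).
  { replace u' with (u - (u - u'))%C by ring. eapply Rle_trans. apply Cmod_sub_le. lra. }
  unfold yw. fold u u'. pose proof Q32_pos as HQ.
  replace (u ^ 5 * Zf (sw w) - u' ^ 5 * Zf (sw w'))%C with ((u ^ 5 - u' ^ 5) * Zf (sw w) + u' ^ 5 * (Zf (sw w)
    - Zf (sw w')))%C by ring.
  eapply Rle_trans. apply Cmod_triangle. rewrite !Cmod_mult, (Cmod_pow u').
  assert (A : Cmod (u ^ 5 - u' ^ 5) <= 80 * (1 - r) * Cmod u ^ 4).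
  { replace (u ^ 5 - u' ^ 5)%C with ((u - u') * (u ^ 4 + u ^ 3 * u' + u ^ 2 * u' ^ 2 + u * u' ^ 3 + u' ^ 4))%C
      by ring.
    rewrite Cmod_mult, Ed. rewrite (Rmult_comm 80), Rmult_assoc. apply Rmult_le_compat_l. lra.
    set (x := Cmod u) in *. set (y := Cmod u') in *.
    eapply Rle_trans. apply Cmod_triangle. eapply Rle_trans. apply Rplus_le_compat_r. apply Cmod_triangle.
    eapply Rle_trans. apply Rplus_le_compat_r. apply Rplus_le_compat_r. apply Cmod_triangle.
    eapply Rle_trans. apply Rplus_le_compat_r. apply Rplus_le_compat_r. apply Rplus_le_compat_r.
    apply Cmod_triangle.
    rewrite !Cmod_mult, !Cmod_pow. fold x y.
    assert (Px : forall i, 0 <= x ^ i) by (intros; apply pow_le; lra).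
    assert (Py : forall i, 0 <= y ^ i) by (intros; apply pow_le; lra).
    assert (Mx : forall i, x ^ i <= (2 * x) ^ i) by (intros; apply pow_incr; lra).
    assert (My : forall i, y ^ i <= (2 * x) ^ i) by (intros; apply pow_incr; lra).
    replace (80 * x ^ 4) with ((2 * x) ^ 4 + (2 * x) ^ 3 * (2 * x) + (2 * x) ^ 2 * (2 * x) ^ 2 + (2 * x) * (2
      * x) ^ 3 + (2 * x) ^ 4) by ring.
    repeat apply Rplus_le_compat; auto; apply Rmult_le_compat; auto; lra. }
  pose proof (Zf_sw_bound w H ltac:(lra)) as HZ. fold u in HZ.
  assert (B1 : Cmod (u ^ 5 - u' ^ 5) * Cmod (Zf (sw w)) <= 4320 * (1 + Q32) * (1 - r)).
  { apply Rle_trans with (80 * (1 - r) * Cmod u ^ 4 * (27 * (1 + Q32) * (/ Cmod u) ^ 3)).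
    - apply Rmult_le_compat; auto; apply Cmod_ge_0.
    - replace (80 * (1 - r) * Cmod u ^ 4 * (27 * (1 + Q32) * (/ Cmod u) ^ 3)) with (2160 * (1 + Q32) * (1 - r)
        * Cmod u) by (field; lra).
      assert (0 <= (1 + Q32) * (1 - r)) by nra. nra. }
  assert (Hs : Cmod (sw w) = / Cmod u) by (now apply Cmod_sw).
  assert (Hs' : Cmod (sw w') = / Cmod u') by (now apply Cmod_sw).
  assert (I1 : / Cmod u <= 2 * / Cmod u').
  { replace (2 * / Cmod u') with (/ (Cmod u' / 2)) by (field; lra). apply Rinv_le_contravar; lra. }
  assert (Hu2' : Cmod u' <= 2) by (unfold u'; eapply Rle_trans; [apply Cmod_sub_le|]; rewrite Cmod_1; lra).
  assert (I2 : 1 <= 2 * / Cmod u'). { replace (2 * / Cmod u') with (/ (Cmod u' / 2)) by (field; lra).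
  rewrite <- Rinv_1 at 1. apply Rinv_le_contravar; lra. }
  assert (B2 : Cmod u' ^ 5 * Cmod (Zf (sw w) - Zf (sw w')) <= 250 * (1 + 3 * Q32) * (1 - r)).
  { assert (L : Cmod (Zf (sw w) - Zf (sw w')) <= (1 + 3 * Q32) * (5 * / Cmod u') ^ 3 * ((1 - r) * / Cmod u * /
      Cmod u')).
    { eapply Rle_trans. apply Zf_lip. apply Re_sw_ge; auto. apply Re_sw_ge; auto; lra.
      assert (Es : Cmod (sw w - sw w') = (1 - r) * / Cmod u * / Cmod u').
      { replace (sw w - sw w')%C with ((u' - u) * / u * / u')%C by (unfold sw; fold u u'; field; auto).
        rewrite !Cmod_mult, !Cmod_inv by auto. f_equal. f_equal. rewrite <- Ed, <- Cmod_opp. f_equal. ring. }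
      rewrite Es, Hs, Hs'. apply Rmult_le_compat_r.
      - assert (0 < / Cmod u) by (apply Rinv_0_lt_compat; auto). repeat apply Rmult_le_pos; lra.
      - apply Rmult_le_compat_l. lra. apply pow_incr. assert (0 < / Cmod u) by (apply Rinv_0_lt_compat; auto).
        lra. }
    apply Rle_trans with (Cmod u' ^ 5 * ((1 + 3 * Q32) * (5 * / Cmod u') ^ 3 * ((1 - r) * / Cmod u * / Cmod
      u'))).
    - apply Rmult_le_compat_l; auto. apply pow_le; lra.
    - replace (Cmod u' ^ 5 * ((1 + 3 * Q32) * (5 * / Cmod u') ^ 3 * ((1 - r) * / Cmod u * / Cmod u')))
        with (125 * (1 + 3 * Q32) * (1 - r) * (Cmod u' * / Cmod u)) by (field; lra).
      assert (Cmod u' * / Cmod u <= 2). { apply Rmult_le_reg_r with (Cmod u); auto.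
      rewrite Rmult_assoc, Rinv_l; lra. }
      assert (0 <= (1 + 3 * Q32) * (1 - r)) by nra. nra. }
  lra.
Qed.

Definition hd (d : R) (w : C) : C := (/ (RtoC (1 + d) - w))%C.

Lemma hd_den (d : R) (w : C) : 0 < d -> Cmod w <= 1 -> d <= Cmod (RtoC (1 + d) - w).
Proof. intros Hd Hw. pose proof (Cmod_sub_ge (RtoC (1 + d)) w). rewrite Cmod_R, Rabs_pos_eq in H by lra. lra.
Qed.

Lemma hd_den_neq0 (d : R) (w : C) : 0 < d -> Cmod w <= 1 -> (RtoC (1 + d) - w)%C <> 0.
Proof. intros Hd Hw E. pose proof (hd_den d w Hd Hw). rewrite E, Cmod_0 in H. lra. Qed.

Lemma hd_bound (d : R) (w : C) : 0 < d -> Cmod w <= 1 -> Cmod (hd d w) <= / d.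
Proof.
  intros Hd Hw. unfold hd. rewrite Cmod_inv by (now apply hd_den_neq0). apply Rinv_le_contravar; auto.
  now apply hd_den.
Qed.

Lemma hd_lip (d : R) (w w' : C) : 0 < d -> Cmod w <= 1 -> Cmod w' <= 1 ->
  Cmod (hd d w - hd d w') <= / d * / d * Cmod (w - w').
Proof.
  intros Hd Hw Hw'. replace (hd d w - hd d w')%C with (hd d w * hd d w' * (w - w'))%C.
  - rewrite !Cmod_mult. apply Rmult_le_compat_r. apply Cmod_ge_0.
    apply Rmult_le_compat; try apply Cmod_ge_0; now apply hd_bound.
  - unfold hd. field. split; now apply hd_den_neq0.
Qed.

(* The regularisation [(1-w)/(1+d-w)] has modulus at most 1 on the closed disc
   and tames the singularity at [w = 1] (i.e. [s = oo]). *)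
Definition reg (d : R) (w : C) : C := ((1 - w) * hd d w)%C.

(** As Re w <= 1, moving the point 1 to 1 + d increases its distance from w. *)
Lemma reg_le_1 (d : R) (w : C) : 0 < d -> Cmod w <= 1 -> Cmod (reg d w) <= 1.
Proof.
  intros Hd Hw. unfold reg, hd. rewrite Cmod_mult, Cmod_inv by (now apply hd_den_neq0).
  pose proof (hd_den d w Hd Hw) as Hp.
  apply Rmult_le_reg_r with (Cmod (RtoC (1 + d) - w)). lra.
  rewrite Rmult_assoc, Rinv_l, Rmult_1_l, Rmult_1_r by lra.
  apply Rsqr_incr_0_var; [|apply Cmod_ge_0]. unfold Rsqr. rewrite <- !normsq_Cmod.
  unfold normsq. rewrite !Re_minus, !Im_minus, !Re_RtoC, !Im_RtoC.
  pose proof (re_le_Cmod w) as R1. assert (R2 : Rabs (Re w) <= 1) by lra. apply Rabs_le_between in R2. nra.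
Qed.

(** From [reg d w] = 1 - d/(1+d-w) and the geometric series in w/(1+d). *)
Definition regc (d : R) (n : nat) : R := delta0 n + (- d * / (1 + d)) * (/ (1 + d)) ^ n.

Lemma geom_pser (q : R) (w : C) : 0 <= q -> q * Cmod w < 1 ->
  absconv (fun n => q ^ n) (Cmod w) /\ pser (fun n => q ^ n) w (/ (1 - RtoC q * w)).
Proof.
  intros Hq H. assert (Hm : Cmod (RtoC q * w) = q * Cmod w) by (rewrite Cmod_mult, Cmod_R, Rabs_pos_eq; auto).
  split.
  - exists (/ (1 - q * Cmod w)). eapply is_series_ext. 2: apply (geom_series (q * Cmod w)).
    intros n. rewrite Rabs_pos_eq by (apply pow_le; auto). Req. apply Rpow_mult_distr. split; auto.
    apply Rmult_le_pos; auto. apply Cmod_ge_0.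
  - assert (P : pser ones (RtoC q * w) (/ (1 - RtoC q * w))) by (apply pser_ones; lra).
    eapply Cser_ext. 2: exact P. intros n. cbv beta. unfold ones. rewrite Cpow_mult_l, RtoC_pow. ring.
Qed.

Lemma regc_conv (d : R) (w : C) : 0 < d -> Cmod w <= 1 -> absconv (regc d) (Cmod w) /\
  pser (regc d) w (reg d w).
Proof.
  intros Hd Hw. pose proof (Cmod_ge_0 w).
  assert (Hq : 0 < / (1 + d)) by (apply Rinv_0_lt_compat; lra).
  assert (Hq1 : / (1 + d) < 1) by (rewrite <- Rinv_1; apply Rinv_lt_contravar; lra).
  destruct (geom_pser (/ (1 + d)) w) as [G1 G2]. lra. nra.
  split.
  - unfold regc. apply absconv_plus; auto. apply absconv_delta0. now apply absconv_scal.
  - unfold regc. replace (reg d w) with (1 + RtoC (- d * / (1 + d)) * / (1 - RtoC (/ (1 + d)) * w))%C.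
    + apply pser_plus. apply pser_delta0. now apply pser_scal.
    + unfold reg, hd. pose proof (hd_den_neq0 d w Hd Hw) as N1.
      assert (N2 : RtoC (1 + d) <> 0). { intros E. injection E. lra. }
      rewrite RtoC_mult, RtoC_opp, RtoC_inv by lra.
      assert (E : (1 - / RtoC (1 + d) * w = (RtoC (1 + d) - w) / RtoC (1 + d))%C) by (field; auto).
      rewrite E.
      replace (RtoC d) with (RtoC (1 + d) - 1)%C by (rewrite RtoC_plus; ring). field. split; auto.
Qed.

Definition bdc (d : R) (k : nat) : nat -> R := PS_pow (PS_mult bc (PS_pow (regc d) 4)) k.

Definition fd (d : R) (k : nat) (w : C) : C := ((bw w * reg d w ^ 4) ^ k)%C.

Lemma bdc_conv (d : R) (k : nat) (w : C) : 0 < d -> Cmod w < 1 -> absconv (bdc d k) (Cmod w) /\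
  pser (bdc d k) w (fd d k w).
Proof.
  intros Hd Hw. pose proof (Cmod_ge_0 w). destruct (bc_conv w Hw) as [B1 B2].
  destruct (regc_conv d w Hd ltac:(lra)) as [R1 R2].
  assert (A : absconv (PS_pow (regc d) 4) (Cmod w)) by (now apply absconv_pow).
  assert (A' : absconv (PS_mult bc (PS_pow (regc d) 4)) (Cmod w)) by (now apply absconv_mult).
  split. now apply absconv_pow. apply pser_pow; auto. apply pser_mult; auto. now apply pser_pow.
Qed.

(** One factor 1 - w comes from [bw] and four come from the fourth power of [reg]: together the
    fifth power in [yw]. This is why the exponent of [reg] is 4. *)
Lemma fd_yw (d : R) (k : nat) (w : C) : fd d k w = ((yw w * hd d w ^ 4) ^ k)%C.
Proof. unfold fd, bw, yw, reg. f_equal. ring. Qed.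

(** [L] is independent of the radius and the angle but grows with 1/d; this is harmless because r ->
    1 is taken before d -> 0. *)
Lemma fd_lip (d : R) (k : nat) : 0 < d -> exists L, 0 <= L /\ forall r t, 0 <= r < 1 -> (1 - cis t)%C <> 0 ->
  Cmod (fd d k (RtoC r * cis t) - fd d k (cis t)) <= L * (1 - r).
Proof.
  intros Hd. pose proof Q32_pos as HQ.
  set (Y := 108 * (1 + Q32)). set (LY := 4320 * (1 + Q32) + 250 * (1 + 3 * Q32)).
  assert (HY : 0 <= Y) by (unfold Y; lra). assert (HLY : 0 <= LY) by (unfold LY; lra).
  assert (Hi : 0 < / d) by (apply Rinv_0_lt_compat; auto).
  set (B := Y * (/ d) ^ 4). assert (HB : 0 <= B) by (unfold B; apply Rmult_le_pos; auto; apply pow_le; lra).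
  set (LP := LY * (/ d) ^ 4 + Y * (INR 4 * (/ d + 1) ^ 4 * (/ d * / d))).
  assert (HLP : 0 <= LP).
  { unfold LP. apply Rplus_le_le_0_compat. apply Rmult_le_pos; auto. apply pow_le; lra.
    apply Rmult_le_pos; auto. apply Rmult_le_pos. apply Rmult_le_pos. apply pos_INR. apply pow_le; lra. nra. }
  exists (INR k * (B + 1) ^ k * LP). split.
  { apply Rmult_le_pos; auto. apply Rmult_le_pos. apply pos_INR. apply pow_le; lra. }
  intros r t Hr H'. rewrite !fd_yw.
  assert (Hw' : Cmod (cis t) <= 1) by (rewrite Cmod_cis; lra).
  assert (Hw : Cmod (RtoC r * cis t) = r) by (rewrite Cmod_mult, Cmod_R, Cmod_cis, Rabs_pos_eq; lra).
  assert (H : (1 - RtoC r * cis t)%C <> 0) by (apply one_minus_neq0; lra).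
  assert (Ed : Cmod (RtoC r * cis t - cis t) = 1 - r).
  { replace (RtoC r * cis t - cis t)%C with (RtoC (- (1 - r)) * cis t)%C by (rewrite RtoC_opp, RtoC_minus;
      ring).
    rewrite Cmod_mult, Cmod_R, Cmod_cis, Rabs_Ropp, Rabs_pos_eq; lra. }
  assert (Bd : forall w, (1 - w)%C <> 0 -> Cmod w <= 1 -> Cmod (yw w * hd d w ^ 4) <= B).
  { intros w N1 N2. rewrite Cmod_mult, Cmod_pow. unfold B. apply Rmult_le_compat. apply Cmod_ge_0.
    apply pow_le, Cmod_ge_0.
    now apply yw_bound. apply pow_incr. split. apply Cmod_ge_0. now apply hd_bound. }
  eapply Rle_trans. apply (Cmod_pow_diff _ _ B). apply Bd; auto; lra. apply Bd; auto.
  rewrite (Rmult_assoc _ LP). apply Rmult_le_compat_l.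
  { apply Rmult_le_pos. apply pos_INR. apply pow_le; lra. }
  eapply Rle_trans. apply Cmod_mult_diff. unfold LP. rewrite Rmult_plus_distr_r. apply Rplus_le_compat.
  - replace (LY * (/ d) ^ 4 * (1 - r)) with (LY * (1 - r) * (/ d) ^ 4) by ring.
    apply Rmult_le_compat; try apply Cmod_ge_0. now apply yw_lip. rewrite Cmod_pow. apply pow_incr. split.
    apply Cmod_ge_0. apply hd_bound; auto; lra.
  - rewrite Rmult_assoc. apply Rmult_le_compat; try apply Cmod_ge_0. now apply yw_bound.
    eapply Rle_trans. apply (Cmod_pow_diff _ _ (/ d)); apply hd_bound; auto; lra.
    rewrite (Rmult_assoc _ (/ d * / d) (1 - r)). apply Rmult_le_compat_l. apply Rmult_le_pos. apply pos_INR.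
    apply pow_le; lra.
    rewrite <- Ed. apply hd_lip; auto; lra.
Qed.

Lemma Cmod_sub1_half (z : C) : Re z = 1 / 2 -> Cmod (z - 1) = Cmod z.
Proof. destruct z as [a b]. simpl. intros ->. unfold Cmod. simpl. f_equal. field. Qed.

(** The unit circle without 1 corresponds to the critical line, with |s| = 1/(2 sin(t/2)). There |s
    - 1| = |s|, so |bw w| = |Zf s| / |s| is exactly |zeta s|. *)
Lemma bw_boundary (k : nat) : (1 <= k)%nat -> Lindelof -> exists C2, 0 <= C2 /\
  forall t, 0 < sin (t / 2) -> (Cmod (bw (cis t)) ^ k) * (Cmod (bw (cis t)) ^ k) <= C2 * sqrt (/ sin (t / 2)).
Proof.
  intros Hk HL. assert (Hkp : 0 < INR k) by (apply lt_0_INR; lia).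
  (* The power 2k turns this exponent into 1/2, which is summable over the nodes by
     [sum_sqrt_inv_sin]. *)
  set (e := / (4 * INR k)). assert (He : 0 < e) by (apply Rinv_0_lt_compat; lra).
  destruct (HL e He) as [M [T0 HM]]. pose proof Q32_pos as HQ.
  set (T1 := Rmax T0 1). set (C0 := Rabs M + (1 + Q32) * (2 + T1) ^ 3 * 2).
  assert (HT1 : 1 <= T1) by apply Rmax_r.
  assert (HC0 : 0 <= C0).
  { unfold C0. apply Rplus_le_le_0_compat. apply Rabs_pos. apply Rmult_le_pos; [|lra]. apply Rmult_le_pos.
    lra. apply pow_le; lra. }
  exists (C0 ^ k * C0 ^ k). split. { apply Rmult_le_pos; apply pow_le; auto. }
  intros t Ht. set (w := cis t). set (S1 := / sin (t / 2)).
  assert (HmW : Cmod (1 - w) = 2 * sin (t / 2)) by (apply Cmod_one_cis; lra).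
  assert (H1 : (1 - w)%C <> 0). { apply Cmod_gt_0. lra. }
  assert (Hw1 : Cmod w = 1) by apply Cmod_cis.
  set (s := sw w).
  assert (HsR : Re s = 1 / 2). { pose proof (Re_sw_half w H1) as E. rewrite (normsq_Cmod w), Hw1 in E.
  fold s in E. replace (1 - 1 * 1) with 0 in E by ring. unfold Rdiv at 2 in E. rewrite Rmult_0_l in E. lra. }
  assert (HsM : Cmod s = / (2 * sin (t / 2))) by (unfold s; rewrite Cmod_sw, HmW; auto).
  assert (HS1 : S1 = 2 * Cmod s) by (rewrite HsM; unfold S1; field; lra).
  assert (Es : s = ((1 / 2)%R, Im s)) by (rewrite <- HsR; now destruct s).
  assert (Hsh : 1 / 2 <= Cmod s). { pose proof (re_le_Cmod s) as R1. rewrite HsR, Rabs_pos_eq in R1; lra. }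
  assert (Hs0 : s <> 0). { intros E. rewrite E, Cmod_0 in Hsh. lra. }
  assert (Hrp : 1 <= Rpower S1 e). { rewrite <- (Rpower_O S1) by lra. apply Rle_Rpower; lra. }
  assert (Eb : Cmod (bw w) = Cmod (Zf s) / Cmod s).
  { unfold bw. fold s. rewrite Cmod_mult. replace (1 - w)%C with (/ s)%C by (unfold s, sw; field; auto).
    rewrite Cmod_inv by auto. field. lra. }
  assert (Es1 : Cmod (s - 1) = Cmod s).
  { now apply Cmod_sub1_half. }
  assert (B : Cmod (bw w) <= C0 * Rpower S1 e).
  (* The hypothesis speaks only of large |Im s|; on the remaining bounded arc [Zf_bound] and |s| >=
     1/2 suffice. *)
  { destruct (Rle_dec T1 (Rabs (Im s))) as [h|h].
    - assert (E : Cmod (bw w) = Cmod (zeta ((1 / 2)%R, Im s))).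
      { rewrite zeta_half, <- Es, Eb, Cmod_div, Es1; auto. intros E. rewrite E, Cmod_0 in Es1. lra. }
      rewrite E. eapply Rle_trans. apply HM. pose proof (Rmax_l T0 1). unfold T1 in h. lra.
      assert (Hi : Rabs (Im s) <= S1) by (pose proof (im_le_Cmod s); lra).
      assert (Rpower (Rabs (Im s)) e <= Rpower S1 e).
      { unfold Rpower. apply exp_mono. apply Rmult_le_compat_l. lra. apply ln_mono; lra. }
      assert (M <= C0). { unfold C0. pose proof (Rle_abs M).
      assert (0 <= (1 + Q32) * (2 + T1) ^ 3 * 2); [|lra]. apply Rmult_le_pos; [|lra]. apply Rmult_le_pos. lra.
      apply pow_le; lra. }
      assert (0 < Rpower (Rabs (Im s)) e) by apply exp_pos.
      apply Rle_trans with (C0 * Rpower (Rabs (Im s)) e). apply Rmult_le_compat_r; lra.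
      apply Rmult_le_compat_l; lra.
    - assert (Hsb : Cmod s <= 1 / 2 + T1). { eapply Rle_trans. apply Cmod_le_sum.
      rewrite HsR, Rabs_pos_eq; lra. }
      assert (Cmod (bw w) <= C0).
      { rewrite Eb. apply Rle_trans with ((1 + Q32) * (2 + T1) ^ 3 * 2).
        - apply Rmult_le_compat. apply Cmod_ge_0. left; apply Rinv_0_lt_compat; lra.
          eapply Rle_trans. apply Zf_bound. lra. apply Rmult_le_compat_l. lra. apply pow_incr. lra.
          replace 2 with (/ (1 / 2)) by field. apply Rinv_le_contravar; lra.
        - unfold C0. pose proof (Rabs_pos M). lra. }
      nra. }
  pose proof (Cmod_ge_0 (bw w)).
  assert (Bk : Cmod (bw w) ^ k <= C0 ^ k * Rpower S1 e ^ k). { rewrite <- Rpow_mult_distr. apply pow_incr.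
  lra. }
  assert (Hpk : 0 <= Cmod (bw w) ^ k) by (apply pow_le; auto).
  apply Rle_trans with ((C0 ^ k * Rpower S1 e ^ k) * (C0 ^ k * Rpower S1 e ^ k)).
  { apply Rmult_le_compat; auto. }
  right. replace ((C0 ^ k * Rpower S1 e ^ k) * (C0 ^ k * Rpower S1 e ^ k)) with (C0 ^ k * C0 ^ k * (Rpower S1
    e ^ k * Rpower S1 e ^ k)) by ring.
  f_equal. rewrite <- (Rpower_pow k (Rpower S1 e)) by apply exp_pos. rewrite Rpower_mult, <- Rpower_plus.
  rewrite <- Rpower_sqrt by lra. f_equal. unfold e. field. lra.
Qed.

Lemma PS_mult_lim (a b : nat -> nat -> R) (a' b' : nat -> R) :
  (forall n, is_lim_seq (fun i => a i n) (a' n)) -> (forall n, is_lim_seq (fun i => b i n) (b' n)) ->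
  forall n, is_lim_seq (fun i => PS_mult (a i) (b i) n) (PS_mult a' b' n).
Proof.
  intros Ha Hb n. rewrite PS_mult_fsum.
  apply (is_lim_seq_ext (fun i => fsum (fun k => a i k * b i (n - k)%nat) (S n))). { intros i.
  now rewrite PS_mult_fsum. }
  generalize (S n) as m. induction m; simpl. apply is_lim_seq_const.
  apply is_lim_seq_plus'; auto. apply is_lim_seq_mult'; auto.
Qed.

Lemma PS_pow_lim (a : nat -> nat -> R) (a' : nat -> R) (k : nat) :
  (forall n, is_lim_seq (fun i => a i n) (a' n)) -> forall n,
    is_lim_seq (fun i => PS_pow (a i) k n) (PS_pow a' k n).
Proof. intros Ha. induction k; simpl. intros; apply is_lim_seq_const. apply PS_mult_lim; auto. Qed.

Lemma PS_mult_delta0 (a : nat -> R) (n : nat) : PS_mult delta0 a n = a n.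
Proof.
  rewrite PS_mult_fsum, fsum_head, (fsum_ext (fun i => delta0 (S i) * a (n - S i)%nat) (fun _ => 0)),
    fsum_const by (intros; simpl; ring).
  simpl. rewrite Nat.sub_0_r. ring.
Qed.

Lemma PS_mult_delta0_r (a : nat -> R) (n : nat) : PS_mult a delta0 n = a n.
Proof.
  rewrite PS_mult_fsum, (fsum_delta _ n). rewrite Nat.sub_diag. simpl; ring. lia.
  intros j Hj Hne. replace (n - j)%nat with (S (n - S j)) by lia. simpl. ring.
Qed.

Lemma PS_mult_ext (a b a' b' : nat -> R) (n : nat) : (forall n, a n = a' n) -> (forall n, b n = b' n) ->
  PS_mult a b n = PS_mult a' b' n.
Proof. intros H H'. rewrite !PS_mult_fsum. apply fsum_ext. intros; now rewrite H, H'. Qed.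

Lemma PS_pow_delta0 (k n : nat) : PS_pow delta0 k n = delta0 n.
Proof. revert n. induction k; intros n; simpl. now destruct n. now rewrite PS_mult_delta0. Qed.

Lemma PS_pow_ext (a b : nat -> R) (k : nat) : (forall n, a n = b n) -> forall n, PS_pow a k n = PS_pow b k n.
Proof. intros H. induction k; intros n; simpl; auto. apply PS_mult_ext; auto. Qed.

Lemma inv_INR_S_lim : is_lim_seq (fun i => / INR (S i)) 0.
Proof.
  apply (is_lim_seq_incr_1 (fun i => / INR i)). replace (Finite 0) with (Rbar_inv p_infty) by reflexivity.
  apply is_lim_seq_inv; [apply is_lim_seq_INR|discriminate].
Qed.

Lemma Rinv_le_1 (x : R) : 1 <= x -> / x <= 1.
Proof. intros H. rewrite <- Rinv_1. apply Rinv_le_contravar; lra. Qed.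

(** As d -> 0 the coefficients of [reg d] tend to those of the constant 1, and each coefficient of a
    product or power is a polynomial in finitely many coefficients. *)
Lemma bdc_lim (k n : nat) : is_lim_seq (fun i => bdc (/ INR (S i)) k n) (PS_pow bc k n).
Proof.
  rewrite <- (PS_pow_ext (PS_mult bc (PS_pow delta0 4)) bc k).
  2: { intros m. rewrite <- (PS_mult_delta0_r bc m). apply PS_mult_ext; auto. intros; apply PS_pow_delta0. }
  unfold bdc. apply (PS_pow_lim (fun i => PS_mult bc (PS_pow (regc (/ INR (S i))) 4))).
  apply (PS_mult_lim (fun _ => bc)). intros; apply is_lim_seq_const.
  apply PS_pow_lim. intros m. unfold regc.
  replace (Finite (delta0 m)) with (Finite (delta0 m + 0)) by (f_equal; ring).
  apply is_lim_seq_plus'. apply is_lim_seq_const.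
  apply (is_lim_seq_abs_0).
  apply (is_lim_seq_le_le (fun _ => 0) _ (fun i => / INR (S i))).
  - intros i. pose proof (INR_S_ge1 i). assert (0 < / INR (S i)) by (apply Rinv_0_lt_compat; lra).
    assert (Hq : 0 < / (1 + / INR (S i)) <= 1). { split. apply Rinv_0_lt_compat; lra. apply Rinv_le_1. lra. }
    split. apply Rabs_pos. rewrite Rabs_mult, Rabs_mult, Rabs_Ropp, !Rabs_pos_eq; try lra; [|apply pow_le;
      lra].
    assert (Hp : 0 <= (/ (1 + / INR (S i))) ^ m <= 1). { split. apply pow_le; lra.
    apply Rle_trans with (1 ^ m). apply pow_incr; lra. rewrite pow1; lra. }
    assert (/ (1 + / INR (S i)) * (/ (1 + / INR (S i))) ^ m <= 1) by nra. nra.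
  - apply is_lim_seq_const.
  - apply inv_INR_S_lim.
Qed.

Lemma fsum_lim (f : nat -> nat -> R) (g : nat -> R) (N : nat) :
  (forall n, is_lim_seq (fun M => f M n) (g n)) -> is_lim_seq (fun M => fsum (f M) N) (fsum g N).
Proof. intros H. induction N; simpl. apply is_lim_seq_const. apply is_lim_seq_plus'; auto. Qed.

(** The order of the limits matters. At fixed d, the values at radius r differ from those on the
    circle by at most L (1 - r), which disappears as r -> 1. The remaining bound is free of d since
    |reg| <= 1, so d -> 0 can follow in each finite sum. The constant 32 is 8 from the node average,
    doubled by splitting the square and doubled again in [parseval_bound]. *)
Lemma Lindelof_square_summable (k : nat) : (1 <= k)%nat -> Lindelof -> ex_series (fun n => cc k n * cc k n).
Proof.
  intros Hk HL. destruct (bw_boundary k Hk HL) as [C2 [HC2 HB]].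
  assert (Main : forall d, 0 < d -> forall N, fsum (fun n => bdc d k n * bdc d k n) N <= 32 * C2).
  { intros d Hd N. destruct (fd_lip d k Hd) as [L [HL0 HLip]].
    assert (Hr : forall r, 0 <= r < 1 -> fsum (fun n => (bdc d k n * r ^ n) * (bdc d k n * r ^ n)) N <=
      2 * (16 * C2 + 2 * (L * (1 - r)) ^ 2)).
    { intros r Hr. assert (Hm : forall t, Cmod (RtoC r * cis t) = r) by (intros t; rewrite Cmod_mult, Cmod_R,
        Cmod_cis, Rabs_pos_eq; lra).
      apply (parseval_bound (bdc d k) r _ (fd d k)). lra.
      - rewrite <- (Hm 0). apply bdc_conv; auto. rewrite Hm; lra.
      - intros t. apply bdc_conv; auto. rewrite Hm; lra.
      - intros M HM. apply Rle_trans with (fsum (fun j => (2 * C2) * sqrt (/ sin (node M j / 2)) + 2 * (L * (1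
          - r)) ^ 2) M).
        + apply fsum_le. intros j Hj. set (t := node M j). pose proof (sin_node_pos M j Hj) as Hs.
          fold t in Hs.
          assert (H1 : (1 - cis t)%C <> 0). { apply Cmod_gt_0. rewrite Cmod_one_cis; lra. }
          pose proof (HLip r t Hr H1) as H2. pose proof (HB t Hs) as H3.
          assert (H4 : Cmod (fd d k (cis t)) <= Cmod (bw (cis t)) ^ k).
          { unfold fd. rewrite Cmod_pow, Cmod_mult. apply pow_incr. split.
            apply Rmult_le_pos; apply Cmod_ge_0.
            rewrite <- (Rmult_1_r (Cmod (bw (cis t)))) at 2. apply Rmult_le_compat_l. apply Cmod_ge_0.
            rewrite Cmod_pow, <- (pow1 4). apply pow_incr. split. apply Cmod_ge_0. apply reg_le_1; auto.
            rewrite Cmod_cis; lra. }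
          rewrite normsq_Cmod. set (A := Cmod (fd d k (RtoC r * cis t))).
          assert (H5 : A <= Cmod (bw (cis t)) ^ k + L * (1 - r)).
          { unfold A. replace (fd d k (RtoC r * cis t)) with (fd d k (cis t) + (fd d k (RtoC r * cis t) - fd d
              k (cis t)))%C by ring.
            eapply Rle_trans. apply Cmod_triangle. lra. }
          assert (0 <= A) by apply Cmod_ge_0. set (X := Cmod (bw (cis t)) ^ k) in *.
          set (Y := L * (1 - r)) in *.
          pose proof (Rle_0_sqr (X - Y)) as Hsq. unfold Rsqr in Hsq. simpl.
nra.
        + rewrite fsum_plus, fsum_scal, fsum_const. pose proof (sum_sqrt_inv_sin M).
          assert (2 * C2 * fsum (fun j => sqrt (/ sin (node M j / 2))) M <=
            2 * C2 * (INR M * 8)) by (apply Rmult_le_compat_l; lra).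
          lra. }
    set (ri := fun i => 1 - / INR (S i)).
    assert (Hri : forall i, 0 <= ri i < 1).
    { intros i. unfold ri. pose proof (INR_S_ge1 i).
      assert (0 < / INR (S i)) by (apply Rinv_0_lt_compat; lra).
      assert (/ INR (S i) <= 1) by (rewrite <- Rinv_1; apply Rinv_le_contravar; lra). lra. }
    assert (Lri : is_lim_seq ri 1). { unfold ri. replace (Finite 1) with (Finite (1 - 0)) by (f_equal; ring).
    apply is_lim_seq_minus'. apply is_lim_seq_const. apply inv_INR_S_lim. }
    assert (Lp : forall n, is_lim_seq (fun i => ri i ^ n) 1).
    { induction n; simpl. apply is_lim_seq_const. replace (Finite 1) with (Finite (1 * 1)) by (f_equal; ring).
      apply is_lim_seq_mult'; auto. }
    assert (LL : is_lim_seq (fun i => fsum (fun n => (bdc d k n * ri i ^ n) * (bdc d k n * ri i ^ n)) N) (fsum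
      (fun n => bdc d k n * bdc d k n) N)).
    { apply (fsum_lim (fun i n => (bdc d k n * ri i ^ n) * (bdc d k n * ri i ^ n)) (fun n => bdc d k n * bdc d
        k n)).
      intros n. assert (H1 : is_lim_seq (fun i => bdc d k n * ri i ^ n) (bdc d k n)).
      { replace (Finite (bdc d k n)) with (Finite (bdc d k n * 1)) by (f_equal; ring).
        apply is_lim_seq_mult'; auto. apply is_lim_seq_const. }
      now apply is_lim_seq_mult'. }
    assert (LR : is_lim_seq (fun i => 2 * (16 * C2 + 2 * (L * (1 - ri i)) ^ 2)) (2 * (16 * C2 + 2 * (L * (1 -
      1)) ^ 2))).
    { apply is_lim_seq_mult'. apply is_lim_seq_const. apply is_lim_seq_plus'. apply is_lim_seq_const.
      apply is_lim_seq_mult'. apply is_lim_seq_const. simpl.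
      assert (H1 : is_lim_seq (fun i => L * (1 - ri i)) (L * (1 - 1))).
      { apply is_lim_seq_mult'. apply is_lim_seq_const. apply is_lim_seq_minus'; auto. apply is_lim_seq_const.
        }
      apply is_lim_seq_mult'; auto. apply is_lim_seq_mult'; auto. apply is_lim_seq_const. }
    replace (32 * C2) with (2 * (16 * C2 + 2 * (L * (1 - 1)) ^ 2)) by ring.
    exact (is_lim_seq_le _ _ _ _ (fun i => Hr (ri i) (Hri i)) LL LR). }
  assert (Fin : forall N, fsum (fun n => PS_pow bc k n * PS_pow bc k n) N <= 32 * C2).
  { intros N.
    assert (LL : is_lim_seq (fun i => fsum (fun n => bdc (/ INR (S i)) k n * bdc (/ INR (S i)) k n) N) (fsum
      (fun n => PS_pow bc k n * PS_pow bc k n) N)).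
    { apply (fsum_lim (fun i n => bdc (/ INR (S i)) k n * bdc (/ INR (S i)) k n)). intros n.
      apply is_lim_seq_mult'; apply bdc_lim. }
    refine (is_lim_seq_le _ (fun _ => 32 * C2) _ (32 * C2) _ LL (is_lim_seq_const _)).
    intros i. apply Main. apply Rinv_0_lt_compat. pose proof (INR_S_ge1 i). lra. }
  apply (ex_series_pos_bounded _ (32 * C2)). intros; apply Rle_0_sqr.
  intros N. rewrite sum_n_fsum. eapply Rle_trans. 2: apply (Fin (k + S N)%nat).
  rewrite fsum_app. assert (0 <= fsum (fun n => PS_pow bc k n * PS_pow bc k n) k) by (apply fsum_pos; intros;
    apply Rle_0_sqr).
  rewrite (fsum_ext (fun n => cc k n * cc k n) (fun i => PS_pow bc k (k + i) * PS_pow bc k (k + i))). lra.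
  intros i _. unfold cc. rewrite ell_coef. now rewrite Nat.add_comm.
Qed.

(** * Functions of the form P(ln x) + O(x^{-d}) *)

Definition small (g : R -> R) : Prop :=
  exists C d, 0 <= C /\ 0 < d /\ forall x, 1 <= x -> Rabs (g x) <= C * exp (- d * ln x).

Fixpoint peval (l : list R) (u : R) : R :=
  match l with nil => 0 | a :: l' => a + u * peval l' u end.

(** The polynomial is existentially quantified: in this form the class is an algebra, stable under x
    -> sqrt x and under integration against dr/r, which are the operations of the hyperbola
    method. *)
Definition asym (h : R -> R) : Prop := exists l, small (fun x => h x - peval l (ln x)).

Lemma small_dom (g h : R -> R) : (forall x, 1 <= x -> Rabs (g x) <= Rabs (h x)) -> small h -> small g.
Proof.
  intros H [C [d [HC [Hd Hh]]]]. exists C, d. repeat split; auto. intros x Hx. eapply Rle_trans; auto.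
Qed.

Lemma small_ext (g h : R -> R) : (forall x, 1 <= x -> g x = h x) -> small h -> small g.
Proof. intros H. apply small_dom. intros x Hx. rewrite H; auto. lra. Qed.

Lemma exp_weaken (d d' x : R) : d' <= d -> 1 <= x -> exp (- d * ln x) <= exp (- d' * ln x).
Proof. intros H Hx. apply exp_mono. pose proof (ln_ge_0 x Hx). nra. Qed.

Lemma small_plus (g h : R -> R) : small g -> small h -> small (fun x => g x + h x).
Proof.
  intros [C [d [HC [Hd Hg]]]] [C' [d' [HC' [Hd' Hh]]]]. exists (C + C'), (Rmin d d').
  split. lra. split. now apply Rmin_pos. intros x Hx. eapply Rle_trans. apply Rabs_triang.
  rewrite Rmult_plus_distr_r. apply Rplus_le_compat; (eapply Rle_trans; [eauto|]); apply Rmult_le_compat_l;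
    auto; apply exp_weaken; auto.
  apply Rmin_l. apply Rmin_r.
Qed.

Lemma small_scal (c : R) (g : R -> R) : small g -> small (fun x => c * g x).
Proof.
  intros [C [d [HC [Hd Hg]]]]. exists (Rabs c * C), d. split. apply Rmult_le_pos; auto. apply Rabs_pos.
  split; auto.
  intros x Hx. rewrite Rabs_mult, Rmult_assoc. apply Rmult_le_compat_l. apply Rabs_pos. auto.
Qed.

Lemma small_mult (g h : R -> R) : small g -> small h -> small (fun x => g x * h x).
Proof.
  intros [C [d [HC [Hd Hg]]]] [C' [d' [HC' [Hd' Hh]]]]. exists (C * C'), (d + d').
  split. now apply Rmult_le_pos. split. lra. intros x Hx. rewrite Rabs_mult.
  replace (C * C' * exp (- (d + d') * ln x)) with ((C * exp (- d * ln x)) * (C' * exp (- d' * ln x))).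
  - apply Rmult_le_compat; auto; apply Rabs_pos.
  - replace (- (d + d') * ln x) with (- d * ln x + - d' * ln x) by ring. rewrite exp_plus. ring.
Qed.

Lemma le_exp_scaled (d u : R) : 0 < d -> 0 <= u -> u <= / d * exp (d * u).
Proof.
  intros Hd Hu. apply Rmult_le_reg_l with d; auto. rewrite <- Rmult_assoc, Rinv_r, Rmult_1_l by lra.
  pose proof (exp_ineq1_le (d * u)). lra.
Qed.

Lemma peval_exp_bound (l : list R) (d : R) : 0 < d -> exists C, 0 <= C /\ forall u, 0 <= u ->
  Rabs (peval l u) <= C * exp (d * u).
Proof.
  revert d. induction l as [|a l IH]; intros d Hd.
  - exists 0. split. lra. intros u Hu. simpl. rewrite Rabs_R0. lra.
  - destruct (IH (d / 2) ltac:(lra)) as [C [HC H]]. exists (Rabs a + / (d / 2) * C).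
    assert (Hi : 0 < / (d / 2)) by (apply Rinv_0_lt_compat; lra).
    split. { pose proof (Rabs_pos a). nra. }
    intros u Hu. simpl. eapply Rle_trans. apply Rabs_triang. rewrite Rmult_plus_distr_r.
    apply Rplus_le_compat.
    + rewrite <- (Rmult_1_r (Rabs a)) at 1. apply Rmult_le_compat_l. apply Rabs_pos. rewrite <- exp_0.
      apply exp_mono. nra.
    + rewrite Rabs_mult, (Rabs_pos_eq u) by auto. specialize (H u Hu).
      pose proof (le_exp_scaled (d / 2) u ltac:(lra) Hu) as HE.
      apply Rle_trans with ((/ (d / 2) * exp (d / 2 * u)) * (C * exp (d / 2 * u))).
      * apply Rmult_le_compat; auto. apply Rabs_pos.
      * right. replace (d * u) with (d / 2 * u + d / 2 * u) by field. rewrite exp_plus. ring.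
Qed.

(** Half of the exponent d is given up to absorb the polynomial in log x. *)
Lemma small_mult_poly (l : list R) (g : R -> R) : small g -> small (fun x => peval l (ln x) * g x).
Proof.
  intros [C [d [HC [Hd Hg]]]]. destruct (peval_exp_bound l (d / 2) ltac:(lra)) as [C' [HC' Hl]].
  exists (C' * C), (d / 2). split. now apply Rmult_le_pos. split. lra. intros x Hx. rewrite Rabs_mult.
  apply Rle_trans with ((C' * exp (d / 2 * ln x)) * (C * exp (- d * ln x))).
  - apply Rmult_le_compat; try apply Rabs_pos; auto. apply Hl. now apply ln_ge_0.
  - right. replace (- (d / 2) * ln x) with (d / 2 * ln x + - d * ln x) by field. rewrite exp_plus. ring.
Qed.

Fixpoint padd (l m : list R) : list R :=
  match l, m with
  | nil, _ => m
  | _, nil => l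
  | a :: l', b :: m' => (a + b) :: padd l' m'
  end.

Lemma peval_padd (l m : list R) (u : R) : peval (padd l m) u = peval l u + peval m u.
Proof. revert m. induction l as [|a l IH]; intros [|b m]; simpl; try ring. rewrite IH. ring. Qed.

Definition pscal (c : R) (l : list R) : list R := map (Rmult c) l.

Lemma peval_pscal (c : R) (l : list R) (u : R) : peval (pscal c l) u = c * peval l u.
Proof. induction l; simpl. ring. rewrite IHl. ring. Qed.

Fixpoint pmul (l m : list R) : list R :=
  match l with nil => nil | a :: l' => padd (pscal a m) (0 :: pmul l' m) end.

Lemma peval_pmul (l m : list R) (u : R) : peval (pmul l m) u = peval l u * peval m u.
Proof. induction l; simpl. ring. rewrite peval_padd, peval_pscal. simpl. rewrite IHl. ring. Qed.

Lemma asym_ext (g h : R -> R) : (forall x, 1 <= x -> g x = h x) -> asym h -> asym g.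
Proof. intros H [l Hl]. exists l. eapply small_ext. 2: exact Hl. intros x Hx. cbv beta. now rewrite H. Qed.

Lemma asym_plus (g h : R -> R) : asym g -> asym h -> asym (fun x => g x + h x).
Proof.
  intros [l Hl] [m Hm]. exists (padd l m). eapply small_ext. 2: exact (small_plus _ _ Hl Hm).
  intros x Hx. cbv beta. rewrite peval_padd. ring.
Qed.

Lemma asym_small (g : R -> R) : small g -> asym g.
Proof. intros H. exists nil. eapply small_ext. 2: exact H. intros x Hx. simpl. ring. Qed.

Lemma asym_scal (c : R) (g : R -> R) : asym g -> asym (fun x => c * g x).
Proof.
  intros [l Hl]. exists (pscal c l). eapply small_ext. 2: exact (small_scal c _ Hl).
  intros x Hx. cbv beta. rewrite peval_pscal. ring.
Qed.

Lemma asym_mult (g h : R -> R) : asym g -> asym h -> asym (fun x => g x * h x).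
Proof.
  intros [l Hl] [m Hm]. exists (pmul l m).
  eapply small_ext. 2: exact (small_plus _ _ (small_plus _ _ (small_mult_poly l _ Hm) (small_mult_poly m _
    Hl)) (small_mult _ _ Hl Hm)).
  intros x Hx. cbv beta. rewrite peval_pmul. ring.
Qed.

Lemma asym_poly (l : list R) : asym (fun x => peval l (ln x)).
Proof. exists l. exists 0, 1. repeat split; try lra. intros x Hx. rewrite Rminus_diag, Rabs_R0. lra. Qed.

Lemma asym_const (c : R) : asym (fun _ => c).
Proof. eapply asym_ext. 2: exact (asym_poly (c :: nil)). intros; simpl; ring. Qed.

Lemma asym_ln : asym ln.
Proof. eapply asym_ext. 2: exact (asym_poly (0 :: 1 :: nil)). intros; simpl; ring. Qed.

Lemma asym_ln_pow (i : nat) : asym (fun x => ln x ^ i).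
Proof. induction i; simpl. apply asym_const. apply asym_mult; auto. apply asym_ln. Qed.

Lemma small_mult_asym (g h : R -> R) : small g -> asym h -> small (fun x => g x * h x).
Proof.
  intros Hg [l Hl]. eapply small_ext. 2: exact (small_plus _ _ (small_mult_poly l _ Hg) (small_mult _ _ Hg
    Hl)).
  intros x Hx. cbv beta. ring.
Qed.

Lemma sqrt_ge_1 (x : R) : 1 <= x -> 1 <= sqrt x.
Proof. intros H. rewrite <- sqrt_1. now apply sqrt_le_1_alt. Qed.

Lemma ln_sqrt (x : R) : 1 <= x -> ln (sqrt x) = ln x / 2.
Proof.
  intros H. pose proof (sqrt_ge_1 x H). rewrite <- (sqrt_sqrt x) at 2 by lra. rewrite ln_mult by lra. field.
Qed.

Lemma small_sqrt (g : R -> R) : small g -> small (fun x => g (sqrt x)).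
Proof.
  intros [C [d [HC [Hd Hg]]]]. exists C, (d / 2). repeat split; auto. lra.
  intros x Hx. pose proof (sqrt_ge_1 x Hx). specialize (Hg (sqrt x) H). rewrite ln_sqrt in Hg by auto.
  replace (- (d / 2) * ln x) with (- d * (ln x / 2)) by field. auto.
Qed.

Lemma peval_half (l : list R) : exists l', forall u, peval l (u / 2) = peval l' u.
Proof.
  induction l as [|a l [l' IH]]. exists nil; auto.
  exists (a :: pscal (/ 2) l'). intros u. simpl. rewrite peval_pscal, IH. field.
Qed.

Lemma asym_sqrt (h : R -> R) : asym h -> asym (fun x => h (sqrt x)).
Proof.
  intros [l Hl]. destruct (peval_half l) as [l' Hl']. exists l'. eapply small_ext. 2: exact (small_sqrt _ Hl).
  intros x Hx. cbv beta. now rewrite ln_sqrt, Hl'.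
Qed.

Lemma small_inv : small (fun x => / x).
Proof.
  exists 1, 1. repeat split; try lra. intros x Hx. rewrite Rabs_pos_eq by (left; apply Rinv_0_lt_compat; lra).
  replace (- (1) * ln x) with (- ln x) by ring. rewrite exp_Ropp, exp_ln; lra.
Qed.

Lemma is_derive_ln_pow (i : nat) (x : R) : 0 < x -> is_derive (fun r => ln r ^ S i / INR (S i)) x (ln x ^ i /
  x).
Proof.
  intros Hx. auto_derive. lra.
  change (match i with 0%nat => 1 | S _ => INR i + 1 end) with (INR (S i)). change (Nat.pred (S i)) with i.
  field.
  split. lra. apply not_0_INR. lia.
Qed.

Lemma continuous_ln_pow_div (i : nat) (x : R) : 0 < x -> continuous (fun r => ln r ^ i / r) x.
Proof. intros Hx. apply (ex_derive_continuous (fun r => ln r ^ i / r)). auto_derive. split; lra. Qed.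

Lemma is_RInt_ln_pow (i : nat) (x : R) : 1 <= x -> is_RInt (fun r => ln r ^ i / r) 1 x (ln x ^ S i / INR (S
  i)).
Proof.
  intros Hx. replace (ln x ^ S i / INR (S i)) with (minus (ln x ^ S i / INR (S i)) (ln 1 ^ S i / INR (S i))).
  - apply (is_RInt_derive (fun r => ln r ^ S i / INR (S i)) (fun r => ln r ^ i / r)).
    + intros r Hr. rewrite Rmin_left in Hr by lra. apply is_derive_ln_pow. lra.
    + intros r Hr. rewrite Rmin_left in Hr by lra. apply continuous_ln_pow_div. lra.
  - rewrite ln_1. unfold minus, plus, opp; simpl. unfold Rdiv. ring.
Qed.

Fixpoint pmono (c : R) (i : nat) : list R := match i with O => c :: nil | S i' => 0 :: pmono c i' end.
Lemma peval_pmono (c : R) (i : nat) (u : R) : peval (pmono c i) u = c * u ^ i.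
Proof. induction i; simpl. ring. rewrite IHi. ring. Qed.

Lemma is_RInt_0 (a b : R) : is_RInt (fun _ => 0) a b 0.
Proof.
  pose proof (is_RInt_const (V := R_NormedModule) a b 0) as H.
  assert (E : scal (b - a) 0 = 0) by apply Rmult_0_r.
  exact (eq_ind _ (fun l => is_RInt (fun _ => 0) a b l) H _ E).
Qed.

(** The exponent [i] records the powers of log r already split off by the Horner form of [peval];
    the inductions of [asym_conv_poly] and [laplace_poly] use the same device. *)
Lemma is_RInt_poly (l : list R) (i : nat) : exists l', forall x, 1 <= x ->
  is_RInt (fun r => ln r ^ i * peval l (ln r) / r) 1 x (peval l' (ln x)).
Proof.
  revert i. induction l as [|a l IH]; intros i.
  - exists nil. intros x Hx. apply (is_RInt_ext (fun _ => 0)). intros r Hr. rewrite Rmin_left in Hr by lra.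
    simpl. Req. field. lra.
    apply is_RInt_0.
  - destruct (IH (S i)) as [l' Hl']. exists (padd (pmono (a / INR (S i)) (S i)) l'). intros x Hx.
    rewrite peval_padd, peval_pmono.
    apply (is_RInt_ext (fun r => plus (scal a (ln r ^ i / r)) (ln r ^ S i * peval l (ln r) / r))).
    + intros r Hr. rewrite Rmin_left in Hr by lra. unfold plus, scal; simpl; unfold mult; simpl. field. lra.
    + apply (is_RInt_plus (V := R_NormedModule)). 2: now apply Hl'.
      replace (a / INR (S i) * ln x ^ S i) with (scal a (ln x ^ S i / INR (S i))).
      apply (is_RInt_scal (V := R_NormedModule)). now apply is_RInt_ln_pow.
      unfold scal; simpl scal; unfold mult; simpl mult. unfold Rdiv.
      change (a * (ln x ^ S i * / INR (S i)) = a * / INR (S i) * ln x ^ S i). ring.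
Qed.

Lemma is_RInt_exp_ln (d x y : R) : 0 < d -> 1 <= x <= y ->
  is_RInt (fun r => exp (- d * ln r) / r) x y ((exp (- d * ln x) - exp (- d * ln y)) / d).
Proof.
  intros Hd H. replace ((exp (- d * ln x) - exp (- d * ln y)) / d) with (minus (- exp (- d * ln y) / d) (- exp
    (- d * ln x) / d)).
  - apply (is_RInt_derive (fun r => - exp (- d * ln r) / d) (fun r => exp (- d * ln r) / r)).
    + intros r Hr. rewrite Rmin_left in Hr by lra. auto_derive. lra. field. lra.
    + intros r Hr. rewrite Rmin_left in Hr by lra.
      apply (ex_derive_continuous (fun r => exp (- d * ln r) / r)). auto_derive. split; lra.
  - unfold minus, plus, opp; simpl. field. lra.
Qed.

Lemma RInt_abs_le (f g : R -> R) (a b l : R) : a <= b -> ex_RInt f a b -> is_RInt g a b l ->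
  (forall x, a < x < b -> Rabs (f x) <= g x) -> Rabs (RInt f a b) <= l.
Proof.
  intros Hab Hf Hg H.
  assert (H1 : RInt f a b <= l).
  { rewrite <- (is_RInt_unique _ _ _ _ Hg). apply RInt_le; auto. now exists l. intros x Hx.
    specialize (H x Hx). pose proof (Rle_abs (f x)). lra. }
  assert (H2 : - l <= RInt f a b).
  { rewrite <- (is_RInt_unique _ _ _ _ Hg).
    rewrite <- (RInt_opp (V := R_CompleteNormedModule) g) by (now exists l).
    apply RInt_le; auto. apply (ex_RInt_opp (V := R_NormedModule)). now exists l.
    intros x Hx. specialize (H x Hx). unfold opp; simpl. pose proof (Rle_abs (- f x)).
    rewrite Rabs_Ropp in H0. lra. }
  apply Rabs_le. lra.
Qed.

Lemma RInt_Chasles_R (f : R -> R) (a b c : R) : ex_RInt f a b -> ex_RInt f b c ->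
  RInt f a c = RInt f a b + RInt f b c.
Proof. intros H1 H2. symmetry. exact (RInt_Chasles f a b c H1 H2). Qed.

(** Integrating the bound for [e] shows that J(y) - J(x) is at most (C/d) x^(-d) for y >= x. So J is
    Cauchy along the integers, and letting y tend to infinity gives the rate towards the limit
    [c]. *)
Lemma small_int (e : R -> R) : (forall b, 1 <= b -> ex_RInt (fun r => e r / r) 1 b) -> small e ->
  exists c, small (fun x => RInt (fun r => e r / r) 1 x - c).
Proof.
  intros Hex [C [d [HC [Hd He]]]]. set (J := (fun x => RInt (fun r => e r / r) 1 x) : R -> R).
  assert (HJ : forall x y, 1 <= x <= y -> Rabs (J y - J x) <= C / d * exp (- d * ln x)).
  { intros x y H. unfold J.
    assert (E1 : ex_RInt (fun r => e r / r) 1 x) by (apply Hex; lra).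
    assert (E2 : ex_RInt (fun r => e r / r) x y) by (apply (ex_RInt_Chasles_2 (fun r => e r / r) 1 x y);
      [lra|apply Hex; lra]).
    rewrite (RInt_Chasles_R _ 1 x y E1 E2).
    rewrite Rplus_minus_l.
    apply Rle_trans with (C * ((exp (- d * ln x) - exp (- d * ln y)) / d)).
    - apply (RInt_abs_le _ (fun r => scal C (exp (- d * ln r) / r))); auto. lra.
      apply (is_RInt_scal (V := R_NormedModule)). apply is_RInt_exp_ln; auto.
      intros r Hr. unfold scal; simpl; unfold mult; simpl. unfold Rdiv.
      rewrite Rabs_mult, (Rabs_pos_eq (/ r)) by (left; apply Rinv_0_lt_compat; lra).
      rewrite <- Rmult_assoc. apply Rmult_le_compat_r. left; apply Rinv_0_lt_compat; lra. apply He; lra.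
    - pose proof (exp_pos (- d * ln y)). unfold Rdiv. assert (0 < / d) by (apply Rinv_0_lt_compat; auto).
      replace (C * / d * exp (- d * ln x)) with (C * (exp (- d * ln x) * / d)) by ring.
      apply Rmult_le_compat_l; auto. nra. }
  assert (HC' : 0 <= C / d) by (apply Rmult_le_pos; auto; left; apply Rinv_0_lt_compat; auto).
  assert (HL : exists c, is_lim_seq (fun n => J (INR (S n))) (Finite c)).
  { apply ex_lim_seq_cauchy_corr. intros [eps Heps]. simpl.
    assert (L0 : is_lim_seq (fun n => C / d * exp (- d * ln (INR (S n)))) 0).
    { replace (Finite 0) with (Finite (C / d * 0)) by (f_equal; ring). apply is_lim_seq_mult'.
      apply is_lim_seq_const. now apply exp_ln_INR_lim. }
    apply is_lim_seq_spec in L0. destruct (L0 (mkposreal eps Heps)) as [N HN]. simpl in HN. exists N.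
    assert (G : forall n m, (N <= n)%nat -> (n <= m)%nat -> Rabs (J (INR (S m)) - J (INR (S n))) < eps).
    { intros n m Hn Hm. eapply Rle_lt_trans. apply HJ. split. apply INR_S_ge1. apply le_INR; lia.
      specialize (HN n Hn). rewrite Rminus_0_r in HN. eapply Rle_lt_trans. 2: exact HN. apply Rle_abs. }
    intros n m Hn Hm. destruct (Nat.le_ge_cases n m).
    - rewrite Rabs_minus_sym. now apply G.
    - now apply G. }
  destruct HL as [c Hc]. exists c, (C / d), d. repeat split; auto. intros x Hx. fold (J x).
  rewrite Rabs_minus_sym.
  assert (LA : is_lim_seq (fun n => Rabs (J (INR (S n)) - J x)) (Rabs (c - J x))).
  { apply (is_lim_seq_abs _ (c - J x)). apply is_lim_seq_minus'; auto. apply is_lim_seq_const. }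
  assert (LE : eventually (fun n => Rabs (J (INR (S n)) - J x) <= C / d * exp (- d * ln x))).
  { destruct (INR_unbounded x) as [N HN]. exists N. intros n Hn. apply HJ. split; auto.
    assert (INR N <= INR n) by (now apply le_INR). rewrite S_INR. lra. }
  exact (is_lim_seq_le_loc _ (fun _ => C / d * exp (- d * ln x)) _ (C / d * exp (- d * ln x)) LE LA
    (is_lim_seq_const _)).
Qed.

Lemma asym_int (h : R -> R) : (forall b, 1 <= b -> ex_RInt (fun r => h r / r) 1 b) -> asym h ->
  asym (fun x => RInt (fun r => h r / r) 1 x).
Proof.
  intros Hex [l Hl]. destruct (is_RInt_poly l 0) as [l' Hl'].
  assert (Hp : forall x, 1 <= x -> is_RInt (fun r => peval l (ln r) / r) 1 x (peval l' (ln x))).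
  { intros x Hx. eapply is_RInt_ext. 2: exact (Hl' x Hx). intros r Hr. simpl. unfold Rdiv. Req. ring. }
  assert (He : forall b, 1 <= b -> ex_RInt (fun r => (h r - peval l (ln r)) / r) 1 b).
  { intros b Hb. apply (ex_RInt_ext (fun r => minus (h r / r) (peval l (ln r) / r))).
    intros r Hr. unfold minus, plus, opp; simpl. unfold Rdiv; ring.
    apply (ex_RInt_minus (V := R_NormedModule)); auto. eexists. now apply Hp. }
  destruct (small_int _ He Hl) as [c Hc].
  exists (padd l' (c :: nil)). eapply small_ext. 2: exact Hc. intros x Hx. cbv beta.
  rewrite peval_padd. simpl.
  assert (E : RInt (fun r => (h r - peval l (ln r)) / r) 1 x = RInt (fun r => h r / r) 1 x - peval l' (ln x)).
  { rewrite <- (is_RInt_unique _ _ _ _ (Hp x Hx)).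
    rewrite <- (RInt_minus (V := R_CompleteNormedModule) (fun r => h r / r) (fun r => peval l (ln r) / r)).
    - apply RInt_ext. intros r Hr. unfold minus, plus, opp; simpl. unfold Rdiv; ring.
    - auto.
    - eexists. now apply Hp. }
  rewrite E. ring.
Qed.

(** * Summatory functions and Abel summation *)

Definition nf (x : R) : nat := Z.to_nat (Int_part x).

Lemma nf_spec (x : R) : 0 <= x -> INR (nf x) <= x < INR (nf x) + 1.
Proof.
  intros Hx. unfold nf. destruct (base_Int_part x) as [H1 H2].
  assert (Hz : (0 <= Int_part x)%Z). { assert (-1 < Int_part x)%Z; [|lia]. apply lt_IZR. simpl. lra. }
  rewrite INR_IZR_INZ, Z2Nat.id by auto. lra.
Qed.

Lemma nf_ge (x : R) (n : nat) : 0 <= x -> (n <= nf x)%nat <-> INR n <= x.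
Proof.
  intros Hx. destruct (nf_spec x Hx) as [H1 H2]. split; intros H.
  - apply le_INR in H. lra.
  - apply Nat.lt_succ_r. apply INR_lt. rewrite S_INR. lra.
Qed.

Lemma nf_uniq (x : R) (n : nat) : 0 <= x -> INR n <= x -> x < INR n + 1 -> nf x = n.
Proof.
  intros Hx H1 H2. apply Nat.le_antisymm.
  - destruct (nf_spec x Hx) as [H3 H4]. apply Nat.lt_succ_r. apply INR_lt. rewrite S_INR. lra.
  - now apply nf_ge.
Qed.

Lemma nf_div (x : R) (n : nat) : 0 <= x -> (1 <= n)%nat -> nf (x / INR n) = (nf x / n)%nat.
Proof.
  intros Hx Hn. assert (Hn' : 0 < INR n) by (apply lt_0_INR; lia). destruct (nf_spec x Hx) as [H1 H2].
  apply nf_uniq.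
  - apply Rmult_le_pos; auto. left. now apply Rinv_0_lt_compat.
  - apply Rmult_le_reg_r with (INR n); auto. unfold Rdiv. rewrite Rmult_assoc, Rinv_l, Rmult_1_r by lra.
    rewrite <- mult_INR. apply Rle_trans with (INR (nf x)); auto. apply le_INR. rewrite Nat.mul_comm.
    apply Nat.Div0.mul_div_le.
  - apply Rmult_lt_reg_r with (INR n); auto. unfold Rdiv. rewrite Rmult_assoc, Rinv_l, Rmult_1_r by lra.
    rewrite <- S_INR, <- mult_INR. apply Rlt_le_trans with (INR (nf x) + 1); auto. rewrite <- S_INR.
    apply le_INR.
    pose proof (Nat.mul_succ_div_gt (nf x) n ltac:(lia)). lia.
Qed.

Definition SS (a : nat -> R) (x : R) : R := fsum (fun i => a (S i)) (nf x).

Definition ind (m : nat) (r : R) : R := if Rle_dec (INR m) r then 1 else 0.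

Lemma is_RInt_ind (m : nat) (f f' : R -> R) (x : R) : (1 <= m)%nat -> 1 <= x ->
  (forall r, 1 <= r <= x -> is_derive f r (f' r)) -> (forall r, 1 <= r <= x -> continuous f' r) ->
  is_RInt (fun r => ind m r * f' r) 1 x (ind m x * (f x - f (INR m))).
Proof.
  intros Hm Hx Hd Hc. assert (Hm1 : 1 <= INR m) by (apply (le_INR 1); auto).
  unfold ind at 2. destruct (Rle_dec (INR m) x) as [h|h].
  - replace (1 * (f x - f (INR m))) with (plus 0 (minus (f x) (f (INR m)))) by (unfold plus, minus, opp;
      simpl; unfold plus; simpl; ring).
    apply (is_RInt_Chasles (V := R_NormedModule) _ 1 (INR m)).
    + apply (is_RInt_ext (fun _ => 0)).
      * intros r Hr. rewrite Rmax_right in Hr by lra. unfold ind. destruct (Rle_dec (INR m) r). lra. Req.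
        ring.
      * apply is_RInt_0.
    + apply (is_RInt_ext f').
      * intros r Hr. rewrite Rmin_left in Hr by lra. unfold ind. destruct (Rle_dec (INR m) r). Req; ring. lra.
      * apply (is_RInt_derive f f'); intros r Hr; rewrite Rmin_left, Rmax_right in Hr by lra;
          [apply Hd|apply Hc]; lra.
  - rewrite Rmult_0_l. apply (is_RInt_ext (fun _ => 0)).
    + intros r Hr. rewrite Rmax_right in Hr by lra. unfold ind. destruct (Rle_dec (INR m) r). lra. Req. ring.
    + apply is_RInt_0.
Qed.

Lemma SS_ind (a : nat -> R) (N : nat) (r : R) : 0 <= r -> r < INR N + 1 -> SS a r =
  fsum (fun i => a (S i) * ind (S i) r) N.
Proof.
  intros Hr HN. unfold SS. assert (HnN : (nf r <= N)%nat).
  { destruct (nf_spec r Hr) as [H _]. apply Nat.lt_succ_r. apply INR_lt. rewrite S_INR. lra. }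
  replace N with (nf r + (N - nf r))%nat by lia. rewrite fsum_app.
  rewrite (fsum_ext (fun i => a (S (nf r + i)) * ind (S (nf r + i)) r) (fun _ => 0)), fsum_const.
  - rewrite Rmult_0_r, Rplus_0_r. apply fsum_ext. intros i Hi. unfold ind.
    destruct (Rle_dec (INR (S i)) r) as [|n]. ring.
    exfalso. apply n. apply nf_ge; auto.
  - intros i Hi. unfold ind. destruct (Rle_dec (INR (S (nf r + i))) r) as [l|]. 2: ring.
    apply nf_ge in l; auto. lia.
Qed.

(** The summatory function is a finite combination of unit steps on [1, x], and for a single step
    the statement is the fundamental theorem of calculus on [m, x]. *)
Lemma abel_summation (a : nat -> R) (f f' : R -> R) (x : R) : 1 <= x ->
  (forall r, 1 <= r <= x -> is_derive f r (f' r)) -> (forall r, 1 <= r <= x -> continuous f' r) ->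
  is_RInt (fun r => SS a r * f' r) 1 x (SS a x * f x - SS (fun n => a n * f (INR n)) x).
Proof.
  intros Hx Hd Hc. set (N := nf x). destruct (nf_spec x ltac:(lra)) as [HN1 HN2]. fold N in HN1, HN2.
  assert (H : forall K, is_RInt (fun r => fsum (fun i => a (S i) * ind (S i) r) K * f' r) 1 x
     (fsum (fun i => a (S i) * (ind (S i) x * (f x - f (INR (S i))))) K)).
  { induction K.
    - simpl. apply (is_RInt_ext (fun _ => 0)). intros; Req; ring. apply is_RInt_0.
    - cbn [fsum]. apply (is_RInt_ext (fun r => plus (fsum (fun i => a (S i) * ind (S i) r) K * f' r) (scal (a
        (S K)) (ind (S K) r * f' r)))).
      { intros r Hr. unfold plus, scal; simpl; unfold mult; simpl. ring. }
      apply (is_RInt_plus (V := R_NormedModule)); auto. apply (is_RInt_scal (V := R_NormedModule)).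
      apply is_RInt_ind; auto. lia. }
  specialize (H N).
  replace (SS a x * f x - SS (fun n => a n * f (INR n)) x) with (fsum (fun i => a (S i) * (ind (S i) x * (f x
    - f (INR (S i))))) N).
  - eapply is_RInt_ext. 2: exact H. intros r Hr. rewrite Rmin_left, Rmax_right in Hr by lra. cbv beta.
    rewrite (SS_ind a N) by lra. reflexivity.
  - unfold SS. fold N. rewrite Rmult_comm, <- fsum_scal, <- fsum_minus. apply fsum_ext. intros i Hi.
    unfold ind. destruct (Rle_dec (INR (S i)) x) as [|n]. ring. exfalso. apply n. apply nf_ge. lra. exact Hi.
Qed.

Lemma ex_RInt_SS (a : nat -> R) (g : R -> R) (x : R) : 1 <= x -> (forall r, 1 <= r <= x -> continuous g r) ->
  ex_RInt (fun r => SS a r * g r) 1 x.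
Proof.
  intros Hx Hc. set (N := nf x). destruct (nf_spec x ltac:(lra)) as [HN1 HN2]. fold N in HN1, HN2.
  assert (Hi : forall m, (1 <= m)%nat -> ex_RInt (fun r => ind m r * g r) 1 x).
  { intros m Hm. assert (Hm1 : 1 <= INR m) by (apply (le_INR 1); auto).
    destruct (Rle_dec (INR m) x) as [h|h].
    - apply (ex_RInt_Chasles _ 1 (INR m)).
      + apply (ex_RInt_ext (fun _ => 0)). intros r Hr. rewrite Rmax_right in Hr by lra. unfold ind.
        destruct (Rle_dec (INR m) r). lra. Req. ring. apply ex_RInt_const.
      + apply (ex_RInt_ext g). intros r Hr. rewrite Rmin_left in Hr by lra. unfold ind.
        destruct (Rle_dec (INR m) r). Req; ring. lra.
        apply (ex_RInt_continuous (V := R_CompleteNormedModule)). intros r Hr.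
        rewrite Rmin_left, Rmax_right in Hr by lra. apply Hc; lra.
    - apply (ex_RInt_ext (fun _ => 0)). intros r Hr. rewrite Rmax_right in Hr by lra. unfold ind.
      destruct (Rle_dec (INR m) r). lra. Req. ring. apply ex_RInt_const. }
  assert (H : forall K, ex_RInt (fun r => fsum (fun i => a (S i) * ind (S i) r) K * g r) 1 x).
  { induction K.
    - simpl. apply (ex_RInt_ext (fun _ => 0)). intros; Req; ring. apply ex_RInt_const.
    - cbn [fsum]. apply (ex_RInt_ext (fun r => plus (fsum (fun i => a (S i) * ind (S i) r) K * g r) (scal (a
        (S K)) (ind (S K) r * g r)))).
      { intros r Hr. unfold plus, scal; simpl; unfold mult; simpl. ring. }
      apply (ex_RInt_plus (V := R_NormedModule)); auto. apply (ex_RInt_scal (V := R_NormedModule)). apply Hi.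
      lia. }
  eapply ex_RInt_ext. 2: exact (H N). intros r Hr. rewrite Rmin_left, Rmax_right in Hr by lra. cbv beta.
  rewrite (SS_ind a N) by lra. reflexivity.
Qed.

Lemma nf_INR (n : nat) : nf (INR n) = n.
Proof. apply nf_uniq; pose proof (pos_INR n); lra. Qed.

Lemma SS_1 (x : R) : SS (fun _ => 1) x = INR (nf x).
Proof. unfold SS. rewrite fsum_const. ring. Qed.

Lemma asym_floor : asym (fun x => INR (nf x) / x).
Proof.
  apply (asym_ext _ (fun x => (INR (nf x) / x - 1) + 1)). intros; ring.
  apply asym_plus; [|apply asym_const]. apply asym_small. eapply small_dom. 2: exact small_inv.
  intros x Hx. destruct (nf_spec x ltac:(lra)) as [H1 H2].
  replace (INR (nf x) / x - 1) with ((INR (nf x) - x) * / x) by (field; lra).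
  rewrite Rabs_mult. rewrite <- (Rmult_1_l (Rabs (/ x))) at 2. apply Rmult_le_compat_r. apply Rabs_pos.
  apply Rabs_le. lra.
Qed.

Lemma is_derive_inv (r : R) : 0 < r -> is_derive (fun r => / r) r (- / r ^ 2).
Proof. intros H. auto_derive. lra. field. lra. Qed.

Lemma continuous_inv2 (r : R) : 0 < r -> continuous (fun r => - / r ^ 2) r.
Proof. intros H. apply (ex_derive_continuous (fun r => - / r ^ 2)). auto_derive. apply Rgt_not_eq. nra. Qed.

(** Abel summation against 1/r: the weighted sum is [SS a x / x] plus the integral of [SS a r / r]
    against dr/r, and both stay in the class. *)
Lemma asym_harmonic (a : nat -> R) : asym (fun x => SS a x / x) -> asym (SS (fun n => a n * / INR n)).
Proof.
  intros H.
  assert (HI : forall b, 1 <= b -> is_RInt (fun r => SS a r * - / r ^ 2) 1 b (SS a b * / b - SS (fun n => a n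
    * / INR n) b)).
  { intros b Hb. apply (abel_summation a (fun r => / r)). auto. intros r Hr. apply is_derive_inv. lra.
    intros r Hr. apply continuous_inv2. lra. }
  assert (HI' : forall b, 1 <= b -> is_RInt (fun r => (SS a r / r) / r) 1 b (- (SS a b * / b - SS (fun n => a
    n * / INR n) b))).
  { intros b Hb. eapply is_RInt_ext. 2: exact (is_RInt_opp _ _ _ _ (HI b Hb)). intros r Hr.
    rewrite Rmin_left in Hr by lra. unfold opp; simpl. field. lra. }
  apply (asym_ext _ (fun x => SS a x / x + RInt (fun r => (SS a r / r) / r) 1 x)).
  - intros x Hx. rewrite (is_RInt_unique _ _ _ _ (HI' x Hx)). unfold Rdiv. ring.
  - apply asym_plus; auto. apply asym_int; auto. intros b Hb. eexists. apply HI'; auto.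
Qed.

Definition Lh (i : nat) : R -> R := SS (fun n => / INR n * ln (INR n) ^ i).

(** Counting integers gives the harmonic sum by [asym_harmonic]; a further Abel summation against
    the powers of log r gives the other cases. *)
Lemma asym_Lh (i : nat) : asym (Lh i).
Proof.
  assert (H0 : asym (SS (fun n => / INR n))).
  { eapply asym_ext. 2: apply (asym_harmonic (fun _ => 1)).
    - intros x _. unfold SS. apply fsum_ext. intros; ring.
    - eapply asym_ext. 2: exact asym_floor. intros x _. now rewrite SS_1. }
  destruct i.
  - eapply asym_ext. 2: exact H0. intros x _. unfold Lh, SS. apply fsum_ext. intros; simpl; ring.
  - set (f := fun r => ln r ^ S i). set (f' := fun r => INR (S i) * (ln r ^ i / r)).
    assert (HI : forall b, 1 <= b -> is_RInt (fun r => SS (fun n => / INR n) r * f' r) 1 b (SS (fun n => / INR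
      n) b * f b - Lh (S i) b)).
    { intros b Hb. apply (abel_summation (fun n => / INR n) f f' b Hb).
      - intros r Hr. unfold f, f'. auto_derive. lra.
        change (match i with 0%nat => 1 | S _ => INR i + 1 end) with (INR (S i)).
        change (Nat.pred (S i)) with i. field. lra.
      - intros r Hr. unfold f'. apply (continuous_scal_r (INR (S i)) (fun r => ln r ^ i / r)).
        apply continuous_ln_pow_div. lra. }
    apply (asym_ext _ (fun x => SS (fun n => / INR n) x * f x + (-1) * RInt (fun r => (SS (fun n => / INR n) r
      * (INR (S i) * ln r ^ i)) / r) 1 x)).
    + intros x Hx. rewrite (RInt_ext _ (fun r => SS (fun n => / INR n) r * f' r)).
      rewrite (is_RInt_unique _ _ _ _ (HI x Hx)). ring. intros r Hr. rewrite Rmin_left in Hr by lra.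
      unfold f'. Req. field. lra.
    + apply asym_plus. apply asym_mult; auto. apply asym_ln_pow. apply asym_scal. apply asym_int.
      * intros b Hb. eapply ex_RInt_ext. 2: eexists; exact (HI b Hb). intros r Hr.
        rewrite Rmin_left in Hr by lra. unfold f'. Req. field. lra.
      * apply asym_mult; auto. apply asym_scal, asym_ln_pow.
Qed.

(** * The hyperbola method *)

Lemma fsum_leb (g : nat -> R) (q K : nat) : (q <= K)%nat ->
  fsum (fun i => if Nat.leb (S i) q then g i else 0) K = fsum g q.
Proof.
  intros H. replace K with (q + (K - q))%nat by lia. rewrite fsum_app.
  rewrite (fsum_ext (fun i => if Nat.leb (S (q + i)) q then _ else _) (fun _ => 0)), fsum_const.
  - rewrite Rmult_0_r, Rplus_0_r. apply fsum_ext. intros i Hi. destruct (Nat.leb_spec (S i) q); auto; lia.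
  - intros i Hi. destruct (Nat.leb_spec (S (q + i)) q); auto; lia.
Qed.

Lemma fsum_multiples (F : nat -> R) (d X : nat) : (1 <= d)%nat ->
  fsum (fun j => if Nat.eqb (S j mod d) 0 then F (S j) else 0) X = fsum (fun e => F (d * S e)%nat) (X / d).
Proof.
  intros Hd. induction X.
  - rewrite Nat.Div0.div_0_l. reflexivity.
  - cbn [fsum]. rewrite IHX. pose proof (Nat.div_mod_eq X d) as E.
    pose proof (Nat.mod_upper_bound X d ltac:(lia)) as B.
    destruct (Nat.eqb_spec (S X mod d) 0) as [h|h].
    + pose proof (Nat.div_mod_eq (S X) d) as E2. rewrite h, Nat.add_0_r in E2.
      assert (HQ : (S X / d)%nat = S (X / d)).
      {
        assert (S X / d > X / d)%nat by nia. assert (S X / d < X / d + 2)%nat by nia. lia. }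
      rewrite HQ. cbn [fsum]. f_equal. f_equal. rewrite E2, HQ. lia.
    + rewrite Rplus_0_r. f_equal. apply (Nat.div_unique _ _ _ (S (X mod d))).
      * destruct (Nat.eq_dec (S (X mod d)) d); [|lia]. exfalso. apply h.
        replace (S X) with (d * (X / d + 1))%nat by lia. rewrite Nat.mul_comm. apply Nat.Div0.mod_mul.
      * lia.
Qed.

(** Dirichlet convolution of [a] with the constant function 1. *)
Definition dconv (a : nat -> R) (n : nat) : R :=
  fsum (fun i => if Nat.eqb (n mod S i) 0 then a (n / S i)%nat else 0) n.

Lemma dk_dconv (k n : nat) : INR (dk (S k) n) = dconv (fun m => INR (dk k m)) n.
Proof.
  unfold dconv. simpl dk.
  assert (H : forall f : nat -> nat, forall n m, INR (fold_right Nat.add 0%nat (map f (seq m n))) =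
    fsum (fun i => INR (f (m + i)%nat)) n).
  { intros f. induction n0; intros m. reflexivity.
    rewrite fsum_head, Nat.add_0_r. simpl. rewrite plus_INR, IHn0. f_equal. apply fsum_ext.
    intros; do 2 f_equal; lia. }
  rewrite H. apply fsum_ext. intros i _. simpl Nat.add.
  destruct (Nat.eqb (n mod S i) 0); auto.
Qed.

(** The weight [f] is the constant 1 in the hyperbola method and n^(-s) for the Dirichlet series. *)
Lemma dconv_sum (a f : nat -> R) (X : nat) :
  fsum (fun j => dconv a (S j) * f (S j)) X =
  fsum (fun i => fsum (fun e => a (S e) * f (S i * S e)%nat) (X / S i)) X.
Proof.
  rewrite (fsum_ext _ (fun j => fsum (fun i => if Nat.eqb (S j mod S i) 0 then a (S j / S i)%nat * f (S j)
    else 0) X)).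
  - rewrite fsum_swap. apply fsum_ext. intros i _.
    rewrite (fsum_multiples (fun n => a (n / S i)%nat * f n)) by lia.
    apply fsum_ext. intros e _. do 2 f_equal. rewrite Nat.mul_comm. apply Nat.div_mul. lia.
  - intros j Hj. unfold dconv. rewrite Rmult_comm, <- fsum_scal.
    replace X with (S j + (X - S j))%nat by lia. rewrite fsum_app.
    rewrite (fsum_ext (fun i => if Nat.eqb (S j mod S (S j + i)) 0 then _ else _) (fun _ => 0)), fsum_const.
    + rewrite Rmult_0_r, Rplus_0_r. apply fsum_ext. intros i _. destruct (Nat.eqb _ 0); ring.
    + intros i _. rewrite Nat.mod_small by lia. reflexivity.
Qed.

Lemma fsum_count (Y q X : nat) : (q <= X)%nat -> fsum (fun i => if Nat.leb (S (Y + i)) q then 1 else 0) (X -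
  Y) = INR (q - Y).
Proof.
  intros H. rewrite <- (Rmult_1_r (INR (q - Y))), <- fsum_const,
    <- (fsum_leb (fun _ => 1) (q - Y) (X - Y)) by lia.
  apply fsum_ext. intros i _. destruct (Nat.leb_spec (S (Y + i)) q), (Nat.leb_spec (S i) (q - Y)); auto; lia.
Qed.

Lemma le_div_iff (a b X : nat) : (1 <= a)%nat -> (b <= X / a)%nat <-> (a * b <= X)%nat.
Proof.
  intros Ha. split; intros H.
  - apply Nat.le_trans with (a * (X / a))%nat. now apply Nat.mul_le_mono_l. apply Nat.Div0.mul_div_le.
  - apply Nat.div_le_lower_bound; lia.
Qed.

(** [Y] is the integer square root of [X]. In a product i e <= X with i > Y one has e <= Y, and for
    given e the number of such i is X/e - Y. *)
Lemma hyperbola (a : nat -> R) (X Y : nat) : (Y * Y <= X)%nat -> (X < S Y * S Y)%nat ->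
  fsum (fun i => fsum (fun e => a (S e)) (X / S i)) X =
  fsum (fun i => fsum (fun e => a (S e)) (X / S i)) Y + fsum (fun j => a (S j) * INR (X / S j - Y)) Y.
Proof.
  intros H1 H2. assert (HYX : (Y <= X)%nat) by nia.
  assert (HX : forall i, (X / S i <= X)%nat) by (intros i; apply Nat.Div0.div_le_upper_bound; nia).
  assert (EX : forall g, fsum g X = fsum g Y + fsum (fun i => g (Y + i)%nat) (X - Y)) by (intros g;
    rewrite <- fsum_app; f_equal; lia).
  rewrite (EX (fun i => fsum (fun e => a (S e)) (X / S i))). f_equal.
  rewrite (fsum_ext _ (fun i => fsum (fun e => a (S e) * (if Nat.leb (S (Y + i)) (X / S e) then 1 else 0))
    X)).
  - rewrite fsum_swap, EX.
    rewrite (fsum_ext (fun i => fsum (fun i0 => a (S (Y + i)) * _) _) (fun _ => 0)), fsum_const.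
    + rewrite Rmult_0_r, Rplus_0_r. apply fsum_ext. intros j _. rewrite fsum_scal, fsum_count; auto.
    + intros j _. rewrite fsum_scal, fsum_count by auto.
      assert (X / S (Y + j) <= Y)%nat. { apply Nat.lt_succ_r. apply Nat.Div0.div_lt_upper_bound. nia. }
      replace (X / S (Y + j) - Y)%nat with 0%nat by lia. simpl; ring.
  - intros i _. rewrite <- (fsum_leb (fun e => a (S e)) (X / S (Y + i)) X) by auto.
    apply fsum_ext. intros e _.
    destruct (Nat.leb_spec (S e) (X / S (Y + i))) as [h|h], (Nat.leb_spec (S (Y + i)) (X / S e)) as [h'|h'];
      try ring; exfalso.
    + apply le_div_iff in h; try lia. assert (S (Y + i) <= X / S e)%nat by (apply le_div_iff; lia). lia.
    + apply le_div_iff in h'; try lia. assert (S e <= X / S (Y + i))%nat by (apply le_div_iff; lia). lia.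
Qed.

Lemma small_exp (C d : R) : 0 < d -> small (fun x => C * exp (- d * ln x)).
Proof.
  intros Hd. exists (Rabs C), d. split. apply Rabs_pos. split; auto. intros x Hx.
  rewrite Rabs_mult, (Rabs_pos_eq (exp _)); [lra|]. left; apply exp_pos.
Qed.

Lemma SS_plus (a b : nat -> R) (x : R) : SS (fun n => a n + b n) x = SS a x + SS b x.
Proof. unfold SS. apply fsum_plus. Qed.

Lemma SS_scal (c : R) (a : nat -> R) (x : R) : SS (fun n => c * a n) x = c * SS a x.
Proof. unfold SS. apply fsum_scal. Qed.

(** Each Horner step contributes a factor log x - log n: log x leaves the sum, and log n raises the
    exponent [i]. *)
Lemma asym_conv_poly (l : list R) (i : nat) :
  asym (fun x => SS (fun n => / INR n * ln (INR n) ^ i * peval l (ln x - ln (INR n))) (sqrt x)).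
Proof.
  revert i. induction l as [|a l IH]; intros i.
  - eapply asym_ext. 2: exact (asym_const 0). intros x _. unfold SS.
    rewrite (fsum_ext _ (fun _ => 0)), fsum_const. ring. intros; simpl; ring.
  - apply (asym_ext _ (fun x => a * Lh i (sqrt x) + (ln x * SS (fun n => / INR n * ln (INR n) ^ i * peval l
      (ln x - ln (INR n))) (sqrt x)
      + (-1) * SS (fun n => / INR n * ln (INR n) ^ S i * peval l (ln x - ln (INR n))) (sqrt x)))).
    + intros x _. unfold Lh. rewrite <- !SS_scal, <- !SS_plus. unfold SS. apply fsum_ext. intros; simpl; ring.
    + apply asym_plus. apply asym_scal. apply (asym_sqrt (Lh i)). apply asym_Lh.
      apply asym_plus. apply asym_mult. apply asym_ln. apply IH. apply asym_scal. apply IH.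
Qed.

(** The inductive step of the divisor problem: cutting the hyperbola at sqrt x keeps x/n >= sqrt x
    in [T1], so that a power saving for [a] yields one for [dconv a]; in [T2] replacing integer
    parts costs at most one unit per term. *)
Lemma asym_dconv (a : nat -> R) : (forall n, 0 <= a n) -> asym (fun x => SS a x / x) ->
  asym (fun x => SS (dconv a) x / x).
Proof.
  intros Ha Hh. set (h := fun x => SS a x / x) in *. pose proof Hh as Hh'.
  destruct Hh' as [l [C [d [HC [Hd Hl]]]]].
  set (e := fun x => h x - peval l (ln x)) in *.
  set (T1 := fun x => SS (fun n => / INR n * h (x / INR n)) (sqrt x)).
  set (T2 := fun x => / x * SS (fun m => a m * (INR (nf (x / INR m)) - INR (nf (sqrt x)))) (sqrt x)).
  assert (Hs : forall x, 1 <= x -> 1 <= sqrt x) by apply sqrt_ge_1.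
  assert (Hle : forall x i, 1 <= x -> (i < nf (sqrt x))%nat -> 1 <= INR (S i) <= sqrt x).
  { intros x i Hx Hi. split. apply INR_S_ge1. apply nf_ge; auto. apply sqrt_pos. }
  apply (asym_ext _ (fun x => T1 x + T2 x)).
  { intros x Hx. specialize (Hs x Hx). set (X := nf x). set (Y := nf (sqrt x)).
    destruct (nf_spec x ltac:(lra)) as [B1 B2]. fold X in B1, B2.
    destruct (nf_spec (sqrt x) ltac:(lra)) as [B3 B4]. fold Y in B3, B4.
    assert (Hss : sqrt x * sqrt x = x) by (apply sqrt_sqrt; lra).
    assert (H1 : (Y * Y <= X)%nat). { apply nf_ge. lra. rewrite mult_INR. nra. }
    assert (H2 : (X < S Y * S Y)%nat). { apply INR_lt. rewrite mult_INR, S_INR. nra. }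
    assert (E : SS (dconv a) x = fsum (fun i => fsum (fun e => a (S e)) (X / S i)) X).
    { unfold SS. fold X. pose proof (dconv_sum a (fun _ => 1) X) as E.
      rewrite (fsum_ext (fun j => dconv a (S j)) (fun j => dconv a (S j) * 1)) by (intros; ring). rewrite E.
      apply fsum_ext. intros; apply fsum_ext; intros; ring. }
    rewrite E, (hyperbola a X Y H1 H2). unfold T1, T2, SS. fold Y. unfold Rdiv at 1.
    rewrite Rmult_plus_distr_r. f_equal.
    - rewrite Rmult_comm, <- fsum_scal. apply fsum_ext. intros i Hi. specialize (Hle x i Hx Hi).
      unfold h, SS. rewrite nf_div by (try lia; lra). fold X. field. lra.
    - rewrite Rmult_comm. f_equal. apply fsum_ext. intros j Hj. specialize (Hle x j Hx Hj).
      rewrite nf_div by (try lia; lra). fold X. f_equal.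
      apply minus_INR. apply le_div_iff. lia. nia. }
  apply asym_plus.
  (* The polynomial part of h(x/n) is handled by [asym_conv_poly]; the error part is at most C
     x^(-d/2) times a harmonic sum. *)
  - apply (asym_ext _ (fun x => SS (fun n => / INR n * ln (INR n) ^ 0 * peval l (ln x - ln (INR n))) (sqrt x)
      + SS (fun n => / INR n * e (x / INR n)) (sqrt x))).
    + intros x Hx. unfold T1. rewrite <- SS_plus. unfold SS. apply fsum_ext. intros i Hi.
      specialize (Hle x i Hx Hi).
      unfold e. rewrite ln_div by lra. simpl; ring.
    + apply asym_plus. apply asym_conv_poly. apply asym_small.
      apply (small_dom _ (fun x => (C * exp (- d * ln (sqrt x))) * Lh 0 (sqrt x))).
      * intros x Hx. rewrite (Rabs_pos_eq (_ * _)).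
        2: { apply Rmult_le_pos. apply Rmult_le_pos; auto. left; apply exp_pos. apply fsum_pos. intros i Hi.
             specialize (Hle x i Hx Hi). simpl pow. rewrite Rmult_1_r. left. apply Rinv_0_lt_compat. lra. }
        unfold Lh, SS. eapply Rle_trans. apply fsum_Rabs. rewrite <- fsum_scal. apply fsum_le. intros i Hi.
        specialize (Hle x i Hx Hi).
        assert (Hss : sqrt x * sqrt x = x) by (apply sqrt_sqrt; lra).
        assert (HI : 0 < / INR (S i)) by (apply Rinv_0_lt_compat; lra).
        assert (Hxn : sqrt x <= x / INR (S i)). { apply Rmult_le_reg_r with (INR (S i)). lra. unfold Rdiv.
        rewrite Rmult_assoc, Rinv_l by lra. nra. }
        rewrite Rabs_mult, (Rabs_pos_eq (/ _)) by lra. simpl pow. rewrite Rmult_1_r, (Rmult_comm (C * _)).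
        apply Rmult_le_compat_l. lra.
        specialize (Hs x Hx). eapply Rle_trans. apply Hl. lra. apply Rmult_le_compat_l; auto. apply exp_mono.
        assert (ln (sqrt x) <= ln (x / INR (S i))) by (apply ln_mono; lra). nra.
      * apply (small_mult_asym (fun x => C * exp (- d * ln (sqrt x))) (fun x => Lh 0 (sqrt x))).
        apply (small_sqrt (fun x => C * exp (- d * ln x))). now apply small_exp. apply (asym_sqrt (Lh 0)).
        apply asym_Lh.
  (* The fractional part of x/m. Since [a] is nonnegative, its total contribution is at most
     [SS a (sqrt x) / x], that is h(sqrt x)/sqrt x. *)
  - set (th := fun x m => x / INR m - INR (nf (x / INR m))).
    apply (asym_ext _ (fun x => SS (fun n => a n * / INR n) (sqrt x) + ((-1) * ((INR (nf (sqrt x)) / sqrt x) *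
      h (sqrt x)) + (-1) * (/ x * SS (fun m => a m * th x m) (sqrt x))))).
    + intros x Hx. specialize (Hs x Hx). assert (Hss : sqrt x * sqrt x = x) by (apply sqrt_sqrt; lra).
      unfold T2. set (Y := nf (sqrt x)).
      replace (-1 * (INR Y / sqrt x * h (sqrt x))) with (/ x * SS (fun m => (- INR Y) * a m) (sqrt x)).
      2: { rewrite SS_scal. unfold h. rewrite <- Hss at 1. field. lra. }
      replace (SS (fun n => a n * / INR n) (sqrt x)) with (/ x * SS (fun n => x * (a n * / INR n)) (sqrt x))
        by (rewrite SS_scal; field; lra).
      replace (-1 * (/ x * SS (fun m => a m * th x m) (sqrt x))) with (/ x * SS (fun m => (-1) * (a m * th x
        m)) (sqrt x)) by (rewrite SS_scal; ring).
      rewrite <- !Rmult_plus_distr_l, <- !SS_plus. f_equal. unfold SS. apply fsum_ext. intros i Hi.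
      unfold th, Rdiv. ring.
    + apply asym_plus. apply (asym_sqrt (SS (fun n => a n * / INR n))). now apply asym_harmonic.
      apply asym_plus. apply asym_scal. apply asym_mult. apply (asym_sqrt (fun x => INR (nf x) / x)).
      apply asym_floor. now apply (asym_sqrt h).
      apply asym_scal, asym_small. apply (small_dom _ (fun x => / sqrt x * h (sqrt x))).
      * intros x Hx. specialize (Hs x Hx). assert (Hss : sqrt x * sqrt x = x) by (apply sqrt_sqrt; lra).
        assert (HI : 0 < / x) by (apply Rinv_0_lt_compat; lra).
        assert (HA : 0 <= SS a (sqrt x)) by (apply fsum_pos; auto).
        unfold h. rewrite (Rabs_pos_eq (_ * (_ / _))).
        2: { apply Rmult_le_pos. left; apply Rinv_0_lt_compat; lra. apply Rmult_le_pos; auto.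
             left; apply Rinv_0_lt_compat; lra. }
        rewrite Rabs_mult, (Rabs_pos_eq (/ x)) by lra.
        replace (/ sqrt x * (SS a (sqrt x) / sqrt x)) with (/ x * SS a (sqrt x)) by (rewrite <- Hss at 1;
          field; lra).
        apply Rmult_le_compat_l. lra. unfold SS. eapply Rle_trans. apply fsum_Rabs. apply fsum_le.
        intros i Hi. specialize (Hle x i Hx Hi).
        assert (Hxm : 0 <= x / INR (S i)) by (apply Rmult_le_pos; [lra|left; apply Rinv_0_lt_compat; lra]).
        destruct (nf_spec (x / INR (S i)) Hxm) as [N1 N2]. rewrite Rabs_mult, (Rabs_pos_eq (a (S i))) by auto.
        rewrite <- (Rmult_1_r (a (S i))) at 2. apply Rmult_le_compat_l; auto. unfold th. apply Rabs_le. lra.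
      * apply (small_mult_asym (fun x => / sqrt x) (fun x => h (sqrt x))). apply (small_sqrt (fun x => / x)).
        apply small_inv. now apply (asym_sqrt h).
Qed.

Definition Dk (k : nat) : R -> R := SS (fun n => INR (dk k n)).

Lemma asym_Dk (k : nat) : asym (fun x => Dk k x / x).
Proof.
  induction k.
  - apply asym_small. eapply small_ext. 2: exact small_inv. intros x Hx. unfold Dk, SS.
    replace (fsum (fun i => INR (dk 0 (S i))) (nf x)) with 1. field; lra.
    assert (H1 : (1 <= nf x)%nat) by (apply nf_ge; simpl; lra). destruct (nf x) as [|n]; [lia|].
    rewrite fsum_head, (fsum_ext _ (fun _ => 0)), fsum_const by (intros; reflexivity). simpl. ring.
  - eapply asym_ext. 2: apply (asym_dconv (fun n => INR (dk k n))); [intros; apply pos_INR|exact IHk].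
    intros x Hx. unfold Dk, SS. f_equal. apply fsum_ext. intros; apply dk_dconv.
Qed.

(** * Moments of the error term and the function phi *)

Lemma small_lim_seq (g : R -> R) : small g -> is_lim_seq (fun n => g (INR (S n))) 0.
Proof.
  intros [C [d [HC [Hd Hg]]]]. apply is_lim_seq_abs_0.
  apply (is_lim_seq_le_le (fun _ => 0) _ (fun n => C * exp (- d * ln (INR (S n))))).
  - intros n. split. apply Rabs_pos. apply Hg. apply INR_S_ge1.
  - apply is_lim_seq_const.
  - replace (Finite 0) with (Finite (C * 0)) by (f_equal; ring). apply is_lim_seq_mult'.
    apply is_lim_seq_const. now apply exp_ln_INR_lim.
Qed.

Lemma small_minus_lim_seq (g : R -> R) (l : R) : small (fun x => g x - l) ->
  is_lim_seq (fun n => g (INR (S n))) l.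
Proof.
  intros H. apply small_lim_seq in H. apply (is_lim_seq_ext (fun n => (g (INR (S n)) - l) + l)). intros; ring.
  replace (Finite l) with (Finite (0 + l)) by (f_equal; ring). apply is_lim_seq_plus'; auto.
  apply is_lim_seq_const.
Qed.

Lemma RInt_fsum (f : nat -> R -> R) (c : nat -> R) (a b : R) (J : nat) : (forall j, ex_RInt (f j) a b) ->
  is_RInt (fun r => fsum (fun j => c j * f j r) J) a b (fsum (fun j => c j * RInt (f j) a b) J).
Proof.
  intros H. induction J; cbn [fsum]. apply is_RInt_0.
  apply (is_RInt_plus (fun r => fsum (fun j => c j * f j r) J) (fun r => c J * f J r)); auto.
  apply (is_RInt_scal (V := R_NormedModule) (f J)). apply (RInt_correct (V := R_CompleteNormedModule)). auto.
Qed.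

Definition mono (j : nat) (u : R) : R := u ^ j / INR (fact j).

Lemma mono_pos (j : nat) (u : R) : 0 <= u -> 0 <= mono j u.
Proof. intros H. apply Rmult_le_pos. apply pow_le; auto. left. apply Rinv_0_lt_compat, INR_fact_lt_0. Qed.

(** (d u / 2)^j / j! is a term of the series of exp(d u / 2). Half of the power saving thus pays for
    a power of u at the price of (2/d)^j. *)
Lemma mono_bound (j : nat) (d u : R) : 0 < d -> 0 <= u -> mono j u <= (2 / d) ^ j * exp (d / 2 * u).
Proof.
  intros Hd Hu. replace (mono j u) with ((2 / d) ^ j * ((d / 2 * u) ^ j / INR (fact j))).
  - apply Rmult_le_compat_l. apply pow_le. left. apply Rdiv_lt_0_compat; lra. apply pow_fact_exp. nra.
  - unfold mono, Rdiv. rewrite <- Rmult_assoc, <- Rpow_mult_distr. do 2 f_equal. field. lra.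
Qed.

(** Term-by-term integration of [Phi] against the error term. After J terms, [mono_bound] leaves an
    integrand bounded by rho J times r^(-d/2)/r, where rho J is C times a tail of a convergent
    series; the integrals then differ by at most rho J (2/d), uniformly in b. It serves for the
    Laplace kernel exp(-z u) and for the Bessel kernel J_0(2 sqrt(x u)). *)
Lemma moment_series (e : R -> R) (C d : R) (al m : nat -> R) (Phi : R -> R) :
  0 <= C -> 0 < d -> (forall x, 1 <= x -> Rabs (e x) <= C * exp (- d * ln x)) ->
  ex_series (fun j => Rabs (al j) * (2 / d) ^ j) ->
  (forall u, 0 <= u -> is_series (fun j => al j * mono j u) (Phi u)) ->
  (forall b, 1 <= b -> ex_RInt (fun r => e r * Phi (ln r) / r) 1 b) ->
  (forall j b, 1 <= b -> ex_RInt (fun r => e r * mono j (ln r) / r) 1 b) ->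
  (forall j, small (fun b => RInt (fun r => e r * mono j (ln r) / r) 1 b - m j)) ->
  exists l, small (fun b => RInt (fun r => e r * Phi (ln r) / r) 1 b - l) /\
    is_series (fun j => al j * m j) l.
Proof.
  intros HC Hd He Hal HPhi HI HJ Hm.
  set (rho := fun J => C * (Series (fun j => Rabs (al j) * (2 / d) ^ j) - fsum (fun j => Rabs (al j) * (2 / d)
    ^ j) J)).
  assert (Hd2 : 0 < 2 / d) by (apply Rdiv_lt_0_compat; lra).
  assert (Ht : forall j, 0 <= Rabs (al j) * (2 / d) ^ j) by (intros; apply Rmult_le_pos;
    [apply Rabs_pos|apply pow_le; lra]).
  assert (Pt : forall J r, 1 <= r -> Rabs (e r * Phi (ln r) - fsum (fun j => al j * (e r * mono j (ln r))) J)
    <= rho J * exp (- (d / 2) * ln r)).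
  { intros J r Hr. pose proof (ln_ge_0 r Hr) as Hu. set (u := ln r) in *.
    replace (fsum (fun j => al j * (e r * mono j u)) J) with (e r * fsum (fun j => al j * mono j u) J) by
      (rewrite <- fsum_scal; apply fsum_ext; intros; ring).
    rewrite <- Rmult_minus_distr_l, Rabs_mult.
    assert (T : Rabs (Phi u - fsum (fun j => al j * mono j u) J) <=
      (Series (fun j => Rabs (al j) * (2 / d) ^ j) - fsum (fun j => Rabs (al j) * (2 / d) ^ j) J) * exp (d / 2
      * u)).
    { pose proof (HPhi u Hu) as HP. apply fsum_lim_series in HP.
      assert (LA : is_lim_seq (fun N => Rabs (fsum (fun j => al j * mono j u) (J + N) - fsum (fun j => al j *
        mono j u) J)) (Rabs (Phi u - fsum (fun j => al j * mono j u) J))).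
      { apply (is_lim_seq_abs _ (Phi u - fsum (fun j => al j * mono j u) J)).
        apply is_lim_seq_minus'; [|apply is_lim_seq_const].
        apply (is_lim_seq_incr_n _ J) in HP. eapply is_lim_seq_ext. 2: exact HP. intros n. cbv beta. f_equal.
        lia. }
      refine (is_lim_seq_le _ (fun _ => _) _ (Finite _) _ LA (is_lim_seq_const _)). intros N. cbv beta.
      rewrite fsum_app. rewrite Rplus_minus_l. eapply Rle_trans. apply fsum_Rabs.
      apply Rle_trans with (fsum (fun i => Rabs (al (J + i)%nat) * (2 / d) ^ (J + i)) N * exp (d / 2 * u)).
      - rewrite Rmult_comm, <- fsum_scal. apply fsum_le. intros i _.
        rewrite Rabs_mult, (Rabs_pos_eq (mono _ _)) by (now apply mono_pos).
        rewrite (Rmult_comm (exp _)), Rmult_assoc. apply Rmult_le_compat_l. apply Rabs_pos.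
        now apply mono_bound.
      - apply Rmult_le_compat_r. left; apply exp_pos. pose proof (fsum_le_Series _ (J + N) Ht Hal) as H.
        rewrite fsum_app in H. lra. }
    apply Rle_trans with ((C * exp (- d * u)) * ((Series (fun j => Rabs (al j) * (2 / d) ^ j) - fsum (fun j =>
      Rabs (al j) * (2 / d) ^ j) J) * exp (d / 2 * u))).
    - apply Rmult_le_compat; try apply Rabs_pos; auto.
    - right. unfold rho. replace (- (d / 2) * u) with (- d * u + d / 2 * u) by field. rewrite exp_plus. ring.
      }
  assert (Hrho : forall J, 0 <= rho J).
  { intros J. unfold rho. apply Rmult_le_pos; auto. pose proof (fsum_le_Series _ J Ht Hal). lra. }
  assert (Lrho : is_lim_seq rho 0).
  { unfold rho. replace (Finite 0) with (Finite (C * (Series (fun j => Rabs (al j) * (2 / d) ^ j) - Series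
      (fun j => Rabs (al j) * (2 / d) ^ j)))) by (f_equal; ring).
    apply is_lim_seq_mult'. apply is_lim_seq_const. apply is_lim_seq_minus'. apply is_lim_seq_const.
    apply fsum_lim_series. now apply Series_correct. }
  assert (HS : small (fun r => e r * Phi (ln r))).
  { exists (rho 0%nat), (d / 2). repeat split; auto. lra. intros r Hr. pose proof (Pt 0%nat r Hr) as H.
    simpl in H. now rewrite Rminus_0_r in H. }
  destruct (small_int _ HI HS) as [l Hl]. exists l. split; auto.
  apply fsum_lim_series.
  assert (Key : forall J, Rabs (l - fsum (fun j => al j * m j) J) <= rho J * (2 / d)).
  { intros J.
    assert (B : forall b, 1 <= b -> Rabs (RInt (fun r => e r * Phi (ln r) / r) 1 b - fsum (fun j => al j *
      RInt (fun r => e r * mono j (ln r) / r) 1 b) J) <= rho J * (2 / d)).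
    { intros b Hb. pose proof (RInt_fsum (fun j r => e r * mono j (ln r) / r) al 1 b J (fun j => HJ j b Hb))
        as HF.
      rewrite <- (is_RInt_unique _ _ _ _ HF).
      assert (EF : ex_RInt (fun r => fsum (fun j => al j * (e r * mono j (ln r) / r)) J) 1 b) by (eexists;
        exact HF).
      pose proof (RInt_minus (V := R_CompleteNormedModule) _ _ 1 b (HI b Hb) EF) as EM.
      change (minus ?p ?q) with (p - q) in EM. rewrite <- EM.
      apply Rle_trans with (rho J * ((exp (- (d / 2) * ln 1) - exp (- (d / 2) * ln b)) / (d / 2))).
      - apply (RInt_abs_le _ (fun r => rho J * (exp (- (d / 2) * ln r) / r))); auto.
        + apply (ex_RInt_minus (V := R_NormedModule)); auto.
        + apply (is_RInt_scal (V := R_NormedModule) (fun r => exp (- (d / 2) * ln r) / r)).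
          apply is_RInt_exp_ln; lra.
        + intros r Hr. specialize (Pt J r ltac:(lra)).
          apply Rle_trans with (Rabs ((e r * Phi (ln r) - fsum (fun j => al j * (e r * mono j (ln r))) J) * /
            r)).
          * right. f_equal. change (minus ?p ?q) with (p - q). rewrite Rmult_minus_distr_r. unfold Rdiv.
            f_equal. rewrite Rmult_comm, <- fsum_scal. apply fsum_ext. intros; ring.
          * rewrite Rabs_mult, (Rabs_pos_eq (/ r)) by (left; apply Rinv_0_lt_compat; lra).
            replace (rho J * (exp (- (d / 2) * ln r) / r)) with (rho J * exp (- (d / 2) * ln r) * / r) by
              (unfold Rdiv; ring).
            apply Rmult_le_compat_r; auto. left; apply Rinv_0_lt_compat; lra.
      - apply Rmult_le_compat_l; auto. rewrite ln_1, Rmult_0_r, exp_0.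
        pose proof (exp_pos (- (d / 2) * ln b)).
        replace (2 / d) with (1 / (d / 2)) by (field; lra). apply Rmult_le_compat_r.
        left; apply Rinv_0_lt_compat; lra. lra. }
    assert (LA : is_lim_seq (fun n => Rabs (RInt (fun r => e r * Phi (ln r) / r) 1 (INR (S n)) - fsum (fun j
      => al j * RInt (fun r => e r * mono j (ln r) / r) 1 (INR (S n))) J)) (Rabs (l - fsum (fun j => al j * m
      j) J))).
    { apply (is_lim_seq_abs _ (l - fsum (fun j => al j * m j) J)). apply is_lim_seq_minus'.
      - apply (small_minus_lim_seq (fun b => RInt (fun r => e r * Phi (ln r) / r) 1 b)). exact Hl.
      - apply (fsum_lim (fun n j => al j * RInt (fun r => e r * mono j (ln r) / r) 1 (INR (S n)))). intros j.
        apply is_lim_seq_mult'. apply is_lim_seq_const.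
        apply (small_minus_lim_seq (fun b => RInt (fun r => e r * mono j (ln r) / r) 1 b)). apply Hm. }
    refine (is_lim_seq_le _ (fun _ => _) _ (Finite _) _ LA (is_lim_seq_const _)). intros n. cbv beta. apply B.
    apply INR_S_ge1. }
  apply (is_lim_seq_ext (fun J => l - (l - fsum (fun j => al j * m j) J))). intros; ring.
  replace (Finite l) with (Finite (l - 0)) by (f_equal; ring). apply is_lim_seq_minus'.
  apply is_lim_seq_const.
  apply is_lim_seq_abs_0. apply (is_lim_seq_le_le (fun _ => 0) _ (fun J => rho J * (2 / d))).
  - intros J. split. apply Rabs_pos. auto.
  - apply is_lim_seq_const.
  - replace (Finite 0) with (Finite (0 * (2 / d))) by (f_equal; ring). apply is_lim_seq_mult'; auto.
    apply is_lim_seq_const.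
Qed.

(** * Laplace transforms of polynomials *)

Lemma small_ln_pow_exp (i : nat) (z : R) : 0 < z -> small (fun b => ln b ^ i * exp (- z * ln b)).
Proof.
  intros Hz. eapply small_ext. 2: apply (small_mult_poly (pmono 1 i) (fun b => 1 * exp (- z * ln b))),
    small_exp; exact Hz.
  intros x Hx. cbv beta. rewrite peval_pmono. ring.
Qed.

(** Integration by parts lowers the exponent; the boundary term at r = 1 vanishes and the one at b
    is [small]. *)
Lemma laplace_mono (i : nat) (z : R) : 0 < z -> exists W, (forall b, 1 <= b ->
  is_RInt (fun r => ln r ^ i * exp (- z * ln r) / r) 1 b (W b)) /\
  small (fun b => W b - INR (fact i) / z ^ S i).
Proof.
  intros Hz. induction i as [|i [W [HW1 HW2]]].
  - exists (fun b => (exp (- z * ln 1) - exp (- z * ln b)) / z). split.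
    + intros b Hb. eapply is_RInt_ext. 2: apply is_RInt_exp_ln; lra. intros r _. simpl. unfold Rdiv. Req.
      ring.
    + eapply small_ext. 2: apply (small_exp (- / z) z Hz). intros x Hx. cbv beta.
      rewrite ln_1, Rmult_0_r, exp_0. simpl. field. lra.
  - exists (fun b => (INR (S i) * W b - ln b ^ S i * exp (- z * ln b)) / z). split.
    + intros b Hb.
      assert (D : is_RInt (fun r => INR (S i) * (ln r ^ i * exp (- z * ln r) / r) - z * (ln r ^ S i * exp (- z
        * ln r) / r)) 1 b
                    (minus (ln b ^ S i * exp (- z * ln b)) (ln 1 ^ S i * exp (- z * ln 1)))).
      { apply (is_RInt_derive (fun r => ln r ^ S i * exp (- z * ln r)) (fun r => INR (S i) * (ln r ^ i * exp
          (- z * ln r) / r) - z * (ln r ^ S i * exp (- z * ln r) / r))).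
        - intros r Hr. rewrite Rmin_left in Hr by lra. auto_derive. lra.
          change (match i with 0%nat => 1 | S _ => INR i + 1 end) with (INR (S i)).
          change (Nat.pred (S i)) with i. simpl. field. lra.
        - intros r Hr. rewrite Rmin_left in Hr by lra.
          apply (ex_derive_continuous (fun r => INR (S i) * (ln r ^ i * exp (- z * ln r) / r) - z * (ln r ^ S
            i * exp (- z * ln r) / r))). auto_derive. repeat split; lra. }
      rewrite ln_1 in D. simpl (0 ^ S i) in D. rewrite !Rmult_0_l in D.
      pose proof (is_RInt_minus _ _ _ _ _ _ (is_RInt_scal _ _ _ (INR (S i)) _ (HW1 b Hb)) D) as M.
      apply (is_RInt_scal _ _ _ (/ z)) in M.
      replace ((INR (S i) * W b - ln b ^ S i * exp (- z * ln b)) / z) with (scal (/ z) (minus (scal (INR (S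
        i)) (W b)) (minus (ln b ^ S i * exp (- z * ln b)) 0))).
      * eapply is_RInt_ext. 2: exact M. intros r Hr. rewrite Rmin_left in Hr by lra.
        change (/ z * (INR (S i) * (ln r ^ i * exp (- z * ln r) / r) - (INR (S i) * (ln r ^ i * exp (- z * ln
          r) / r) - z * (ln r ^ S i * exp (- z * ln r) / r))) = ln r ^ S i * exp (- z * ln r) / r). field.
        lra.
      * change (/ z * (INR (S i) * W b - (ln b ^ S i * exp (- z * ln b) - 0)) =
          (INR (S i) * W b - ln b ^ S i * exp (- z * ln b)) / z). field. lra.
    + eapply small_ext. 2: exact (small_plus _ _ (small_scal (INR (S i) / z) _ HW2) (small_scal (- / z) _
        (small_ln_pow_exp (S i) z Hz))).
      intros x Hx. cbv beta. rewrite fact_simpl, mult_INR. change (z ^ S (S i)) with (z * z ^ S i).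
      assert (z ^ S i <> 0) by (apply pow_nonzero; lra). field. split; [lra|assumption].
Qed.

(* [plap l i z] is the integral of [u^i * peval l u * exp (- z u)] over [u >= 0]. *)
Fixpoint plap (l : list R) (i : nat) (z : R) : R :=
  match l with nil => 0 | a :: l' => a * (INR (fact i) / z ^ S i) + plap l' (S i) z end.

Lemma laplace_poly (l : list R) (i : nat) (z : R) : 0 < z -> exists W, (forall b, 1 <= b ->
  is_RInt (fun r => ln r ^ i * peval l (ln r) * exp (- z * ln r) / r) 1 b (W b)) /\
  small (fun b => W b - plap l i z).
Proof.
  intros Hz. revert i. induction l as [|a l IH]; intros i.
  - exists (fun _ => 0). split.
    + intros b Hb. apply (is_RInt_ext (fun _ => 0)). intros r _. simpl. unfold Rdiv. Req. ring.
      apply is_RInt_0.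
    + eapply small_ext. 2: apply (small_exp 0 1 Rlt_0_1). intros; simpl; ring.
  - destruct (IH (S i)) as [W [HW1 HW2]]. destruct (laplace_mono i z Hz) as [U [HU1 HU2]].
    exists (fun b => a * U b + W b). split.
    + intros b Hb. pose proof (is_RInt_plus _ _ _ _ _ _ (is_RInt_scal _ _ _ a _ (HU1 b Hb)) (HW1 b Hb)) as M.
      eapply is_RInt_ext. 2: exact M. intros r Hr. rewrite Rmin_left in Hr by lra.
      change (a * (ln r ^ i * exp (- z * ln r) / r) + ln r ^ S i * peval l (ln r) * exp (- z * ln r) / r =
        ln r ^ i * peval (a :: l) (ln r) * exp (- z * ln r) / r). simpl. field. lra.
    + eapply small_ext. 2: exact (small_plus _ _ (small_scal a _ HU2) HW2). intros; simpl; ring.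
Qed.

(** * The Dirichlet series of d_k *)

Definition pw (s : R) (n : nat) : R := exp (- s * ln (INR n)).

Lemma pw_pos (s : R) (n : nat) : 0 < pw s n. Proof. apply exp_pos. Qed.

Lemma pw_mult (s : R) (m n : nat) : pw s (S m * S n) = pw s (S m) * pw s (S n).
Proof.
  unfold pw. rewrite mult_INR, ln_mult by (apply lt_0_INR; lia). rewrite <- exp_plus. f_equal. ring.
Qed.

Lemma xpow_real (n : nat) (s : R) : xpow (INR n) (RtoC s) = RtoC (pw s n).
Proof.
  unfold xpow, cexp, pw. rewrite Re_scal, Im_scal, Re_RtoC, Im_RtoC, Rmult_0_r, cos_0, sin_0.
  apply C_eq; simpl. rewrite Rmult_1_r. f_equal. ring. ring.
Qed.

Lemma Sn_real (N : nat) (s : R) : Sn N (RtoC s) = RtoC (fsum (fun i => pw s (S i)) N).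
Proof. unfold Sn. induction N. reflexivity. cbn [Csumn fsum]. rewrite IHN, xpow_real, RtoC_plus. reflexivity.
Qed.

(** [lz] is the number [Zf (1 + z)], real because the coefficients [zc] are. The expansion of its
    k-th power and the value of the sum of n^(-1-z) are collected here for later comparison. *)
Lemma real_zeta (z : R) : 0 < z <= 1 -> exists lz : R,
  (forall k, is_series (fun i => Lam k i * z ^ i) (lz ^ k)) /\
  is_lim_seq (fun i => pw (1 + z) (S i)) 0 /\
  is_lim_seq (fun N => fsum (fun i => pw (1 + z) (S i)) N) (lz / z).
Proof.
  intros Hz. assert (Hm : Cmod (RtoC z) = z) by (rewrite Cmod_R, Rabs_pos_eq; lra).
  pose proof (pser_zc (RtoC z) ltac:(lra)) as P.
  assert (A : absconv zc z) by (apply (absconv_le _ (5 / 4)); [lra|apply absconv_zc]).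
  assert (E : ex_series (fun n => zc n * z ^ n)).
  { apply ex_series_Rle with (2 := A). intros n.
    rewrite Rabs_mult, (Rabs_pos_eq (z ^ n)) by (apply pow_le; lra). lra. }
  destruct E as [lz Hlz]. apply pser_real in Hlz. pose proof (pser_unique _ _ _ _ P Hlz) as EZ.
  rewrite <- RtoC_plus in EZ.
  exists lz. split; [|split].
  - intros k. apply pser_real. rewrite RtoC_pow, <- EZ, RtoC_plus. apply pser_Lam. lra.
  - apply (exp_ln_INR_lim (1 + z)). lra.
  - apply is_lim_seq_incr_1.
    pose proof (Zf_limit (RtoC (1 + z)) ltac:(simpl; lra)) as [L _]. rewrite EZ in L.
    simpl (Re (RtoC lz)) in L.
    assert (L2 : is_lim_seq (fun N => z * fsum (fun i => pw (1 + z) (S i)) (S N) + pw z (S N)) lz).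
    { eapply is_lim_seq_ext. 2: exact L. intros N. cbv beta.
      replace (RtoC (1 + z) - 1)%C with (RtoC z) by (rewrite RtoC_plus; ring).
      rewrite Sn_real, xpow_real, <- RtoC_mult, <- RtoC_plus. reflexivity. }
    assert (L3 : is_lim_seq (fun N => pw z (S N)) 0) by (apply exp_ln_INR_lim; lra).
    pose proof (is_lim_seq_minus' _ _ _ _ L2 L3) as L4.
    apply (is_lim_seq_ext (fun N => / z * (z * fsum (fun i => pw (1 + z) (S i)) (S N) + pw z (S N) - pw z (S
      N)))). intros; Req; field; lra.
    replace (lz / z) with (/ z * (lz - 0)) by (field; lra). apply is_lim_seq_mult'; auto.
    apply is_lim_seq_const.
Qed.

Definition DP (s : R) (k X : nat) : R := fsum (fun j => INR (dk k (S j)) * pw s (S j)) X.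

Lemma DP_mono (s : R) (k n m : nat) : (n <= m)%nat -> DP s k n <= DP s k m.
Proof. intros H. apply fsum_mono_n; auto. intros i. apply Rmult_le_pos. apply pos_INR. left; apply pw_pos.
Qed.

Lemma DP_pos (s : R) (k n : nat) : 0 <= DP s k n.
Proof. apply (DP_mono s k 0 n). lia. Qed.

Lemma DP_S (s : R) (k X : nat) : DP s (S k) X = fsum (fun i => pw s (S i) * DP s k (X / S i)) X.
Proof.
  unfold DP. rewrite (fsum_ext _ (fun j => dconv (fun m => INR (dk k m)) (S j) * pw s (S j))) by (intros;
    now rewrite dk_dconv).
  rewrite dconv_sum. apply fsum_ext. intros i _. rewrite <- fsum_scal. apply fsum_ext. intros e _.
  rewrite pw_mult. ring.
Qed.

(** A squeeze: all products of an index up to N with another up to N lie below N^2, so the product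
    of the partial sums at N is at most the next partial sum at N^2, and at least the next one at
    N. *)
Lemma DP_lim (s : R) (ze : R) : is_lim_seq (fun N => fsum (fun i => pw s (S i)) N) ze -> forall k,
  is_lim_seq (DP s k) (ze ^ k).
Proof.
  intros Hz. assert (P1 : forall N, 0 <= fsum (fun i => pw s (S i)) N) by (intros; apply fsum_pos; intros;
    left; apply pw_pos).
  assert (U1 : forall N, fsum (fun i => pw s (S i)) N <= ze).
  { intros N. apply (is_lim_seq_incr_compare (fun N => fsum (fun i => pw s (S i)) N) ze); auto. intros n.
    simpl. pose proof (pw_pos s (S n)). lra. }
  induction k.
  - simpl. apply (is_lim_seq_ext_loc (fun _ => 1)); [|apply is_lim_seq_const]. exists 1%nat. intros n Hn.
    destruct n; [lia|].
    unfold DP. rewrite fsum_head, (fsum_ext _ (fun _ => 0)), fsum_const by (intros; simpl; ring).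
    simpl. unfold pw. simpl INR. rewrite ln_1, Rmult_0_r, exp_0. ring.
  - assert (Uk : forall N, DP s k N <= ze ^ k). { intros N.
    apply (is_lim_seq_incr_compare (DP s k) (ze ^ k)); auto. intros n. apply DP_mono. lia. }
    assert (UB : forall N, DP s (S k) N <= fsum (fun i => pw s (S i)) N * DP s k N).
    { intros N. rewrite DP_S, Rmult_comm, <- fsum_scal. apply fsum_le. intros i Hi. rewrite Rmult_comm.
      apply Rmult_le_compat_r. left; apply pw_pos.
      apply DP_mono. apply Nat.Div0.div_le_upper_bound. nia. }
    assert (LB : forall N, fsum (fun i => pw s (S i)) N * DP s k N <= DP s (S k) (N * N)%nat).
    { intros N. rewrite DP_S. apply Rle_trans with (fsum (fun i => pw s (S i) * DP s k (N * N / S i)) N).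
      - rewrite Rmult_comm, <- fsum_scal. apply fsum_le. intros i Hi. rewrite Rmult_comm.
        apply Rmult_le_compat_l. left; apply pw_pos.
        apply DP_mono. apply le_div_iff; nia.
      - apply fsum_mono_n. intros i. apply Rmult_le_pos. left; apply pw_pos. apply DP_pos. nia. }
    assert (LP : is_lim_seq (fun N => fsum (fun i => pw s (S i)) N * DP s k N) (ze * ze ^ k)) by (now apply
      is_lim_seq_mult').
    destruct (ex_finite_lim_seq_incr (DP s (S k)) (ze * ze ^ k)) as [L HL].
    + intros n. apply DP_mono. lia.
    + intros n. apply Rle_trans with (1 := UB n). apply Rmult_le_compat; auto. apply DP_pos.
    + assert (L1 : L <= ze * ze ^ k) by exact (is_lim_seq_le _ _ _ _ UB HL LP).
      assert (HL2 : is_lim_seq (fun N => DP s (S k) (N * N)) L).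
      { apply (is_lim_seq_subseq (DP s (S k)) L (fun N => (N * N)%nat)); auto. apply eventually_subseq.
        intros n. nia. }
      assert (L2 : ze * ze ^ k <= L) by exact (is_lim_seq_le _ _ _ _ LB LP HL2).
      simpl. replace (ze * ze ^ k) with L by lra. exact HL.
Qed.

(** * Identification of the main term and of the moments *)

(** Coefficients of Zf(1+z)^k / (1+z) at z = 0. *)
Definition mu (k n : nat) : R := fsum (fun l => (-1) ^ (n - l) * Lam k l) (S n).

Lemma mu_S (k n : nat) : mu k (S n) = Lam k (S n) - mu k n.
Proof.
  unfold mu. change (fsum ?f (S (S n))) with (fsum f (S n) + f (S n)). cbv beta. rewrite Nat.sub_diag.
  rewrite (fsum_ext _ (fun l => (-1) * ((-1) ^ (n - l) * Lam k l))).
  - rewrite fsum_scal. simpl pow. ring.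
  - intros i Hi. replace (S n - i)%nat with (S (n - i)) by lia. simpl. ring.
Qed.

Lemma mu_0 (k : nat) : mu k 0 = Lam k 0.
Proof. unfold mu. simpl. ring. Qed.

Lemma altrec_unique (x y : nat -> R) : x 0%nat = y 0%nat -> (forall n, x (S n) + x n = y (S n) + y n) ->
  forall n, x n = y n.
Proof. intros H0 H n. induction n; auto. specialize (H n). lra. Qed.

Lemma shiftn_lt (i m : nat) (a : nat -> R) : (m < i)%nat -> shiftn i a m = 0.
Proof. revert m. induction i; intros m H; [lia|]. simpl. destruct m; auto. simpl. apply IHi. lia. Qed.

Lemma is_series_shiftn (i : nat) (a : nat -> R) (z l : R) : is_series (fun n => a n * z ^ n) l ->
  is_series (fun n => shiftn i a n * z ^ n) (z ^ i * l).
Proof. rewrite !pser_real. intros H. rewrite RtoC_mult, RtoC_pow. now apply pser_shiftn. Qed.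

Lemma is_series_shiftc (a : nat -> R) (z l : R) : is_series (fun n => a n * z ^ n) l ->
  is_series (fun n => shiftc a n * z ^ n) (z * l).
Proof. rewrite !pser_real. intros H. rewrite RtoC_mult. now apply pser_shiftc. Qed.

(** Multiplication by z^D clears all negative powers, so the transform of a polynomial can be
    compared with power series coefficient by coefficient. *)
Lemma plap_nth (l : list R) (i D : nat) (z : R) : 0 < z -> (length l + i <= D)%nat ->
  z ^ D * plap l i z = fsum (fun m => nth (D - 1 - m - i) l 0 * INR (fact (D - 1 - m)) * z ^ m) (D - i).
Proof.
  intros Hz. revert i. induction l as [|a l IH]; intros i H.
  - simpl plap. rewrite Rmult_0_r. symmetry. rewrite (fsum_ext _ (fun _ => 0)), fsum_const. ring.
    intros m _. destruct (D - 1 - m - i)%nat; simpl; ring.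
  - simpl in H. simpl plap. rewrite Rmult_plus_distr_l, IH by (simpl; lia).
    replace (D - i)%nat with (S (D - S i)) by lia. cbn [fsum].
    replace (D - 1 - (D - S i) - i)%nat with 0%nat by lia. simpl (nth 0 _ _).
    replace (D - 1 - (D - S i))%nat with i by lia. rewrite Rplus_comm. f_equal.
    + apply fsum_ext. intros m Hm. replace (D - 1 - m - i)%nat with (S (D - 1 - m - S i)) by lia. reflexivity.
    + replace D with (D - S i + S i)%nat at 1 by lia. rewrite pow_add. simpl (z ^ S i). field.
      split; [apply pow_nonzero|]; lra.
Qed.

Lemma peval_nth (l : list R) (D : nat) (u : R) : (length l <= D)%nat -> peval l u =
  fsum (fun j => nth j l 0 * u ^ j) D.
Proof.
  revert D. induction l as [|a l IH]; intros D H.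
  - rewrite (fsum_ext _ (fun _ => 0)), fsum_const. simpl; ring. intros [|j] _; simpl; ring.
  - destruct D; simpl in H; [lia|]. rewrite fsum_head. simpl. rewrite (IH D) by lia. rewrite <- fsum_scal.
    f_equal. ring.
    apply fsum_ext. intros; ring.
Qed.

Lemma continuous_ln (r : R) : 0 < r -> continuous ln r.
Proof. intros H. apply (ex_derive_continuous ln). eexists. now apply is_derive_ln. Qed.

Lemma continuous_peval (l : list R) (u : R) : continuous (peval l) u.
Proof.
  induction l as [|a l IH]; simpl. apply continuous_const.
  apply (continuous_plus (V := R_NormedModule) (fun _ => a) (fun u => u * peval l u)). apply continuous_const.
  apply (continuous_mult (fun u => u) (peval l)). apply continuous_id. auto.
Qed.

Lemma continuous_pw (n : nat) (r : R) : 0 < r -> continuous (fun r => / r ^ n) r.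
Proof. intros H. apply (ex_derive_continuous (fun r => / r ^ n)). auto_derive. apply pow_nonzero. lra. Qed.

(** Delta_k(r)/r, once [Q] has been identified with [Pk k]. *)
Definition err (k : nat) (Q : list R) (r : R) : R := Dk k r / r - peval Q (ln r).

Lemma err_int (k : nat) (Q : list R) (Phi : R -> R) : (forall u, continuous Phi u) ->
  forall b, 1 <= b -> ex_RInt (fun r => err k Q r * Phi (ln r) / r) 1 b.
Proof.
  intros HP b Hb.
  assert (HPl : forall r, 0 < r -> continuous (fun r => Phi (ln r)) r) by (intros r Hr; apply continuous_comp;
    [now apply continuous_ln|auto]).
  apply (ex_RInt_ext (fun r => minus (Dk k r * (Phi (ln r) * / r ^ 2)) (peval Q (ln r) * (Phi (ln r) * / r ^
    1)))).
  - intros r Hr. rewrite Rmin_left in Hr by lra. change (minus ?p ?q) with (p - q). unfold err. Req. field.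
    lra.
  - apply (ex_RInt_minus (V := R_NormedModule)).
    + apply ex_RInt_SS; auto. intros r Hr. apply (continuous_mult (fun r => Phi (ln r)) (fun r => / r ^ 2)).
      apply HPl; lra. apply continuous_pw; lra.
    + apply (ex_RInt_continuous (V := R_CompleteNormedModule)). intros r Hr.
      rewrite Rmin_left, Rmax_right in Hr by lra.
      apply (continuous_mult (fun r => peval Q (ln r)) (fun r => Phi (ln r) * / r ^ 1)).
      apply continuous_comp. apply continuous_ln; lra. apply continuous_peval.
      apply (continuous_mult (fun r => Phi (ln r)) (fun r => / r ^ 1)). apply HPl; lra.
      apply continuous_pw; lra.
Qed.

Lemma continuous_mono (j : nat) (u : R) : continuous (mono j) u.
Proof. apply (ex_derive_continuous (mono j)). unfold mono. auto_derive. auto. Qed.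

Lemma err_moments (k : nat) : exists Q C d m, 0 <= C /\ 0 < d /\
  (forall x, 1 <= x -> Rabs (err k Q x) <= C * exp (- d * ln x)) /\
  (forall j, small (fun b => RInt (fun r => err k Q r * mono j (ln r) / r) 1 b - m j)) /\
  (forall j, Rabs (m j) <= C * (2 / d) * (2 / d) ^ j).
Proof.
  destruct (asym_Dk k) as [Q [C [d [HC [Hd H]]]]]. fold (err k Q) in H. exists Q, C, d.
  assert (Hex : forall j b, 1 <= b -> ex_RInt (fun r => err k Q r * mono j (ln r) / r) 1 b) by (intros j b Hb;
    apply err_int; auto; intros; apply continuous_mono).
  assert (Hsm : forall j, small (fun r => err k Q r * mono j (ln r))).
  { intros j. apply (small_ext _ (fun r => peval (pmono (/ INR (fact j)) j) (ln r) * err k Q r)).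
    - intros x _. rewrite peval_pmono. unfold mono, Rdiv. ring.
    - apply small_mult_poly. exists C, d. auto. }
  assert (Hm0 : forall j, exists c, small (fun b => RInt (fun r => err k Q r * mono j (ln r) / r) 1 b - c)).
  { intros j. apply (small_int (fun r => err k Q r * mono j (ln r))); auto. }
  set (m := fun j => proj1_sig (constructive_indefinite_description _ (Hm0 j))).
  assert (Hm : forall j, small (fun b => RInt (fun r => err k Q r * mono j (ln r) / r) 1 b - m j)).
  { intros j. exact (proj2_sig (constructive_indefinite_description _ (Hm0 j))). }
  exists m. repeat split; auto. intros j.
  pose proof (small_minus_lim_seq (fun b => RInt (fun r => err k Q r * mono j (ln r) / r) 1 b) (m j) (Hm j))
    as L.
  apply (is_lim_seq_abs _ (m j)) in L.
  refine (is_lim_seq_le _ (fun _ => _) _ (Finite _) _ L (is_lim_seq_const _)). intros n. cbv beta.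
  set (b := INR (S n)). assert (Hb : 1 <= b) by apply INR_S_ge1.
  assert (Hd2 : 0 < 2 / d) by (apply Rdiv_lt_0_compat; lra).
  set (K := C * (2 / d) ^ j). assert (HK : 0 <= K) by (apply Rmult_le_pos; auto; apply pow_le; lra).
  apply Rle_trans with (K * ((exp (- (d / 2) * ln 1) - exp (- (d / 2) * ln b)) / (d / 2))).
  - apply (RInt_abs_le _ (fun r => K * (exp (- (d / 2) * ln r) / r))); auto.
    + apply (is_RInt_scal (V := R_NormedModule) (fun r => exp (- (d / 2) * ln r) / r)).
      apply is_RInt_exp_ln; lra.
    + intros r Hr. pose proof (ln_ge_0 r ltac:(lra)) as Hu. unfold Rdiv at 1 2.
      rewrite Rabs_mult, (Rabs_pos_eq (/ r)), <- Rmult_assoc by (left; apply Rinv_0_lt_compat; lra).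
      apply Rmult_le_compat_r. left; apply Rinv_0_lt_compat; lra.
      rewrite Rabs_mult, (Rabs_pos_eq (mono _ _)) by (now apply mono_pos).
      apply Rle_trans with ((C * exp (- d * ln r)) * ((2 / d) ^ j * exp (d / 2 * ln r))).
      * apply Rmult_le_compat; auto. apply Rabs_pos. now apply mono_pos. apply H; lra. now apply mono_bound.
      * right. unfold K. replace (- (d / 2) * ln r) with (- d * ln r + d / 2 * ln r) by field.
        rewrite exp_plus. ring.
  - rewrite ln_1, Rmult_0_r, exp_0. pose proof (exp_pos (- (d / 2) * ln b)).
    replace (C * (2 / d) * (2 / d) ^ j) with (K * (1 / (d / 2))) by (unfold K; field; lra).
    apply Rmult_le_compat_l; auto.
    apply Rmult_le_compat_r. left; apply Rinv_0_lt_compat; lra. lra.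
Qed.

Lemma continuous_exp_scal (z u : R) : continuous (fun u => exp (- z * u)) u.
Proof. apply (ex_derive_continuous (fun u => exp (- z * u))). auto_derive. auto. Qed.

(** Abel summation of d_k(n) against r^(-1-z). As the upper limit grows, the boundary term vanishes
    and the integral splits into the transforms of the error term and of the polynomial; the former
    is a power series in z, as z < d/2. The sum itself tends to zeta(1+z)^k = (lz/z)^k. *)
Lemma laplace_identity (k : nat) (Q : list R) (C d : R) (m : nat -> R) (z : R) :
  0 <= C -> 0 < d ->
  (forall x, 1 <= x -> Rabs (err k Q x) <= C * exp (- d * ln x)) ->
  (forall j, small (fun b => RInt (fun r => err k Q r * mono j (ln r) / r) 1 b - m j)) ->
  0 < z <= 1 -> z * (2 / d) < 1 ->
  exists G lz, is_series (fun j => (-1) ^ j * m j * z ^ j) G /\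
    is_series (fun i => Lam k i * z ^ i) (lz ^ k) /\
    (1 + z) * (G + plap Q 0 z) = (lz / z) ^ k.
Proof.
  intros HC Hd He Hm Hz Hzd. destruct (real_zeta z Hz) as [lz [Z1 [_ Z3]]].
  pose proof (DP_lim (1 + z) (lz / z) Z3 k) as LD. apply is_lim_seq_incr_1 in LD.
  destruct (moment_series (err k Q) C d (fun j => (- z) ^ j) m (fun u => exp (- z * u)) HC Hd He) as [G [G1
    G2]].
  - exists (/ (1 - z * (2 / d))). eapply is_series_ext. 2: apply geom_series.
    + intros n. rewrite <- RPow_abs, Rabs_Ropp, Rabs_pos_eq by lra. Req. apply Rpow_mult_distr.
    + split; auto. apply Rmult_le_pos. lra. left. apply Rdiv_lt_0_compat; lra.
  - intros u Hu. eapply is_series_ext. 2: apply is_series_exp. intros n. cbv beta. unfold mono, Rdiv.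
    rewrite Rpow_mult_distr. Req. ring.
  - apply (err_int k Q (fun u => exp (- z * u))). apply continuous_exp_scal.
  - intros j. apply err_int. apply continuous_mono.
  - exact Hm.
  - exists G, lz. split; [|split; auto].
    { eapply is_series_ext. 2: exact G2. intros n. cbv beta. replace (- z) with (-1 * z) by ring.
      rewrite Rpow_mult_distr. Req. ring. }
    destruct (laplace_poly Q 0 z ltac:(lra)) as [W [W1 W2]].
    assert (Eq : forall n, Dk k (INR (S n)) / INR (S n) * exp (- z * ln (INR (S n))) +
       (1 + z) * (RInt (fun r => err k Q r * exp (- z * ln r) / r) 1 (INR (S n)) + W (INR (S n))) =
         DP (1 + z) k (S n)).
    { intros n. set (b := INR (S n)). assert (Hb : 1 <= b) by apply INR_S_ge1.
      set (f := fun r => exp (- (1 + z) * ln r)). set (f' := fun r => - (1 + z) * exp (- (1 + z) * ln r) / r).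
      assert (AB : is_RInt (fun r => Dk k r * f' r) 1 b (Dk k b * f b - SS (fun n => INR (dk k n) * f (INR n))
        b)).
      { apply (abel_summation (fun n => INR (dk k n)) f f' b Hb).
        - intros r Hr. unfold f, f'. auto_derive. lra. field. lra.
        - intros r Hr. apply (ex_derive_continuous f'). unfold f'. auto_derive. repeat split; lra. }
      assert (ES : SS (fun n => INR (dk k n) * f (INR n)) b = DP (1 + z) k (S n)).
      { unfold SS, DP, b. rewrite nf_INR. reflexivity. }
      rewrite ES in AB.
      assert (EX : ex_RInt (fun r => err k Q r * exp (- z * ln r) / r) 1 b) by (apply (err_int k Q (fun u =>
        exp (- z * u))); auto; apply continuous_exp_scal).
      pose proof (is_RInt_scal _ _ _ (- (1 + z)) _ (is_RInt_plus _ _ _ _ _ _ (RInt_correct _ _ _ EX) (W1 b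
        Hb))) as AC.
      assert (U : Dk k b * f b - DP (1 + z) k (S n) = - (1 + z) * (RInt (fun r => err k Q r * exp (- z * ln r)
        / r) 1 b + W b)).
      { rewrite <- (is_RInt_unique _ _ _ _ AB). apply is_RInt_unique. eapply is_RInt_ext. 2: exact AC.
        intros r Hr. rewrite Rmin_left in Hr by lra.
        change (- (1 + z) * (err k Q r * exp (- z * ln r) / r + ln r ^ 0 * peval Q (ln r) * exp (- z * ln r) /
          r) = Dk k r * f' r).
        unfold err, f'. replace (- (1 + z) * ln r) with (- z * ln r + - ln r) by ring.
        rewrite exp_plus, exp_Ropp, exp_ln by lra. simpl. field. lra. }
      unfold f in U. replace (- (1 + z) * ln b) with (- z * ln b + - ln b) in U by ring.
      rewrite exp_plus, exp_Ropp, exp_ln in U by lra.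
      replace (Dk k b / b * exp (- z * ln b)) with (Dk k b * (exp (- z * ln b) * / b)) by (unfold Rdiv; ring).
      lra. }
    assert (L1 : is_lim_seq (fun n => Dk k (INR (S n)) / INR (S n) * exp (- z * ln (INR (S n)))) 0).
    { apply (small_lim_seq (fun x => Dk k x / x * exp (- z * ln x))). eapply small_ext.
      2: apply (small_mult_asym (fun x => 1 * exp (- z * ln x)) (fun x => Dk k x / x)); [apply small_exp;
           lra|apply asym_Dk]. intros; cbv beta; ring. }
    assert (L2 : is_lim_seq (DP (1 + z) k) (0 + (1 + z) * (G + plap Q 0 z))).
    { apply is_lim_seq_incr_1. apply (is_lim_seq_ext _ _ _ Eq). apply is_lim_seq_plus'; auto.
      apply is_lim_seq_mult'. apply is_lim_seq_const.
      apply is_lim_seq_plus'. apply (small_minus_lim_seq (fun b => RInt (fun r => err k Q r * exp (- z * ln r)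
        / r) 1 b)). exact G1.
      apply small_minus_lim_seq. exact W2. }
    apply is_lim_seq_incr_1 in L2. apply is_lim_seq_unique in L2. apply is_lim_seq_unique in LD.
    rewrite LD in L2. injection L2 as L2. lra.
Qed.

(* Multiplied by [z^(k+D)], with [D] large, both sides of [laplace_identity] are power series in [z];
   comparing coefficients yields the polynomial [Q] and the moments at once. *)
Lemma identification (k : nat) (Q : list R) (C d : R) (m : nat -> R) :
  0 <= C -> 0 < d ->
  (forall x, 1 <= x -> Rabs (err k Q x) <= C * exp (- d * ln x)) ->
  (forall j, small (fun b => RInt (fun r => err k Q r * mono j (ln r) / r) 1 b - m j)) ->
  (forall j, (-1) ^ j * m j = mu k (j + k)) /\ (forall u, peval Q u = Pk k u).
Proof.
  intros HC Hd He Hm. set (D := (length Q + k)%nat).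
  set (p := fun i => if Nat.ltb i D then nth (D - 1 - i) Q 0 * INR (fact (D - 1 - i)) else 0).
  set (ga := fun j => (-1) ^ j * m j).
  (* [p], [ga] and [e'] are the coefficients of z^D [plap Q 0 z], of G and of z^D times their sum.
     The further factor z^k in [x] removes the pole of (lz/z)^k, so the identity becomes (1 + z)
     x(z) = z^D lz^k. *)
  set (e' := fun i => p i + shiftn D ga i). set (x := shiftn k e').
  assert (Hx : forall n, x n + shiftc x n = shiftn D (Lam k) n).
  { apply (coef_unique _ _ (Rmin 1 (d / 2))). apply Rmin_pos; lra. intros z Hz.
    assert (Hz1 : z < 1) by (pose proof (Rmin_l 1 (d / 2)); lra).
    assert (Hz2 : z < d / 2) by (pose proof (Rmin_r 1 (d / 2)); lra).
    assert (Hzd : z * (2 / d) < 1). { apply Rmult_lt_reg_r with (d / 2). lra.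
    replace (z * (2 / d) * (d / 2)) with z by (field; lra). lra. }
    destruct (laplace_identity k Q C d m z HC Hd He Hm ltac:(lra) Hzd) as [G [lz [S1 [S2 ID]]]].
    exists (z ^ D * lz ^ k). split; [|now apply is_series_shiftn].
    assert (Sp : is_series (fun i => p i * z ^ i) (z ^ D * plap Q 0 z)).
    { rewrite plap_nth by (unfold D; lia || lra). rewrite Nat.sub_0_r.
      rewrite (fsum_ext _ (fun i => p i * z ^ i)).
      - apply (finite_series (fun i => p i * z ^ i)). intros i Hi. unfold p.
        destruct (Nat.ltb_spec i D); [lia|ring].
      - intros i Hi. unfold p. destruct (Nat.ltb_spec i D); [|lia]. rewrite Nat.sub_0_r. reflexivity. }
    assert (Se : is_series (fun i => e' i * z ^ i) (z ^ D * plap Q 0 z + z ^ D * G)).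
    { eapply is_series_ext. 2: exact (is_series_Rplus _ _ _ _ Sp (is_series_shiftn D ga z G S1)). intros i.
      unfold e'. Req. ring. }
    pose proof (is_series_shiftn k e' z _ Se) as Sx. fold x in Sx.
    assert (E : z ^ D * lz ^ k = z ^ k * (z ^ D * plap Q 0 z + z ^ D * G) + z * (z ^ k * (z ^ D * plap Q 0 z +
      z ^ D * G))).
    { replace (z ^ k * (z ^ D * plap Q 0 z + z ^ D * G) + z * (z ^ k * (z ^ D * plap Q 0 z + z ^ D * G)))
        with (z ^ D * (z ^ k * ((1 + z) * (G + plap Q 0 z)))) by ring.
      rewrite ID, <- Rpow_mult_distr. do 2 f_equal. field. lra. }
    rewrite E. eapply is_series_ext. 2: exact (is_series_Rplus _ _ _ _ Sx (is_series_shiftc x z _ Sx)).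
    intros i. Req. ring. }
  (* The other solution of the same equation; it is unique because 1 + z is invertible as a power
     series. *)
  set (y := shiftn D (mu k)).
  assert (Hy : forall n, y n + shiftc y n = shiftn D (Lam k) n).
  { intros n. unfold y. destruct (Nat.lt_ge_cases n D) as [h|h].
    - rewrite !shiftn_lt by auto. destruct n; simpl; try rewrite shiftn_lt by lia; ring.
    - replace n with ((n - D) + D)%nat by lia. set (j := (n - D)%nat). rewrite !shiftn_add.
      destruct j as [|j].
      + simpl (0 + D)%nat. rewrite mu_0. replace (shiftc (shiftn D (mu k)) D) with 0. ring.
        destruct D; cbn [shiftc]; [reflexivity|]. now rewrite shiftn_lt by lia.
      + simpl (S j + D)%nat. cbn [shiftc]. rewrite shiftn_add, mu_S. ring. }
  assert (Exy : forall n, x n = y n).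
  { apply altrec_unique.
    - pose proof (Hx 0%nat) as H1. pose proof (Hy 0%nat) as H2. simpl in H1, H2. lra.
    - intros n. pose proof (Hx (S n)) as H1. pose proof (Hy (S n)) as H2. simpl shiftc in H1, H2. lra. }
  assert (Ee : forall i, e' i = shiftn D (mu k) (i + k)).
  { intros i. change (shiftn D (mu k) (i + k)) with (y (i + k)%nat). rewrite <- Exy. unfold x.
    now rewrite shiftn_add. }
  split.
  - intros j. specialize (Ee (j + D)%nat). unfold e', p in Ee. rewrite shiftn_add in Ee.
    destruct (Nat.ltb_spec (j + D) D); [lia|]. replace (j + D + k)%nat with (j + k + D)%nat in Ee by lia.
    rewrite shiftn_add in Ee. unfold ga in Ee. lra.
  - intros u. unfold Pk. rewrite rsum_fsum, (peval_nth Q D) by (unfold D; lia).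
    assert (Hq : forall j, (j < D)%nat -> nth j Q 0 * INR (fact j) = shiftn D (mu k) (D - 1 - j + k)).
    { intros j Hj. rewrite <- Ee. unfold e', p. destruct (Nat.ltb_spec (D - 1 - j) D); [|lia].
      rewrite shiftn_lt by lia.
      replace (D - 1 - (D - 1 - j))%nat with j by lia. ring. }
    replace D with (k + length Q)%nat at 1 by (unfold D; lia). rewrite fsum_app.
    rewrite (fsum_ext (fun i => nth (k + i) Q 0 * u ^ (k + i)) (fun _ => 0)), fsum_const.
    + rewrite Rmult_0_r, Rplus_0_r. apply fsum_ext. intros j Hj. simpl (0 + j)%nat.
      specialize (Hq j ltac:(unfold D; lia)).
      replace (D - 1 - j + k)%nat with ((k - 1 - j) + D)%nat in Hq by (unfold D; lia).
      rewrite shiftn_add in Hq.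
      f_equal. replace (a_coef j k) with (mu k (k - 1 - j)). rewrite <- Hq. field. apply INR_fact_neq_0.
      unfold a_coef, mu. rewrite rsum_fsum, <- fsum_scal. apply fsum_ext. intros i Hi. simpl (0 + i)%nat.
      unfold Rdiv. rewrite (Rmult_assoc ((-1) ^ i)). fold (Rdiv (lam i k) (INR (fact i))). rewrite lam_zc.
      fold (Lam k i).
      replace ((-1) ^ (k - 1 - j)) with ((-1) ^ (k - 1 - j - i) * (-1) ^ i) by (rewrite <- pow_add; f_equal;
        lia).
      replace ((-1) ^ (k - 1 - j - i) * (-1) ^ i * ((-1) ^ i * Lam k i)) with ((-1) ^ (k - 1 - j - i) * ((-1)
        ^ i * (-1) ^ i) * Lam k i) by ring.
      rewrite <- Rpow_mult_distr. replace (-1 * -1) with 1 by ring. rewrite pow1. ring.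
    (* A coefficient of [Q] of index at least k corresponds to a pole of order greater than k; it is
       matched with an entry of [shiftn D (mu k)] below D, which is zero. *)
    + intros i Hi. specialize (Hq (k + i)%nat ltac:(unfold D; lia)).
      rewrite shiftn_lt in Hq by (unfold D; lia).
      apply Rmult_integral in Hq. destruct Hq as [-> | Hq]; [ring|]. now apply INR_fact_neq_0 in Hq.
Qed.

(** * The power series of phi and of exp(x) phi(x) *)

Lemma is_RInt_gen_intro (f : R -> R) (a l : R) :
  (forall b, a <= b -> ex_RInt f a b) ->
  (forall eps, 0 < eps -> exists M, forall b, M < b -> a <= b -> Rabs (RInt f a b - l) < eps) ->
  is_RInt_gen f (at_point a) (Rbar_locally p_infty) l.
Proof.
  intros Hex H P [eps HP]. destruct (H eps (cond_pos eps)) as [M HM].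
  apply (Filter_prod _ _ _ (fun x => x = a) (fun b => Rmax M a < b)).
  - reflexivity.
  - exists (Rmax M a). auto.
  - intros x b -> Hb. pose proof (Rmax_l M a). pose proof (Rmax_r M a). exists (RInt f a b). split.
    + apply (RInt_correct (V := R_CompleteNormedModule)). apply Hex. lra.
    + apply HP. apply HM; lra.
Qed.

Lemma small_eventually (g : R -> R) (eps : R) : small g -> 0 < eps -> exists M, forall b, M < b -> 1 <= b ->
  Rabs (g b) < eps.
Proof.
  intros [C [d [HC [Hd H]]]] He. set (t := eps / (C + 1)).
  assert (Ht : 0 < t) by (apply Rdiv_lt_0_compat; lra).
  exists (exp (- ln t / d)). intros b Hb H1. eapply Rle_lt_trans. apply H; auto.
  assert (L : - ln t / d < ln b). { rewrite <- (ln_exp (- ln t / d)). apply ln_increasing; auto.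
  apply exp_pos. }
  assert (L2 : exp (- d * ln b) < t).
  { rewrite <- (exp_ln t) by auto. apply exp_increasing. apply Rmult_lt_compat_l with (r := d) in L; auto.
    replace (d * (- ln t / d)) with (- ln t) in L by (field; lra). lra. }
  apply Rle_lt_trans with (C * t). apply Rmult_le_compat_l; lra.
  replace eps with ((C + 1) * t) by (unfold t; field; lra). lra.
Qed.

(** The moments of Delta_k(r)/r against u^j / j! in u = log r, with the sign (-1)^j, by
    [identification]. *)
Definition gam (k j : nat) : R := mu k (j + k).

(** J_0(2 sqrt(x u)) is the sum of (-x)^j / j! times u^j / j!, so [moment_series] applies with [al],
    and its sign cancels the one between the moments and [gam]. The factor r^(-2) in [phi] splits
    into 1/r for [err] and 1/r for du. *)
Lemma phi_series (k : nat) (x : R) : 0 <= x ->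
  is_series (fun j => gam k j / INR (fact j) * x ^ j) (phi k x) /\
    ex_series (fun j => Rabs (gam k j / INR (fact j) * x ^ j)).
Proof.
  intros Hx. destruct (err_moments k) as [Q [C [d [m [HC [Hd [He [Hm Hb]]]]]]]].
  destruct (identification k Q C d m HC Hd He Hm) as [Ig IQ].
  assert (Hf : forall n, 0 < / INR (fact n) <= 1).
  { intros n. split. apply Rinv_0_lt_compat, INR_fact_lt_0. apply Rinv_le_1. apply (le_INR 1).
    apply lt_O_fact. }
  set (al := fun j => (-1) ^ j * x ^ j / INR (fact j)). set (a := fun j => al j / INR (fact j)).
  assert (Pm : forall n, Rabs ((-1) ^ n) = 1) by (intros; apply pow_1_abs).
  assert (Aal : forall n, Rabs (al n) = x ^ n / INR (fact n)).
  { intros n. unfold al, Rdiv. rewrite !Rabs_mult, Pm, (Rabs_pos_eq (x ^ n)), (Rabs_pos_eq (/ _)). ring.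
    left; apply Hf. apply pow_le; auto. }
  assert (Ra : CV_radius a = p_infty).
  { apply (CV_radius_infinite a x); auto. intros n. unfold a, Rdiv.
    rewrite Rabs_mult, Aal, (Rabs_pos_eq (/ _)) by (left; apply Hf).
    rewrite <- (Rmult_1_r (x ^ n * / INR (fact n))). apply Rmult_le_compat_l. apply Rmult_le_pos.
    apply pow_le; auto. left; apply Hf. apply Hf. }
  assert (HP : forall u, 0 <= u -> is_series (fun j => al j * mono j u) (PSeries a u)).
  { intros u Hu. assert (E : ex_pseries a u) by (apply CV_radius_inside; rewrite Ra; exact I).
    apply PSeries_correct in E. apply is_pseries_series in E. eapply is_series_ext. 2: exact E. intros n.
    unfold a, mono, Rdiv. Req. ring. }
  assert (Hc : forall u, continuous (PSeries a) u).
  { intros u. apply continuity_pt_filterlim. apply PSeries_continuity. rewrite Ra. exact I. }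
  assert (Sal : ex_series (fun j => Rabs (al j) * (2 / d) ^ j)).
  { exists (exp (x * (2 / d))). eapply is_series_ext. 2: apply is_series_exp. intros n. cbv beta.
    rewrite Aal, Rpow_mult_distr. Req. unfold Rdiv. ring. }
  destruct (moment_series (err k Q) C d al m (PSeries a) HC Hd He) as [l [l1 l2]]; auto.
  { apply err_int; auto. }
  { intros j. apply err_int. apply continuous_mono. }
  assert (Eterm : forall j, al j * m j = gam k j / INR (fact j) * x ^ j).
  { intros j. unfold gam. rewrite <- Ig. unfold al, Rdiv. ring. }
  assert (EJ : forall u, 0 <= u -> J0 (2 * sqrt (x * u)) = PSeries a u).
  { intros u Hu. unfold J0. apply is_series_Series. eapply is_series_ext. 2: exact (HP u Hu). intros j.
    cbv beta.
    replace (2 * sqrt (x * u) / 2) with (sqrt (x * u)) by field. rewrite pow_mult.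
    replace (sqrt (x * u) ^ 2) with (x * u) by (simpl; rewrite Rmult_1_r, sqrt_sqrt; auto; apply Rmult_le_pos;
      auto).
    unfold al, mono. rewrite Rpow_mult_distr. Req. field. apply INR_fact_neq_0. }
  assert (EI : forall r, 1 <= r -> err k Q r * PSeries a (ln r) / r =
    Defs.Delta k r * J0 (2 * sqrt (x * ln r)) / r ^ 2).
  { intros r Hr. rewrite EJ by (now apply ln_ge_0). unfold Defs.Delta. rewrite rsum_fsum. unfold err, Dk, SS.
    rewrite IQ. fold (nf r). simpl. field. lra. }
  assert (Ephi : phi k x = l).
  { unfold phi. apply is_RInt_gen_unique. apply is_RInt_gen_intro.
    - intros b Hb1. apply (ex_RInt_ext (fun r => err k Q r * PSeries a (ln r) / r)). intros r Hr.
      rewrite Rmin_left in Hr by lra. apply EI; lra. apply err_int; auto.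
    - intros eps Heps. destruct (small_eventually _ eps l1 Heps) as [M HM]. exists M. intros b Hb1 Hb2.
      rewrite <- (RInt_ext (fun r => err k Q r * PSeries a (ln r) / r)). auto. intros r Hr.
      rewrite Rmin_left in Hr by lra. apply EI; lra. }
  rewrite Ephi. split.
  - eapply is_series_ext. 2: exact l2. exact Eterm.
  - apply (ex_series_Rle _ (fun j => C * (2 / d) * (Rabs (al j) * (2 / d) ^ j))).
    + intros j. rewrite Rabs_Rabsolu, <- Eterm, Rabs_mult.
      replace (C * (2 / d) * (Rabs (al j) * (2 / d) ^ j)) with (Rabs (al j) * (C * (2 / d) * (2 / d) ^ j)) by
        ring.
      apply Rmult_le_compat_l. apply Rabs_pos. auto.
    + apply (ex_series_scal_l (C * (2 / d)) _ Sal).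
Qed.

(** The recursion [mu_S] writes each [Lam] as a sum of two consecutive [mu]; Pascal's rule then
    regroups the formula for [ell] into the binomial transform of [gam]. *)
Lemma cc_gam (k n : nat) : cc k n = fsum (fun j => bin n j * gam k j) (S n).
Proof.
  unfold cc, gam. destruct n.
  - rewrite ell_0. simpl. unfold mu. cbn [fsum]. ring.
  - rewrite ell_S, (fsum_head (fun j => bin (S n) j * mu k (j + k))), bin_0_r.
    rewrite (fsum_ext (fun i => bin n i * Lam k (S i + k)) (fun i => bin n i * mu k (S i + k) + bin n i * mu k
      (i + k))).
    2: { intros i Hi. simpl (S i + k)%nat. rewrite mu_S. ring. }
    rewrite (fsum_ext (fun i => bin (S n) (S i) * mu k (S i + k)) (fun i => bin n i * mu k (S i + k) + bin n
      (S i) * mu k (S i + k))) by (intros; rewrite bin_SS; ring).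
    rewrite !fsum_plus, (fsum_head (fun i => bin n i * mu k (i + k))), bin_0_r. cbn [fsum].
    rewrite (bin_gt n (S n)) by lia. ring.
Qed.

Lemma bin_fact (n j : nat) : (j <= n)%nat -> bin n j / INR (fact n) = / INR (fact (n - j)) * / INR (fact j).
Proof. intros H. rewrite <- bin_C by auto. unfold Binomial.C. field. repeat split; apply INR_fact_neq_0. Qed.

(** Multiplying an exponential generating series by exp x performs the binomial transform of its
    coefficients. *)
Lemma exp_phi_series (k : nat) (x : R) : 0 <= x -> is_series (fun n => cc k n / INR (fact n) * x ^ n) (exp x *
  phi k x).
Proof.
  intros Hx. destruct (phi_series k x Hx) as [P1 P2].
  assert (A : ex_series (fun n => Rabs (/ INR (fact n) * x ^ n))).
  { exists (exp x). eapply is_series_ext. 2: apply is_series_exp. intros n. rewrite Rabs_pos_eq; auto.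
    apply Rmult_le_pos. left; apply Rinv_0_lt_compat, INR_fact_lt_0. apply pow_le; auto. }
  rewrite Rmult_comm. eapply is_series_ext. 2: exact (is_series_mult _ _ _ _ P1 (is_series_exp x) P2 A).
  intros n. cbv beta. rewrite sum_f_R0_fsum, cc_gam. unfold Rdiv.
  rewrite Rmult_assoc, Rmult_comm, <- fsum_scal. apply fsum_ext. intros j Hj.
  replace (/ INR (fact n) * x ^ n * (bin n j * gam k j)) with (bin n j / INR (fact n) * gam k j * x ^ n) by
    (unfold Rdiv; ring).
  rewrite bin_fact by lia. replace (x ^ n) with (x ^ j * x ^ (n - j)) by (rewrite <- pow_add; f_equal; lia).
  Req. ring.
Qed.

(** * Square summability gives L2 convergence *)

(** The sum of p_i (c_i - m)^2 is nonnegative for the weighted sum m; since the total mass is at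
    most 1, expanding gives the claim. *)
Lemma jensen (p c : nat -> R) (L : nat) : (forall i, (i < L)%nat -> 0 <= p i) -> fsum p L <= 1 ->
  fsum (fun i => p i * c i) L ^ 2 <= fsum (fun i => p i * (c i * c i)) L.
Proof.
  intros Hp H1. set (m := fsum (fun i => p i * c i) L).
  assert (H : 0 <= fsum (fun i => p i * (c i * c i) + ((-2 * m) * (p i * c i) + (m * m) * p i)) L).
  { apply fsum_pos. intros i Hi. replace (p i * (c i * c i) + (-2 * m * (p i * c i) + m * m * p i)) with (p i
      * Rsqr (c i - m)) by (unfold Rsqr; ring).
    apply Rmult_le_pos; auto. apply Rle_0_sqr. }
  rewrite !fsum_plus, !fsum_scal in H. fold m in H. simpl. nra.
Qed.

Lemma is_derive_exp_sum (n : nat) (x : R) : is_derive (fun x => fsum (fun i => mono i x) (S n)) x (fsum (fun i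
  => mono i x) n).
Proof.
  induction n.
  - simpl. apply (is_derive_ext (fun _ => 1)). intros t. unfold mono. simpl. Req. field.
    apply is_derive_Reals, derivable_pt_lim_const.
  - apply (is_derive_plus (fun x => fsum (fun i => mono i x) (S n)) (fun x => mono (S n) x)); auto.
    unfold mono. auto_derive. auto. change (fact n + n * fact n)%nat with (S n * fact n)%nat.
    rewrite mult_INR.
    change (match n with 0%nat => 1 | S _ => INR n + 1 end) with (INR (S n)). field. split.
    apply INR_fact_neq_0. apply not_0_INR. lia.
Qed.

(** An antiderivative is -exp(-x) times the partial exponential sum of degree n, so the integral is
    1 minus a number between 0 and 1. *)
Lemma RInt_poisson (n : nat) (b : R) : 0 <= b -> exists l, is_RInt (fun x => exp (- x) * mono n x) 0 b l /\
  0 <= l <= 1.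
Proof.
  intros Hb. set (S0 := fun x => fsum (fun i => mono i x) (S n)).
  assert (D : is_RInt (fun x => exp (- x) * mono n x) 0 b (minus (- (exp (- b) * S0 b)) (- (exp (- 0) * S0
    0)))).
  { apply (is_RInt_derive (fun x => - (exp (- x) * S0 x)) (fun x => exp (- x) * mono n x)).
    - intros x _. pose proof (is_derive_exp_sum n x) as H. fold S0 in H. auto_derive. eexists; exact H.
      rewrite (is_derive_unique _ _ _ H : Derive (fun x => S0 x) x = _). unfold S0. cbn [fsum]. ring.
    - intros x _. apply (ex_derive_continuous (fun x => exp (- x) * mono n x)). unfold mono. auto_derive.
      auto. }
  eexists. split. exact D. change (minus ?p ?q) with (p - q).
  assert (E0 : S0 0 = 1). { unfold S0. rewrite fsum_head, (fsum_ext _ (fun _ => 0)), fsum_const. unfold mono.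
  simpl. field. intros i _. unfold mono. simpl. unfold Rdiv. ring. }
  rewrite E0, Ropp_0, exp_0.
  assert (0 <= S0 b) by (apply fsum_pos; intros; now apply mono_pos).
  assert (S0 b <= exp b).
  { unfold S0. rewrite <- (is_series_Series _ _ (is_series_exp b)).
    rewrite (fsum_ext _ (fun n => / INR (fact n) * b ^ n)) by (intros; unfold mono, Rdiv; ring).
    apply fsum_le_Series. intros i. apply Rmult_le_pos. left; apply Rinv_0_lt_compat, INR_fact_lt_0.
    apply pow_le; auto. eexists. apply is_series_exp. }
  pose proof (exp_pos (- b)). assert (exp (- b) * exp b = 1) by (rewrite <- exp_plus, Rplus_opp_l;
    apply exp_0). nra.
Qed.

(** On [0, b] the difference of phi and its partial sum is split into a finite block of L terms, to
    which [jensen] applies, and a uniformly small remainder. So only finite sums are integrated: L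
    grows at fixed b, and the resulting bound 2 [T N] does not depend on b. The integrals increase
    with b, hence converge. *)
Lemma square_summable_L2 (k : nat) : ex_series (fun n => cc k n * cc k n) -> L2_converges k.
Proof.
  intros Hs. set (c' := fun n => cc k n / INR (fact n)).
  assert (Hex : forall x, 0 <= x -> ex_pseries c' x) by (intros x Hx; eexists; apply is_pseries_series;
    exact (exp_phi_series k x Hx)).
  assert (HR : CV_radius c' = p_infty).
  { assert (B : forall r, Rbar_le (Rabs r) (CV_radius c')). { intros r. rewrite <- (Rabs_Rabsolu r).
    apply ex_pseries_radius, Hex, Rabs_pos. }
    destruct (CV_radius c') as [r| |]; auto.
    - specialize (B (Rabs r + 1)). simpl in B. pose proof (Rle_abs r).
      rewrite Rabs_pos_eq in B; pose proof (Rabs_pos r); lra.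
    - specialize (B 0). simpl in B. contradiction. }
  assert (Ephi : forall x, 0 <= x -> phi k x = exp (- x) * PSeries c' x).
  { intros x Hx. rewrite (is_pseries_unique c' x (exp x * phi k x)) by (apply is_pseries_series;
      exact (exp_phi_series k x Hx)).
    rewrite <- Rmult_assoc, <- exp_plus, Rplus_opp_l, exp_0. ring. }
  (* The series of [phi] is available for x >= 0 only. With the entire function [PSeries c'] in its
     place the integrand is continuous on the whole line, and it agrees with the original one where
     needed. *)
  set (H := fun N x => (exp (- x) * (fsum (fun n => c' n * x ^ n) (S N) - PSeries c' x)) ^ 2).
  assert (EH : forall N x, 0 <= x -> (phiN N k x - phi k x) ^ 2 = H N x).
  { intros N x Hx. rewrite phiN_fsum, Ephi by auto. unfold H. f_equal. unfold c'. ring. }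
  assert (Cfs : forall K x, continuous (fun x => fsum (fun n => c' n * x ^ n) K) x).
  { induction K; intros x; cbn [fsum]. apply continuous_const.
    apply (continuous_plus (V := R_NormedModule) (fun x => fsum (fun n => c' n * x ^ n) K) (fun x => c' K * x
      ^ K)); auto.
    apply (ex_derive_continuous (fun x => c' K * x ^ K)). auto_derive. auto. }
  assert (Cex : forall x, continuous (fun x => exp (- x)) x) by (intros x;
    apply (ex_derive_continuous (fun x => exp (- x))); auto_derive; auto).
  assert (CH : forall N x, continuous (H N) x).
  { intros N x. unfold H. apply (continuous_ext (fun x => (exp (- x) * (fsum (fun n => c' n * x ^ n) (S N) -
      PSeries c' x)) * (exp (- x) * (fsum (fun n => c' n * x ^ n) (S N) - PSeries c' x)))).
    { intros y. simpl. Req. ring. }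
    assert (C1 : continuous (fun x => exp (- x) * (fsum (fun n => c' n * x ^ n) (S N) - PSeries c' x)) x).
    { apply (continuous_mult (fun x => exp (- x)) (fun x => fsum (fun n => c' n * x ^ n) (S N) - PSeries c'
        x)); auto.
      apply (continuous_minus (V := R_NormedModule) (fun x => fsum (fun n => c' n * x ^ n) (S N)) (PSeries
        c')); auto.
      apply continuity_pt_filterlim. apply PSeries_continuity. rewrite HR. exact I. }
    now apply (continuous_mult (fun x => exp (- x) * (fsum (fun n => c' n * x ^ n) (S N) - PSeries c' x)) (fun
      x => exp (- x) * (fsum (fun n => c' n * x ^ n) (S N) - PSeries c' x))). }
  assert (XH : forall N a b, ex_RInt (H N) a b) by (intros; apply (ex_RInt_continuous (V :=
    R_CompleteNormedModule)); intros; apply CH).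
  assert (PH : forall N x, 0 <= H N x) by (intros; apply pow2_ge_0).
  set (T := fun N => Series (fun n => cc k (S N + n)%nat * cc k (S N + n)%nat)).
  assert (Hpos : forall n, 0 <= cc k n * cc k n) by (intros; apply Rle_0_sqr).
  assert (Main : forall N b, 0 <= b -> RInt (H N) 0 b <= 2 * T N).
  { intros N b Hb.
    assert (Hab : ex_series (fun n => Rabs (c' n) * b ^ n)).
    { assert (Hq : ex_series (fun n => Rabs (c' n * b ^ n))) by (apply (CV_disk_inside c' b); rewrite HR;
        exact I).
      eapply ex_series_ext. 2: exact Hq. intros n. cbv beta. rewrite Rabs_mult, (Rabs_pos_eq (b ^ n)); auto.
      apply pow_le; auto. }
    (* The tail of absolute values at the right end b, which bounds the remainder on all of
       [0, b]. *)
    set (tau := fun L => Series (fun n => Rabs (c' (S N + L + n)%nat) * b ^ (S N + L + n))).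
    assert (Htau : forall L, RInt (H N) 0 b <= 2 * T N + 2 * (tau L ^ 2) * b).
    { intros L.
      assert (Pt : forall x, 0 <= x <= b -> H N x <= fsum (fun i => 2 * (cc k (S N + i) * cc k (S N + i)) *
        (exp (- x) * mono (S N + i) x)) L + 2 * tau L ^ 2).
      { intros x Hx.
        assert (Tl : Rabs (PSeries c' x - fsum (fun n => c' n * x ^ n) (S N + L)) <= tau L).
        { pose proof (exp_phi_series k x (proj1 Hx)) as ES. fold (c') in ES.
          change (fun n => cc k n / INR (fact n) * x ^ n) with (fun n => c' n * x ^ n) in ES.
          rewrite (is_pseries_unique c' x (exp x * phi k x)) by (apply is_pseries_series; exact ES).
          destruct L as [|L'].
          - rewrite Nat.add_0_r. rewrite <- (is_series_Series _ _ ES).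
            rewrite (Series_incr_n (fun n => c' n * x ^ n) (S N)) by (try lia; eexists; exact ES).
            simpl Nat.pred. rewrite sum_f_R0_fsum, Rplus_minus_l. unfold tau. rewrite Nat.add_0_r.
            apply Series_abs_le.
            + intros n. rewrite Rabs_mult. apply Rmult_le_compat_l. apply Rabs_pos.
              rewrite Rabs_pos_eq by (apply pow_le; lra). apply pow_incr; lra.
            + apply (ex_series_incr_n (fun n => Rabs (c' n) * b ^ n) (S N)). auto.
          - rewrite <- (is_series_Series _ _ ES).
            rewrite (Series_incr_n (fun n => c' n * x ^ n) (S N + S L')) by (try lia; eexists; exact ES).
            replace (Nat.pred (S N + S L')) with (N + S L')%nat by lia. rewrite sum_f_R0_fsum.
            replace (S (N + S L')) with (S N + S L')%nat by lia. rewrite Rplus_minus_l. unfold tau.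
            apply Series_abs_le.
            + intros n. rewrite Rabs_mult. apply Rmult_le_compat_l. apply Rabs_pos.
              rewrite Rabs_pos_eq by (apply pow_le; lra). apply pow_incr; lra.
            + apply (ex_series_incr_n (fun n => Rabs (c' n) * b ^ n) (S N + S L')). auto. }
        set (A := fsum (fun i => (exp (- x) * mono (S N + i) x) * cc k (S N + i)) L).
        assert (EA : exp (- x) * (fsum (fun n => c' n * x ^ n) (S N + L) - fsum (fun n => c' n * x ^ n) (S N))
          = A).
        { rewrite fsum_app, Rplus_minus_l, <- fsum_scal. apply fsum_ext. intros i _. unfold c', mono, Rdiv.
          ring. }
        set (B := exp (- x) * (PSeries c' x - fsum (fun n => c' n * x ^ n) (S N + L))).
        assert (EB : H N x = (A + B) ^ 2). { unfold H, B. rewrite <- EA. ring. }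
        assert (HB : B ^ 2 <= tau L ^ 2).
        { assert (Rabs B <= tau L). { unfold B.
          rewrite Rabs_mult, (Rabs_pos_eq (exp _)) by (left; apply exp_pos).
            assert (exp (- x) <= 1) by (rewrite <- exp_0; apply exp_mono; lra).
            pose proof (Rabs_pos (PSeries c' x - fsum (fun n => c' n * x ^ n) (S N + L))). nra. }
          rewrite <- (pow2_abs B). apply pow_incr. split; auto. apply Rabs_pos. }
        assert (HA : A ^ 2 <= fsum (fun i => (exp (- x) * mono (S N + i) x) * (cc k (S N + i) * cc k (S N +
          i))) L).
        { unfold A. apply (jensen (fun i => exp (- x) * mono (S N + i) x) (fun i => cc k (S N + i))).
          - intros i _. apply Rmult_le_pos. left; apply exp_pos. apply mono_pos; lra.
          - rewrite fsum_scal. assert (S1 : fsum (fun i => mono (S N + i) x) L <= exp x).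
            { rewrite <- (is_series_Series _ _ (is_series_exp x)).
              apply Rle_trans with (fsum (fun n => / INR (fact n) * x ^ n) (S N + L)).
              - rewrite fsum_app. rewrite (fsum_ext (fun i => mono (S N + i) x) (fun i => / INR (fact (S N +
                  i)) * x ^ (S N + i))) by (intros; unfold mono, Rdiv; ring).
                assert (0 <= fsum (fun n => / INR (fact n) * x ^ n) (S N)); [|lra]. apply fsum_pos.
                intros i _. apply Rmult_le_pos. left; apply Rinv_0_lt_compat, INR_fact_lt_0.
                apply pow_le; lra.
              - apply fsum_le_Series. intros i. apply Rmult_le_pos.
                left; apply Rinv_0_lt_compat, INR_fact_lt_0. apply pow_le; lra. eexists. apply is_series_exp.
                }
            pose proof (exp_pos (- x)).
            assert (exp (- x) * exp x = 1) by (rewrite <- exp_plus, Rplus_opp_l; apply exp_0). nra. }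
        rewrite EB. rewrite (fsum_ext _ (fun i => 2 * ((exp (- x) * mono (S N + i) x) * (cc k (S N + i) * cc k
          (S N + i))))) by (intros; ring). rewrite fsum_scal.
        pose proof (pow2_ge_0 (A - B)). simpl in *. nra. }
      assert (IG : is_RInt (fun x => fsum (fun i => 2 * (cc k (S N + i) * cc k (S N + i)) * (exp (- x) * mono
        (S N + i) x)) L + 2 * tau L ^ 2) 0 b
          (fsum (fun i => 2 * (cc k (S N + i) * cc k (S N + i)) * RInt (fun x => exp (- x) * mono (S N + i) x)
            0 b) L + 2 * tau L ^ 2 * b)).
      { apply (is_RInt_plus (V := R_NormedModule) (fun x => fsum (fun i => 2 * (cc k (S N + i) * cc k (S N +
          i)) * (exp (- x) * mono (S N + i) x)) L) (fun _ => 2 * tau L ^ 2)).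
        - apply (RInt_fsum (fun i x => exp (- x) * mono (S N + i) x) (fun i => 2 * (cc k (S N + i) * cc k (S N
            + i)))). intros j. destruct (RInt_poisson (S N + j) b Hb) as [l [Hl _]]. now exists l.
        - pose proof (is_RInt_const (V := R_NormedModule) 0 b (2 * tau L ^ 2)) as IC.
          assert (E : scal (b - 0) (2 * tau L ^ 2) = 2 * tau L ^ 2 * b) by (unfold scal; simpl; unfold mult;
            simpl; ring).
          exact (eq_ind _ (fun l => is_RInt (fun _ => 2 * tau L ^ 2) 0 b l) IC _ E). }
      apply Rle_trans with (RInt (fun x => fsum (fun i => 2 * (cc k (S N + i) * cc k (S N + i)) * (exp (- x) *
        mono (S N + i) x)) L + 2 * tau L ^ 2) 0 b).
      - apply RInt_le; auto. eexists; exact IG. intros x Hx. apply Pt. lra.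
      - rewrite (is_RInt_unique _ _ _ _ IG). apply Rplus_le_compat; [|lra].
        apply Rle_trans with (fsum (fun i => 2 * (cc k (S N + i) * cc k (S N + i))) L).
        + apply fsum_le. intros i _. destruct (RInt_poisson (S N + i) b Hb) as [l [Hl1 Hl2]].
          rewrite (is_RInt_unique _ _ _ _ Hl1).
          specialize (Hpos (S N + i)%nat). nra.
        + rewrite fsum_scal. apply Rmult_le_compat_l. lra. apply fsum_le_Series; auto.
          apply (ex_series_incr_n (fun n => cc k n * cc k n) (S N)). auto. }
    apply le_epsilon. intros eps Heps.
    (* The remainder contributes 2 tau^2 b over the interval; the minimum with 1 again bounds tau^2
       by the second argument, and b + 1 avoids division by zero at b = 0. *)
    set (e1 := Rmin 1 (eps / (2 * (b + 1)))).
    assert (He1 : 0 < e1) by (apply Rmin_pos; [lra|apply Rdiv_lt_0_compat; lra]).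
    destruct (Series_tail_small (fun n => Rabs (c' n) * b ^ n) e1 Hab He1) as [N0 HN0].
    specialize (HN0 (N + N0)%nat ltac:(lia)). change (S (N + N0)) with (S N + N0)%nat in HN0.
    fold (tau N0) in HN0.
    apply Rle_trans with (1 := Htau N0). apply Rplus_le_compat_l.
    assert (Ht2 : tau N0 ^ 2 <= eps / (2 * (b + 1))).
    { rewrite <- pow2_abs. pose proof (Rabs_pos (tau N0)). pose proof (Rmin_l 1 (eps / (2 * (b + 1)))).
      pose proof (Rmin_r 1 (eps / (2 * (b + 1)))). fold e1 in H1, H2.
      apply Rle_trans with (1 * (eps / (2 * (b + 1)))). simpl. rewrite Rmult_1_r. apply Rmult_le_compat; lra.
      lra. }
    apply Rle_trans with (2 * (eps / (2 * (b + 1))) * (b + 1)). nra. right. field. lra. }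
  assert (Mono : forall N a b, 0 <= a <= b -> RInt (H N) 0 a <= RInt (H N) 0 b).
  { intros N a b Hab. rewrite (RInt_Chasles_R (H N) 0 a b) by auto.
    assert (0 <= RInt (H N) a b) by (apply RInt_ge_0; auto; lra). lra. }
  assert (Hv : forall N, exists v, is_lim_seq (fun n => RInt (H N) 0 (INR n)) (Finite v)).
  { intros N. destruct (ex_finite_lim_seq_incr (fun n => RInt (H N) 0 (INR n)) (2 * T N)) as [v Hv].
    - intros n. apply Mono. split. apply pos_INR. apply le_INR; lia.
    - intros n. apply Main. apply pos_INR.
    - now exists v. }
  set (v := fun N => proj1_sig (constructive_indefinite_description _ (Hv N))).
  assert (Lv : forall N, is_lim_seq (fun n => RInt (H N) 0 (INR n)) (v N)) by (intros N;
    exact (proj2_sig (constructive_indefinite_description _ (Hv N)))).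
  assert (Uv : forall N b, 0 <= b -> RInt (H N) 0 b <= v N).
  { intros N b Hb. destruct (INR_unbounded b) as [n Hn]. apply Rle_trans with (RInt (H N) 0 (INR n)).
    apply Mono. lra.
    apply (is_lim_seq_incr_compare (fun n => RInt (H N) 0 (INR n)) (v N)). apply Lv. intros i. apply Mono.
    split. apply pos_INR. apply le_INR; lia. }
  exists v. split.
  - intros N.
    assert (IH : is_RInt_gen (H N) (at_point 0) (Rbar_locally p_infty) (v N)).
    { apply is_RInt_gen_intro; auto. intros eps Heps. pose proof (Lv N) as L. apply is_lim_seq_spec in L.
      destruct (L (mkposreal eps Heps)) as [n0 Hn0]. specialize (Hn0 n0 (le_n _)). simpl in Hn0.
      exists (INR n0). intros b Hb1 Hb2.
      pose proof (Uv N b Hb2). pose proof (Mono N (INR n0) b ltac:(pose proof (pos_INR n0); lra)).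
      apply Rabs_def2 in Hn0. apply Rabs_def1; lra. }
    refine (is_RInt_gen_ext (H N) _ (v N) _ IH).
    apply (Filter_prod _ _ _ (fun x => x = 0) (fun b => 0 < b)). reflexivity. exists 0; auto.
    intros x b -> Hb y Hy. simpl in Hy. rewrite Rmin_left in Hy by lra. symmetry. apply EH. lra.
  - apply (is_lim_seq_le_le (fun _ => 0) _ (fun N => 2 * T N)).
    + intros N. split. apply Rle_trans with (RInt (H N) 0 0). rewrite RInt_point. apply Rle_refl. apply Uv.
      lra.
      refine (is_lim_seq_le _ (fun _ => _) _ (Finite _) _ (Lv N) (is_lim_seq_const _)). intros n. apply Main.
      apply pos_INR.
    + apply is_lim_seq_const.
    + replace (Finite 0) with (Finite (2 * 0)) by (f_equal; ring). apply is_lim_seq_mult'.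
      apply is_lim_seq_const.
      apply is_lim_seq_spec. intros [eps Heps].
      destruct (Series_tail_small (fun n => cc k n * cc k n) eps Hs Heps) as [N0 HN0].
      exists N0. intros n Hn. rewrite Rminus_0_r. apply HN0. auto.
Qed.

Theorem theorem4 : Lindelof <-> (forall k : nat, (1 <= k)%nat -> L2_converges k).
Proof.
  split.
  - intros HL k Hk. apply square_summable_L2. now apply Lindelof_square_summable.
  - apply L2_implies_Lindelof.
Qed.
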